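(* Consider, for $\alpha>0$, $s\in[0,T)$ and $y_0\in Y$, the problem of minimizing $$J_s(g)=\alpha\int_s^T\|g(t)\|_U^2\,dt+\|y(T)\|_Y^2$$ over all $g\in L^2(s,T;U)$, where $y$ is the solution of Maxwell's equations on $(s,T)$ with boundary control $\nu\times h=g$ and datum $y_0$ at the initial time $s$, that is, $y(t)=y(t,s,y_0)=e^{(t-s)A}y_0+\int_s^t e^{(t-r)A}Bg(r)\,dr$ (spaces $Y,U$ and operators $A,B$ as in the context). The following statements hold for any $s\in[0,T)$. **S1.** For each $y_0\in Y$ there exists a unique optimal pair $(\hat g(\cdot,s,y_0),\hat y(\cdot,s,y_0))$, which satisfies $\hat g(\cdot,s,y_0)\in L^2(s,T;U)$, $\hat y(\cdot,s,y_0)\in C([s,T],Y)$. **S2.** Given $t\in[s,T]$, the linear bounded operator $\Phi(t,s)\colon Y\to Y$ defined by $\Phi(t,s)y_0:=\hat y(t,s,y_0)$ is an evolution operator, namely, it satisfies the transition property $\Phi(t,t)=I$, $\Phi(t,s)=\Phi(t,\tau)\Phi(\tau,s)$ for $s\le\tau\le t\le T$. **S3.** There exists a linear bounded operator $P(s)$ on $Y$, defined in terms of the optimal evolution and of the data of the problem by $P(s)x=e^{(T-s)A^*}\Phi(T,s)x$, such that the optimal cost is given by $J_s(\hat g)=(P(s)y_0,y_0)_Y$. $P(t)$ is a non-negative self-adjoint operator in $Y$ for any $t\in[0,T]$, and for each $z\in Y$ the map $t\mapsto P(t)z$ is continuous from $[0,T]$ to $Y$. **S4.** The optimal control admits the feedback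 representation $$\hat g(t,s,y_0)=-B^*P(t)\hat y(t,s,y_0),$$ with $\hat y(t,s,y_0)=\Phi(t,s)y_0$. **S5.** The operator $P(t)$ in S3 is a solution to the Cauchy problem associated with the differential Riccati equation $$\begin{cases}\frac{d}{dt}(P(t)x,y)_Y+(P(t)x,Ay)_Y+(Ax,P(t)y)_Y-(B^*P(t)x,B^*P(t)y)_U=0,\quad x,y\in\mathcal D(A),\ t\in[0,T),\\ P(T)=I\end{cases}$$ in a generalized sense (only): to wit, there exists a sequence of operators $\{P_n(\cdot)\}_n$, with $P_n(t)\in\mathcal L(Y)$, such that (i) $P_n(t)$ solves the displayed Cauchy problem, with the gain operator $B^*P_n(t)$ which is bounded (for all $n$); and (ii) $\|P_n(\cdot)z-P(\cdot)z\|_Y\to0$ in $C([0,T],Y)$ as $n\to\infty$, for all $z\in Y$.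
   Context: Setting. $T>0$; $\Omega\subset\mathbb R^3$ is a bounded, open, connected set with $C^{1,1}$ boundary $\Gamma$ and exterior unit normal $\nu$. $\varepsilon,\mu$ are $3\times3$ real-symmetric, uniformly positive definite matrix functions with entries in $W^{1,\infty}(\Omega)$; $\sigma$ is a real-symmetric, non-negative definite matrix function with entries in $L^\infty(\Omega)$. Maxwell's equations for $y=(e,h)$ are $\varepsilon e_t-\nabla\times h+\sigma e=0$, $\mu h_t+\nabla\times e=0$ in $\Omega$, with boundary condition $\nu\times h=g$ on $\Gamma$. Spaces. $Y=L^2(\Omega,\mathbb C^6)$ with inner product $(y,z)_Y=(y_1,\varepsilon z_1)_{L^2(\Omega)}+(y_2,\mu z_2)_{L^2(\Omega)}$. $U=H^{1/2}_{\mathrm{tan}}(\Gamma)$ (tangential $\mathbb C^3$-valued fields in $H^{1/2}(\Gamma)$) with inner product $(f,g)_U=(\sqrt{-\Delta_\Gamma}f,g)_{L^2(\Gamma)}$, where $-\Delta_\Gamma$ is the Laplace–Beltrami operator on $\Gamma$, taken to be positive and self-adjoint. $H(\mathrm{curl},\Omega)=\{u\in L^2(\Omega,\mathbb C^3):\nabla\times u\in L^2(\Omega,\mathbb C^3)\}$, $H_0(\mathrm{curl},\Omega)=\{u\in H(\mathrm{curl},\Omega):\nu\times u=0\text{ on }\Gamma\}$. Operators. $\mathcal D(A)=H(\mathrm{curl},\Omega)\times H_0(\mathrm{curl},\Omega)$, $Ay=(\varepsilon^{-1}\nabla\times y_2-\varepsilon^{-1}\sigma y_1,\,-\mu^{-1}\nabla\times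 y_1)$. $A$ generates a strongly continuous contraction semigroup $e^{tA}$ on $Y$; $\mathcal D(A^* )=\mathcal D(A)$ and $A^*z=(-\varepsilon^{-1}\nabla\times z_2-\varepsilon^{-1}\sigma z_1,\ \mu^{-1}\nabla\times z_1)$. $A$ extends to a bounded operator $Y\to[\mathcal D(A^* )]'$ by $(A y,z)=(y,A^*z)_Y$, $z\in\mathcal D(A^* )$ (duality with pivot space $Y$), and $e^{tA}$ extends to $[\mathcal D(A^* )]'$. The Green map $\mathcal G\colon U\to H(\mathrm{curl},\Omega)^2$ sends $g$ to the solution $y=(y_1,y_2)$ of $\varepsilon y_1-\nabla\times y_2+\sigma y_1=0$, $\mu y_2+\nabla\times y_1=0$ in $\Omega$, $\nu\times y_2=g$ on $\Gamma$. The control operator is $B=(I-A)\mathcal G\colon U\to[\mathcal D(A^* )]'$, and $B^*\colon\mathcal D(A^* )\to U$ is given by $(B^*z,g)_U=((I-A^* )z,\mathcal Gg)_Y$. Known well-posedness facts: $g\mapsto\int_s^{\cdot}e^{(\cdot-r)A}Bg(r)\,dr$ is bounded from $L^2(s,T;U)$ to $C([s,T],Y)$; equivalently, there is $c_T>0$ with $\int_0^T\|B^*e^{tA^*}x\|_U^2\,dt\le c_T\|x\|_Y^2$ for $x\in\mathcal D(A^* )$, so that $B^*e^{\cdot A^*}$ extends continuously to an operator $Y\to L^2(0,T;U)$. In S4, $B^*P(t)\hat y(t,s,y_0)$ is understood through this extension as $B^*e^{(T-t)A^*}\hat y(T,s,y_0)$ (since $P(t)\hat y(t,s,y_0)=e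^{(T-t)A^*}\Phi(T,s)y_0$).
   Formalization: The feedback in S4 and the quadratic term in S5 carry the factor 1/α, needed unless α=1; in S5 the P_n have terminal data P_n(T) converging strongly to I instead of P_n(T)=I, which is incompatible with bounded gain B*P_n since B* is unbounded on Y. *)

(* Defs.v *)
From HB Require Import structures.
From mathcomp Require Import all_boot all_order all_algebra complex.
From mathcomp Require Import all_classical all_reals all_analysis.

Set Implicit Arguments.
Unset Strict Implicit.
Unset Printing Implicit Defensive.

Import Order.TTheory GRing.Theory Num.Theory numFieldNormedType.Exports.
Import ComplexField.

Local Open Scope classical_set_scope.
Local Open Scope complex_scope.
Local Open Scope ring_scope.

(* A Hilbert space of (classes of) functions is handled through
   representatives: [icar] is a space of honest functions, [imem] the set of
   representatives, [idot] the inner product (linear in its first argument,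
   antilinear in the second one).  Two representatives denote the same element
   iff their difference has norm 0, see [ieq]. *)
Record ispace (R : realType) := ISpace {
  icar :> lmodType R[i];
  imem : set icar;
  idot : icar -> icar -> R[i] }.

Arguments imem {R} i.
Arguments idot {R} i.

Section Operators.
Variable R : realType.

Definition inorm (X : ispace R) (x : X) : R := Num.sqrt (complex.Re (idot X x x)).

Definition ieq (X : ispace R) (x y : X) : Prop := inorm (x - y) = 0.

Definition bounded_linear (X Y : ispace R) (f : X -> Y) : Prop :=
  [/\ forall x, imem X x -> imem Y (f x),
      forall (a : R[i]) x y, imem X x -> imem X y ->
        ieq (f (a *: x + y)) (a *: f x + f y)
    & exists c : R, forall x, imem X x -> inorm (f x) <= c * inorm x].

(* Unbounded operators are given by their graph [A x w], meaning that
   x is in D(A) and A x = w. *)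
Definition dom (V : Type) (A : V -> V -> Prop) : set V := [set x | exists w, A x w].

(* The value A x for x in D(A); it is determined up to [ieq]. *)
Definition opval (X : ispace R) (A : X -> X -> Prop) (x : X) : X :=
  xget 0 [set w | A x w].

Definition adjoint (X : ispace R) (A : X -> X -> Prop) (z w : X) : Prop :=
  [/\ imem X z, imem X w & forall x v, A x v -> idot X v z = idot X x w].

Definition densely_defined (X : ispace R) (A : X -> X -> Prop) : Prop :=
  forall x, imem X x -> forall e : R, 0 < e ->
    exists y, dom A y /\ inorm (x - y) < e.

Definition positive_selfadjoint (X : ispace R) (A : X -> X -> Prop) : Prop :=
  [/\ densely_defined A,
      forall x w, A x w <-> adjoint A x w
    & forall x w, A x w -> 0 <= idot X w x].

Definition is_sqrt_of (X : ispace R) (S L : X -> X -> Prop) : Prop :=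
  positive_selfadjoint S /\
  forall x w, L x w <-> exists v, S x v /\ S v w.

Definition C0_semigroup (X : ispace R) (E : R -> X -> X) : Prop :=
  [/\ forall t, 0 <= t -> bounded_linear (E t),
      forall x, imem X x -> ieq (E 0 x) x,
      forall s t x, 0 <= s -> 0 <= t -> imem X x ->
        ieq (E (s + t) x) (E s (E t x))
    & forall x, imem X x -> inorm (E t x - x) @[t --> 0^'+] --> (0 : R)].

Definition contractive (X : ispace R) (E : R -> X -> X) : Prop :=
  forall t x, 0 <= t -> imem X x -> inorm (E t x) <= inorm x.

Definition generates (X : ispace R) (A : X -> X -> Prop) (E : R -> X -> X) : Prop :=
  forall x w, A x w <->
    [/\ imem X x, imem X w &
        inorm ((t^-1)%:C *: (E t x - x) - w) @[t --> 0^'+] --> (0 : R)].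

Definition cintegral d (T : measurableType d) (mu : set T -> \bar R) (D : set T)
    (f : T -> R[i]) : R[i] :=
  fine (\int[mu]_(x in D) (complex.Re (f x))%:E)%E +i*
  fine (\int[mu]_(x in D) (complex.Im (f x))%:E)%E.

Definition time_measure : set R -> \bar R := @lebesgue_measure R.

Definition simple_fun (X : ispace R) (h : R -> X) : Prop :=
  exists n (B : 'I_n -> set R) (u : 'I_n -> X),
    (forall k, measurable (B k) /\ imem X (u k)) /\
    h = (fun r => \sum_(k < n) (if `[< B k r >] then u k else 0)).

Definition strongly_measurable (X : ispace R) (s T : R) (g : R -> X) : Prop :=
  exists h : nat -> R -> X, (forall n, simple_fun (h n)) /\
    {ae time_measure, forall r, s < r < T ->
       inorm (h n r - g r) @[n --> \oo] --> (0 : R)}.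

Definition sq_integral (X : ispace R) (s T : R) (g : R -> X) : \bar R :=
  (\int[time_measure]_(r in `]s, T[) ((inorm (g r)) ^+ 2)%:E)%E.

Definition L2_in_time (X : ispace R) (s T : R) (g : R -> X) : Prop :=
  [/\ forall r, s < r < T -> imem X (g r),
      strongly_measurable s T g
    & (sq_integral s T g < +oo)%E].

Definition continuous_in_time (X : ispace R) (s T : R) (y : R -> X) : Prop :=
  forall t, s <= t <= T -> imem X (y t) /\
    inorm (y r - y t) @[r --> within `[s, T] (nbhs t)] --> (0 : R).

(* d is the derivative at t of f, regarded as a function on [0, T]. *)
Definition has_derivative_within (T : R) (f : R -> R[i]) (t : R) (d : R[i]) : Prop :=
  Normc.normc (((r - t)^-1)%:C * (f r - f t) - d)
    @[r --> within `[0, T] t^'] --> (0 : R).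

End Operators.

Notation E3 R := (R * R * R)%type.

Section Geometry.
Variable R : realType.

Definition row3 (a b c : R) : 'rV[R]_3 := \row_i tnth [tuple a; b; c] i.
Definition vec (p : E3 R) : 'rV[R]_3 := row3 p.1.1 p.1.2 p.2.
Definition unvec (v : 'rV[R]_3) : E3 R := (v 0 0, v 0 1, v 0 (1 + 1)).

Definition leb3 : set (E3 R) -> \bar R :=
  ((@lebesgue_measure R \x @lebesgue_measure R) \x @lebesgue_measure R)%E.

Definition boundary (O : set (E3 R)) : set (E3 R) := closure O `\` interior O.

(* Near x0, in the orthonormal frame given by the rows of Q, the set O is the
   part lying strictly below the graph of the C^{1,1} function phi, whose
   gradient is dphi. *)
Definition graph_chart (O : set (E3 R)) (x0 : E3 R) (Q : 'M[R]_3)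
    (phi : R * R -> R) (dphi : R * R -> R * R) : Prop :=
  [/\ Q *m Q^T = 1%:M,
      phi (0, 0) = 0,
      forall p : R * R, @is_derive R (R * R)%type R p (1, 0) phi (dphi p).1 /\
        @is_derive R (R * R)%type R p (0, 1) phi (dphi p).2,
      exists L : R, forall p q, `|dphi p - dphi q| <= L * `|p - q|
    & exists r h : R, [/\ 0 < r, 0 < h &
        forall a b c : R, `|a| < r -> `|b| < r -> `|c| < h ->
          (O (x0 + unvec (row3 a b c *m Q)) <-> c < phi (a, b))]].

Definition C11_boundary (O : set (E3 R)) : Prop :=
  forall x0, boundary O x0 -> exists Q phi dphi, graph_chart O x0 Q phi dphi.

Definition exterior_unit_normal (O : set (E3 R)) (nu : E3 R -> 'rV[R]_3) : Prop :=
  forall x0 Q phi dphi, boundary O x0 -> graph_chart O x0 Q phi dphi ->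
    let: (a, b) := dphi (0, 0) in
    nu x0 = (Num.sqrt (1 + a ^+ 2 + b ^+ 2))^-1 *: (row3 (- a) (- b) 1 *m Q).

Definition edist (p q : E3 R) : R :=
  Num.sqrt (\sum_i (vec p 0 i - vec q 0 i) ^+ 2).

(* Two-dimensional Hausdorff measure, normalised to be the area on planes;
   d k runs over the upper bounds of the diameter of C k. *)
Definition hausdorff2 (A : set (E3 R)) : \bar R :=
  ereal_sup [set m | exists2 delta : R, 0 < delta &
    m = ereal_inf [set v | exists (C : nat -> set (E3 R)) (d : nat -> R),
      [/\ A `<=` \bigcup_k C k,
          forall k, 0 <= d k <= delta,
          forall k p q, C k p -> C k q -> edist p q <= d k
        & v = (\sum_(0 <= k <oo) (pi / 4 * d k ^+ 2)%:E)%E]]].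

Definition surface_measure (O : set (E3 R))
    (sg : {measure set (E3 R) -> \bar R}) : Prop :=
  forall A, measurable A -> sg A = hausdorff2 (A `&` boundary O).

Definition partial (i : 'I_3) (f : E3 R -> R) (p : E3 R) : R :=
  'D_(unvec (delta_mx 0 i)) f p.

Definition smooth (f : E3 R -> R) : Prop :=
  forall l : seq 'I_3,
    let g := foldr partial f l in
    continuous g /\ forall i p, derivable g p (unvec (delta_mx 0 i)).

Definition test_fun (O : set (E3 R)) (f : E3 R -> R) : Prop :=
  [/\ smooth f, compact (closure [set p | f p != 0])
    & closure [set p | f p != 0] `<=` O].

(* Indices are taken modulo 3. *)
Definition curl_test (v : 'I_3 -> E3 R -> R) (i : 'I_3) (p : E3 R) : R :=
  partial (i + 1) (v (i + 1 + 1)) p - partial (i + 1 + 1) (v (i + 1)) p.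

Definition csq (z : R[i]) : R := complex.Re z ^+ 2 + complex.Im z ^+ 2.

Definition L2_fun (mu : set (E3 R) -> \bar R) (D : set (E3 R))
    (f : E3 R -> R[i]) : Prop :=
  [/\ measurable_fun D (fun x => complex.Re (f x)),
      measurable_fun D (fun x => complex.Im (f x))
    & (\int[mu]_(x in D) (csq (f x))%:E < +oo)%E].

Notation field := (E3 R -> 'rV[R[i]]_3).

Definition L2_field (mu : set (E3 R) -> \bar R) (D : set (E3 R)) (u : field) : Prop :=
  forall i, L2_fun mu D (fun x => u x 0 i).

(* w = curl u in the sense of distributions; u is in H(curl, O). *)
Definition is_curl (O : set (E3 R)) (u w : field) : Prop :=
  [/\ L2_field leb3 O u, L2_field leb3 O w &
    forall v : 'I_3 -> E3 R -> R, (forall i, test_fun O (v i)) ->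
      cintegral leb3 O (fun x => \sum_i w x 0 i * (v i x)%:C) =
      cintegral leb3 O (fun x => \sum_i u x 0 i * (curl_test v i x)%:C)].

(* nu x u = g on the boundary of O, for u in H(curl, O): the tangential trace
   is the functional given by Green's formula
   int_O (curl u . v - u . curl v) = int_Gamma (nu x u) . v. *)
Definition tangential_trace (O : set (E3 R)) (sg : set (E3 R) -> \bar R)
    (u g : field) : Prop :=
  exists2 w, is_curl O u w &
    forall v : 'I_3 -> E3 R -> R, (forall i, test_fun setT (v i)) ->
      cintegral leb3 O
        (fun x => \sum_i (w x 0 i * (v i x)%:C - u x 0 i * (curl_test v i x)%:C)) =
      cintegral sg (boundary O) (fun x => \sum_i g x 0 i * (v i x)%:C).

Definition Linfty (O : set (E3 R)) (f : E3 R -> R) : Prop :=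
  measurable_fun O f /\ exists M : R, {ae leb3, forall x, O x -> `|f x| <= M}.

Definition W1infty (O : set (E3 R)) (f : E3 R -> R) : Prop :=
  Linfty O f /\ forall i, exists2 g, Linfty O g &
    forall v, test_fun O v ->
      fine (\int[leb3]_(x in O) (f x * partial i v x)%:E)%E =
      - fine (\int[leb3]_(x in O) (g x * v x)%:E)%E.

Notation coef := (E3 R -> 'M[R]_3).

Definition coef_symmetric (O : set (E3 R)) (M : coef) : Prop :=
  {ae leb3, forall x, O x -> (M x)^T = M x}.

Definition coef_posdef (O : set (E3 R)) (M : coef) : Prop :=
  exists2 c : R, 0 < c & {ae leb3, forall x, O x ->
    forall xi : 'rV[R]_3, c * (xi *m xi^T) 0 0 <= (xi *m M x *m xi^T) 0 0}.

Definition coef_nonneg (O : set (E3 R)) (M : coef) : Prop :=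
  {ae leb3, forall x, O x ->
    forall xi : 'rV[R]_3, 0 <= (xi *m M x *m xi^T) 0 0}.

Section Boundary.
Variables (O : set (E3 R)) (nu : E3 R -> 'rV[R]_3).
Variable sg : {measure set (E3 R) -> \bar R}.
Local Notation Gam := (boundary O).

Definition L2_boundary : ispace R :=
  @ISpace R (E3 R -> R[i]^o) (L2_fun sg Gam)
    (fun f g => cintegral sg Gam (fun x => f x * (g x)^*)).

Definition tangential_grad (a : E3 R -> R) (x : E3 R) : 'rV[R]_3 :=
  let grad := \row_i partial i a x in
  grad - (grad *m (nu x)^T) 0 0 *: nu x.

(* f is in H^1(Gamma), with surface gradient G: completion of the restrictions
   to Gamma of the test functions a + ib. *)
Definition surface_grad (f : E3 R -> R[i]) (G : field) : Prop :=
  [/\ L2_fun sg Gam f, L2_field sg Gam G &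
    exists a b : nat -> E3 R -> R,
    [/\ forall n, test_fun setT (a n) /\ test_fun setT (b n),
        (\int[sg]_(x in Gam) (csq (f x - (a n x +i* b n x)))%:E)%E
          @[n --> \oo] --> 0%E
      & (\int[sg]_(x in Gam)
           (\sum_i csq (G x 0 i -
              (tangential_grad (a n) x 0 i +i* tangential_grad (b n) x 0 i)))%:E)%E
          @[n --> \oo] --> 0%E]].

(* Graph of the non-negative self-adjoint operator - Delta_Gamma. *)
Definition laplace_beltrami (f w : L2_boundary) : Prop :=
  imem L2_boundary w /\
  exists2 G, surface_grad f G &
    forall v H, surface_grad v H ->
      cintegral sg Gam (fun x => \sum_i G x 0 i * (H x 0 i)^*) =
      idot L2_boundary w v.

(* Squared Sobolev-Slobodeckij norm on the surface Gamma. *)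
Definition Hhalf_sqnorm (f : E3 R -> R[i]) : \bar R :=
  (\int[sg]_(x in Gam) (csq (f x))%:E +
   \int[sg]_(x in Gam) \int[sg]_(y in Gam)
     (csq (f x - f y) / edist x y ^+ 3)%:E)%E.

Definition Hhalf (f : E3 R -> R[i]^o) : Prop :=
  L2_fun sg Gam f /\ (Hhalf_sqnorm f < +oo)%E.

(* q is the form (f, g) |-> (sqrt(- Delta_Gamma) f, g)_{L^2(Gamma)} on
   H^{1/2}(Gamma): it is the continuous extension of (S f, g), f in D(S), where
   S = sqrt(- Delta_Gamma) (recall that D(S) = H^1(Gamma) is dense). *)
Definition sqrt_form (S : L2_boundary -> L2_boundary -> Prop)
    (q : (E3 R -> R[i]^o) -> (E3 R -> R[i]^o) -> R[i]) : Prop :=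
  [/\ forall (a : R[i]) f g h, Hhalf f -> Hhalf g -> Hhalf h ->
        q (a *: f + g) h = a * q f h + q g h,
      forall f g, Hhalf f -> Hhalf g -> q g f = (q f g)^*,
      forall f, Hhalf f -> 0 <= q f f,
      exists c : R, forall f g, Hhalf f -> Hhalf g ->
        csq (q f g) <= c * fine (Hhalf_sqnorm f) * fine (Hhalf_sqnorm g)
    & forall f w g, S f w -> Hhalf f -> Hhalf g -> q f g = idot L2_boundary w g].

Definition Htan (q : (E3 R -> R[i]^o) -> (E3 R -> R[i]^o) -> R[i]) : ispace R :=
  @ISpace R (E3 R -> 'rV[R[i]]_3)
    [set g | (forall i, Hhalf (fun x => g x 0 i)) /\
             {ae sg, forall x, Gam x -> \sum_i g x 0 i * (nu x 0 i)%:C = 0}]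
    (fun f g => \sum_i q (fun x => f x 0 i) (fun x => g x 0 i)).

End Boundary.

Definition mulv (M : 'M[R]_3) (u : 'rV[R[i]]_3) : 'rV[R[i]]_3 :=
  u *m (map_mx (real_complex R) M)^T.

Section Maxwell.
Variables (O : set (E3 R)) (sg : {measure set (E3 R) -> \bar R}).
Variables (eps mu sigma : coef).

Definition stateY : ispace R :=
  @ISpace R ((E3 R -> 'rV[R[i]]_3) * (E3 R -> 'rV[R[i]]_3))%type
    [set y | L2_field leb3 O y.1 /\ L2_field leb3 O y.2]
    (fun y z =>
       cintegral leb3 O (fun x => \sum_i y.1 x 0 i * (mulv (eps x) (z.1 x) 0 i)^*) +
       cintegral leb3 O (fun x => \sum_i y.2 x 0 i * (mulv (mu x) (z.2 x) 0 i)^*)).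

Definition maxwell_op (y w : stateY) : Prop :=
  imem stateY w /\
  exists c1 c2 : field,
    [/\ is_curl O y.1 c1, is_curl O y.2 c2, tangential_trace O sg y.2 0 &
      {ae leb3, forall x, O x ->
         w.1 x = mulv (invmx (eps x)) (c2 x)
                 - mulv (invmx (eps x)) (mulv (sigma x) (y.1 x)) /\
         w.2 x = - mulv (invmx (mu x)) (c1 x)}].

Definition green_map (D : set field) (G : field -> stateY) : Prop :=
  forall g, D g ->
    exists c1 c2 : field,
    [/\ is_curl O (G g).1 c1, is_curl O (G g).2 c2,
        tangential_trace O sg (G g).2 g &
      {ae leb3, forall x, O x ->
         mulv (eps x) ((G g).1 x) - c2 x + mulv (sigma x) ((G g).1 x) = 0 /\
         mulv (mu x) ((G g).2 x) + c1 x = 0}].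

End Maxwell.
End Geometry.

Section Control.
Variables (R : realType) (Y U : ispace R).
(* A and its adjoint As, the semigroups E = e^{tA} and Es = e^{tAs}, the Green
   map G, and the final time T. *)
Variables (A As : Y -> Y -> Prop) (E Es : R -> Y -> Y) (G : U -> Y) (T : R).

(* Elements of the dual space [D(As)]' are functionals on D(As).  The
   extension of A to Y is z |-> (y, As z), hence
   B g = (I - A) G g is z |-> (G g, (I - As) z). *)
Definition control_op (g : U) : Y -> R[i] :=
  fun z => idot Y (G g) (z - opval As z).

(* Extension of the semigroup e^{tA} to [D(As)]', by duality. *)
Definition ext_semigroup (t : R) (F : Y -> R[i]) : Y -> R[i] := fun z => F (Es t z).

(* y(t) = e^{(t-s)A} y0 + int_s^t e^{(t-r)A} B g(r) dr in [D(As)]', for all t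
   in [s, T]. *)
Definition mild_solution (s : R) (y0 : Y) (g : R -> U) (y : R -> Y) : Prop :=
  forall t, s <= t <= T -> forall z, dom As z ->
    idot Y (y t) z = idot Y (E (t - s) y0) z +
      cintegral (@time_measure R) `[s, t]
        (fun r => ext_semigroup (t - r) (control_op (g r)) z).

Definition admissible_pair (s : R) (y0 : Y) (g : R -> U) (y : R -> Y) : Prop :=
  [/\ L2_in_time s T g, continuous_in_time s T y & mild_solution s y0 g y].

Definition cost (alpha s : R) (g : R -> U) (y : R -> Y) : R :=
  alpha * fine (sq_integral s T g) + inorm (y T) ^+ 2.

Definition optimal_pair (alpha s : R) (y0 : Y) (g : R -> U) (y : R -> Y) : Prop :=
  admissible_pair s y0 g y /\
  forall g' y', admissible_pair s y0 g' y' -> cost alpha s g y <= cost alpha s g' y'.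

Definition control_adjoint (Bs : Y -> U) : Prop :=
  forall z w, As z w -> imem U (Bs z) /\
    forall g, imem U g -> idot U (Bs z) g = idot Y (z - w) (G g).

(* Boundedness of g |-> int_s^(.) e^{(.-r)A} B g(r) dr from L^2(s,T;U) to
   C([s,T],Y). *)
Definition input_map_bounded : Prop :=
  forall s, 0 <= s < T -> exists c : R,
    forall g, L2_in_time s T g ->
      exists y, [/\ continuous_in_time s T y, mild_solution s 0 g y &
        forall t, s <= t <= T -> inorm (y t) ^+ 2 <= c * fine (sq_integral s T g)].

(* int_0^T || Bs e^{tAs} x ||_U^2 dt <= c_T ||x||_Y^2 on D(As), and K is the
   continuous extension of Bs e^{(.)As} to a map from Y to L^2(0,T;U). *)
Definition adjoint_observation (Bs : Y -> U) (K : Y -> R -> U) : Prop :=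
  [/\ exists c : R, forall x, dom As x ->
        L2_in_time 0 T (fun t => Bs (Es t x)) /\
        fine (sq_integral 0 T (fun t => Bs (Es t x))) <= c * inorm x ^+ 2,
      forall x, imem Y x -> L2_in_time 0 T (K x),
      exists c : R, forall x, imem Y x -> fine (sq_integral 0 T (K x)) <= c * inorm x ^+ 2,
      forall (a : R[i]) x y, imem Y x -> imem Y y ->
        {ae @time_measure R, forall t, 0 < t < T ->
           ieq (K (a *: x + y) t) (a *: K x t + K y t)}
    & forall x, dom As x ->
        {ae @time_measure R, forall t, 0 < t < T -> ieq (K x t) (Bs (Es t x))}].

(* The weight alpha^{-1} comes from the control cost alpha ||g||_U^2: minimising
   the Hamiltonian gives the feedback g = - alpha^{-1} Bs P y, and it is 1 when
   alpha = 1. *)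
Definition riccati_problem (alpha : R) (Bs : Y -> U) (PT : Y -> Y) (P : R -> Y -> Y) : Prop :=
  (forall x Ax y Ay, A x Ax -> A y Ay -> forall t, 0 <= t < T ->
     exists2 d : R[i],
       has_derivative_within T (fun r => idot Y (P r x) y) t d &
       d + idot Y (P t x) Ay + idot Y Ax (P t y)
         - (alpha^-1)%:C * idot U (Bs (P t x)) (Bs (P t y)) = 0) /\
  forall x, imem Y x -> ieq (P T x) (PT x).

Definition bounded_gain (Bs : Y -> U) (P : R -> Y -> Y) : Prop :=
  forall t, 0 <= t <= T ->
    (forall x, imem Y x -> dom As (P t x)) /\
    bounded_linear (fun x => Bs (P t x)).

End Control.

(* Main.v *)
(** Write (x, y) for the real part of the inner product of Y, and k_t(x, y) for
    that of K x and K y in L^2(0, t; U).  Completing the square in the cost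
    shows that the final state v of the optimal trajectory solves the coercive
    variational problem
      (v, y) + alpha^-1 k_{T-s}(v, y) = (e^{(T-s)A} y0, y)  for all y,
    and that the optimal control is - alpha^-1 (K v)(T - t).  The problem on a
    later interval, started on the optimal trajectory, has the same solution v;
    this gives the transition property and the feedback law.

    For the Riccati equation, replace the identity by the averages
    G_n x = n int_0^{1/n} e^{rA} x dr and their adjoints G_n^*, which map Y into
    D(A^* ), and put P_n(t) x = e^{tau A^*} G_n^* v_n with tau = T - t and
      (v_n, y) + alpha^-1 k_tau(G_n^* v_n, G_n^* y) = (G_n e^{tau A} x, y).
    By the uniform boundedness principle B^* G_n^* is bounded, so this form is
    C^1 in tau, and differentiating the variational problem gives the Riccati
    equation with P_n(T) = G_n^* G_n.  Coercivity turns the strong convergence of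
    the averages, which is uniform along the (compact) orbits, into that of P_n.

    That the Sobolev-Slobodeckij space on the boundary is a vector space needs
    Tonelli's theorem, hence a sigma-finite surface measure: the boundary is
    locally a Lipschitz graph, so it has locally finite Hausdorff measure. *)

(* An element of Y or U is a function known up to a seminorm, so algebraic laws hold only up to
   [ieq], and [K] is moreover given only for almost every time. The proof therefore works with real
   semi-inner products on modules of representatives and recovers a complex pairing from its real
   parts against [y] and ['i *: y]. Two obstacles shape it. First, [Bs] lives on the domain of [As]
   and trajectories are mild solutions in the dual of that domain. Identities in Y are tested
   against this dense domain, where [K x t] is [Bs (Es t x)], and they reach all of Y once Riesz'
   theorem has turned the control integral into an element of Y. Second, nothing places P(t) x in
   the domain of [As], so [Bs (P t x)] has no direct meaning. The averages are chosen because they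
   map into that domain and commute with the semigroup: the observation of an averaged orbit is then
   a bounded operator applied to the orbit, hence continuous in time instead of merely square
   integrable, and this is what makes the form differentiable. *)
Require Import Defs.
From HB Require Import structures.
From mathcomp Require Import all_boot all_order all_algebra complex.
From mathcomp Require Import all_classical all_reals all_analysis.
From mathcomp Require Import measurable_realfun ring lra.
Set Implicit Arguments.
Unset Strict Implicit.
Unset Printing Implicit Defensive.
Import Order.TTheory GRing.Theory Num.Theory numFieldNormedType.Exports.
Local Open Scope classical_set_scope.
Local Open Scope complex_scope.
Local Open Scope ring_scope.

(** * Integrals of functions known up to null sets *)

Section AlmostIntegrable.
Context d (T : measurableType d) (R : realType) (mu : {measure set T -> \bar R}).

Import HBNNSimple.

(** A simple function below [f], multiplied by the indicator of the complement of the exceptional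
    null set, lies below [g] and keeps its integral. *)
Lemma ge0_integral_ae_le (f g : T -> \bar R) :
  (forall x, 0 <= f x)%E -> (forall x, 0 <= g x)%E ->
  {ae mu, forall x, f x = g x} ->
  (\int[mu]_x f x <= \int[mu]_x g x)%E.
Proof.
move=> f0 g0 [N [mN N0 fgN]].
rewrite !ge0_integralTE//.
apply: ge_ereal_sup => _ [h hf <-].
pose h' : {nnsfun T >-> R} := proj_nnsfun h (measurableC mN).
have h'E x : h' x = (h x * \1_(~` N) x)%R by [].
apply: (@le_trans _ _ (sintegral mu h')).
  rewrite -[X in (X <= _)%E](_ : \int[mu]_(x in setT) (h x)%:E = _)%E; last first.
    by rewrite integral_nnsfun// patch_setT.
  rewrite -[X in (_ <= X)%E](_ : \int[mu]_(x in setT) (h' x)%:E = _)%E; last first.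
    by rewrite integral_nnsfun// patch_setT.
  rewrite le_eqVlt; apply/orP; left; apply/eqP/ge0_ae_eq_integral => //.
  - exact/measurable_EFinP.
  - exact/measurable_EFinP.
  - by move=> x _; rewrite lee_fin.
  - by move=> x _; rewrite lee_fin.
  exists N; split => // x xN; apply: contrapT => Nx; apply: xN => _.
  by rewrite h'E indicE mem_set// mulr1.
apply: ereal_sup_ubound; exists h' => // x.
rewrite h'E indicE; have [Nx|Nx] := pselect (N x).
  by rewrite memNset ?mulr0//; apply.
rewrite mem_set// mulr1 -[g x](_ : f x = _)//.
by apply: contrapT => fgx; apply: Nx; apply: fgN.
Qed.

(* No measurability is assumed: the integral of a non-negative function is a
   supremum over the simple functions below it. *)
Lemma integral_ae (D : set T) (f g : T -> \bar R) :
  {ae mu, forall x, D x -> f x = g x} ->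
  (\int[mu]_(x in D) f x = \int[mu]_(x in D) g x)%E.
Proof.
move=> fg.
have fgD : {ae mu, forall x, (f \_ D) x = (g \_ D) x}.
  apply: filterS fg => x fgx; rewrite /patch; case: ifPn => //.
  by rewrite inE => /fgx.
rewrite integral_mkcond [RHS]integral_mkcond integralE [RHS]integralE.
by congr (_ - _)%E; apply/eqP; rewrite eq_le !ge0_integral_ae_le//; move: fgD;
  apply: filterS => x fgx; rewrite ?funeposE ?funenegE fgx.
Qed.

Variables (D : set T) (mD : measurable D).
Implicit Types f g h : T -> R.

(** Measurability and, in [aint], integrability modulo null sets. Strongly measurable paths are
    almost everywhere limits of simple functions, so their pairings need not be measurable as they
    stand. *)
Definition aemf f := exists2 f0 : T -> R, measurable_fun D f0 &
  {ae mu, forall x, D x -> f x = f0 x}.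

Definition aint f := exists2 f0 : T -> R, mu.-integrable D (EFin \o f0) &
  {ae mu, forall x, D x -> f x = f0 x}.

Definition rI f : R := fine (\int[mu]_(x in D) (f x)%:E)%E.

Lemma rI_ae f g : {ae mu, forall x, D x -> f x = g x} -> rI f = rI g.
Proof.
move=> fg; rewrite /rI (@integral_ae _ _ (EFin \o g))//.
by apply: filterS fg => x /= fgx /fgx ->.
Qed.

Lemma rI_eq f g : (forall x, D x -> f x = g x) -> rI f = rI g.
Proof. by move=> fg; apply: rI_ae; exact: aeW. Qed.

Lemma aint_ae f g : {ae mu, forall x, D x -> f x = g x} -> aint f -> aint g.
Proof.
move=> fg [f0 i0 ff0]; exists f0 => //.
by apply: filterS2 fg ff0 => x + + Dx => <-// ->.
Qed.

Lemma aint_eq f g : (forall x, D x -> f x = g x) -> aint f -> aint g.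
Proof. by move=> fg; apply: aint_ae; exact: aeW. Qed.

Lemma aemf_ae f g : {ae mu, forall x, D x -> f x = g x} -> aemf f -> aemf g.
Proof.
move=> fg [f0 i0 ff0]; exists f0 => //.
by apply: filterS2 fg ff0 => x + + Dx => <-// ->.
Qed.

Lemma integrable_aint f : mu.-integrable D (EFin \o f) -> aint f.
Proof. by move=> fi; exists f => //; exact: aeW. Qed.

Lemma measurable_aemf f : measurable_fun D f -> aemf f.
Proof. by move=> fi; exists f => //; exact: aeW. Qed.

Lemma aint_aemf f : aint f -> aemf f.
Proof.
move=> [f0 i0 ff0]; exists f0 => //; exact/measurable_EFinP/(measurable_int mu).
Qed.

Lemma aint0 : aint (fun=> 0).
Proof. by apply: integrable_aint; exact: integrable0. Qed.

Lemma rI0 : rI (fun=> 0) = 0.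
Proof. by rewrite /rI integral0. Qed.

Lemma aint_EFin f : aint f -> (\int[mu]_(x in D) (f x)%:E)%E = (rI f)%:E.
Proof.
move=> [f0 i0 ff0]; rewrite (rI_ae ff0) (@integral_ae _ _ (EFin \o f0)).
  by rewrite /rI fineK//; exact: (integrable_fin_num mD i0).
by apply: filterS ff0 => x /= + Dx => ->.
Qed.

Lemma aintD f g : aint f -> aint g -> aint (fun x => f x + g x).
Proof.
move=> [f0 i0 ff0] [g0 j0 gg0]; exists (fun x => f0 x + g0 x).
  by have := integrableD mD i0 j0.
by apply: filterS2 ff0 gg0 => x + + Dx => -> // ->.
Qed.

Lemma rID f g : aint f -> aint g -> rI (fun x => f x + g x) = rI f + rI g.
Proof.
move=> [f0 i0 ff0] [g0 j0 gg0]; rewrite (rI_ae ff0) (rI_ae gg0).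
rewrite (@rI_ae _ (fun x => f0 x + g0 x)).
  by have := RintegralD mD i0 j0.
by apply: filterS2 ff0 gg0 => x + + Dx => -> // ->.
Qed.

Lemma aintZ (r : R) f : aint f -> aint (fun x => r * f x).
Proof.
move=> [f0 i0 ff0]; exists (fun x => r * f0 x).
  by have := integrableZl mD r i0.
by apply: filterS ff0 => x + Dx => ->.
Qed.

Lemma rIZ (r : R) f : aint f -> rI (fun x => r * f x) = r * rI f.
Proof.
move=> [f0 i0 ff0]; rewrite (rI_ae ff0) (@rI_ae _ (fun x => r * f0 x)).
  by have := RintegralZl r mD i0.
by apply: filterS ff0 => x + Dx => ->.
Qed.

Lemma aintN f : aint f -> aint (fun x => - f x).
Proof.
by move=> /(aintZ (-1)); apply: aint_eq => x _; rewrite mulN1r.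
Qed.

Lemma rIN f : aint f -> rI (fun x => - f x) = - rI f.
Proof.
move=> fi; rewrite -mulN1r -rIZ//; by apply: rI_eq => x _; rewrite mulN1r.
Qed.

Lemma aintB f g : aint f -> aint g -> aint (fun x => f x - g x).
Proof. by move=> fi /aintN; exact: aintD. Qed.

Lemma rIB f g : aint f -> aint g -> rI (fun x => f x - g x) = rI f - rI g.
Proof. by move=> fi gi; rewrite rID// ?rIN//; exact: aintN. Qed.

Lemma rI_ge0 f : {ae mu, forall x, D x -> 0 <= f x} -> 0 <= rI f.
Proof.
move=> f0; rewrite (@rI_ae _ (fun x => `|f x|)).
  by rewrite /rI fine_ge0// integral_ge0// => x _; rewrite lee_fin.
by apply: filterS f0 => x + Dx => /(_ Dx) /ger0_norm ->.
Qed.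

Lemma le_rI f g : aint f -> aint g -> {ae mu, forall x, D x -> f x <= g x} ->
  rI f <= rI g.
Proof.
move=> fi gi fg; rewrite -subr_ge0 -rIB//; apply: rI_ge0.
by apply: filterS fg => x + Dx => /(_ Dx); rewrite subr_ge0.
Qed.

Lemma aemfD f g : aemf f -> aemf g -> aemf (fun x => f x + g x).
Proof.
move=> [f0 i0 ff0] [g0 j0 gg0]; exists (fun x => f0 x + g0 x).
  exact: measurable_funD.
by apply: filterS2 ff0 gg0 => x + + Dx => -> // ->.
Qed.

Lemma aemfM f g : aemf f -> aemf g -> aemf (fun x => f x * g x).
Proof.
move=> [f0 i0 ff0] [g0 j0 gg0]; exists (fun x => f0 x * g0 x).
  exact: measurable_funM.
by apply: filterS2 ff0 gg0 => x + + Dx => -> // ->.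
Qed.

Lemma aemf_cst (r : R) : aemf (fun=> r).
Proof. by apply: measurable_aemf; exact: measurable_cst. Qed.

Lemma aemf_cvg (F : nat -> T -> R) f : (forall n, aemf (F n)) ->
  {ae mu, forall x, D x -> F n x @[n --> \oo] --> f x} -> aemf f.
Proof.
move=> mF [N [mN N0 cvN]].
have /choice[F0 F0P] : forall n, exists f0 : T -> R, measurable_fun D f0 /\
    {ae mu, forall x, D x -> F n x = f0 x}.
  by move=> n; have [f0 ? ?] := mF n; exists f0.
have /choice[M MP] : forall n, exists M, [/\ measurable M, mu M = 0%E &
    ~` [set x | D x -> F n x = F0 n x] `<=` M].
  by move=> n; have [_ [M [? ? ?]]] := F0P n; exists M.
(* All exceptional null sets together. Off [W] the representatives [F0 n] equal [F n] and converge;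
   on [W] they are replaced by 0, so that convergence holds everywhere on [D]. *)
pose W := N `|` \bigcup_n M n.
have mW : measurable W by apply: measurableU => //; apply: bigcup_measurable => n _; case: (MP n).
have W0 : mu W = 0%E.
  apply: measure_negligible => //; apply: negligibleU; last first.
    by apply: negligible_bigcup => n; exists (M n); case: (MP n) => ? ? _; split => //; exact: subset_refl.
  by exists N; split => //; exact: subset_refl.
pose G n x := F0 n x * \1_(~` W) x.
have mG n : measurable_fun D (G n).
  apply: measurable_funM; first by case: (F0P n).
  by apply: measurable_indic; exact: measurableC.
have W1 x : D x -> ~ W x -> forall n, F n x = F0 n x.
  move=> Dx Wx n; apply: contrapT => Fx; apply: Wx; right; exists n => //.
  have [_ _] := MP n; apply => /= H; exact/Fx/H.
pose f0 x := f x * \1_(~` W) x.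
exists f0; last first.
  exists W; split => // x /= fx; apply: contrapT => Wx; apply: fx => Dx.
  by rewrite /f0 indicE mem_set// mulr1.
apply: (@measurable_fun_cvg _ _ _ D G) => // x Dx.
rewrite /f0 /G indicE /=; have [Wx|Wx] := pselect (W x).
  rewrite memNset/= ?mulr0; last by move=> /=; apply.
  under eq_fun do rewrite mulr0; exact: cvg_cst.
rewrite mem_set// mulr1; under eq_fun do rewrite mulr1 -(W1 _ Dx Wx).
apply: contrapT => cx; apply: Wx; left; apply: cvN => /= H; exact/cx/H.
Qed.

Lemma aint_dom f g : aemf f -> aint g ->
  {ae mu, forall x, D x -> `|f x| <= g x} -> aint f.
Proof.
move=> [f0 mf0 ff0] [g0 ig0 gg0] fg.
(* Truncating [f0] between [- |g0|] and [|g0|] makes the domination hold everywhere and changes [f0]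
   only on a null set. *)
pose f1 x := Num.max (- `|g0 x|) (Num.min (f0 x) `|g0 x|).
have mg0 : measurable_fun D g0 by exact/measurable_EFinP/(measurable_int mu).
have mng : measurable_fun D (fun x => `|g0 x|) by exact: measurableT_comp.
exists f1; last first.
  apply: filterS3 ff0 gg0 fg => x f1E g1E fgx Dx.
  rewrite /f1 -g1E// -f1E//.
  have := fgx Dx; rewrite ler_norml => /andP[a b].
  have g0x : 0 <= g x by lra.
  rewrite ger0_norm// min_l// max_r//.
apply: (le_integrable mD) ig0.
  apply/measurable_EFinP; apply: measurable_maxr; first exact: measurableT_comp.
  exact: measurable_minr.
move=> x Dx /=; rewrite lee_fin /f1 ler_norml.
rewrite le_max lexx /= ge_max ge_min lexx orbT andbT.
by have := normr_ge0 (g0 x); lra.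
Qed.

Lemma rI_norm f : aint f -> aint (fun x => `|f x|) /\ `|rI f| <= rI (fun x => `|f x|).
Proof.
move=> fi.
have nfi : aint (fun x => `|f x|).
  case: fi => f0 if0 ff0; exists (fun x => `|f0 x|).
    by have := integrable_norm if0.
  by apply: filterS ff0 => x + Dx => ->.
split => //; rewrite ler_norml -rIN//; apply/andP; split; apply: le_rI => //.
- exact: aintN.
- by apply: aeW => x _; rewrite lerNl -normrN ler_norm.
- by apply: aeW => x _; exact: ler_norm.
Qed.

Lemma aintM2 f g : aemf f -> aemf g -> aint (fun x => f x ^+ 2) ->
  aint (fun x => g x ^+ 2) -> aint (fun x => f x * g x).
Proof.
move=> mf mg f2 g2; apply: (aint_dom _ (aintD f2 g2)); first exact: aemfM.
apply: aeW => x _; rewrite ler_norml; nra.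
Qed.

Lemma aint_lty f : aemf f -> {ae mu, forall x, D x -> 0 <= f x} ->
  (\int[mu]_(x in D) (f x)%:E < +oo)%E -> aint f.
Proof.
move=> [f0 mf ff0] f_ge0 fy; exists f0 => //; apply/integrableP; split.
  exact/measurable_EFinP.
rewrite -(@integral_ae D (fun x => (f x)%:E))//.
by apply: filterS2 ff0 f_ge0 => x f0x fx Dx /=; rewrite -f0x// ger0_norm ?fx.
Qed.

Lemma rI_eq0 f : aint f -> {ae mu, forall x, D x -> 0 <= f x} -> rI f = 0 ->
  {ae mu, forall x, D x -> f x = 0}.
Proof.
move=> [f0 if0 ff0] f_ge0 If.
have mf0 : measurable_fun D (EFin \o f0) by exact: (measurable_int mu).
have : (\int[mu]_(x in D) `|(f0 x)%:E| = 0)%E.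
  rewrite -(@integral_ae D (fun x => (f x)%:E)).
    rewrite aint_EFin ?If//; by exists f0.
  by apply: filterS2 ff0 f_ge0 => x f0x fx Dx /=; rewrite -f0x// ger0_norm ?fx.
move=> /(ae_eq_integral_abs mu mD mf0) f00.
by apply: filterS2 ff0 f00 => x + + Dx => -> // /(_ Dx) [].
Qed.

End AlmostIntegrable.

(** * Semi-inner products *)

Section SemiInnerProduct.
Variables (R : realType) (V : lmodType R[i]).
Implicit Types (d : V -> V -> R) (x y z u v : V) (r c : R).

(* The real part of a complex semi-inner product, which determines it. *)
Record sip d : Prop := Sip {
  sipD : forall x y z, d (x + y) z = d x z + d y z;
  sipZ : forall (a : R[i]) x y, d (a *: x) y = d x (conjc a *: y);
  sipR : forall r x y, d (r%:C *: x) y = r * d x y;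
  sipC : forall x y, d x y = d y x;
  sip_ge0 : forall x, 0 <= d x x }.

Definition nm d x : R := Num.sqrt (d x x).
Definition eqv d x y : Prop := nm d (x - y) = 0.
(** Completeness for sequences with increments at most 4^-n, the rate at which the minimising
    sequence in [riesz] and the partial sums in [gliding_hump] converge. Limits are unique only up
    to [eqv]. *)
Definition complete_sip d := forall u : nat -> V,
  (forall n, nm d (u n.+1 - u n) <= 4^-1 ^+ n) ->
  exists l, nm d (u n - l) @[n --> \oo] --> (0 : R).

Lemma real_complexN1 : (-1)%:C = -1 :> R[i].
Proof. by apply/eqP; rewrite eq_complex /= oppr0 !eqxx. Qed.

Lemma le0_geo (x c : R) : (forall n, x <= c * 4^-1 ^+ n) -> x <= 0.
Proof.
move=> xc; rewrite leNgt; apply/negP => x0.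
have : (c * 4^-1 ^+ n)%R @[n --> \oo] --> (c * 0 : R).
  by apply: cvgMl_tmp; apply: cvg_expr; rewrite ger0_norm; lra.
rewrite mulr0 => /cvgr_lt /(_ x x0)[n _ /(_ n (leqnn n)) /=].
by rewrite ltNge xc.
Qed.

Section Theory.
Variables (d : V -> V -> R) (H : sip d).
Local Notation N := (nm d).

Lemma dDl x y z : d (x + y) z = d x z + d y z. Proof. exact: sipD. Qed.
Lemma dDr x y z : d z (x + y) = d z x + d z y.
Proof. by rewrite (sipC H) dDl !(sipC H _ z). Qed.
Lemma dRl r x y : d (r%:C *: x) y = r * d x y. Proof. exact: sipR. Qed.
Lemma dRr r x y : d x (r%:C *: y) = r * d x y.
Proof. by rewrite (sipC H) dRl (sipC H). Qed.
Lemma dNl x y : d (- x) y = - d x y.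
Proof. by rewrite -scaleN1r -real_complexN1 dRl mulN1r. Qed.
Lemma dNr x y : d x (- y) = - d x y.
Proof. by rewrite (sipC H) dNl (sipC H). Qed.
Lemma dBl x y z : d (x - y) z = d x z - d y z. Proof. by rewrite dDl dNl. Qed.
Lemma dBr x y z : d z (x - y) = d z x - d z y. Proof. by rewrite dDr dNr. Qed.
Lemma d0l y : d 0 y = 0. Proof. by rewrite -(subrr y) dBl subrr. Qed.
Lemma d0r y : d y 0 = 0. Proof. by rewrite (sipC H) d0l. Qed.

Lemma nm_ge0 x : 0 <= N x. Proof. exact: sqrtr_ge0. Qed.
Lemma nm2 x : N x ^+ 2 = d x x. Proof. by rewrite sqr_sqrtr// (sip_ge0 H). Qed.
Lemma nm0 : N 0 = 0. Proof. by rewrite /nm d0l sqrtr0. Qed.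
Lemma nmN x : N (- x) = N x. Proof. by rewrite /nm dNl dNr opprK. Qed.
Lemma nmBC x y : N (x - y) = N (y - x). Proof. by rewrite -nmN opprB. Qed.
Lemma nmR r x : N (r%:C *: x) = `|r| * N x.
Proof. by rewrite /nm dRl dRr mulrA -expr2 sqrtrM ?sqr_ge0// sqrtr_sqr. Qed.

Lemma nm_normc (a : R[i]) x : N (a *: x) = Normc.normc a * N x.
Proof.
rewrite /nm (sipZ H) scalerA.
have -> : conjc a * a = (complex.Re a ^+ 2 + complex.Im a ^+ 2)%:C.
  by case: a => p q; apply/eqP; rewrite eq_complex /=; apply/andP; split; apply/eqP; ring.
rewrite dRr sqrtrM; last by rewrite addr_ge0 ?sqr_ge0.
by case: a.
Qed.

Lemma cs x y : d x y <= N x * N y.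
Proof.
have q (t : R) : 0 <= d x x + 2 * t * d x y + t ^+ 2 * d y y.
  have := sip_ge0 H (x + t%:C *: y).
  rewrite dDl !dDr !dRl !dRr (sipC H y x); lra.
have [y0|y0] := eqVneq (N y) 0.
  (* With [d y y = 0] the polynomial [q] is affine in t; unless [d x y] vanishes, this t gives it
     the value -1. *)
  have := q (- (d x x + 1) / (2 * d x y)); rewrite -!nm2 y0 expr0n/= !mulr0 !addr0.
  have [-> //|dn0] := eqVneq (d x y) 0.
  rewrite (_ : 2 * (- (N x ^+ 2 + 1) / (2 * d x y)) * d x y = - (N x ^+ 2 + 1)); last by field.
  lra.
have y1 : 0 < N y by rewrite lt_def y0 nm_ge0.
have [x0|x0] := eqVneq (N x) 0.
  have := q (- d x y / d y y); rewrite -!nm2 x0 expr0n/= mul0r add0r.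
  rewrite (_ : _ + _ = - ((d x y) ^+ 2 / N y ^+ 2)); last by field.
  rewrite oppr_ge0 pmulr_lle0 ?invr_gt0 ?exprn_gt0//.
  by move=> h; have /eqP -> : d x y == 0 by rewrite -sqrf_eq0 eq_le h sqr_ge0.
have x1 : 0 < N x by rewrite lt_def x0 nm_ge0.
have := q (- N x / N y); rewrite -!nm2.
rewrite (_ : _ + _ = 2 * N x / N y * (N x * N y - d x y)); last by field.
by rewrite pmulr_rge0 ?subr_ge0// divr_gt0// mulr_gt0.
Qed.

Lemma cs_abs x y : `|d x y| <= N x * N y.
Proof. by rewrite ler_norml cs andbT lerNl -dNl (le_trans (cs _ _))// nmN. Qed.

Lemma nm_le_sq x c : 0 <= c -> d x x <= c ^+ 2 -> N x <= c.
Proof. by move=> c0; rewrite -nm2 ler_sqr ?nnegrE ?nm_ge0. Qed.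

Lemma nmD x y : N (x + y) <= N x + N y.
Proof.
apply: nm_le_sq; first by rewrite addr_ge0 ?nm_ge0.
by rewrite dDl !dDr sqrrD !nm2 (sipC H y x); have := cs x y; lra.
Qed.

Lemma nmB x y : N (x - y) <= N x + N y.
Proof. by rewrite (le_trans (nmD _ _))// nmN. Qed.

Lemma nm_tri y x z : N (x - z) <= N (x - y) + N (y - z).
Proof. by rewrite (le_trans _ (nmD _ _))// addrA subrK. Qed.

Lemma nm_dual x c : 0 <= c -> d x x <= c * N x -> N x <= c.
Proof.
move=> c0; have [->//|x0] := eqVneq (N x) 0; rewrite -nm2 expr2.
by rewrite ler_pM2r// lt_def x0 nm_ge0.
Qed.

Lemma eqv_d x y z : eqv d x y -> d x z = d y z.
Proof.
move=> xy; apply/eqP; rewrite -subr_eq0 -dBl -normr_le0.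
by rewrite (le_trans (cs_abs _ _))// (_ : N _ = 0)// mul0r.
Qed.

Lemma eqv_dr x y z : eqv d x y -> d z x = d z y.
Proof. by move=> xy; rewrite (sipC H) (eqv_d _ xy) (sipC H). Qed.

Lemma eqvP x y : (forall z, d x z = d y z) -> eqv d x y.
Proof. by move=> xy; rewrite /eqv /nm dBl xy subrr sqrtr0. Qed.

Lemma eqv_refl x : eqv d x x. Proof. exact: eqvP. Qed.
Lemma eqv_sym x y : eqv d x y -> eqv d y x.
Proof. by move=> xy; apply: eqvP => z; rewrite (eqv_d _ xy). Qed.
Lemma eqv_trans y x z : eqv d x y -> eqv d y z -> eqv d x z.
Proof. by move=> xy yz; apply: eqvP => w; rewrite (eqv_d _ xy) (eqv_d _ yz). Qed.

Lemma eqv_nm x y : eqv d x y -> N x = N y.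
Proof. by move=> xy; rewrite /nm (eqv_d _ xy) (eqv_dr _ xy). Qed.

Lemma eqvD x y x' y' : eqv d x x' -> eqv d y y' -> eqv d (x + y) (x' + y').
Proof. by move=> xx yy; apply: eqvP => z; rewrite !dDl (eqv_d _ xx) (eqv_d _ yy). Qed.

Lemma eqvN x x' : eqv d x x' -> eqv d (- x) (- x').
Proof. by move=> xx; apply: eqvP => z; rewrite !dNl (eqv_d _ xx). Qed.

Lemma eqvB x y x' y' : eqv d x x' -> eqv d y y' -> eqv d (x - y) (x' - y').
Proof. by move=> xx yy; apply: eqvD => //; exact: eqvN. Qed.

Lemma eqvZ (a : R[i]) x x' : eqv d x x' -> eqv d (a *: x) (a *: x').
Proof. by move=> xx; apply: eqvP => z; rewrite !(sipZ H) (eqv_d _ xx). Qed.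

Lemma geo_tail (u : nat -> V) (l : V) :
  (forall n, N (u n.+1 - u n) <= 4^-1 ^+ n) ->
  N (u n - l) @[n --> \oo] --> (0 : R) ->
  forall n, N (l - u n) <= 4 / 3 * 4^-1 ^+ n.
Proof.
move=> ui ul n.
have un k : N (u (n + k)%N - u n) <= 4 / 3 * (4^-1 ^+ n - 4^-1 ^+ (n + k)).
  elim: k => [|k IH]; first by rewrite addn0 !subrr nm0 mulr0.
  rewrite addnS (le_trans (nm_tri (u (n + k)%N) _ _))//.
  have := ui (n + k)%N; rewrite exprS; lra.
rewrite -subr_le0; apply/ler_addgt0Pr => e e0; rewrite add0r.
move/cvgrPdist_lt : ul => /(_ e e0) [m _ me].
have := me (n + m)%N (leq_addl _ _); rewrite /= sub0r normrN ger0_norm ?nm_ge0// => h.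
have := nm_tri (u (n + m)%N) l (u n); rewrite nmBC => h2.
have := un m; have : 0 < 4^-1 ^+ (n + m) :> R by rewrite exprn_gt0.
rewrite (nmBC l) in h2; lra.
Qed.

Lemma riesz (f : V -> R) (c : R) : complete_sip d ->
  (forall x y, f (x + y) = f x + f y) -> (forall r x, f (r%:C *: x) = r * f x) ->
  (forall x, f x <= c * N x) -> exists v, forall x, d v x = f x.
Proof.
move=> cpl fD fR fc.
pose F x := d x x - 2 * f x.
have Flb x : - c ^+ 2 <= F x.
  by rewrite /F -nm2; have := fc x; have := sqr_ge0 (N x - c); lra.
have hinf : has_inf (range F).
  by split; [exists (F 0), 0|exists (- c ^+ 2) => _ [x _ <-]].
pose m := inf (range F).
have mF x : m <= F x by apply: ge_inf; [case: hinf|exists x].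
(* The parallelogram identity bounds the squared increment by [2 * (e n + e n.+1)]; this choice
   keeps it below the square of [4^-1 ^+ n]. *)
pose e n : R := (4^-1 ^+ n) ^+ 2 / 4.
have e0 n : 0 < e n by rewrite /e divr_gt0// !exprn_gt0.
have /choice[u uP] n : exists x, F x < m + e n.
  by have [_ [x _ <-] ?] := inf_adherent (e0 n) hinf; exists x.
have ui n : N (u n.+1 - u n) <= 4^-1 ^+ n.
  apply: nm_le_sq; first by rewrite exprn_ge0.
  have := uP n; have := uP n.+1; have := mF (2^-1%:C *: (u n.+1 + u n)).
  have -> : e n.+1 = e n / 16 by rewrite /e [4^-1 ^+ n.+1]exprS; field.
  have := e0 n; have : (4^-1 ^+ n) ^+ 2 = 4 * e n by rewrite /e; field.
  rewrite /F !dBl !dBr !fR !dRl !dRr !fD !dDl !dDr (sipC H (u n) (u n.+1)); lra.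
have [l ul] := cpl _ ui; have tl := geo_tail ui ul.
exists l => x; apply/eqP; rewrite -subr_eq0 -normr_le0.
apply: (@le0_geo _ (4 / 3 * N x + (1 + d x x))) => n.
set E := 4^-1 ^+ n; have E0 : 0 < E by rewrite /E exprn_gt0.
have h1 := cs_abs (l - u n) x; rewrite dBl in h1.
have h2 : N (l - u n) * N x <= 4 / 3 * E * N x by rewrite ler_wpM2r ?nm_ge0 ?tl.
(* Near minimality of [u n] against [u n + t x]. With t = E and t = - E, of the order of the square
   root of [e n], it bounds the defect of [u n] in the equation by a multiple of E. *)
have q t : - (e n) <= 2 * t * (d (u n) x - f x) + t ^+ 2 * d x x.
  have := mF (u n + t%:C *: x); have := uP n.
  rewrite /F fD fR dDl !dDr !dRl !dRr (sipC H x (u n)); lra.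
have h3 : `|d (u n) x - f x| <= E * (1 + d x x).
  have hp := q E; have hm := q (- E).
  have -> : E * (1 + d x x) = (E ^+ 2 + E ^+ 2 * d x x) / E by field; lra.
  rewrite ler_pdivlMr//; have e1 : e n <= E ^+ 2 by rewrite /e -/E; have := sqr_ge0 E; lra.
  have e2 : 0 <= E ^+ 2 * d x x by rewrite mulr_ge0 ?sqr_ge0 ?(sip_ge0 H).
  have [hs|hs] := ger0P (d (u n) x - f x); have := sqr_ge0 E; nra.
rewrite (_ : d l x - f x = (d l x - d (u n) x) + (d (u n) x - f x)); last by lra.
by rewrite (le_trans (ler_normD _ _))//; lra.
Qed.

(* Gliding hump: the partial sums of [\sum_n +- 4^-n u_n], with signs chosen so
   that the n-th step makes [p n] large. *)
Lemma gliding_hump (p : nat -> V -> R) : complete_sip d ->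
  (forall n x y, p n (x + y) <= p n x + p n y) ->
  (forall n r x, p n (r%:C *: x) = `|r| * p n x) ->
  (forall n, exists c, forall x, p n x <= c * N x) ->
  (forall n, exists x, 16 ^+ n * N x < p n x) ->
  exists x, forall n, 4 ^+ n / 6 <= p n x.
Proof.
move=> cpl pD pR pb pu.
have pN n x : p n (- x) = p n x.
  by rewrite -scaleN1r -real_complexN1 pR normrN1 mul1r.
have p_ge0 n x : 0 <= p n x.
  have := pD n x (- x); rewrite pN subrr.
  have := pR n 0 0; rewrite normr0 mul0r scaler0 => ->; lra.
pose B n := [set y | exists2 x, N x <= 1 & y = p n x].
have hB n : has_sup (B n).
  split; first by exists (p n 0), 0; rewrite ?nm0.
  have [c hc] := pb n; exists `|c| => _ [x x1 ->].
  apply: (le_trans (hc x)); apply: (@le_trans _ _ (`|c| * N x)).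
    by rewrite ler_wpM2r ?nm_ge0 ?ler_norm.
  by rewrite ler_piMr.
(* The operator norm of [p n]: finite by [pb], at least [16 ^+ n] by [pu]. *)
pose S n := sup (B n).
have SN n x : p n x <= S n * N x.
  have [x0|x0] := eqVneq (N x) 0.
    by have [c hc] := pb n; have := hc x; rewrite x0 !mulr0.
  have x1 : 0 < N x by rewrite lt_def x0 nm_ge0.
  rewrite -ler_pdivrMr// mulrC; apply: sup_upper_bound => //.
  exists ((N x)^-1%:C *: x); first by rewrite nmR ger0_norm ?invr_ge0 ?nm_ge0// mulVf.
  by rewrite pR ger0_norm ?invr_ge0 ?nm_ge0.
have S0 n : 16 ^+ n <= S n.
  have [x hx] := pu n; have := SN n x => h.
  have x1 : 0 < N x.
    rewrite lt_def nm_ge0 andbT; apply/eqP => x0; move: h hx; rewrite x0 !mulr0; lra.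
  by rewrite -(ler_pM2r x1); lra.
have Sp n : 0 < S n by rewrite (lt_le_trans _ (S0 n))// exprn_gt0.
have /choice[u uP] n : exists x, N x <= 1 /\ S n / 2 < p n x.
  have h : 0 < S n / 2 by rewrite divr_gt0.
  have [_ [x x1 ->] hx] := sup_adherent h (hB n).
  by exists x; split => //; move: hx; rewrite -/(S n); lra.
pose r n : R := 4^-1 ^+ n.
have r0 n : 0 < r n by rewrite exprn_gt0.
(* The values of [p n] at [y + r u] and [y - r u] add up to at least [2 r p n u], so one of the two
   signs works. *)
pose g n y := if r n * p n (u n) <= p n (y + (r n)%:C *: u n)
  then y + (r n)%:C *: u n else y - (r n)%:C *: u n.
have gp n y : r n * p n (u n) <= p n (g n y).
  rewrite /g; case: ifPn => //; rewrite -ltNge => h.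
  have := pD n (y + (r n)%:C *: u n) (- (y - (r n)%:C *: u n)).
  rewrite pN opprB (addrC y) addrACA subrr addr0 -mulr2n -scaler_nat scalerA.
  rewrite (addrC _ y).
  rewrite (_ : 2 * (r n)%:C = (2 * r n)%:C :> R[i]); last by rewrite rmorphM rmorph_nat.
  rewrite pR ger0_norm ?mulr_ge0 ?(ltW (r0 n))//; lra.
have gn n y : N (g n y - y) <= r n.
  rewrite /g; case: ifPn => _; rewrite addrAC subrr add0r ?nmN nmR ger0_norm ?(ltW (r0 n))//;
  by rewrite ler_piMr ?(ltW (r0 n))//; case: (uP n).
pose x := fix x n := if n is k.+1 then g k (x k) else 0.
have xi n : N (x n.+1 - x n) <= 4^-1 ^+ n by exact: gn.
have [l xl] := cpl _ xi; have tl := geo_tail xi xl.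
exists l => n.
(* After step n the partial sums move by at most [4 / 3 * 4^-1 ^+ n.+1 = r n / 3], while [u n]
   attains half of [S n]. What remains is [r n * S n * (1 / 2 - 1 / 3)], whence the 6. *)
have h1 := gp n (x n); have h2 := tl n.+1; have h3 := SN n (x n.+1 - l).
have h4 := pD n (x n.+1 - l) l; rewrite subrK in h4.
rewrite -/(x n.+1) in h1; rewrite nmBC in h3.
have h5 : S n * N (l - x n.+1) <= S n * (4 / 3 * 4^-1 ^+ n.+1) by rewrite ler_wpM2l// ltW.
have [_ h6] := uP n.
have h7 : r n * (S n / 2) <= r n * p n (u n) by rewrite ler_wpM2l ?(ltW (r0 n))// ltW.
have h8 : r n * 16 ^+ n <= r n * S n by rewrite ler_wpM2l ?(ltW (r0 n)).
have h9 : r n * 16 ^+ n = 4 ^+ n.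
  by rewrite /r -exprMn; congr (_ ^+ _); field.
move: h5; rewrite [4^-1 ^+ n.+1]exprS -/(r n).
have -> : S n * (4 / 3 * (4^-1 * r n)) = r n * S n / 3 by field.
lra.
Qed.

(** If no constant works, members of the family exceed the norm by the factors [16 ^+ n], and the
    gliding hump yields one vector on which they are unbounded. *)
Lemma uniform_boundedness (I : Type) (p : I -> V -> R) : complete_sip d ->
  (forall n x y, p n (x + y) <= p n x + p n y) ->
  (forall n r x, p n (r%:C *: x) = `|r| * p n x) ->
  (forall n, exists c, forall x, p n x <= c * N x) ->
  (forall x, exists c, forall n, p n x <= c) ->
  exists c, forall n x, p n x <= c * N x.
Proof.
move=> cpl pD pR pb ptb; apply: contrapT => /forallNP h.
have /choice[j jP] n : exists i, exists x, 16 ^+ n * N x < p i x.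
  have /existsNP[i /existsNP[x]] := h (16 ^+ n); move=> /negP; rewrite -ltNge => hx.
  by exists i, x.
have [x xP] := @gliding_hump (fun n => p (j n)) cpl (fun n => pD _) (fun n => pR _) (fun n => pb _) jP.
have [c cP] := ptb x.
suff : 1 / 6 <= (0 : R) by lra.
apply: (@le0_geo _ c) => n; rewrite exprVn ler_pdivlMr ?exprn_gt0//.
by have := xP n; have := cP (j n); lra.
Qed.

End Theory.
End SemiInnerProduct.

(** * Spaces of representatives *)

Section Members.
Variable R : realType.

Definition rdot (X : ispace R) (x y : X) : R := complex.Re (idot X x y).

(** The carrier of an [ispace] is a full function space, and [idot] is meaningful only on [imem];
    hence the relativised laws. By antilinearity in the second argument, [phIm] recovers the
    imaginary part from the real form. *)
Record prehilbert (X : ispace R) : Prop := Prehilbert {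
  ph0 : imem X 0;
  phL : forall (a : R[i]) (x y : X), imem X x -> imem X y -> imem X (a *: x + y);
  phD : forall x y z : X, imem X x -> imem X y -> imem X z ->
    rdot (x + y) z = rdot x z + rdot y z;
  phZ : forall (a : R[i]) (x y : X), imem X x -> imem X y ->
    rdot (a *: x) y = rdot x (conjc a *: y);
  phR : forall (r : R) (x y : X), imem X x -> imem X y ->
    rdot (r%:C *: x) y = r * rdot x y;
  phC : forall x y : X, imem X x -> imem X y -> rdot x y = rdot y x;
  ph_ge0 : forall x : X, imem X x -> 0 <= rdot x x;
  phIm : forall x y : X, imem X x -> imem X y ->
    complex.Im (idot X x y) = rdot x ('i *: y) }.

Section Elements.
Variables (X : ispace R) (hX : prehilbert X).

Definition member : pred X := fun x => `[< imem X x >].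

Record elt := Elt { elv :> X; elP : member elv }.

(** [hX] is part of the type so that the module structure built from it can be inferred from the
    type alone. *)
Definition elt_of_prehilbert := let _ := hX in elt.

End Elements.
End Members.

Section EltLmodule.
Variables (R : realType) (X : ispace R) (hX : prehilbert X).
Local Notation elt := (elt_of_prehilbert hX).

Definition elt_val (x : elt) : X := elv x.

HB.instance Definition _ := [isSub of elt for elt_val].
HB.instance Definition _ := [Choice of elt by <:].

Lemma member_submod : submod_closed (@member R X).
Proof.
split; first by apply/asboolP; exact: ph0.
by move=> a x y /asboolP mx /asboolP my; apply/asboolP; exact: phL.
Qed.

HB.instance Definition _ := GRing.isSubmodClosed.Build R[i] X (@member R X) member_submod.
HB.instance Definition _ := [SubChoice_isSubLmodule of elt by <:].

End EltLmodule.

Section EltSip.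
Variables (R : realType) (X : ispace R) (hX : prehilbert X).
Local Notation H := (elt_of_prehilbert hX).
Implicit Types (x y : H) (a : R[i]).

Lemma elt_mem x : imem X (elt_val x). Proof. by apply/asboolP; exact: (valP x). Qed.
Lemma elt_valD x y : elt_val (x + y) = elt_val x + elt_val y. Proof. by []. Qed.
Lemma elt_valZ a x : elt_val (a *: x) = a *: elt_val x. Proof. by []. Qed.
Lemma elt_val0 : elt_val (0 : H) = 0. Proof. by []. Qed.
Lemma elt_valB x y : elt_val (x - y) = elt_val x - elt_val y. Proof. by []. Qed.

Definition lift (v : X) : H := insubd (0 : H) v.

Lemma liftK v : imem X v -> elt_val (lift v) = v.
Proof. by move=> mv; rewrite /lift /insubd insubT //; exact/asboolP. Qed.

Lemma lift_val x : lift (elt_val x) = x.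
Proof. by apply: val_inj; rewrite /= liftK//; exact: elt_mem. Qed.

Definition hd x y : R := rdot (elt_val x) (elt_val y).

Lemma hd_sip : sip hd.
Proof.
split.
- by move=> x y z; rewrite /hd elt_valD phD//; exact: elt_mem.
- by move=> a x y; rewrite /hd !elt_valZ phZ//; exact: elt_mem.
- by move=> r x y; rewrite /hd !elt_valZ phR//; exact: elt_mem.
- by move=> x y; rewrite /hd phC//; exact: elt_mem.
- by move=> x; apply: ph_ge0 => //; exact: elt_mem.
Qed.

Lemma hdE (x y : X) : imem X x -> imem X y -> rdot x y = hd (lift x) (lift y).
Proof. by move=> mx my; rewrite /hd !liftK. Qed.

Lemma inormE x : inorm (elt_val x) = nm hd x. Proof. by []. Qed.

Lemma ieqE x y : ieq (elt_val x) (elt_val y) = eqv hd x y. Proof. by []. Qed.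

Lemma phB (x y : X) : imem X x -> imem X y -> imem X (x - y).
Proof.
move=> mx my; have := elt_mem (lift x - lift y).
by rewrite elt_valB !liftK.
Qed.

Lemma idotE x y :
  idot X (elt_val x) (elt_val y) = hd x y +i* hd x ('i *: y).
Proof.
apply/eqP; rewrite eq_complex /= eqxx /=; apply/eqP.
by rewrite phIm//; exact: elt_mem.
Qed.

Lemma imemD (x y : X) : imem X x -> imem X y -> imem X (x + y).
Proof.
by move=> mx my; have := elt_mem (lift x + lift y); rewrite elt_valD !liftK.
Qed.

Lemma imemZ (a : R[i]) (x : X) : imem X x -> imem X (a *: x).
Proof. by move=> mx; have := elt_mem (a *: lift x); rewrite elt_valZ !liftK. Qed.

End EltSip.

(** * Integrals over time intervals *)

Section LimitCriteria.
Variable R : realType.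
Implicit Types (f : R -> R) (e t s T : R).

Lemma cvg_at_right0P f : f t @[t --> 0^'+] --> (0 : R) <->
  forall e, 0 < e -> exists2 d, 0 < d & forall t, 0 < t < d -> `|f t| < e.
Proof.
split => [/cvgrPdist_lt h e e0|h].
  have [d /= d0 hd] := h e e0; exists d => // t /andP[t0 td].
  have := hd t; rewrite sub0r normrN; apply => //=.
  by rewrite sub0r normrN gtr0_norm.
apply/cvgrPdist_lt => e e0; have [d d0 hd] := h e e0.
exists d => // t /=; rewrite !sub0r !normrN => td t0; apply: hd.
by rewrite t0 -[t]gtr0_norm.
Qed.

Lemma cvg_within_itvP s T t f : f r @[r --> within `[s, T] (nbhs t)] --> (0 : R) <->
  forall e, 0 < e -> exists2 d, 0 < d &
    forall r, s <= r <= T -> `|r - t| < d -> `|f r| < e.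
Proof.
split => [/cvgrPdist_lt h e e0|h].
  have [d /= d0 hd] := h e e0; exists d => // r rsT rt.
  by have := hd r; rewrite sub0r normrN; apply => //=; rewrite ?in_itv//= distrC.
apply/cvgrPdist_lt => e e0; have [d d0 hd] := h e e0.
exists d => // r /=; rewrite in_itv/= !sub0r !normrN => td rsT; apply: hd => //.
by rewrite distrC.
Qed.

Lemma cvg_within_itv_dnbhsP T t f :
  f r @[r --> within `[0, T] t^'] --> (0 : R) <->
  forall e, 0 < e -> exists2 d, 0 < d &
    forall r, 0 <= r <= T -> r != t -> `|r - t| < d -> `|f r| < e.
Proof.
split => [/cvgrPdist_lt h e e0|h].
  have [d /= d0 hd] := h e e0; exists d => // r rsT rnt rt.
  by have := hd r; rewrite sub0r normrN; apply => //=; rewrite ?in_itv//= distrC.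
apply/cvgrPdist_lt => e e0; have [d d0 hd] := h e e0.
exists d => // r /= td rt; rewrite in_itv/= !sub0r !normrN => rsT; apply: hd => //.
by rewrite distrC.
Qed.

End LimitCriteria.

(* [time_measure] and [leb3] are typed over the default measurable structures of
   [R] and [E3 R], which have the same measurable sets as the structures over
   which [lebesgue_measure] is typed, but another display. *)
Section MeasureInstances.
Variable R : realType.
Local Notation tm := (@time_measure R).
Local Notation l3 := (@leb3 R).
Let leb := @lebesgue_measure R.

Let tm0 : tm set0 = 0%E. Proof. exact: (measure0 leb). Qed.
Let tm_ge0 A : (0 <= tm A)%E. Proof. exact: (measure_ge0 leb). Qed.
Let tm_sigma_additive : semi_sigma_additive tm.
Proof. exact: (@measure_semi_sigma_additive _ _ _ leb). Qed.
HB.instance Definition _ := isMeasure.Build _ _ _ tm tm0 tm_ge0 tm_sigma_additive.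

Let l30 : l3 set0 = 0%E. Proof. exact: (measure0 ((leb \x leb) \x leb)%E). Qed.
Let l3_ge0 A : (0 <= l3 A)%E. Proof. exact: (measure_ge0 ((leb \x leb) \x leb)%E). Qed.
Let l3_sigma_additive : semi_sigma_additive l3.
Proof. exact: (@measure_semi_sigma_additive _ _ _ ((leb \x leb) \x leb)%E). Qed.
HB.instance Definition _ := isMeasure.Build _ _ _ l3 l30 l3_ge0 l3_sigma_additive.

Lemma time_measure_itv (i : interval R) :
  tm [set` i] = (if i.1 < i.2 then (i.2 : \bar R) - i.1 else 0)%E.
Proof. exact: lebesgue_measure_itv. Qed.

Lemma time_measure_unique (mu : {measure set R -> \bar R}) :
  (forall X, ocitv X -> tm X = mu X) -> forall A, measurable A -> tm A = mu A.
Proof.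
move=> h A mA; pose m : set (measurableTypeR R) -> \bar R := mu.
have m0 : m set0 = 0%E by exact: measure0.
have m_ge0 B : (0 <= m B)%E by exact: measure_ge0.
have mS : semi_sigma_additive m by exact: (@measure_semi_sigma_additive _ _ _ mu).
pose M : {measure set (measurableTypeR R) -> \bar R} :=
  HB.pack m (isMeasure.Build _ _ _ m m0 m_ge0 mS).
exact: (@lebesgue_measure_unique R M h).
Qed.

End MeasureInstances.

#[global] Instance ae_time_filter (R : realType) :
  Filter (almost_everywhere (@time_measure R)).
Proof. exact: (ae_filter_ringOfSetsType (@time_measure R)). Qed.

#[global] Instance ae_leb3_filter (R : realType) :
  Filter (almost_everywhere (@leb3 R)).
Proof. exact: (ae_filter_ringOfSetsType (@leb3 R)). Qed.

Section TimeIntegral.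
Variable R : realType.
Local Notation leb := (@time_measure R).
Implicit Types (f g : R -> R) (a b c : R).

Section Mkcond.
Context d (T : measurableType d) (mu : {measure set T -> \bar R}).

Lemma rI_mkcond (D : set T) (f : T -> R) : rI mu D f = rI mu setT (f \_ D).
Proof.
rewrite /rI integral_mkcond; congr fine; apply: eq_integral => x _.
by rewrite restrict_EFin.
Qed.

Lemma aint_mkcond (D : set T) (f : T -> R) : measurable D ->
  aint mu D f <-> aint mu setT (f \_ D).
Proof.
move=> mD; split => [[f0 if0 ff0]|[f0 if0 ff0]].
  exists (f0 \_ D).
    by rewrite -restrict_EFin; apply/(integrable_mkcond _ mD).
  by apply: filterS ff0 => x fx _; rewrite /patch; case: ifPn => //; rewrite inE => /fx.
exists f0; first exact: integrableS if0.
by apply: filterS ff0 => x fx Dx; rewrite -fx// /patch mem_set.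
Qed.

Lemma aintS (D D' : set T) (f : T -> R) : measurable D -> measurable D' ->
  D' `<=` D -> aint mu D f -> aint mu D' f.
Proof.
move=> mD mD' DD [f0 if0 ff0]; exists f0; first exact: integrableS if0.
by apply: filterS ff0 => x fx /DD.
Qed.

End Mkcond.

Definition taint a b f := aint leb `]a, b[ f.
Definition TI a b f : R := rI leb `]a, b[ f.

Lemma ae_leb_neq a : {ae leb, forall x : R, x != a}.
Proof.
exists [set a]; split => //; first exact: lebesgue_measure_set1.
by move=> x /= /negP; rewrite negbK => /eqP.
Qed.

Lemma TI_cc a b f : rI leb `[a, b] f = TI a b f.
Proof.
rewrite /TI rI_mkcond [RHS]rI_mkcond; apply: rI_ae.
apply: filterS2 (ae_leb_neq a) (ae_leb_neq b) => x xa xb _.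
rewrite /patch !mem_setE !in_itv/= !lt_def xa (eq_sym b) xb /=.
by [].
Qed.

Lemma TI_void a b f : b <= a -> TI a b f = 0.
Proof.
move=> ba; rewrite /TI /rI set_itv_ge ?integral_set0//.
by rewrite bnd_simp -leNgt.
Qed.

Lemma taint_sub a b a' b' f : a <= a' -> b' <= b -> taint a b f -> taint a' b' f.
Proof.
move=> aa bb; apply: aintS => // x /=; rewrite !in_itv/= => /andP[h1 h2].
by rewrite (le_lt_trans aa h1) (lt_le_trans h2 bb).
Qed.

Lemma TI_cat b a c f : a <= b -> b <= c -> taint a c f ->
  TI a c f = TI a b f + TI b c f.
Proof.
move=> ab bc h.
have /aint_mkcond h1 : taint a b f by apply: taint_sub h.
have /aint_mkcond h2 : taint b c f by apply: taint_sub h.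
rewrite /TI [LHS]rI_mkcond [X in _ = X + _]rI_mkcond [X in _ = _ + X]rI_mkcond -rID//; [|exact: h1|exact: h2].
apply: rI_ae; apply: filterS (ae_leb_neq b) => x xb _.
rewrite /patch !mem_setE !in_itv/=.
have [h'|h'|h'] := ltgtP x b; rewrite ?andbF ?andbT /= ?addr0 ?add0r//.
- by rewrite (lt_le_trans h' bc) ?andbT ?addr0.
- by rewrite (le_lt_trans ab h') /= ?add0r.
- by rewrite h' eqxx in xb.
Qed.

Lemma TI_eq a b f g : (forall x, a < x < b -> f x = g x) -> TI a b f = TI a b g.
Proof. by move=> fg; apply: rI_eq => x /=; rewrite in_itv; exact: fg. Qed.

Lemma TI_ae a b f g : {ae leb, forall x, a < x < b -> f x = g x} ->
  TI a b f = TI a b g.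
Proof. by move=> fg; apply: rI_ae; apply: filterS fg => x /=; rewrite in_itv. Qed.

Lemma taint_ae a b f g : {ae leb, forall x, a < x < b -> f x = g x} ->
  taint a b f -> taint a b g.
Proof. by move=> fg; apply: aint_ae; apply: filterS fg => x /=; rewrite in_itv. Qed.

Lemma taint_cst a b c : taint a b (fun=> c).
Proof.
apply: integrable_aint; apply: measurable_bounded_integrable => //.
  by rewrite /= time_measure_itv/=; case: ifP => // _; rewrite -EFinD ltry.
exists `|c|; split; first exact: num_real.
by move=> M cM x _ /=; exact: ltW.
Qed.

Lemma TI_cst a b c : a <= b -> TI a b (fun=> c) = c * (b - a).
Proof.
move=> ab; rewrite /TI /rI integral_cst//= time_measure_itv/= lte_fin.
case: ltP => h; first by rewrite -EFinD -EFinM.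
by rewrite mule0/= (_ : b - a = 0) ?mulr0//; lra.
Qed.

Lemma TI_le a b f g : taint a b f -> taint a b g ->
  (forall x, a < x < b -> f x <= g x) -> TI a b f <= TI a b g.
Proof.
move=> fi gi fg; apply: le_rI => //; apply: aeW => x /=.
by rewrite in_itv; exact: fg.
Qed.

Lemma TI_le_cst a b f c : a <= b -> taint a b f ->
  (forall x, a < x < b -> f x <= c) -> TI a b f <= c * (b - a).
Proof.
by move=> ab fi fc; rewrite -TI_cst//; apply: TI_le => //; exact: taint_cst.
Qed.

Lemma TI_norm_cst a b f c : a <= b -> taint a b f ->
  (forall x, a < x < b -> `|f x| <= c) -> `|TI a b f| <= c * (b - a).
Proof.
move=> ab fi fc; have [|nfi h] := rI_norm _ fi; first by [].
by rewrite (le_trans h)//; exact: TI_le_cst.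
Qed.

Lemma taint_cont a b f : {within `[a, b], continuous f} -> taint a b f.
Proof.
move=> cf; apply: (@aintS _ _ leb `[a, b]%classic) => //.
  by move=> x /=; rewrite !in_itv/= => /andP[/ltW -> /ltW ->].
have cAB : compact `[a, b] by exact: segment_compact.
apply: integrable_aint; apply: measurable_bounded_integrable => //.
- by rewrite /= time_measure_itv/=; case: ifP => // _; rewrite -EFinD ltry.
- exact: subspace_continuous_measurable_fun.
have /compact_bounded[M [_ mrt]] := continuous_compact cf cAB.
by exists M; split; rewrite ?num_real // => ? ? ? ?; exact: mrt.
Qed.

Section Reflection.
Variable c : R.

Definition refl (r : R) : R := c - r.

Lemma measurable_refl : measurable_fun setT refl.
Proof. by apply: measurable_funB => //; exact: measurable_cst. Qed.

HB.instance Definition _ := isMeasurableFun.Build _ _ _ _ refl measurable_refl.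

(** It is enough to compare the two measures on half-open intervals, where the reflection moves the
    closed end to the other side and keeps the length. *)
Lemma lebesgue_refl (A : set R) : measurable A ->
  leb (refl @^-1` A) = leb A.
Proof.
move=> mA; have := @time_measure_unique R (pushforward leb refl).
move=> /(_ measurable_refl _ A mA) ->//.
move=> _ [[a b] _ <-] /=.
rewrite /pushforward (_ : refl @^-1` _ = `[c - b, c - a[%classic); last first.
  by apply/seteqP; split => x /=; rewrite !in_itv/= /refl => /andP[? ?]; apply/andP; split; lra.
rewrite /= !time_measure_itv/= !lte_fin (_ : c - b < c - a = (a < b)); last first.
  by apply/idP/idP; lra.
by case: ifP => // _; rewrite -!EFinD; congr EFin; lra.
Qed.

Lemma ae_refl (P : R -> Prop) : {ae leb, forall x, P x} -> {ae leb, forall x, P (refl x)}.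
Proof.
move=> [N [mN N0 PN]]; exists (refl @^-1` N); split.
- by rewrite -[_ @^-1` _]setTI; exact: measurable_refl.
- by rewrite lebesgue_refl.
- by move=> x /= Px; exact: PN.
Qed.

Lemma integrable_refl (D : set (R)) (f : R -> \bar R) : measurable D ->
  leb.-integrable D f -> leb.-integrable (refl @^-1` D) (f \o refl) /\
  (\int[leb]_(x in refl @^-1` D) f (refl x) = \int[leb]_(x in D) f x)%E.
Proof.
move=> mD; suff H (g : R -> \bar R) : measurable_fun setT g ->
    leb.-integrable setT g ->
    leb.-integrable setT (g \o refl) /\
    (\int[leb]_x g (refl x) = \int[leb]_x g x)%E.
  move=> fi0; have fi : leb.-integrable setT (f \_ D) by apply/(integrable_mkcond _ mD).
  have [h1 h2] := H _ (measurable_int _ fi) fi.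
  have E : (f \_ D) \o refl = (f \o refl) \_ (refl @^-1` D).
    by apply/funext => x; rewrite /patch /=; congr (if _ then _ else _); apply/idP/idP; rewrite !inE.
  have mD' : measurable (refl @^-1` D).
    by rewrite -[_ @^-1` _]setTI; exact: measurable_refl.
  split; first by apply/(integrable_mkcond _ mD'); rewrite -E.
  by rewrite integral_mkcond [RHS]integral_mkcond -h2; apply: eq_integral => x _; rewrite -[RHS]/((_ \o _) x) E.
move=> mg gi.
have eqm (A : set R) : measurable A -> A `<=` setT -> leb A = pushforward leb refl A.
  by move=> mA _; rewrite -(lebesgue_refl mA).
have EM (k : R -> \bar R) :
    (\int[leb]_x k x = \int[pushforward leb refl]_x k x)%E.
  exact: eq_measure_integral.
have gi' : leb.-integrable setT (g \o refl).
  apply/integrableP; split; first exact: measurableT_comp measurable_refl.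
  have mag : measurable_fun setT (fun x => `|g x|%E) by exact: measurableT_comp.
  have E := ge0_integral_pushforward measurable_refl leb measurableT mag (fun _ _ => abse_ge0 _).
  move/integrableP : gi => [_].
  by rewrite EM => h; apply: le_lt_trans h; rewrite le_eqVlt; apply/orP; left; apply/eqP/esym; exact: E.
split => //; rewrite [RHS]EM; apply: esym.
exact: (integral_pushforward measurable_refl mg gi').
Qed.

End Reflection.

Lemma refl_itv c a b : refl c @^-1` `]c - b, c - a[ = `]a, b[%classic.
Proof.
by apply/seteqP; split => x /=; rewrite !in_itv/= /refl => /andP[? ?]; apply/andP; split; lra.
Qed.

Lemma TI_refl c a b f : taint (c - b) (c - a) f ->
  taint a b (fun r => f (c - r)) /\ TI a b (fun r => f (c - r)) = TI (c - b) (c - a) f.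
Proof.
move=> [f0 if0 ff0].
have mD : measurable (`]c - b, c - a[%classic : set (R)) by [].
have [] := integrable_refl c mD if0; rewrite refl_itv => i0 E0.
have ae0 : {ae leb, forall x, `]a, b[%classic x -> f (c - x) = f0 (c - x)}.
  apply: filterS (ae_refl c ff0) => x /= + xab; apply.
  by move: xab; rewrite !in_itv/= /refl => /andP[? ?]; apply/andP; split; lra.
split; first by exists (fun r => f0 (c - r)).
by rewrite /TI (rI_ae ae0) (rI_ae ff0) /rI; congr fine.
Qed.

Lemma TI_shift c a b f : taint (a + c) (b + c) f ->
  taint a b (fun r => f (r + c)) /\ TI a b (fun r => f (r + c)) = TI (a + c) (b + c) f.
Proof.
(* A translation is the composition of two reflections. *)
have E1 : a + c = c - (0 - a) by lra.
have E2 : b + c = c - (0 - b) by lra.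
rewrite E1 E2 => h; have [h1 e1] := TI_refl h.
have [h2 e2] := TI_refl h1; split.
  by apply: taint_ae h2; apply: aeW => x _; congr f; lra.
by rewrite -e1 -e2; apply: TI_eq => x _; congr f; lra.
Qed.

End TimeIntegral.

(** * Operators and semigroups *)

Section BoundedOperators.
Variables (R : realType) (V : lmodType R[i]) (d : V -> V -> R) (H : sip d).
Hypothesis cpl : complete_sip d.
Local Notation N := (nm d).
Implicit Types (x y z v w : V) (f g : V -> V) (u : R -> V).

Record blin f : Prop := Blin {
  blD : forall x y, eqv d (f (x + y)) (f x + f y);
  blZ : forall (a : R[i]) x, eqv d (f (a *: x)) (a *: f x);
  blB : exists c, forall x, N (f x) <= c * N x }.

Lemma blB0 f : blin f -> exists2 c, 0 <= c & forall x, N (f x) <= c * N x.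
Proof.
move=> [_ _ [c hc]]; exists `|c| => // x; rewrite (le_trans (hc x))//.
by rewrite ler_wpM2r ?nm_ge0 ?ler_norm.
Qed.

Lemma blBb f x y : blin f -> eqv d (f (x - y)) (f x - f y).
Proof.
move=> bf; apply: (eqv_trans H (blD bf _ _)); apply: eqvD => //; first exact: eqv_refl.
by rewrite -scaleN1r; apply: (eqv_trans H (blZ bf _ _)); rewrite scaleN1r; exact: eqv_refl.
Qed.

Lemma blin_eqv f x y : blin f -> eqv d x y -> eqv d (f x) (f y).
Proof.
move=> bf xy; have [c c0 hc] := blB0 bf; rewrite /eqv -(eqv_nm H (blBb x y bf)).
apply/eqP; rewrite eq_le nm_ge0// andbT; apply: (le_trans (hc _)).
by rewrite (_ : N _ = 0) ?mulr0.
Qed.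

Lemma blin_id : blin id.
Proof.
split; first by move=> x y; exact: eqv_refl.
  by move=> a x; exact: eqv_refl.
by exists 1 => x; rewrite mul1r.
Qed.

Lemma blin_comp f g : blin f -> blin g -> blin (f \o g).
Proof.
move=> bf bg; split => [x y|a x|].
- by apply: (eqv_trans H (blin_eqv bf (blD bg _ _))); exact: blD.
- by apply: (eqv_trans H (blin_eqv bf (blZ bg _ _))); exact: blZ.
- have [c c0 hc] := blB0 bf; have [e e0 he] := blB0 bg.
  exists (c * e) => x /=; rewrite (le_trans (hc _))// -mulrA.
  by rewrite ler_wpM2l.
Qed.

Lemma blin_adj f g : blin f -> (forall x y, d (f x) y = d x (g y)) -> blin g.
Proof.
move=> bf fg; have gf x y : d (g x) y = d x (f y) by rewrite (sipC H) -fg (sipC H).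
split.
- by move=> x y; apply: eqvP => // z; rewrite gf (dDl H) -!gf -(dDl H).
- move=> a x; apply: eqvP => // z.
  by rewrite gf !(sipZ H) gf; apply: eqv_dr => //; apply: eqv_sym => //; exact: blZ.
- have [c c0 hc] := blB0 bf; exists c => x; apply: nm_dual => //.
    by rewrite mulr_ge0// nm_ge0.
  rewrite gf (le_trans (cs H _ _))// mulrAC [leRHS]mulrC.
  by rewrite ler_wpM2l ?nm_ge0.
Qed.

Lemma adjoint_ex f : blin f -> exists g, forall x y, d (f x) y = d x (g y).
Proof.
move=> bf; have [c c0 hc] := blB0 bf.
suff /choice[g gP] : forall y, exists v, forall x, d v x = d (f x) y.
  by exists g => x y; rewrite -gP (sipC H).
move=> y; apply: (riesz (c := c * N y) H cpl).
- by move=> x x'; rewrite -(dDl H); apply: eqv_d => //; exact: blD.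
- by move=> r x; rewrite -(dRl H); apply: eqv_d => //; exact: blZ.
- move=> x; rewrite (le_trans (cs H _ _))// mulrAC ler_wpM2r ?nm_ge0//.
Qed.

Definition pcont (a b : R) u := forall t, a <= t <= b -> forall e, 0 < e ->
  exists2 k, 0 < k & forall r, a <= r <= b -> `|r - t| < k -> N (u r - u t) < e.

Lemma pcont_within (a b : R) u (F : V -> R) (c : R) : pcont a b u ->
  (forall x y, `|F x - F y| <= c * N (x - y)) ->
  {within `[a, b], continuous (fun r => F (u r))}.
Proof.
move=> uc Fc; apply/subspace_continuousP => t tab; apply/subr_cvg0.
apply/cvg_within_itvP => e e0.
have c1 : 0 < `|c| + 1 by have := normr_ge0 c; lra.
have [k k0 hk] := uc t tab _ (divr_gt0 e0 c1); exists k => // r rab rt.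
apply: (le_lt_trans (Fc _ _)).
have := hk r rab rt; rewrite ltr_pdivlMr// => h.
apply: le_lt_trans h; rewrite mulrC ler_wpM2l ?nm_ge0//.
by have := ler_norm c; lra.
Qed.

Lemma pcont_dot (a b : R) u y : pcont a b u ->
  {within `[a, b], continuous (fun r => d (u r) y)}.
Proof.
move=> uc; apply: (pcont_within (F := fun x => d x y) (c := N y) uc) => x x'.
by rewrite -(dBl H) mulrC; exact: cs_abs.
Qed.

Lemma pcont_taint (a b : R) u y : pcont a b u -> taint a b (fun r => d (u r) y).
Proof. by move=> uc; apply: taint_cont; exact: pcont_dot. Qed.

Lemma nm_dist x y : `|N x - N y| <= N (x - y).
Proof.
have h := nm_tri H x y 0; have h' := nm_tri H y x 0; rewrite !subr0 in h h'.
rewrite (nmBC H) in h; by rewrite ler_norml; apply/andP; split; lra.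
Qed.

Lemma pcont_bounded (a b : R) u : a <= b -> pcont a b u ->
  exists2 M, 0 <= M & forall r, a <= r <= b -> N (u r) <= M.
Proof.
move=> ab uc; have cN := pcont_within (F := N) (c := 1) uc.
have [|c cab cM] := EVT_max ab (cN _).
  by move=> x y; rewrite mul1r; exact: nm_dist.
by exists (N (u c)) => [|r rab]; [exact: nm_ge0|exact: cM].
Qed.

(** A vector integral without vector-valued measure theory: the pairings with [y] form a functional
    that is bounded because the path is, and Riesz' theorem represents it. *)
Lemma weak_integral (a b : R) u : a <= b -> pcont a b u ->
  exists v, forall y, d v y = TI a b (fun r => d (u r) y).
Proof.
move=> ab uc; have [M M0 hM] := pcont_bounded ab uc.
apply: (riesz (c := M * (b - a)) H cpl).
- move=> x y; rewrite -rID => //; try exact: pcont_taint.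
  by apply: TI_eq => r _; rewrite (dDr H).
- move=> r x; rewrite -rIZ => //; try exact: pcont_taint.
  by apply: TI_eq => t _; rewrite (dRr H).
- move=> x; rewrite mulrAC; apply: TI_le_cst => //; first exact: pcont_taint.
  move=> r /andP[ar rb]; apply: (le_trans (cs H _ _)).
  by rewrite ler_wpM2r ?nm_ge0// hM// !ltW.
Qed.

(** Uniformly bounded operators that tend to 0 strongly do so uniformly on the compact range of a
    path: near each time the bound [M] transfers smallness from one point to its neighbours, and
    compactness of [[0, T]] leaves finitely many conditions on n. *)
Lemma uniform_cvg_path (T M : R) (S : nat -> V -> V) u : 0 <= M ->
  (forall n x y, eqv d (S n (x - y)) (S n x - S n y)) ->
  (forall n x, N (S n x) <= M * N x) ->
  (forall x e, 0 < e -> \forall n \near \oo, N (S n x) < e) ->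
  pcont 0 T u ->
  forall e, 0 < e -> \forall n \near \oo, forall t, 0 <= t <= T -> N (S n (u t)) < e.
Proof.
move=> M0 SB SM S0 uc e e0.
have /compact_near_coveringP/(_ _ (@nbhs nat _ \oo)
    (fun n t => 0 <= t <= T -> N (S n (u t)) < e) _) cov := @segment_compact R 0 T.
have [t|m _ hm] := cov.
  rewrite /= in_itv/= => tT.
  have M1 : 0 < M + 1 by lra.
  have e2 : 0 < e / 2 by lra.
  have [k k0 hk] := uc t tT _ (divr_gt0 e2 M1).
  exists ([set r | `|t - r| < k], [set n | N (S n (u t)) < e / 2]).
    split => /=; last exact: S0.
    by exists k => // r.
  move=> [r n] /= [rt hn] rT.
  have := hk r rT; rewrite distrC => /(_ rt); rewrite ltr_pdivlMr// => h.
  have := SB n (u r) (u t) => /(eqv_nm H) h1.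
  have h2 := SM n (u r - u t); rewrite h1 in h2.
  have := nmD H (S n (u r) - S n (u t)) (S n (u t)); rewrite subrK.
  have := nm_ge0 d (u r - u t); nra.
exists m => // n mn t tT; exact: hm.
Qed.

End BoundedOperators.

(** The increment of an integral over a sliding window, rewritten with two intervals of length [h]
    only. *)
Lemma TI_window (R : realType) (a h : R) (f : R -> R) : 0 <= a -> 0 <= h ->
  taint 0 (a + h) f -> TI h (a + h) f - TI 0 a f = TI a (a + h) f - TI 0 h f.
Proof.
move=> a0 h0 fi; have ah : a <= a + h by rewrite lerDl.
have hh : h <= a + h by rewrite lerDr.
apply/eqP; rewrite subr_eq addrAC eq_sym subr_eq; apply/eqP.
by rewrite addrC -TI_cat// [RHS]addrC -TI_cat.
Qed.

(** * Strongly continuous semigroups and averages of their orbits *)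

Section Semigroups.
Variables (R : realType) (V : lmodType R[i]) (d : V -> V -> R) (H : sip d).
Hypothesis cpl : complete_sip d.
Local Notation N := (nm d).
Implicit Types (x y z v w : V) (t r h : R).

Record semigroup (E : R -> V -> V) : Prop := Semigroup {
  sgb : forall t, 0 <= t -> blin d (E t);
  sg0 : forall x, eqv d (E 0 x) x;
  sgD : forall s t x, 0 <= s -> 0 <= t -> eqv d (E (s + t) x) (E s (E t x));
  sgc : forall x (e : R), 0 < e -> exists2 k, 0 < k &
    forall t, 0 <= t < k -> N (E t x - x) < e }.

(** The graph of the infinitesimal generator, with the difference quotient cleared of its
    denominator. *)
Definition gen (E : R -> V -> V) x w := forall e : R, 0 < e -> exists2 k, 0 < k &
  forall t, 0 < t < k -> N (E t x - x - t%:C *: w) <= e * t.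

Section OneSemigroup.
Variables (E : R -> V -> V) (sE : semigroup E).

(** If no bound held near 0, there would be times t_n tending to 0 at which the norm of [E] exceeds
    [16 ^+ n]. The gliding hump then gives an [x] for which [E (t n) x] is unbounded, against
    continuity at 0. *)
Lemma sg_bounded0 : exists2 k, 0 < k & exists M, forall t x, 0 <= t <= k ->
  N (E t x) <= M * N x.
Proof.
apply: contrapT => hn.
have /choice[t tP] n : exists t, 0 <= t <= n.+1%:R^-1 /\
    exists x, 16 ^+ n * N x < N (E t x).
  apply: contrapT => hn'; apply: hn; exists n.+1%:R^-1; first by rewrite invr_gt0 ltr0n.
  exists (16 ^+ n) => t x tn; rewrite leNgt; apply/negP => h; apply: hn'.
  by exists t; split => //; exists x.
have tge n : 0 <= t n by case: (tP n) => /andP[].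
have [x hx] : exists x, forall n, 4 ^+ n / 6 <= N (E (t n) x).
  apply: (@gliding_hump _ _ _ H (fun n x => N (E (t n) x)) cpl).
  - move=> n x y; rewrite (eqv_nm H (blD (sgb sE (tge n)) x y)).
    exact: nmD.
  - by move=> n r x; rewrite (eqv_nm H (blZ (sgb sE (tge n)) _ _)) nmR.
  - by move=> n; have [c _ hc] := blB0 (sgb sE (tge n)); exists c.
  - by move=> n; case: (tP n).
have [k k0 hk] := sgc sE x (@ltr01 R).
(* For an n above [B] the first summand gives [t n < k] and the second gives
   [4 ^+ n / 6 > N x + 1]. *)
pose B := k^-1 + 6 * (N x + 1).
have B0 : 0 <= B by rewrite addr_ge0// ?invr_ge0 ?(ltW k0) ?mulr_ge0 ?addr_ge0 ?nm_ge0.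
pose n := (Num.truncn B).+1.
have nB : B < n%:R by apply: truncnS_gt.
have tk : t n < k.
  have [/andP[_ h] _] := tP n; apply: (le_lt_trans h).
  rewrite -[ltRHS]invrK ltf_pV2 ?posrE ?invr_gt0 ?ltr0n//.
  apply: (@le_lt_trans _ _ B); first by rewrite lerDl mulr_ge0// addr_ge0 ?nm_ge0.
  by apply: (lt_trans nB); rewrite ltr_nat.
have h1 := hk (t n); rewrite tge tk in h1; have {}h1 := h1 isT.
have h2 := hx n; have h3 := nmD H (E (t n) x - x) x; rewrite subrK in h3.
have h4 : n%:R <= 4 ^+ n :> R.
  by rewrite -natrX ler_nat ltnW// ltn_expl.
have h5 : 6 * (N x + 1) <= B by rewrite lerDr invr_ge0 ltW.
by lra.
Qed.

Lemma sg_bounded (T : R) : exists2 M, 1 <= M & forall t x, 0 <= t <= T ->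
  N (E t x) <= M * N x.
Proof.
have [k k0 [M0 hM0]] := sg_bounded0.
(* At least 1, so that the bounds [M ^+ n] for n steps of length [k] increase with n. *)
pose M := Num.max 1 M0.
have M1 : 1 <= M by rewrite le_max lexx.
have hM t x : 0 <= t <= k -> N (E t x) <= M * N x.
  move=> tk; rewrite (le_trans (hM0 _ _ tk))// ler_wpM2r ?nm_ge0//.
  by rewrite le_max lexx orbT.
have ind n t x : 0 <= t -> t <= n%:R * k -> N (E t x) <= M ^+ n * N x.
  elim: n t x => [|n IH] t x t0 tn.
    rewrite mul0r in tn; have -> : t = 0 by lra.
    by rewrite expr0 mul1r (eqv_nm H (sg0 sE x)).
  have [tk|tk] := leP t k.
    rewrite (le_trans (hM t x _)) ?t0// ler_wpM2r ?nm_ge0// exprS ler_peMr//; first by lra.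
    by rewrite exprn_ege1.
  have e1 : t = k + (t - k) by lra.
  have t1 : 0 <= t - k by lra.
  rewrite e1 (eqv_nm H (sgD sE _ (ltW k0) t1)) exprS -mulrA.
  apply: (le_trans (hM _ _ _)); first by rewrite lexx (ltW k0).
  rewrite ler_wpM2l//; first by lra.
  by apply: IH => //; rewrite -natr1 mulrDl mul1r in tn; lra.
exists (M ^+ (Num.truncn (T / k)).+1); first by rewrite exprn_ege1.
move=> t x /andP[t0 tT]; apply: ind => //.
by rewrite -ler_pdivrMr// (le_trans _ (ltW (truncnS_gt _)))// ler_pM2r ?invr_gt0.
Qed.

Lemma sg_diff (T : R) : exists2 M, 0 <= M & forall t r x, 0 <= t <= T -> 0 <= r <= T ->
  N (E t x - E r x) <= M * N (E `|t - r| x - x).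
Proof.
have [M M1 hM] := sg_bounded T; exists M; first lra.
suff h t r x : 0 <= r -> r <= t -> t <= T -> N (E t x - E r x) <= M * N (E `|t - r| x - x).
  move=> t r x /andP[t0 tT] /andP[r0 rT]; have [rt|/ltW tr] := leP r t; first exact: h.
  by rewrite (nmBC H) distrC; exact: h.
move=> r0 rt tT; rewrite ger0_norm ?subr_ge0//.
have e1 : t = r + (t - r) by lra.
rewrite {1}e1 (eqv_nm H (eqvB H (sgD sE x r0 _) (eqv_refl H _))) ?subr_ge0//.
rewrite -(eqv_nm H (blBb H _ _ (sgb sE r0))); apply: hM.
by rewrite r0 (le_trans rt).
Qed.

Lemma sg_pcont (T : R) x : pcont d 0 T (E^~ x).
Proof.
move=> t tT e e0; have [M M0 hM] := sg_diff T.
have M1 : 0 < M + 1 by lra.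
have [k k0 hk] := sgc sE x (divr_gt0 e0 M1); exists k => // r rT rt.
apply: (le_lt_trans (hM _ _ _ rT tT)).
have := hk `|r - t|; rewrite normr_ge0 rt => /(_ isT); rewrite ltr_pdivlMr//.
have := nm_ge0 d (E `|r - t| x - x); lra.
Qed.

Lemma gen_E t x w : 0 <= t -> gen E x w -> gen E (E t x) (E t w).
Proof.
move=> t0 g e e0; have [c c0 hc] := blB0 (sgb sE t0).
have c1 : 0 < c + 1 by lra.
have [k k0 hk] := g _ (divr_gt0 e0 c1); exists k => // r /andP[r0 rk].
have r0' := ltW r0; have bt := sgb sE t0.
have E1 : eqv d (E r (E t x)) (E t (E r x)).
  apply: (eqv_trans H (eqv_sym H (sgD sE _ r0' t0))).
  by rewrite addrC; exact: sgD.
rewrite (eqv_nm H (eqvB H (eqvB H E1 (eqv_refl H _)) (eqv_sym H (blZ bt _ _)))).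
rewrite (eqv_nm H (eqvB H (eqv_sym H (blBb H _ _ bt)) (eqv_refl H _))).
rewrite -(eqv_nm H (blBb H _ _ bt)) (le_trans (hc _))//.
have := hk r; rewrite r0 rk => /(_ isT); set n := N _.
rewrite mulrAC ler_pdivlMr//; have : 0 <= n by exact: nm_ge0.
lra.
Qed.

Lemma gen_eqv x x' w w' : eqv d x x' -> eqv d w w' -> gen E x w -> gen E x' w'.
Proof.
move=> xx ww g e e0; have [k k0 hk] := g e e0; exists k => // t tk.
have t0 : 0 <= t by case/andP: tk => /ltW.
have E1 := blin_eqv H (sgb sE t0) xx.
by rewrite -(eqv_nm H (eqvB H (eqvB H E1 xx) (eqvZ H _ ww))); exact: hk.
Qed.

Lemma gen_lin (a : R[i]) x x' w w' : gen E x w -> gen E x' w' ->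
  gen E (a *: x + x') (a *: w + w').
Proof.
move=> g g' e e0; pose c := Normc.normc a.
have c0 : 0 <= c by rewrite /c /Normc.normc; case: (a) => p q; exact: sqrtr_ge0.
have c1 : 0 < e / (2 * (c + 1)) by rewrite divr_gt0// mulr_gt0//; lra.
have [k k0 hk] := g _ c1; have [k' k0' hk'] := g' (e / 2) ltac:(lra).
exists (Num.min k k'); first by rewrite lt_min k0.
move=> t /andP[t0]; rewrite lt_min => /andP[tk tk'].
have bt := sgb sE (ltW t0).
have E1 : eqv d (E t (a *: x + x')) (a *: E t x + E t x').
  by apply: (eqv_trans H (blD bt _ _)); apply: (eqvD H (blZ bt _ _)); exact: eqv_refl.
rewrite (eqv_nm H (eqvB H (eqvB H E1 (eqv_refl H _)) (eqv_refl H _))).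
rewrite (_ : _ - _ = a *: (E t x - x - t%:C *: w) + (E t x' - x' - t%:C *: w')); last first.
  rewrite !scalerBr scalerDr (scalerA a) (mulrC a) -scalerA.
  by rewrite !opprD (addrACA (a *: E t x)) [LHS]addrACA.
rewrite (le_trans (nmD H _ _))// (nm_normc H) -/c.
have := hk t; rewrite t0 tk => /(_ isT) h1.
have := hk' t; rewrite t0 tk' => /(_ isT) h2.
have h3 : c * N (E t x - x - t%:C *: w) <= e / 2 * t.
  apply: (@le_trans _ _ (c * (e / (2 * (c + 1)) * t))); first by rewrite ler_wpM2l.
  rewrite (_ : c * _ = (c / (c + 1)) * (e / 2 * t)); last by field; lra.
  rewrite ler_piMl ?mulr_ge0 ?(ltW t0)//; first by lra.
  by rewrite ler_pdivrMr; lra.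
by lra.
Qed.

Lemma gen_uniq x w w' : gen E x w -> gen E x w' -> eqv d w w'.
Proof.
move=> g g'; rewrite /eqv; apply/eqP; rewrite eq_le nm_ge0 andbT.
apply/ler_addgt0Pr => e e0; rewrite add0r.
have e2 : 0 < e / 2 by lra.
have [k k0 hk] := g _ e2; have [k' k0' hk'] := g' _ e2.
pose t := Num.min k k' / 2.
have t0 : 0 < t by rewrite divr_gt0// lt_min k0.
have mk : Num.min k k' <= k by rewrite ge_min lexx.
have mk' : Num.min k k' <= k' by rewrite ge_min lexx orbT.
have tm : t < Num.min k k' by rewrite /t in t0 *; lra.
have tk := lt_le_trans tm mk; have tk' := lt_le_trans tm mk'.
have h1 := hk t; rewrite t0 tk in h1; have {}h1 := h1 isT.
have h2 := hk' t; rewrite t0 tk' in h2; have {}h2 := h2 isT.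
rewrite -(ler_pM2r t0).
have -> : N (w - w') * t = N (t%:C *: (w - w')) by rewrite (nmR H) gtr0_norm// mulrC.
rewrite scalerBr (nmBC H).
set a := E t x - x in h1 h2.
have := nm_tri H a (t%:C *: w') (t%:C *: w); rewrite (nmBC H (t%:C *: w') a); lra.
Qed.

(** Specified by its pairings, hence only up to [eqv]; operators of averages are choices of such
    elements. *)
Definition is_avg (ep : R) x g := forall y, d g y = ep^-1 * TI 0 ep (fun r => d (E r x) y).

Lemma avg_ex ep x : 0 < ep -> exists g, is_avg ep x g.
Proof.
move=> ep0; have [v hv] := weak_integral H cpl (ltW ep0) (@sg_pcont ep x).
by exists (ep^-1%:C *: v) => y; rewrite (dRl H) hv.
Qed.

Lemma avg_taint ep x y : taint 0 ep (fun r => d (E r x) y).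
Proof. by apply: pcont_taint => //; exact: sg_pcont. Qed.

Lemma avg_bd ep M x g : 0 < ep -> 0 <= M ->
  (forall t, 0 <= t <= ep -> N (E t x) <= M) -> is_avg ep x g -> N g <= M.
Proof.
move=> ep0 M0 hM hg; apply: nm_dual => //; rewrite hg.
rewrite mulrC ler_pdivrMr// -[X in _ <= _ * X](subr0 ep).
apply: TI_le_cst; [exact: ltW|exact: avg_taint|].
move=> r /andP[r0 rep]; apply: (le_trans (cs H _ _)).
by rewrite ler_wpM2r ?nm_ge0// hM// !ltW.
Qed.

Lemma avg_lin ep (a : R[i]) x x' g g' : 0 < ep -> is_avg ep x g -> is_avg ep x' g' ->
  is_avg ep (a *: x + x') (a *: g + g').
Proof.
move=> ep0 hg hg' y; rewrite (dDl H) (sipZ H) hg hg' -mulrDr -rID//; try exact: avg_taint.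
congr (_ * _); apply: TI_eq => r /andP[r0 _]; have bt := sgb sE (ltW r0).
rewrite (eqv_d H _ (blD bt _ _)) (dDl H); congr (_ + _).
by rewrite (eqv_d H _ (blZ bt _ _)) (sipZ H).
Qed.

Lemma avg_diff ep x y0 c g : 0 < ep -> 0 <= c ->
  (forall t, 0 <= t <= ep -> N (E t x - y0) <= c) -> is_avg ep x g -> N (g - y0) <= c.
Proof.
move=> ep0 c0 hc hg; apply: nm_dual => //; set y := g - y0.
rewrite /y (dBl H) hg -/y.
have -> : d y0 y = ep^-1 * TI 0 ep (fun=> d y0 y).
  by rewrite TI_cst ?(ltW ep0)// subr0 mulrCA mulVf ?mulr1// gt_eqF.
rewrite -mulrBr -rIB//; [|exact: avg_taint|exact: taint_cst].
rewrite mulrC ler_pdivrMr// -[X in _ <= _ * X](subr0 ep).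
apply: TI_le_cst; [exact: ltW| |].
  by apply: aintB => //; [exact: avg_taint|exact: taint_cst].
move=> r /andP[r0 rep]; rewrite -(dBl H); apply: (le_trans (cs H _ _)).
by rewrite ler_wpM2r ?nm_ge0// hc// !ltW.
Qed.

Lemma avg_cvg x (e : R) : 0 < e -> exists2 k, 0 < k &
  forall ep g, 0 < ep < k -> is_avg ep x g -> N (g - x) <= e.
Proof.
move=> e0; have [k k0 hk] := sgc sE x e0; exists k => // ep g /andP[ep0 epk] hg.
apply: (avg_diff ep0 (ltW e0) _ hg) => t /andP[t0 tep]; apply/ltW/hk.
by rewrite t0 (le_lt_trans tep).
Qed.

Lemma avg_E ep t x g : 0 < ep -> 0 <= t -> is_avg ep x g -> is_avg ep (E t x) (E t g).
Proof.
move=> ep0 t0 hg y; have bt := sgb sE t0; have [f hf] := adjoint_ex H cpl bt.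
rewrite hf hg; congr (_ * _); apply: TI_eq => r /andP[/ltW r0 _].
rewrite -hf; apply: eqv_d => //.
apply: (eqv_trans H (eqv_sym H (sgD sE _ t0 r0))).
by rewrite addrC; exact: sgD.
Qed.

(** [E h] shifts the window of the average, so [E h g - g] is [ep^-1] times the integral over
    [[ep, ep + h]] minus the one over [[0, h]]. Continuity of the orbit at [ep] and at 0 gives the
    limit; the error is estimated by pairing it with itself. *)
Lemma avg_gen ep x g : 0 < ep -> is_avg ep x g ->
  gen E g (ep^-1%:C *: (E ep x - x)).
Proof.
move=> ep0 hg e e0.
have e1 : 0 < ep * e / 2 by rewrite divr_gt0// mulr_gt0.
have [k k0 hk] := @sg_pcont (ep + 1) x ep ltac:(lra) _ e1.
have [k' k0' hk'] := sgc sE x e1.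
exists (Num.min (Num.min k k') (Num.min ep 1)).
  by rewrite !lt_min k0 k0' ep0 ltr01.
move=> h /andP[h0]; rewrite !lt_min => /andP[/andP[hk1 hk2] /andP[hep h1]].
apply: nm_dual => //; first by rewrite mulr_ge0// ltW.
suff key D : d (E h g - g - h%:C *: (ep^-1%:C *: (E ep x - x))) D <= e * h * N D by exact: key.
have tE a b : 0 <= a -> taint a b (fun r => d (E r x) D).
  by move=> a0; apply: taint_sub (avg_taint b x D).
have e2 : d (E h g) D = ep^-1 * TI h (ep + h) (fun r => d (E r x) D).
  have := avg_E ep0 (ltW h0) hg D => ->; congr (_ * _).
  have sh : taint (0 + h) (ep + h) (fun r => d (E r x) D) by apply: tE; rewrite add0r ltW.
  have [_ ee] := TI_shift sh; rewrite add0r in ee; rewrite -ee.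
  apply: TI_eq => r /andP[r0 _]; apply: eqv_d => //; apply: eqv_sym => //.
  by apply: sgD => //; exact: ltW.
have e3 := TI_window (ltW ep0) (ltW h0) (tE 0 (ep + h) (lexx _)).
have h0' := ltW h0; have ep0' := ltW ep0.
have eph : ep <= ep + h by rewrite lerDl.
have b1 : TI ep (ep + h) (fun r => d (E r x) D) - h * d (E ep x) D <= ep * e / 2 * N D * h.
  have -> : h * d (E ep x) D = TI ep (ep + h) (fun=> d (E ep x) D).
    by rewrite TI_cst// addrAC subrr add0r mulrC.
  rewrite -rIB//; [|exact: tE|exact: taint_cst].
  have eh : ep + h - ep = h by rewrite addrAC subrr add0r.
  rewrite -[X in _ <= _ * X]eh.
  apply: TI_le_cst => //; first by apply: aintB => //; [exact: tE|exact: taint_cst].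
  move=> r /andP[r1 r2]; rewrite -(dBl H); apply: (le_trans (cs H _ _)).
  rewrite ler_wpM2r ?nm_ge0//; apply/ltW/hk; first by apply/andP; split; lra.
  by rewrite gtr0_norm; lra.
have b2 : h * d x D - TI 0 h (fun r => d (E r x) D) <= ep * e / 2 * N D * h.
  have -> : h * d x D = TI 0 h (fun=> d x D) by rewrite TI_cst// subr0 mulrC.
  rewrite -rIB//; [|exact: taint_cst|exact: tE].
  rewrite -[X in _ <= _ * X](subr0 h).
  apply: TI_le_cst => //; first by apply: aintB => //; [exact: taint_cst|exact: tE].
  move=> r /andP[r1 r2]; rewrite -(dBl H); apply: (le_trans (cs H _ _)).
  rewrite ler_wpM2r ?nm_ge0// (nmBC H); apply/ltW/hk'.
  by rewrite (ltW r1) (lt_trans r2).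
have -> : d (E h g - g - h%:C *: (ep^-1%:C *: (E ep x - x))) D =
    ep^-1 * ((TI ep (ep + h) (fun r => d (E r x) D) - h * d (E ep x) D) +
    (h * d x D - TI 0 h (fun r => d (E r x) D))).
  rewrite !(dBl H) (dRl H) (dRl H) (dBl H) e2 hg -mulrBr e3; ring.
move: b1 b2; move: (TI _ _ _ - _) (_ - TI _ _ _) => p q b1 b2.
rewrite mulrC ler_pdivrMr//; apply: (le_trans (lerD b1 b2)).
by rewrite le_eqVlt; apply/orP; left; apply/eqP; field.
Qed.

Lemma gen_dense x (e : R) : 0 < e -> exists2 y, (exists w, gen E y w) & N (x - y) < e.
Proof.
move=> e0; have e2 : 0 < e / 2 by lra.
have [k k0 hk] := avg_cvg x e2.
have [g hg] := avg_ex x (ep := k / 2) ltac:(lra).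
exists g; first by eexists; apply: avg_gen hg; lra.
by rewrite (nmBC H) (le_lt_trans (hk _ _ _ hg))//; [apply/andP; split; lra|lra].
Qed.

(** Mild trajectories and [Bs] are available only against elements of the domain of a generator;
    density of the domain makes such tests sufficient. *)
Lemma eqv_gen x y : (forall z w, gen E z w -> d x z = d y z) -> eqv d x y.
Proof.
move=> h; rewrite /eqv; apply/eqP; rewrite eq_le nm_ge0 andbT.
apply/ler_addgt0Pr => e e0; rewrite add0r.
have [z [w gz] hz] := gen_dense (x - y) e0.
apply: nm_dual => //; first exact: ltW.
have -> : d (x - y) (x - y) = d (x - y) (x - y - z).
  by rewrite (dBr H _ z) [d _ z](dBl H) (h _ _ gz) subrr subr0.
by rewrite (le_trans (cs H _ _))// mulrC ler_wpM2r ?nm_ge0// ltW.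
Qed.

End OneSemigroup.
End Semigroups.

(** * Adjoint generators and adjoint semigroups *)

Section Duality.
Variables (R : realType) (V : lmodType R[i]) (d : V -> V -> R) (H : sip d).
Hypothesis cpl : complete_sip d.
Local Notation N := (nm d).
Variables (E Es : R -> V -> V) (sE : semigroup d E) (sEs : semigroup d Es).
Hypothesis adj : forall x v z w, gen d E x v -> gen d Es z w -> d v z = d x w.

(** The derivative in s of the pairing of [E (T - s) x] with [Es s z] vanishes by [adj]. The
    remainder is bounded uniformly in [s], so that it can be summed over a subdivision. *)
Lemma duality_step T x v z w : gen d E x v -> gen d Es z w ->
  exists2 C, 0 <= C & forall e : R, 0 < e -> exists2 k, 0 < k &
    forall s h, 0 < h < k -> 0 <= s -> s + h <= T ->
    `|d (E (T - (s + h)) x) (Es (s + h) z) - d (E (T - s) x) (Es s z)| <= C * e * h.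
Proof.
move=> gx gz.
have [M M1 hM] := sg_bounded H cpl sE T; have [M' M1' hM'] := sg_bounded H cpl sEs T.
have M0 : 0 <= M by lra.
have M0' : 0 <= M' by lra.
exists (M * M' * (N x + N z)).
  by rewrite !mulr_ge0// addr_ge0 ?nm_ge0.
move=> e e0.
have [k k0 hk] := gx _ e0; have [k' k0' hk'] := gz _ e0.
exists (Num.min k k'); first by rewrite lt_min k0.
move=> s h /andP[h0]; rewrite lt_min => /andP[hk1 hk2] s0 shT.
have h0' := ltW h0.
pose a := T - (s + h).
have a0 : 0 <= a by rewrite subr_ge0.
have aT : 0 <= a <= T by rewrite a0 /= /a; lra.
have sT : 0 <= s <= T by rewrite s0 /=; lra.
have ba := sgb sE a0; have bs := sgb sEs s0.
have -> : T - s = a + h by rewrite /a; lra.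
rewrite -/a (eqv_dr H _ (sgD sEs z s0 h0')) (eqv_d H _ (sgD sE x a0 h0')).
have hz : Es h z = h%:C *: w + (Es h z - z - h%:C *: w) + z.
  by rewrite [X in X + z]addrC !subrK.
have hx : E h x = h%:C *: v + (E h x - x - h%:C *: v) + x.
  by rewrite [X in X + x]addrC !subrK.
have e1 : d (E a x) (Es s (Es h z)) = d (E a x) (Es s z) + h * d (E a x) (Es s w) +
    d (E a x) (Es s (Es h z - z - h%:C *: w)).
  rewrite {1}hz; set r := Es h z - z - _.
  rewrite (eqv_dr H _ (blD bs _ _)) (dDr H).
  rewrite (eqv_dr H _ (blD bs _ _)) (dDr H) (eqv_dr H _ (blZ bs _ _)) (dRr H).
  by rewrite [LHS]addrC addrA.
have e2 : d (E a (E h x)) (Es s z) = d (E a x) (Es s z) + h * d (E a v) (Es s z) +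
    d (E a (E h x - x - h%:C *: v)) (Es s z).
  rewrite {1}hx; set r := E h x - x - _.
  rewrite (eqv_d H _ (blD ba _ _)) (dDl H).
  rewrite (eqv_d H _ (blD ba _ _)) (dDl H) (eqv_d H _ (blZ ba _ _)) (dRl H).
  by rewrite [LHS]addrC addrA.
(* The two terms of first order in h coincide: this is where the duality of the generators
   enters. *)
have e3 : d (E a v) (Es s z) = d (E a x) (Es s w).
  by apply: adj; [exact: gen_E|exact: gen_E].
have b1 : `|d (E a x) (Es s (Es h z - z - h%:C *: w))| <= (M * N x) * (M' * (e * h)).
  apply: (le_trans (cs_abs H _ _)); apply: ler_pM; rewrite ?nm_ge0//; first exact: hM.
  apply: (le_trans (hM' _ _ sT)); rewrite ler_wpM2l//; apply: hk'.
  by rewrite h0.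
have b2 : `|d (E a (E h x - x - h%:C *: v)) (Es s z)| <= (M * (e * h)) * (M' * N z).
  apply: (le_trans (cs_abs H _ _)); apply: ler_pM; rewrite ?nm_ge0//; last exact: hM'.
  apply: (le_trans (hM _ _ aT)); rewrite ler_wpM2l//; apply: hk.
  by rewrite h0.
rewrite e1 e2 e3; move: b1 b2; set p := d _ (Es s (_ - _)); set q := d (E a (_ - _)) _.
move=> b1 b2; rewrite opprD addrACA subrr add0r.
apply: (le_trans (ler_normB _ _)); apply: (le_trans (lerD b1 b2)).
by rewrite le_eqVlt; apply/orP; left; apply/eqP; ring.
Qed.

(** Telescoping over n steps of length T/n, each below the threshold [k], gives a total error
    proportional to e, which is arbitrary. *)
Lemma duality_gen T x v z w : 0 < T -> gen d E x v -> gen d Es z w ->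
  d (E T x) z = d x (Es T z).
Proof.
move=> T0 gx gz; have [C C0 hC] := duality_step T gx gz.
have C1 : 0 < C * T + 1 by have := mulr_ge0 C0 (ltW T0); lra.
apply/eqP; rewrite eq_sym -subr_eq0 -normr_le0; apply/ler_addgt0Pr => e e0; rewrite add0r.
have [k k0 hk] := hC _ (divr_gt0 e0 C1).
pose n := (Num.truncn (T / k)).+1.
have n0 : 0 < n%:R :> R by rewrite ltr0n.
pose h := T / n%:R.
have h0 : 0 < h by rewrite divr_gt0.
have hk1 : h < k by rewrite ltr_pdivrMr// mulrC -ltr_pdivrMr//; exact: truncnS_gt.
pose f s := d (E (T - s) x) (Es s z).
have step j : (j <= n)%N -> `|f (j%:R * h) - f 0| <= j%:R * (C * (e / (C * T + 1)) * h).
  elim: j => [|j IH] jn; first by rewrite !mul0r subrr normr0.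
  have jT : j%:R * h + h <= T.
    have -> : T = n%:R * h by rewrite /h mulrC divfK// gt_eqF.
    by rewrite -[X in _ + X]mul1r -mulrDl natr1 ler_pM2r// ler_nat.
  have := hk (j%:R * h) h; rewrite h0 hk1 mulr_ge0 ?(ltW h0)// jT => /(_ isT isT isT) h1.
  have e1 : j.+1%:R * h = j%:R * h + h by rewrite -natr1 mulrDl mul1r.
  rewrite e1 (_ : f _ - f 0 = (f (j%:R * h + h) - f (j%:R * h)) + (f (j%:R * h) - f 0)); last first.
    by rewrite addrA subrK.
  apply: (le_trans (ler_normD _ _)); rewrite -natr1 mulrDl mul1r addrC.
  by apply: lerD; [exact: IH (ltnW jn)|exact: h1].
have := step n (leqnn _).
have nh : n%:R * h = T by rewrite /h mulrC divfK// gt_eqF.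
rewrite nh /f subrr subr0 (eqv_d H _ (sg0 sE x)) (eqv_dr H _ (sg0 sEs z)) => /le_trans; apply.
have -> : n%:R * (C * (e / (C * T + 1)) * h) = C * T / (C * T + 1) * e.
  transitivity (n%:R * h * (C * (e / (C * T + 1)))); first by ring.
  by rewrite nh; ring.
rewrite ler_piMl ?(ltW e0)// ler_pdivrMr//; lra.
Qed.

(** Only the generators are known to be adjoint. The identity on their domains extends by density in
    one argument at a time, after the operators have been moved across by Riesz adjoints. *)
Lemma semigroup_dual t x y : 0 <= t -> d (E t x) y = d x (Es t y).
Proof.
rewrite le_eqVlt => /predU1P[<-|t0].
  by rewrite (eqv_d H _ (sg0 sE x)) (eqv_dr H _ (sg0 sEs y)).
have [g hg] := adjoint_ex H cpl (sgb sE (ltW t0)).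
rewrite hg; apply: eqv_dr => //; have bg := blin_adj H (sgb sE (ltW t0)) hg.
apply: (eqv_gen H cpl sE) => x' v' gx'.
rewrite (sipC H) -hg (sipC H (Es t y)).
have : eqv d y y by exact: eqv_refl.
have [g' hg'] := adjoint_ex H cpl (sgb sEs (ltW t0)).
have g'E (a b : V) : d a (Es t b) = d (g' a) b by rewrite (sipC H) hg' (sipC H).
move=> _; rewrite g'E; apply: eqv_d => //.
apply: (eqv_gen H cpl sEs) => z w gz.
by rewrite -g'E; exact: duality_gen gx' gz.
Qed.

Lemma avg_dual ep x y g g' : is_avg d E ep x g -> is_avg d Es ep y g' ->
  0 < ep -> d g y = d x g'.
Proof.
move=> hg hg' ep0; rewrite hg (sipC H) hg'; congr (_ * _).
apply: TI_eq => r /andP[r0 _]; rewrite semigroup_dual ?ltW// (sipC H).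
by [].
Qed.

End Duality.

(** * Square integrable paths *)

Section SquareIntegrablePaths.
Variables (R : realType) (U : ispace R) (hU : prehilbert U).
Local Notation leb := (@time_measure R).
Local Notation HU := (elt_of_prehilbert hU).
Local Notation SU := (hd_sip hU).
Implicit Types (g k h : R -> U) (s T c : R) (x y : U).

Lemma imem0 : imem U 0. Proof. exact: ph0. Qed.

Lemma simple_elt h : simple_fun h ->
  exists n (B : 'I_n -> set R) (u : 'I_n -> HU), (forall i, measurable (B i)) /\
    h = (fun r => elt_val (\sum_(i < n) (if `[< B i r >] then u i else 0))).
Proof.
move=> [n [B [u [Bu ->]]]]; exists n, B, (fun i => lift hU (u i)); split.
  by move=> i; case: (Bu i).
apply/funext => r; elim/big_ind2 : _ => //.
  by move=> x x' y y' -> ->.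
move=> i _; case: ifP => // _; rewrite liftK//; by case: (Bu i).
Qed.

Lemma simple_imem h r : simple_fun h -> imem U (h r).
Proof. by move=> /simple_elt[n [B [u [_ ->]]]]; exact: elt_mem. Qed.

Lemma sip_suml n (F : 'I_n -> HU) (y : HU) : hd (\sum_i F i) y = \sum_i hd (F i) y.
Proof.
elim: n F => [|n IH] F; first by rewrite !big_ord0 (d0l SU).
by rewrite !big_ord_recl (dDl SU) IH.
Qed.

Lemma measurable_simple_dot h k : simple_fun h -> simple_fun k ->
  measurable_fun setT (fun r : R => rdot (h r) (k r)).
Proof.
move=> /simple_elt[n [B [u [mB ->]]]] /simple_elt[m [C [v [mC ->]]]].
have -> : (fun r => rdot (elt_val (\sum_(i < n) (if `[< B i r >] then u i else 0)))
    (elt_val (\sum_(i < m) (if `[< C i r >] then v i else 0)))) =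
  (fun r : R => \sum_(i < n) \sum_(j < m) (\1_(B i) r * \1_(C j) r * hd (u i) (v j))).
  apply/funext => r; rewrite -[LHS]/(hd _ _) sip_suml; apply: eq_bigr => i _.
  rewrite (sipC SU) sip_suml; apply: eq_bigr => j _; rewrite !indicE.
  have E (X : set R) : (r \in X) = `[< X r >] by apply/idP/idP => [/set_mem/asboolP|/asboolP/mem_set].
  rewrite !E; case: ifP => _; case: ifP => _; rewrite ?mul1r ?mul0r ?(d0l SU) ?(d0r SU)//=.
  by rewrite (sipC SU).
apply: measurable_sum => i; apply: measurable_sum => j.
apply: measurable_funM; last exact: measurable_cst.
by apply: measurable_funM; apply: measurable_indic; [exact: mB|exact: mC].
Qed.

Lemma cvg_dot (x y : nat -> HU) (a b : HU) :
  nm (@hd _ _ hU) (x n - a) @[n --> \oo] --> (0 : R) ->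
  nm (@hd _ _ hU) (y n - b) @[n --> \oo] --> (0 : R) ->
  hd (x n) (y n) @[n --> \oo] --> hd a b.
Proof.
move=> xa yb; apply/subr_cvg0.
have h1 : nm (@hd _ _ hU) (x n - a) * nm (@hd _ _ hU) (y n - b) +
   nm (@hd _ _ hU) (x n - a) * nm (@hd _ _ hU) b +
   nm (@hd _ _ hU) a * nm (@hd _ _ hU) (y n - b) @[n --> \oo] --> 0 * 0 + 0 * nm (@hd _ _ hU) b + nm (@hd _ _ hU) a * 0.
  apply: cvgD; first apply: cvgD; first exact: cvgM.
    by apply: cvgM => //; exact: cvg_cst.
  by apply: cvgM => //; exact: cvg_cst.
rewrite !mul0r mulr0 !addr0 in h1.
apply/cvgrPdist_lt => e e0; move/cvgrPdist_lt : h1 => /(_ _ e0); apply: filterS => n.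
rewrite !sub0r !normrN; apply: le_lt_trans.
have -> : hd (x n) (y n) - hd a b = hd (x n - a) (y n - b) + hd (x n - a) b + hd a (y n - b).
  rewrite !(dBl SU) !(dBr SU); ring.
rewrite [leRHS]ger0_norm; last by rewrite !addr_ge0// mulr_ge0 ?nm_ge0.
apply: (le_trans (ler_normD _ _)); apply: lerD; last exact: cs_abs SU _ _.
by apply: (le_trans (ler_normD _ _)); apply: lerD; exact: cs_abs SU _ _.
Qed.

Lemma L2_mem s T g r : L2_in_time s T g -> s < r < T -> imem U (g r).
Proof. by case=> + _ _; apply. Qed.

(** The pairing is an almost everywhere limit of pairings of simple functions, which are
    measurable. *)
Lemma aemf_dot s T g k : L2_in_time s T g -> L2_in_time s T k ->
  aemf leb `]s, T[ (fun r => rdot (g r) (k r)).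
Proof.
move=> [mg [h [sh hg]] _] [mk [h' [sh' hk]] _].
apply: (aemf_cvg (F := fun n (r : R) => rdot (h n r) (h' n r))) => //.
  move=> n; apply: measurable_aemf; apply: measurable_funTS.
  exact: measurable_simple_dot.
apply: filterS2 hg hk => r hgr hkr /=; rewrite in_itv => /= rsT.
rewrite (hdE hU (mg _ rsT) (mk _ rsT)).
have -> : (fun n => rdot (h n r) (h' n r)) = (fun n => hd (lift hU (h n r)) (lift hU (h' n r))).
  by apply/funext => n; rewrite -hdE//; exact: simple_imem.
apply: cvg_dot.
- apply: cvg_trans (hgr rsT); apply: near_eq_cvg; near=> n.
  by rewrite -inormE elt_valB !liftK//; [exact: mg|exact: simple_imem].
- apply: cvg_trans (hkr rsT); apply: near_eq_cvg; near=> n.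
  by rewrite -inormE elt_valB !liftK//; [exact: mk|exact: simple_imem].
Unshelve. all: by end_near. Qed.

Lemma inorm2 x : imem U x -> inorm x ^+ 2 = rdot x x.
Proof. by move=> mx; rewrite -(liftK hU mx) inormE (nm2 SU). Qed.

Lemma L2_taint_sq s T g : L2_in_time s T g -> taint s T (fun r => inorm (g r) ^+ 2).
Proof.
move=> lg; apply: aint_lty => //; last by case: lg => _ _; exact.
  apply: aemf_ae (aemf_dot lg lg) => //; apply: aeW => r /=; rewrite in_itv => /= rsT.
  by rewrite inorm2//; apply: L2_mem rsT.
by apply: aeW => r _; exact: sqr_ge0.
Qed.

Lemma L2_sq_integral s T g : L2_in_time s T g ->
  sq_integral s T g = (TI s T (fun r => inorm (g r) ^+ 2))%:E.
Proof. by move=> lg; exact: (aint_EFin _ (L2_taint_sq lg)). Qed.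

Lemma L2_TI_sq s T g : L2_in_time s T g ->
  TI s T (fun r => inorm (g r) ^+ 2) = TI s T (fun r => rdot (g r) (g r)).
Proof. by move=> lg; apply: TI_eq => r rsT; rewrite inorm2//; exact: L2_mem rsT. Qed.

Lemma fine_sq_integral s T g : L2_in_time s T g ->
  fine (sq_integral s T g) = TI s T (fun r => rdot (g r) (g r)).
Proof. by move=> lg; rewrite L2_sq_integral// L2_TI_sq. Qed.

Lemma cs_mem x y : imem U x -> imem U y -> `|rdot x y| <= inorm x * inorm y.
Proof.
move=> mx my; rewrite (hdE hU mx my) -{2}(liftK hU mx) -{2}(liftK hU my).
exact: (cs_abs SU).
Qed.

Lemma L2_taint s T g k : L2_in_time s T g -> L2_in_time s T k ->
  taint s T (fun r => rdot (g r) (k r)).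
Proof.
move=> lg lk; apply: (aint_dom _ (aemf_dot lg lk) (aintD _ (L2_taint_sq lg) (L2_taint_sq lk))) => //.
apply: aeW => r /=; rewrite in_itv => /= rsT.
apply: (le_trans (cs_mem (L2_mem lg rsT) (L2_mem lk rsT))).
have := sqr_ge0 (inorm (g r) - inorm (k r)).
have := sqr_ge0 (inorm (g r) + inorm (k r)).
lra.
Qed.

Lemma simple_lin (a : R[i]) h k : simple_fun h -> simple_fun k -> simple_fun (a *: h + k).
Proof.
move=> [n [B [u [Bu ->]]]] [m [C [v [Cv ->]]]].
exists (n + m)%N, (fun i => match fintype.split i with inl j => B j | inr j => C j end),
  (fun i => match fintype.split i with inl j => a *: u j | inr j => v j end); split.
  move=> i; case: (fintype.split i) => j; last exact: Cv.
  by case: (Bu j) => mB mu; split => //; exact: imemZ.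
apply/funext => r; rewrite big_split_ord /=.
rewrite -[LHS]/(a *: (\sum_(k < n) (if `[< B k r >] then u k else 0)) +
  \sum_(k < m) (if `[< C k r >] then v k else 0)).
rewrite scaler_sumr; congr (_ + _); apply: eq_bigr => i _.
  case: splitP => j /= ij; last by move: (ltn_ord i); rewrite ij ltnNge leq_addr.
  rewrite (_ : j = i); last exact/val_inj.
  by case: ifP => //; rewrite scaler0.
case: splitP => j /= ij; first by move: (ltn_ord j); rewrite -ij ltnNge leq_addr.
by rewrite (_ : j = i)//; apply/val_inj/(@addnI n).
Qed.

Lemma L2_lin s T (a : R[i]) g k : L2_in_time s T g -> L2_in_time s T k ->
  L2_in_time s T (a *: g + k).
Proof.
move=> lg lk; have [mg [h [sh hg]] _] := lg; have [mk [h' [sh' hk]] _] := lk.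
have mm r : s < r < T -> imem U ((a *: g + k) r).
  by move=> rsT; apply: phL => //; [exact: mg|exact: mk].
have sm : strongly_measurable s T (a *: g + k).
  exists (fun n => a *: h n + h' n); split; first by move=> n; exact: simple_lin.
  apply: filterS2 hg hk => r hgr hkr rsT.
  have {}hgr := hgr rsT; have {}hkr := hkr rsT.
  have lim : Normc.normc a * inorm (h n r - g r) + inorm (h' n r - k r) @[n --> \oo] --> Normc.normc a * 0 + 0.
    by apply: cvgD => //; apply: cvgM => //; exact: cvg_cst.
  rewrite mulr0 addr0 in lim.
  apply/cvgrPdist_lt => e e0; move/cvgrPdist_lt : lim => /(_ _ e0); apply: filterS => n.
  rewrite !sub0r !normrN; apply: le_lt_trans.
  rewrite ger0_norm ?sqrtr_ge0// [leRHS]ger0_norm; last first.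
    by rewrite addr_ge0 ?mulr_ge0 ?sqrtr_ge0//; case: (a) => p q; exact: sqrtr_ge0.
  rewrite (_ : _ - _ = a *: (h n r - g r) + (h' n r - k r)); last first.
    by rewrite -[LHS]/(a *: h n r + h' n r - (a *: g r + k r)) opprD addrACA scalerBr.
  have m1 := phB hU (simple_imem r (sh n)) (mg _ rsT).
  have m2 := phB hU (simple_imem r (sh' n)) (mk _ rsT).
  rewrite -(liftK hU m1) -(liftK hU m2) -elt_valZ -elt_valD !inormE.
  by apply: (le_trans (nmD SU _ _)); rewrite (nm_normc SU).
split => //.
have ame : aemf leb `]s, T[ (fun r => inorm ((a *: g + k) r) ^+ 2).
  (* Measurability of the squared norm comes from expanding the square. The cross term is again
     obtained as a limit of simple pairings, because [a *: g] is not yet known to be in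
     [L2_in_time]. *)
  have := aemfD (aemfM (aemf_cst _ _ (Normc.normc a ^+ 2)) (aemf_dot lg lg)) (aemf_dot lk lk).
  move=> h1.
  have h2 : aemf leb `]s, T[ (fun r => rdot (g r) (k r)) by exact: aemf_dot.
  suff h3 : aemf leb `]s, T[ (fun r => rdot (a *: g r) (k r)).
    have := aemfD h1 (aemfM (aemf_cst leb _ 2) h3); apply: aemf_ae => //.
    apply: aeW => r /=; rewrite in_itv => /= rsT.
    have m1 := mg _ rsT; have m2 := mk _ rsT.
    have -> : (a *: g + k) r = elt_val (a *: lift hU (g r) + lift hU (k r)).
      by rewrite elt_valD elt_valZ !liftK.
    rewrite inormE (nm2 SU) (hdE hU m1 m1) (hdE hU m2 m2) (hdE hU (imemZ hU a m1) m2).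
    have -> : lift hU (a *: g r) = a *: lift hU (g r).
      by apply: val_inj; rewrite /= liftK ?elt_valZ ?liftK//; exact: imemZ.
    rewrite (dDl SU) !(dDr SU) (sipC SU (lift hU (k r)) (a *: _)).
    rewrite -[hd (a *: _) (a *: _)](nm2 SU) (nm_normc SU) exprMn (nm2 SU); ring.
  apply: (aemf_cvg (F := fun n (r : R) => rdot ((a *: h n + 0) r) (h' n r))) => //.
    move=> n; apply: measurable_aemf; apply: measurable_funTS.
    apply: measurable_simple_dot => //; apply: simple_lin => //.
    exists 0%N, (fun=> set0), (fun=> 0); split; first by case.
    by apply/funext => r; rewrite big_ord0.
  apply: filterS2 hg hk => r hgr hkr /=; rewrite in_itv => /= rsT.
  have m1 := mg _ rsT; have m2 := mk _ rsT.
  rewrite (hdE hU (imemZ hU a m1) m2).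
  have E1 x : imem U x -> lift hU (a *: x) = a *: lift hU x.
    by move=> mx; apply: val_inj; rewrite /= liftK ?elt_valZ ?liftK//; exact: imemZ.
  have -> : (fun n => rdot ((a *: h n + 0) r) (h' n r)) = (fun n => hd (a *: lift hU (h n r)) (lift hU (h' n r))).
    apply/funext => n; rewrite -E1; last exact: simple_imem.
    rewrite -hdE; [|apply: imemZ => //; exact: simple_imem|exact: simple_imem].
    by rewrite -[(a *: h n + 0) r]/(a *: h n r + 0) addr0.
  rewrite E1//; apply: cvg_dot.
    have lim : Normc.normc a * inorm (h n r - g r) @[n --> \oo] --> Normc.normc a * 0.
      by apply: cvgM; [exact: cvg_cst|exact: hgr].
    rewrite mulr0 in lim; apply: cvg_trans lim; apply: near_eq_cvg; near=> n.
    rewrite -scalerBr (nm_normc SU) -inormE elt_valB !liftK//.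
    exact: simple_imem.
  apply: cvg_trans (hkr rsT); apply: near_eq_cvg; near=> n.
  by rewrite -inormE elt_valB !liftK//; exact: simple_imem.
have ai : taint s T (fun r => inorm ((a *: g + k) r) ^+ 2).
  apply: (aint_dom _ ame (aintD _ (aintZ _ (2 * Normc.normc a ^+ 2) (L2_taint_sq lg)) (aintZ _ 2 (L2_taint_sq lk)))) => //.
  apply: aeW => r /=; rewrite in_itv => /= rsT.
  have m1 := mg _ rsT; have m2 := mk _ rsT.
  have -> : (a *: g + k) r = elt_val (a *: lift hU (g r) + lift hU (k r)).
    by rewrite elt_valD elt_valZ !liftK.
  rewrite ger0_norm ?sqr_ge0// inormE.
  have h1 := nmD SU (a *: lift hU (g r)) (lift hU (k r)).
  rewrite (nm_normc SU) -!inormE !liftK// in h1.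
  rewrite inormE in h1 *.
  have := nm_ge0 (@hd _ _ hU) (a *: lift hU (g r) + lift hU (k r)).
  move: (nm _ _) h1 => p h1 p0.
  have : p ^+ 2 <= (Normc.normc a * inorm (g r) + inorm (k r)) ^+ 2.
    by rewrite ler_sqr ?nnegrE// (le_trans p0).
  move/le_trans; apply.
  have := sqr_ge0 (Normc.normc a * inorm (g r) - inorm (k r)); lra.
by rewrite /sq_integral (aint_EFin _ ai)// ltry.
Unshelve. all: by end_near. Qed.

Lemma L2_0 s T : L2_in_time s T (0 : R -> U).
Proof.
have s0 : simple_fun (0 : R -> U).
  exists 0%N, (fun=> set0), (fun=> 0); split; first by case.
  by apply/funext => r; rewrite big_ord0.
have n0 : inorm (0 : U) = 0 by rewrite -(elt_val0 hU) inormE nm0//; exact: SU.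
split; first by move=> r _; exact: imem0.
  exists (fun=> 0); split => //; apply: aeW => r _.
  by rewrite subrr n0; exact: cvg_cst.
rewrite /sq_integral (_ : (fun r => _) = cst 0%E); first by rewrite integral0.
by apply/funext => r; rewrite n0 expr0n.
Qed.

Lemma L2_sub s T s' T' g : s <= s' -> T' <= T -> L2_in_time s T g -> L2_in_time s' T' g.
Proof.
move=> ss TT lg; have [mg [h [sh hg]] _] := lg.
have sub r : s' < r < T' -> s < r < T.
  by move=> /andP[h1 h2]; rewrite (le_lt_trans ss h1) (lt_le_trans h2 TT).
split; first by move=> r /sub; exact: mg.
  by exists h; split => //; apply: filterS hg => r hr /sub.
have ai : taint s' T' (fun r => inorm (g r) ^+ 2) by apply: taint_sub (L2_taint_sq lg).
by rewrite /sq_integral (aint_EFin _ ai)// ltry.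
Qed.

Lemma L2_refl c s T g : L2_in_time (c - T) (c - s) g -> L2_in_time s T (fun r => g (c - r)).
Proof.
move=> lg; have [mg [h [sh hg]] _] := lg.
have sub r : s < r < T -> c - T < c - r < c - s.
  by move=> /andP[h1 h2]; apply/andP; split; lra.
split; first by move=> r /sub; exact: mg.
  exists (fun n r => h n (c - r)); split.
    move=> n; have [m [B [u [Bu ->]]]] := sh n.
    exists m, (fun i => refl c @^-1` (B i)), u; split => // i.
    have [mB mu] := Bu i; split => //.
    by rewrite -[_ @^-1` _]setTI; apply: measurable_refl.
  by apply: filterS (ae_refl c hg) => r hr /sub; exact: hr.
have [ai _] := TI_refl (L2_taint_sq lg).
by rewrite /sq_integral (aint_EFin _ ai)// ltry.
Qed.

(** Making it an [ispace] gives L^2 in time the laws of a semi-inner product, in particular the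
    Cauchy-Schwarz inequality and the completion of squares. *)
Definition L2space s T : ispace R :=
  @ISpace R (R -> U) (@L2_in_time R U s T)
    (fun g k => TI s T (fun r => rdot (g r) (k r)) +i*
      TI s T (fun r => rdot (g r) ('i *: k r))).

Lemma L2_prehilbert s T : prehilbert (L2space s T).
Proof.
split => /=.
- exact: L2_0.
- exact: L2_lin.
- move=> x y z lx ly lz; rewrite -rID//; try exact: L2_taint.
  by apply: TI_eq => r rsT; rewrite (phD hU)//; apply: L2_mem rsT.
- by move=> a x y lx ly; apply: TI_eq => r rsT; rewrite (phZ hU)//; apply: L2_mem rsT.
- move=> r x y lx ly; rewrite -rIZ//; try exact: L2_taint.
  by apply: TI_eq => t tsT; rewrite (phR hU)//; apply: L2_mem tsT.
- by move=> x y lx ly; apply: TI_eq => r rsT; rewrite (phC hU)//; apply: L2_mem rsT.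
- move=> x lx; apply: rI_ge0; apply: aeW => r /=; rewrite in_itv => /= rsT.
  by apply: (ph_ge0 hU); exact: L2_mem rsT.
- by [].
Qed.

Lemma L2_cs s T g k : L2_in_time s T g -> L2_in_time s T k ->
  `|TI s T (fun r => rdot (g r) (k r))| <=
  Num.sqrt (TI s T (fun r => rdot (g r) (g r))) * Num.sqrt (TI s T (fun r => rdot (k r) (k r))).
Proof.
move=> lg lk; have hL := L2_prehilbert s T.
have lg' : imem (L2space s T) g by []. have lk' : imem (L2space s T) k by [].
have := cs_abs (hd_sip hL) (lift hL (g : L2space s T)) (lift hL (k : L2space s T)).
by rewrite /nm /hd !liftK.
Qed.

End SquareIntegrablePaths.

(** * Variational problems and Riccati operators *)

Section FormFamily.
Variables (R : realType) (V : lmodType R[i]) (d : V -> V -> R) (H : sip d).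
Hypothesis cpl : complete_sip d.
Local Notation N := (nm d).
Variables (T alpha : R) (k : R -> V -> V -> R).
Hypotheses (alpha0 : 0 < alpha).

(** The properties of the observation forms [kappa t] on which the variational problems rest: they
    increase with t, and continuity in t is required on the diagonal only. *)
Record form_family : Prop := FormFamily {
  ff_sip : forall s, 0 <= s <= T -> sip (k s);
  ff_mono : forall s t x, 0 <= s -> s <= t -> t <= T -> k s x x <= k t x x;
  ff_bd : exists2 c, 0 <= c & forall s x, 0 <= s <= T -> k s x x <= c * N x ^+ 2;
  ff_cont : forall x t, 0 <= t <= T -> forall e : R, 0 < e -> exists2 h, 0 < h &
    forall s, 0 <= s <= T -> `|s - t| < h -> `|k s x x - k t x x| < e }.

Hypothesis kF : form_family.
Implicit Types (x y z v w : V) (s t : R).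

Lemma ff_bd2 : exists2 c, 0 <= c & forall s x y, 0 <= s <= T -> `|k s x y| <= c * N x * N y.
Proof.
have [c c0 hc] := ff_bd kF; exists c => // s x y sT.
have sk := ff_sip kF sT.
have nk z : nm (k s) z <= Num.sqrt c * N z.
  apply: (nm_le_sq sk); first by rewrite mulr_ge0 ?sqrtr_ge0 ?nm_ge0.
  by rewrite exprMn sqr_sqrtr// hc.
apply: (le_trans (cs_abs sk _ _)).
have := ler_pM (nm_ge0 _ _) (nm_ge0 _ _) (nk x) (nk y); move/le_trans; apply.
by rewrite mulrACA -expr2 sqr_sqrtr// mulrA.
Qed.

Lemma ff_eqv s x x' y : 0 <= s <= T -> eqv d x x' -> k s x y = k s x' y.
Proof.
move=> sT xx; have [c c0 hc] := ff_bd2; have sk := ff_sip kF sT.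
apply/eqP; rewrite -subr_eq0 -(dBl sk) -normr_le0; apply: (le_trans (hc _ _ _ sT)).
by rewrite (_ : N _ = 0) ?mulr0 ?mul0r.
Qed.

(** By monotonicity the difference of two members is itself a semi-inner product; its Cauchy-Schwarz
    inequality transfers continuity from the diagonal to all pairs. *)
Lemma ff_diff s t x y : 0 <= s <= T -> 0 <= t <= T ->
  `|k t x y - k s x y| <= Num.sqrt `|k t x x - k s x x| * Num.sqrt `|k t y y - k s y y|.
Proof.
suff h s' t' : 0 <= s' -> s' <= t' -> t' <= T ->
    `|k t' x y - k s' x y| <= Num.sqrt `|k t' x x - k s' x x| * Num.sqrt `|k t' y y - k s' y y|.
  move=> /andP[s0 sT] /andP[t0 tT]; have [st|/ltW ts] := leP s t; first exact: h.
  by rewrite distrC (distrC (k t x x)) (distrC (k t y y)); exact: h.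
move=> s0 st tT; have sk := ff_sip kF (s := s') ltac:(by rewrite s0 (le_trans st)).
have tk := ff_sip kF (s := t') ltac:(by rewrite (le_trans s0)).
have sd : sip (fun x y => k t' x y - k s' x y).
  split => [x' y' z|a x' y'|r x' y'|x' y'|x'].
  - by rewrite (dDl sk) (dDl tk); ring.
  - by rewrite (sipZ sk) (sipZ tk).
  - by rewrite (dRl sk) (dRl tk); ring.
  - by rewrite (sipC sk) (sipC tk).
  - by rewrite subr_ge0; apply: (ff_mono kF).
have := cs_abs sd x y; rewrite /nm.
by rewrite (ger0_norm (sip_ge0 sd x)) (ger0_norm (sip_ge0 sd y)).
Qed.

Section Solver.
Variables (Gs : V -> V) (bGs : blin d Gs).

(** For [Gs = id] the solution is the final state of the optimal trajectory; averaging operators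
    [Gs] give the regularised problems. *)
Definition solves s z v := forall y, d v y + alpha^-1 * k s (Gs v) (Gs y) = d z y.

Definition gform s x y : R := d x y + alpha^-1 * k s (Gs x) (Gs y).

Lemma gform_sip s : 0 <= s <= T -> sip (gform s).
Proof.
move=> sT; have sk := ff_sip kF sT; have al : 0 <= alpha^-1 by rewrite invr_ge0 ltW.
have kr x y y' : eqv d y y' -> k s x y = k s x y'.
  by move=> yy; rewrite (sipC sk) (ff_eqv _ sT yy) (sipC sk).
split => [x y z|a x y|r x y|x y|x]; rewrite /gform.
- by rewrite (dDl H) (ff_eqv _ sT (blD bGs _ _)) (dDl sk); ring.
- by rewrite (sipZ H) (ff_eqv _ sT (blZ bGs _ _)) (sipZ sk) (kr _ _ _ (blZ bGs _ _)).
- by rewrite (dRl H) (ff_eqv _ sT (blZ bGs _ _)) (dRl sk); ring.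
- by rewrite (sipC H) (sipC sk).
- by rewrite addr_ge0 ?mulr_ge0 ?(sip_ge0 H) ?(sip_ge0 sk).
Qed.

Lemma nm_le_gform s x : 0 <= s <= T -> N x <= nm (gform s) x.
Proof.
move=> sT; rewrite ler_wsqrtr// lerDl mulr_ge0 ?invr_ge0 ?(ltW alpha0)//.
exact: (sip_ge0 (ff_sip kF sT)).
Qed.

(** The norms of [gform s] and [d] are equivalent: coercivity gives one bound, [ff_bd] and the
    boundedness of [Gs] the other. *)
Lemma gform_complete s : 0 <= s <= T -> complete_sip (gform s).
Proof.
move=> sT u hu; have [l hl] := cpl (fun n => le_trans (nm_le_gform _ sT) (hu n)).
have [c c0 hc] := ff_bd kF; have [b b0 hb] := blB0 bGs.
pose C := 1 + alpha^-1 * (c * b ^+ 2).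
have C0 : 0 <= C by rewrite addr_ge0// !mulr_ge0 ?invr_ge0 ?(ltW alpha0) ?sqr_ge0.
exists l.
have hC x : nm (gform s) x <= Num.sqrt C * N x.
  apply: (nm_le_sq (gform_sip sT)); first by rewrite mulr_ge0 ?sqrtr_ge0 ?nm_ge0.
  rewrite exprMn sqr_sqrtr// /gform -(nm2 H) /C mulrDl mul1r lerD2l -mulrA.
  rewrite ler_wpM2l ?invr_ge0 ?(ltW alpha0)//; apply: (le_trans (hc _ _ sT)).
  rewrite -mulrA ler_wpM2l// -exprMn ler_sqr ?nnegrE ?nm_ge0//.
  by rewrite mulr_ge0 ?nm_ge0.
have lim : Num.sqrt C * N (u n - l) @[n --> \oo] --> Num.sqrt C * 0.
  by apply: cvgM => //; exact: cvg_cst.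
rewrite mulr0 in lim; apply/cvgrPdist_lt => e e0; move/cvgrPdist_lt : lim => /(_ _ e0).
apply: filterS => n; rewrite !sub0r !normrN; apply: le_lt_trans.
by rewrite ger0_norm ?nm_ge0// [leRHS]ger0_norm// mulr_ge0 ?sqrtr_ge0 ?nm_ge0.
Qed.

Lemma solves_ex s z : 0 <= s <= T -> exists v, solves s z v.
Proof.
move=> sT; apply: (riesz (c := N z) (gform_sip sT) (gform_complete sT)).
- by move=> x y; rewrite (dDr H).
- by move=> r x; rewrite (dRr H).
- move=> x; apply: (le_trans (cs H _ _)).
  by rewrite ler_wpM2l ?nm_ge0//; exact: nm_le_gform.
Qed.

Lemma solves_bd s z v : 0 <= s <= T -> solves s z v -> N v <= N z.
Proof.
move=> sT hv; apply: nm_dual => //; first exact: nm_ge0.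
apply: le_trans (cs H z v); rewrite -hv lerDl mulr_ge0 ?invr_ge0 ?(ltW alpha0)//.
exact: (sip_ge0 (ff_sip kF sT)).
Qed.

Lemma solves_lin s (a : R[i]) z z' v v' : 0 <= s <= T ->
  solves s z v -> solves s z' v' -> solves s (a *: z + z') (a *: v + v').
Proof.
move=> sT hv hv' y; have := hv (conjc a *: y); have := hv' y.
rewrite -/(gform s v' y) -/(gform s v (conjc a *: y)) -/(gform s (a *: v + v') y).
have gs := gform_sip sT; rewrite (dDl gs) (sipZ gs) (dDl H) (sipZ H).
by move=> -> ->.
Qed.

Lemma solves_sub s z z' v v' : 0 <= s <= T ->
  solves s z v -> solves s z' v' -> solves s (z - z') (v - v').
Proof.
move=> sT hv hv'; have := solves_lin (-1) sT hv' hv.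
by rewrite !scaleN1r (addrC z) (addrC v).
Qed.

Lemma solves_eqv s z z' v v' : 0 <= s <= T -> eqv d z z' ->
  solves s z v -> solves s z' v' -> eqv d v v'.
Proof.
move=> sT zz hv hv'; have := solves_bd sT (solves_sub sT hv hv').
by rewrite (_ : N (z - z') = 0)// => h; apply/eqP; rewrite eq_le h nm_ge0.
Qed.

Lemma solves_sym s z z' v v' : 0 <= s <= T -> solves s z v -> solves s z' v' ->
  d v z' = d z v'.
Proof.
move=> sT hv hv'; rewrite (sipC H) -hv' -hv (sipC H v) (sipC (ff_sip kF sT) (Gs v)).
by [].
Qed.

(** Subtract the problems at two times and test with the difference [D]. Coercivity controls the
    square of [N D], and [ff_diff] the change of the form at the fixed vector [Gs (v t)], with one
    factor [N D] left over. *)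
Lemma solves_pcont (u v : R -> V) : pcont d 0 T u ->
  (forall s, 0 <= s <= T -> solves s (u s) (v s)) -> pcont d 0 T v.
Proof.
move=> uc hv t tT e e0; have [c c0 hc] := ff_bd kF; have [b b0 hb] := blB0 bGs.
have al : 0 < alpha^-1 by rewrite invr_gt0.
have e2 : 0 < e / 2 by lra.
pose q := alpha^-1 * (Num.sqrt c * b) + 1.
have q0 : 0 < q.
  have := mulr_ge0 (ltW al) (mulr_ge0 (sqrtr_ge0 c) b0); rewrite /q; lra.
have [h1 h10 hu] := uc t tT _ e2.
(* [ff_diff] bounds by a square root, so the variation on the diagonal has to stay below a
   square. *)
have e3 : 0 < (e / (2 * q)) ^+ 2 by rewrite exprn_gt0// divr_gt0// mulr_gt0.
have [h2 h20 hk] := ff_cont kF (Gs (v t)) tT e3.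
exists (Num.min h1 h2); first by rewrite lt_min h10.
move=> r rT; rewrite lt_min => /andP[rh1 rh2].
have {}hu := hu r rT rh1; have {}hk := hk r rT rh2.
have rk := ff_sip kF rT; have tk := ff_sip kF tT.
set D := v r - v t.
suff : N D <= N (u r - u t) + e / (2 * q) * (alpha^-1 * (Num.sqrt c * b)).
  move/le_lt_trans; apply.
  have : e / (2 * q) * (alpha^-1 * (Num.sqrt c * b)) <= e / 2; last by lra.
  have qX : alpha^-1 * (Num.sqrt c * b) = q - 1 by rewrite /q addrK.
  rewrite qX (_ : e / (2 * q) * _ = e / 2 * ((q - 1) / q)); last first.
    by move: (q) q0 => q' q0'; field; rewrite gt_eqF.
  by rewrite ler_piMr ?(ltW e2)// ler_pdivrMr//; lra.
apply: nm_dual => //.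
  by rewrite addr_ge0 ?nm_ge0// !mulr_ge0 ?invr_ge0 ?mulr_ge0 ?sqrtr_ge0// ltW.
have gr := gform_sip rT; have gt := gform_sip tT.
have h : d D D + alpha^-1 * k r (Gs D) (Gs D) =
    d (u r - u t) D - alpha^-1 * (k r (Gs (v t)) (Gs D) - k t (Gs (v t)) (Gs D)).
  have := hv r rT D; have := hv t tT D.
  rewrite -/(gform r D D) {3}/D (dBl gr) /gform (dBl H); lra.
have p0 : 0 <= alpha^-1 * k r (Gs D) (Gs D).
  by rewrite mulr_ge0 ?(ltW al)//; exact: (sip_ge0 rk).
have b1 := cs H (u r - u t) D.
have b2 := ff_diff (Gs (v t)) (Gs D) tT rT.
have b3 : Num.sqrt `|k r (Gs (v t)) (Gs (v t)) - k t (Gs (v t)) (Gs (v t))| <= e / (2 * q).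
  rewrite -[leRHS]ger0_norm; last by rewrite ltW// divr_gt0// mulr_gt0.
  by rewrite -[leRHS]sqrtr_sqr ler_wsqrtr// ltW.
have b4 : Num.sqrt `|k r (Gs D) (Gs D) - k t (Gs D) (Gs D)| <= Num.sqrt c * b * N D.
  rewrite -[leRHS]ger0_norm; last by rewrite !mulr_ge0 ?sqrtr_ge0 ?nm_ge0.
  rewrite -[leRHS]sqrtr_sqr ler_wsqrtr// -mulrA exprMn sqr_sqrtr//.
  have k1 := hc r (Gs D) rT; have k2 := hc t (Gs D) tT.
  have k3 := sip_ge0 rk (Gs D); have k4 := sip_ge0 tk (Gs D).
  have : c * N (Gs D) ^+ 2 <= c * (b * N D) ^+ 2.
    by rewrite ler_wpM2l// ler_sqr ?nnegrE ?nm_ge0 ?mulr_ge0 ?nm_ge0.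
  by rewrite ler_norml; move=> k5; apply/andP; split; lra.
have b5 := ler_pM (sqrtr_ge0 _) (sqrtr_ge0 _) b3 b4.
have b6 := le_trans b2 b5.
have b7 : alpha^-1 * `|k r (Gs (v t)) (Gs D) - k t (Gs (v t)) (Gs D)| <=
    alpha^-1 * (e / (2 * q) * (Num.sqrt c * b * N D)) by rewrite ler_wpM2l// ltW.
have b8 : - (alpha^-1 * (k r (Gs (v t)) (Gs D) - k t (Gs (v t)) (Gs D))) <=
   alpha^-1 * `|k r (Gs (v t)) (Gs D) - k t (Gs (v t)) (Gs D)|.
  by rewrite -mulrN ler_wpM2l ?(ltW al)// -normrN ler_norm.
rewrite (_ : _ * N D = N (u r - u t) * N D + alpha^-1 * (e / (2 * q) * (Num.sqrt c * b * N D))); last by ring.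
move: p0 b1 b7 b8 h; clear; lra.
Qed.

End Solver.

Lemma blin_pcont (S : V -> V) u : blin d S -> pcont d 0 T u -> pcont d 0 T (fun t => S (u t)).
Proof.
move=> bS uc t tT e e0; have [c c0 hc] := blB0 bS.
have c1 : 0 < c + 1 by lra.
have [h h0 hh] := uc t tT _ (divr_gt0 e0 c1); exists h => // r rT rt.
rewrite -(eqv_nm H (blBb H _ _ bS)); apply: (le_lt_trans (hc _)).
have := hh r rT rt; rewrite ltr_pdivlMr//; have := nm_ge0 d (u r - u t); nra.
Qed.

Lemma sg_path_pcont (F : R -> V -> V) u : semigroup d F -> pcont d 0 T u ->
  pcont d 0 T (fun t => F t (u t)).
Proof.
move=> sF uc t tT e e0; have [M M1 hM] := sg_bounded H cpl sF T.
have e1 : 0 < e / (2 * (M + 1)) by rewrite divr_gt0// mulr_gt0//; lra.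
have [h h0 hh] := uc t tT _ e1.
have [h' h0' hh'] := sg_pcont H cpl sF (u t) tT (ltac:(lra) : 0 < e / 2).
exists (Num.min h h'); first by rewrite lt_min h0.
move=> r rT; rewrite lt_min => /andP[rh rh'].
have r0 : 0 <= r by case/andP: rT.
apply: (le_lt_trans (nm_tri H (F r (u t)) _ _)).
have h1 := hh' r rT rh'; have h2 := hh r rT rh.
rewrite -(eqv_nm H (blBb H _ _ (sgb sF r0))).
have h3 := hM r (u r - u t) rT.
have : M * N (u r - u t) <= e / 2; last by lra.
apply: (@le_trans _ _ ((M + 1) * (e / (2 * (M + 1))))).
  by apply: ler_pM; rewrite ?nm_ge0 ?(ltW h2)//; lra.
by rewrite le_eqVlt; apply/orP; left; apply/eqP; field; lra.
Qed.

End FormFamily.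

Lemma frac_bound (R : realType) (p e n : R) : 0 <= p -> 0 <= e -> 0 <= n ->
  p * (e / (4 * (p + 1)) * n) <= e / 4 * n.
Proof.
move=> p0 e0 n0; rewrite mulrA ler_wpM2r//.
rewrite (_ : p * _ = p / (p + 1) * (e / 4)); last by field; lra.
by rewrite ler_piMl ?ler_pdivrMr; lra.
Qed.

(** * Riccati operators and their derivative in time *)

Section RiccatiForm.
Variables (R : realType) (V : lmodType R[i]) (d : V -> V -> R) (H : sip d).
Hypothesis cpl : complete_sip d.
Local Notation N := (nm d).
Variables (T alpha : R) (k : R -> V -> V -> R).
Hypotheses (alpha0 : 0 < alpha) (T0 : 0 < T) (kF : form_family d T k).
Variables (E Es : R -> V -> V) (sE : semigroup d E) (sEs : semigroup d Es).
Hypothesis dual : forall t x y, 0 <= t -> d (E t x) y = d x (Es t y).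
Implicit Types (x y z w : V) (s t : R).

Section OnePair.
Variables (G Gs : V -> V) (bG : blin d G) (bGs : blin d Gs).
Hypothesis dualG : forall x y, d (G x) y = d x (Gs y).
Variable v : R -> V -> V.
Hypothesis hv : forall s z, 0 <= s <= T -> solves d alpha k Gs s (G (E s z)) (v s z).

(** [s] is the time to go, so the operator at time t is [riccati_op (T - t)]. *)
Definition riccati_op s z := Es s (Gs (v s z)).
Local Notation Q := riccati_op.

Lemma solution_lin s (a : R[i]) x y : 0 <= s <= T ->
  eqv d (v s (a *: x + y)) (a *: v s x + v s y).
Proof.
move=> sT; have s0 : 0 <= s by case/andP: sT.
have hs := solves_lin H alpha0 kF bGs a sT (hv x sT) (hv y sT).
apply: (solves_eqv H alpha0 kF bGs sT _ (hv _ sT) hs).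
apply: (eqv_trans H (blin_eqv H bG (blD (sgb sE s0) _ _))).
apply: (eqv_trans H (blD bG _ _)); apply: (eqvD H) => //; last exact: eqv_refl.
by apply: (eqv_trans H (blin_eqv H bG (blZ (sgb sE s0) _ _))); exact: blZ.
Qed.

Lemma solution_blin s : 0 <= s <= T -> blin d (v s).
Proof.
move=> sT; have s0 : 0 <= s by case/andP: sT.
have vD x y : eqv d (v s (x + y)) (v s x + v s y).
  by have := solution_lin 1 x y sT; rewrite !scale1r.
have v0 : eqv d (v s 0) 0.
  have := vD 0 0; rewrite addr0 => h; apply: (eqvP H) => z.
  by have := eqv_d H z h; rewrite (dDl H) (d0l H); lra.
split=> [//|a x|].
  have := solution_lin a x 0 sT; rewrite !addr0 => h; apply: (eqv_trans H h).
  have := eqvD H (eqv_refl H (a *: v s x)) v0; rewrite addr0.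
  by [].
have [b b0 hb] := blB0 bG; have [c c0 hc] := blB0 (sgb sE s0).
exists (b * c) => x; apply: (le_trans (solves_bd H alpha0 kF sT (hv x sT))).
by apply: (le_trans (hb _)); rewrite -mulrA ler_wpM2l.
Qed.

Lemma riccati_op_blin s : 0 <= s <= T -> blin d (Q s).
Proof.
move=> sT; have s0 : 0 <= s by case/andP: sT.
apply: (blin_comp H (f := Es s) (g := Gs \o v s)); first exact: sgb.
by apply: (blin_comp H) => //; exact: solution_blin.
Qed.

Lemma riccati_opE s x y : 0 <= s <= T -> d (Q s x) y = d (v s x) (G (E s y)).
Proof.
move=> /andP[s0 _]; rewrite /Q (sipC H) -dual// (sipC H) (sipC H (v s x)) dualG.
by rewrite (sipC H).
Qed.

(** By [riccati_opE] both sides pair a datum of the variational problem with a solution of it, and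
    the problem is symmetric. *)
Lemma riccati_op_sym s x y : 0 <= s <= T -> d (Q s x) y = d x (Q s y).
Proof.
move=> sT; rewrite (riccati_opE _ _ sT) (sipC H x) (riccati_opE _ _ sT).
by rewrite (solves_sym H kF sT (hv x sT) (hv y sT)) (sipC H).
Qed.

Lemma riccati_op_form s x : 0 <= s <= T ->
  d (Q s x) x = d (v s x) (v s x) + alpha^-1 * k s (Gs (v s x)) (Gs (v s x)).
Proof. by move=> sT; rewrite (riccati_opE _ _ sT) (sipC H) -(hv x sT). Qed.

Lemma solution_pcont z : pcont d 0 T (fun s => v s z).
Proof.
apply: (solves_pcont H alpha0 kF bGs (u := fun s => G (E s z))).
  by apply: (blin_pcont H bG); exact: (sg_pcont H cpl sE).
by move=> s sT; exact: hv.
Qed.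

Lemma riccati_op_pcont z : pcont d 0 T (fun s => Q s z).
Proof.
apply: (sg_path_pcont H cpl sEs (u := fun s => Gs (v s z))).
by apply: (blin_pcont H bGs); exact: solution_pcont.
Qed.

Lemma sg_derivative x w t : gen d E x w -> 0 <= t <= T ->
  forall e : R, 0 < e -> exists2 h, 0 < h & forall s, 0 <= s <= T -> `|s - t| < h ->
    N (E s x - E t x - (s - t)%:C *: E t w) <= e * `|s - t|.
Proof.
move=> gx tT e e0; have [M M1 hM] := sg_bounded H cpl sE T.
have M0 : 0 < M by lra.
have e1 : 0 < e / (2 * M) by rewrite divr_gt0// mulr_gt0.
have e2 : 0 < e / 2 by lra.
have [h h0 hh] := gx _ e1.
have [h' h0' hh'] := sg_pcont H cpl sE w tT e2.
exists (Num.min h h'); first by rewrite lt_min h0.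
move=> s sT; rewrite lt_min => /andP[sh sh'].
have [st|ts|->] := ltgtP s t; last by rewrite !subrr scale0r subrr (nm0 H) normr0 mulr0.
- have r0 : 0 < t - s by lra.
  have s0 : 0 <= s by case/andP: sT.
  rewrite distrC gtr0_norm// in sh; rewrite (distrC s) gtr0_norm//.
  have bs := sgb sE s0.
  have e3 : eqv d (E t x) (E s (E (t - s) x)).
    have {1}-> : t = s + (t - s) by lra.
    by apply: sgD => //; exact: ltW.
  (* To the left of t the expansion starts from [E s]; the term [E t w - E s w] accounts for the
     derivative being taken at t, and is small by continuity of the orbit of [w]. *)
  have e4 : eqv d (E s x - E t x - (s - t)%:C *: E t w)
     ((t - s)%:C *: (E t w - E s w) - E s (E (t - s) x - x - (t - s)%:C *: w)).
    apply: (eqvP H) => y; rewrite !(dBl H) !(dRl H) (eqv_d H _ e3) (dBl H).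
    rewrite (eqv_d H _ (blBb H _ _ bs)) (dBl H) (eqv_d H _ (blBb H _ _ bs)) (dBl H).
    rewrite (eqv_d H _ (blZ bs _ _)) (dRl H); ring.
  rewrite (eqv_nm H e4); apply: (le_trans (nmB H _ _)); rewrite (nmR H) gtr0_norm//.
  have h1 := hh (t - s); rewrite r0 sh in h1; have {}h1 := h1 isT.
  have h2 := hM s (E (t - s) x - x - (t - s)%:C *: w) sT.
  have h3 := hh' s sT sh'; rewrite (nmBC H) in h3.
  have h4 : M * N (E (t - s) x - x - (t - s)%:C *: w) <= M * (e / (2 * M) * (t - s)).
    by rewrite ler_wpM2l// ltW.
  have h5 : M * (e / (2 * M) * (t - s)) = e / 2 * (t - s) by field; rewrite gt_eqF.
  have h6 : (t - s) * N (E t w - E s w) <= (t - s) * (e / 2).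
    by rewrite ler_wpM2l// ltW.
  rewrite h5 in h4; lra.
- have t0 : 0 <= t by case/andP: tT.
  have st : 0 < s - t by lra.
  rewrite gtr0_norm// in sh; rewrite gtr0_norm//.
  have bs := sgb sE t0.
  have e3 : eqv d (E s x) (E t (E (s - t) x)).
    have {1}-> : s = t + (s - t) by lra.
    by apply: sgD => //; exact: ltW.
  have e4 : eqv d (E s x - E t x - (s - t)%:C *: E t w)
     (E t (E (s - t) x - x - (s - t)%:C *: w)).
    apply: (eqvP H) => y; rewrite !(dBl H) !(dRl H) (eqv_d H _ e3).
    rewrite (eqv_d H _ (blBb H _ _ bs)) (dBl H) (eqv_d H _ (blBb H _ _ bs)) (dBl H).
    by rewrite (eqv_d H _ (blZ bs _ _)) (dRl H).
  rewrite (eqv_nm H e4).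
  have h1 := hh (s - t); rewrite st sh in h1; have {}h1 := h1 isT.
  apply: (le_trans (hM t _ tT)); apply: (le_trans (ler_wpM2l (ltW M0) h1)).
  rewrite (_ : M * _ = e / 2 * (s - t)); last by field; rewrite gt_eqF.
  by rewrite ler_wpM2r ?(ltW st)//; lra.
Qed.

Variable C : V -> V -> R.
Hypotheses (sC : sip C) (bC : exists2 c, 0 <= c & forall x y, `|C x y| <= c * N x * N y).
Hypothesis kC : forall s t x y, 0 <= s -> s <= t -> t <= T ->
  k t (Gs x) (Gs y) - k s (Gs x) (Gs y) = TI s t (fun r => C (Es r x) (Es r y)).

Lemma gain_diff x x' y y' : exists2 c, 0 <= c & forall x x' y y',
  `|C x' y' - C x y| <= c * (N (x' - x) * N y' + N x * N (y' - y)).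
Proof.
have [c c0 hc] := bC; exists c => // {}x {}x' {}y {}y'.
rewrite (_ : C x' y' - C x y = C (x' - x) y' + C x (y' - y)); last first.
  by rewrite (dBl sC) (dBr sC); ring.
apply: (le_trans (ler_normD _ _)); rewrite mulrDr !mulrA; exact: lerD.
Qed.

Lemma gain_taint s t x y : 0 <= s -> t <= T -> taint s t (fun r => C (Es r x) (Es r y)).
Proof.
move=> s0 tT; apply: (@taint_sub _ 0 T) => //; apply: taint_cont.
have [M M1 hM] := sg_bounded H cpl sEs T.
have [c c0 hc] := gain_diff x x y y.
apply/subspace_continuousP => r rT; apply/subr_cvg0; apply/cvg_within_itvP => e e0.
have M0 : 0 <= M by lra.
pose B := c * (M * N y + M * N x) + 1.
have B0 : 0 < B.
  have : 0 <= c * (M * N y + M * N x) by rewrite !(mulr_ge0, addr_ge0) ?nm_ge0.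
  rewrite /B; lra.
have [h h0 hh] := sg_pcont H cpl sEs x rT (divr_gt0 e0 B0).
have [h' h0' hh'] := sg_pcont H cpl sEs y rT (divr_gt0 e0 B0).
exists (Num.min h h'); first by rewrite lt_min h0.
move=> r' rT'; rewrite lt_min => /andP[rh rh'].
apply: (le_lt_trans (hc _ _ _ _)).
have h1 := ltW (hh r' rT' rh); have h2 := ltW (hh' r' rT' rh').
have h3 := ler_pM (nm_ge0 _ _) (nm_ge0 _ _) h1 (hM r' y rT').
have h4 := ler_pM (nm_ge0 _ _) (nm_ge0 _ _) (hM r x rT) h2.
have := ler_wpM2l c0 (lerD h3 h4); move/le_lt_trans; apply.
rewrite (_ : c * _ = (B - 1) / B * e); last by rewrite /B addrK; field; rewrite gt_eqF.
by rewrite gtr_pMl// ltr_pdivrMr//; lra.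
Qed.

(** The increment of the form is an integral over the interval between s and t. There the integrand
    is uniformly close to its value at t, even though the argument [u s] moves along with s. *)
Lemma gain_window t (u : R -> V) y : 0 <= t <= T -> pcont d 0 T u ->
  forall e : R, 0 < e -> exists2 h, 0 < h & forall s, 0 <= s <= T -> `|s - t| < h ->
   `|k s (Gs (u s)) (Gs y) - k t (Gs (u s)) (Gs y) -
     (s - t) * C (Es t (u t)) (Es t y)| <= e * `|s - t|.
Proof.
move=> tT uc e e0.
have [M M1 hM] := sg_bounded H cpl sEs T.
have M0 : 0 < M by lra.
have [c c0 hc] := gain_diff y y y y.
pose B := c * (2 * M * N y + M * N (u t)) + 1.
have B0 : 0 < B.
  have : 0 <= c * (2 * M * N y + M * N (u t)).
    by rewrite !(mulr_ge0, addr_ge0) ?nm_ge0// ltW.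
  rewrite /B; lra.
have eB := divr_gt0 e0 B0.
have [h h0 hh] := uc t tT _ (divr_gt0 eB M0).
have [h1 h10 hh1] := sg_pcont H cpl sEs (u t) tT eB.
have [h2 h20 hh2] := sg_pcont H cpl sEs y tT eB.
exists (Num.min h (Num.min h1 h2)); first by rewrite !lt_min h0 h10.
move=> s sT; rewrite !lt_min => /andP[sh /andP[sh1 sh2]].
have ptw r : 0 <= r <= T -> `|r - t| <= `|s - t| ->
    `|C (Es r (u s)) (Es r y) - C (Es t (u t)) (Es t y)| <= e.
  move=> rT rs; apply: (le_trans (hc _ _ _ _)).
  have r0 : 0 <= r by case/andP: rT.
  have k1 : N (Es r (u s) - Es t (u t)) <= 2 * (e / B).
    apply: (le_trans (nm_tri H (Es r (u t)) _ _)).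
    have k3 := ltW (hh1 r rT (le_lt_trans rs sh1)).
    rewrite -(eqv_nm H (blBb H _ _ (sgb sEs r0))).
    have k4 := le_trans (hM r _ rT) (ler_wpM2l (ltW M0) (ltW (hh s sT sh))).
    rewrite mulrC divfK ?gt_eqF// in k4; lra.
  have k2 := ltW (hh2 r rT (le_lt_trans rs sh2)).
  have k3 := ler_pM (nm_ge0 _ _) (nm_ge0 _ _) k1 (hM r y rT).
  have k4 := ler_pM (nm_ge0 _ _) (nm_ge0 _ _) (hM t (u t) tT) k2.
  apply: (le_trans (ler_wpM2l c0 (lerD k3 k4))).
  rewrite (_ : c * _ = (B - 1) / B * e); last by rewrite /B addrK; field; rewrite gt_eqF.
  by rewrite ler_piMl ?(ltW e0)// ler_pdivrMr//; lra.
have win a b : 0 <= a -> a <= b -> b <= T -> (forall r, a < r < b -> `|r - t| <= `|s - t|) ->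
  `|TI a b (fun r => C (Es r (u s)) (Es r y)) - (b - a) * C (Es t (u t)) (Es t y)| <= e * (b - a).
  move=> a0 ab bT rab.
  have -> : (b - a) * C (Es t (u t)) (Es t y) = TI a b (fun=> C (Es t (u t)) (Es t y)).
    by rewrite TI_cst// mulrC.
  rewrite -rIB//; [|exact: gain_taint|exact: taint_cst].
  apply: TI_norm_cst => //; first by apply: aintB => //; [exact: gain_taint|exact: taint_cst].
  move=> r rr; apply: ptw; last exact: rab.
  by case/andP: rr => r1 r2; apply/andP; split; lra.
case/andP: (sT) => s0 sT'; case/andP: (tT) => t0 tT'.
have [st|ts] := leP t s.
  rewrite (ger0_norm (x := s - t)) ?subr_ge0// kC//; apply: win => // r /andP[r1 r2].
  by rewrite !ger0_norm; lra.
rewrite (ler0_norm (x := s - t)); last by lra.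
rewrite opprB -normrN (_ : - (_ - _) = k t (Gs (u s)) (Gs y) - k s (Gs (u s)) (Gs y) - (t - s) * C (Es t (u t)) (Es t y)); last by ring.
rewrite kC ?(ltW ts)//; apply: win => //; first exact: ltW.
by move=> r /andP[r1 r2]; rewrite !ler0_norm; lra.
Qed.

(** The increment is arranged so that continuity of [v] suffices. Testing the problem of [x] at s
    with [v t y], and that of [y] at t with [v s x], expresses it by the increments of [E s y], of
    [E s x] and of the form, each of which has a derivative. *)
Lemma riccati_derivative x w y w' t : gen d E x w -> gen d E y w' -> 0 <= t <= T ->
  forall e : R, 0 < e -> exists2 h, 0 < h & forall s, 0 <= s <= T -> `|s - t| < h ->
   `|d (Q s x) y - d (Q t x) y - (s - t) * (d (Q t x) w' + d w (Q t y) -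
      alpha^-1 * C (Es t (v t x)) (Es t (v t y)))| <= e * `|s - t|.
Proof.
move=> gx gy tT e e0.
have [b b0 hb] := blB0 bG.
have [M M1 hM] := sg_bounded H cpl sE T.
have vc := solution_pcont x.
have [W W0 hW] := pcont_bounded H (ltW T0) vc.
have al : 0 < alpha^-1 by rewrite invr_gt0.
pose W' := N (v t y).
pose Z := N (G (E t w')).
have nW' : 0 <= W' by exact: nm_ge0.
have nZ : 0 <= Z by exact: nm_ge0.
have p1 : 0 < e / (4 * (W * b + 1)).
  by rewrite divr_gt0// mulr_gt0// ltr_pwDr// mulr_ge0.
have p2 : 0 < e / (4 * (W' * b + 1)).
  by rewrite divr_gt0// mulr_gt0// ltr_pwDr// mulr_ge0.
have p3 : 0 < e / (4 * (Z + 1)) by rewrite divr_gt0// mulr_gt0// ltr_pwDr.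
have p4 : 0 < e / 4 * alpha by rewrite mulr_gt0// divr_gt0.
have [h1 h10 hh1] := sg_derivative gy tT p1.
have [h2 h20 hh2] := sg_derivative gx tT p2.
have [h3 h30 hh3] := vc t tT _ p3.
have [h4 h40 hh4] := gain_window (v t y) tT vc p4.
exists (Num.min (Num.min h1 h2) (Num.min h3 h4)); first by rewrite !lt_min h10 h20 h30.
move=> s sT; rewrite !lt_min => /andP[/andP[s1 s2] /andP[s3 s4]].
have {hh1}q1 := hh1 s sT s1; have {hh2}q2 := hh2 s sT s2.
have {hh3}q3 := ltW (hh3 s sT s3); have {hh4}q4 := hh4 s sT s4.
rewrite !(riccati_opE _ _ sT) !(riccati_opE _ _ tT).
have -> : d w (Q t y) = d (G (E t w)) (v t y).
  by rewrite (sipC H) (riccati_opE _ _ tT) (sipC H).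
set n := `|s - t| in q1 q2 q4 *.
have n0 : 0 <= n by exact: normr_ge0.
have Glin z (r : R) z1 z2 : eqv d (G (z - z1 - r%:C *: z2)) (G z - G z1 - r%:C *: G z2).
  apply: (eqv_trans H (blBb H _ _ bG)); apply: (eqvB H); first exact: blBb.
  exact: blZ.
have t1 : `|d (v s x) (G (E s y - E t y - (s - t)%:C *: E t w'))| <= e / 4 * n.
  apply: (le_trans (cs_abs H _ _)).
  have k1 := le_trans (hb _) (ler_wpM2l b0 q1).
  apply: (le_trans (ler_pM (nm_ge0 _ _) (nm_ge0 _ _) (hW s sT) k1)).
  by rewrite mulrA; apply: frac_bound; rewrite ?mulr_ge0// ltW.
have t2 : `|d (G (E s x - E t x - (s - t)%:C *: E t w)) (v t y)| <= e / 4 * n.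
  apply: (le_trans (cs_abs H _ _)).
  have k1 := le_trans (hb _) (ler_wpM2l b0 q2).
  apply: (le_trans (ler_wpM2r nW' k1)).
  by rewrite mulrC mulrA; apply: frac_bound; rewrite ?mulr_ge0// ltW.
have t3 : `|(s - t) * d (v s x - v t x) (G (E t w'))| <= e / 4 * n.
  rewrite normrM -/n mulrC ler_wpM2r//; apply: (le_trans (cs_abs H _ _)).
  apply: (le_trans (ler_wpM2r nZ q3)).
  by have := frac_bound nZ (ltW e0) (@ler01 R); rewrite !mulr1 mulrC.
have t4 : `|alpha^-1 * (k s (Gs (v s x)) (Gs (v t y)) - k t (Gs (v s x)) (Gs (v t y)) -
     (s - t) * C (Es t (v t x)) (Es t (v t y)))| <= e / 4 * n.
  rewrite normrM gtr0_norm//; apply: (le_trans (ler_wpM2l (ltW al) q4)).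
  by rewrite le_eqVlt; apply/orP; left; apply/eqP; field; rewrite gt_eqF.
rewrite (eqv_dr H _ (Glin _ _ _ _)) !(dBr H) (dRr H) in t1.
rewrite (eqv_d H _ (Glin _ _ _ _)) !(dBl H) (dRl H) in t2.
rewrite (dBl H) in t3.
have e1 := hv y tT (v s x); have e2 := hv x sT (v t y); have e3 := hv x tT (v t y).
have e4 := hv y tT (v t x).
rewrite (sipC H (v t y)) (sipC (ff_sip kF tT) (Gs (v t y))) (sipC H (G _)) in e1.
rewrite (sipC H (v t y)) (sipC (ff_sip kF tT) (Gs (v t y))) (sipC H (G _)) in e4.
move: t1 t2 t3 t4; set a1 := d (v s x) (G (E s y)); set a2 := d (v s x) (G (E t y)) in e1 *.
set a3 := d (v s x) (G (E t w')); set a4 := d (G (E s x)) (v t y) in e2 *.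
set a5 := d (G (E t x)) (v t y) in e3 *; set a6 := d (G (E t w)) (v t y).
set a7 := d (v t x) (G (E t w')); set a8 := d (v t x) (G (E t y)) in e4 *.
set cc := C _ _; set k1 := k s _ _ in e2 *; set k2 := k t (Gs (v s x)) _ in e1 *.
move=> t1 t2 t3 t4.
(* Three increments minus their linear parts, and the error of replacing [v s x] by [v t x] in the
   first linear part; each accounts for a quarter of the bound. *)
rewrite (_ : a1 - a8 - _ = (a1 - a2 - (s - t) * a3) + (a4 - a5 - (s - t) * a6) +
  (s - t) * (a3 - a7) - alpha^-1 * (k1 - k2 - (s - t) * cc)); last by rewrite mulrBr mulrBr -/cc; move: e1 e2 e3 e4; clear; lra.
apply: (le_trans (ler_normB _ _)); apply: (le_trans (lerD (ler_normD _ _) (lexx _))).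
apply: (le_trans (lerD (lerD (ler_normD _ _) (lexx _)) (lexx _))).
move: t1 t2 t3 t4; clear; lra.
Qed.

End OnePair.
End RiccatiForm.

(** * Convergence of the regularised Riccati operators *)

Section RiccatiConvergence.
Variables (R : realType) (V : lmodType R[i]) (d : V -> V -> R) (H : sip d).
Hypothesis cpl : complete_sip d.
Local Notation N := (nm d).
Variables (T alpha : R) (k : R -> V -> V -> R).
Hypotheses (alpha0 : 0 < alpha) (T0 : 0 < T) (kF : form_family d T k).
Variables (E Es : R -> V -> V) (sE : semigroup d E) (sEs : semigroup d Es).
Variables (G Gs : nat -> V -> V) (b : R).
Hypotheses (bG : forall n, blin d (G n)) (bGs : forall n, blin d (Gs n)).
Hypothesis dualG : forall n x y, d (G n x) y = d x (Gs n y).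
Hypotheses (b0 : 0 <= b) (hb : forall n x, N (G n x) <= b * N x)
  (hbs : forall n x, N (Gs n x) <= b * N x).
Hypotheses (G1 : forall x (e : R), 0 < e -> \forall n \near \oo, N (G n x - x) < e)
  (Gs1 : forall x (e : R), 0 < e -> \forall n \near \oo, N (Gs n x - x) < e).
Variables (v : R -> V -> V) (vn : nat -> R -> V -> V).
Hypotheses (hv : forall s z, 0 <= s <= T -> solves d alpha k id s (E s z) (v s z))
  (hvn : forall n s z, 0 <= s <= T ->
    solves d alpha k (Gs n) s (G n (E s z)) (vn n s z)).

Lemma uniform_cvg_sub (S : nat -> V -> V) (u : R -> V) : (forall n, blin d (S n)) ->
  (forall n x, N (S n x) <= b * N x) ->
  (forall x (e : R), 0 < e -> \forall n \near \oo, N (S n x - x) < e) ->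
  pcont d 0 T u ->
  forall e : R, 0 < e -> \forall n \near \oo, forall t, 0 <= t <= T -> N (S n (u t) - u t) < e.
Proof.
move=> bS hS S1 uc; apply: (uniform_cvg_path H (M := b + 1) (S := fun n x => S n x - x)) => //.
- by rewrite addr_ge0.
- move=> n x y; apply: (eqvP H) => z; rewrite !(dBl H) (eqv_d H _ (blBb H _ _ (bS n))) (dBl H).
  ring.
- move=> n x; apply: (le_trans (nmB H _ _)); have := hS n x; lra.
Qed.

(** All problems are tested with the difference [D]. The mismatch [d (E s z - v s z) (D - Gs n D)]
    has no visible small factor, since [D] is unknown; [dualG] moves the averaging operator onto the
    known vector [E s z - v s z], where it converges. *)
Lemma solution_diff : exists2 C, 0 <= C & forall n s z, 0 <= s <= T ->
  N (vn n s z - v s z) <= N (G n (E s z) - E s z) + C * N (Gs n (v s z) - v s z) +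
    N (G n (E s z - v s z) - (E s z - v s z)).
Proof.
have [c c0 hc] := ff_bd2 kF; have al : 0 < alpha^-1 by rewrite invr_gt0.
exists (alpha^-1 * (c * b)); first by rewrite !mulr_ge0// ltW.
move=> n s z sT; set D := vn n s z - v s z; have sk := ff_sip kF sT.
apply: (nm_dual H).
  by rewrite !addr_ge0 ?nm_ge0// !mulr_ge0 ?nm_ge0// ltW.
have gs := gform_sip H alpha0 kF (bGs n) sT.
have e1 : d D D + alpha^-1 * k s (Gs n D) (Gs n D) =
    d (G n (E s z)) D - d (v s z) D - alpha^-1 * k s (Gs n (v s z)) (Gs n D).
  have := hvn n z sT D.
  have : gform d alpha k (Gs n) s D D = gform d alpha k (Gs n) s (vn n s z) D - gform d alpha k (Gs n) s (v s z) D.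
    by rewrite {1}/D (dBl gs).
  rewrite /gform; lra.
have e2 := hv z sT D; have e3 := hv z sT (D - Gs n D).
rewrite /= in e2 e3; rewrite (dBr sk) in e3.
have e4 : k s (Gs n (v s z)) (Gs n D) = k s (v s z) (Gs n D) + k s (Gs n (v s z) - v s z) (Gs n D).
  by rewrite (dBl sk); ring.
have e5 : d (E s z - v s z) (D - Gs n D) = - d (G n (E s z - v s z) - (E s z - v s z)) D.
  by set p := E s z - v s z; rewrite (dBr H) -dualG (dBl H (G n p) p) opprB.
have p0 : 0 <= alpha^-1 * k s (Gs n D) (Gs n D) by rewrite mulr_ge0 ?(ltW al)// (sip_ge0 sk).
have b1 := cs_abs H (G n (E s z) - E s z) D.
have b2 := cs_abs H (G n (E s z - v s z) - (E s z - v s z)) D.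
have b3 : alpha^-1 * `|k s (Gs n (v s z) - v s z) (Gs n D)| <=
    alpha^-1 * (c * b) * N (Gs n (v s z) - v s z) * N D.
  rewrite -!mulrA ler_wpM2l ?(ltW al)//; apply: (le_trans (hc _ _ _ sT)).
  rewrite -mulrA ler_wpM2l// mulrCA ler_wpM2l ?nm_ge0//.
have e6 : d (E s z - v s z) (D - Gs n D) = alpha^-1 * (k s (v s z) D - k s (v s z) (Gs n D)).
  by rewrite (dBl H (E s z)) -e3; ring.
have b4 := ler_norm (d (G n (E s z) - E s z) D).
have b5 : - (alpha^-1 * k s (Gs n (v s z) - v s z) (Gs n D)) <=
    alpha^-1 * `|k s (Gs n (v s z) - v s z) (Gs n D)|.
  by rewrite -mulrN ler_wpM2l ?(ltW al)// -normrN ler_norm.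
have b6 : - d (G n (E s z - v s z) - (E s z - v s z)) D <= `|d (G n (E s z - v s z) - (E s z - v s z)) D|.
  by rewrite -normrN ler_norm.
rewrite e4 in e1; rewrite e5 in e6; rewrite (dBl H (G n (E s z)) (E s z)) in b1 b4.
rewrite !mulrDl.
have e7 : alpha^-1 * (k s (v s z) (Gs n D) + k s (Gs n (v s z) - v s z) (Gs n D)) =
   alpha^-1 * k s (v s z) (Gs n D) + alpha^-1 * k s (Gs n (v s z) - v s z) (Gs n D) by ring.
rewrite e7 in e1; rewrite mulrBr in e6.
move: e1 e2 e6 p0 b1 b2 b3 b4 b5 b6; lra.
Qed.

Lemma riccati_op_cvg z (e : R) : 0 < e -> \forall n \near \oo, forall s, 0 <= s <= T ->
  N (riccati_op Es (Gs n) (vn n) s z - riccati_op Es id v s z) < e.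
Proof.
move=> e0; have [C C0 hC] := solution_diff; have [M M1 hM] := sg_bounded H cpl sEs T.
have M0 : 0 < M by lra.
have pE : pcont d 0 T (fun s => E s z) by exact: (sg_pcont H cpl sE).
have pv : pcont d 0 T (fun s => v s z).
  by apply: (solves_pcont H alpha0 kF (blin_id H) pE) => s sT; exact: hv.
have pp : pcont d 0 T (fun s => E s z - v s z).
  move=> t tT ep ep0; have ep2 : 0 < ep / 2 by lra.
  have [h h0 hh] := pE t tT _ ep2; have [h' h0' hh'] := pv t tT _ ep2.
  exists (Num.min h h'); first by rewrite lt_min h0.
  move=> r rT; rewrite lt_min => /andP[r1 r2]; have := hh r rT r1; have := hh' r rT r2.
  have -> : E r z - v r z - (E t z - v t z) = (E r z - E t z) - (v r z - v t z).
    by rewrite !opprD !opprK addrACA.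
  have := nmB H (E r z - E t z) (v r z - v t z); lra.
pose K := M * (b * (2 + C) + 1) + 1.
have K1 : 0 < K.
  have : 0 <= M * (b * (2 + C) + 1).
    by rewrite mulr_ge0 ?(ltW M0)// addr_ge0// mulr_ge0// addr_ge0.
  by rewrite /K; lra.
have q0 := divr_gt0 e0 K1.
have n1 := uniform_cvg_sub bG hb G1 pE q0.
have n2 := uniform_cvg_sub bGs hbs Gs1 pv q0.
have n3 := uniform_cvg_sub bG hb G1 pp q0.
apply: filterS3 n1 n2 n3 => n k1 k2 k3 s sT.
have h1 := k1 s sT; have h2 := k2 s sT; have h3 := k3 s sT.
have s0 : 0 <= s by case/andP: sT.
have hD := hC n s z sT.
rewrite /riccati_op -(eqv_nm H (blBb H _ _ (sgb sEs s0))).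
apply: (le_lt_trans (hM _ _ sT)).
set D := vn n s z - v s z in hD.
have h4 : N (Gs n (vn n s z) - v s z) <= b * N D + N (Gs n (v s z) - v s z).
  apply: (le_trans (nm_tri H (Gs n (v s z)) _ _)); rewrite lerD2r.
  by rewrite -(eqv_nm H (blBb H _ _ (bGs n))).
have h5 : N D <= (2 + C) * (e / K).
  apply: (le_trans hD); have := ler_wpM2l C0 (ltW h2); lra.
have h6 := ler_wpM2l b0 h5.
have h7 : N (Gs n (vn n s z) - v s z) <= (b * (2 + C) + 1) * (e / K) by lra.
apply: (le_lt_trans (ler_wpM2l (ltW M0) h7)).
rewrite (_ : M * _ = (K - 1) / K * e); last by rewrite /K addrK; ring.
by rewrite gtr_pMl// ltr_pdivrMr//; lra.
Qed.

End RiccatiConvergence.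

Section IntegralContinuity.
Variable R : realType.
Local Notation leb := (@time_measure R).

(** Along endpoints that violate the claim and tend to t, the truncated integrands converge except
    at the point t and are dominated, so dominated convergence gives a contradiction. *)
Lemma TI_cont (T t : R) (f : R -> R) : taint 0 T f -> 0 <= t <= T ->
  forall e : R, 0 < e -> exists2 h, 0 < h & forall s, 0 <= s <= T -> `|s - t| < h ->
    `|TI 0 s f - TI 0 t f| < e.
Proof.
move=> [f0 if0 ff0] tT e e0; apply: contrapT => /forall2NP hn.
have TIf r : r <= T -> TI 0 r f = rI leb setT (f0 \_ `]0, r[).
  move=> rT; rewrite /TI rI_mkcond; apply: rI_ae; apply: filterS ff0 => x hx _.
  rewrite /patch; case: ifPn => // /set_mem; rewrite /= in_itv /= => /andP[x0 xr].
  by apply: hx; rewrite /= in_itv /= x0 (lt_le_trans xr).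
have /choice[s sP] n : exists s, [/\ 0 <= s <= T, `|s - t| < n.+1%:R^-1 &
    e <= `|TI 0 s f - TI 0 t f|].
  have [//|/existsNP[s] hs] := hn n.+1%:R^-1.
  have /not_implyP[sT /not_implyP[st /negP]] := hs.
  by rewrite -leNgt => es; exists s.
have ip r : r <= T -> leb.-integrable setT (EFin \o (f0 \_ `]0, r[)).
  move=> rT; rewrite -restrict_EFin; apply/(integrable_mkcond _ (measurable_itv _)).
  apply: integrableS if0 => // x /=; rewrite !in_itv/= => /andP[-> xr].
  by rewrite (lt_le_trans xr).
have sT n : s n <= T by case: (sP n) => /andP[].
have tT' : t <= T by case/andP: tT.
have [_ _ cv] : [/\ leb.-integrable setT (fun x => (f0 \_ `]0, t[ x)%:E),
   (\int[leb]_x `|(f0 \_ `]0, s n[ x)%:E - (f0 \_ `]0, t[ x)%:E| @[n --> \oo] --> 0)%E &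
   (\int[leb]_x (f0 \_ `]0, s n[ x)%:E @[n --> \oo] --> \int[leb]_x (f0 \_ `]0, t[ x)%:E)%E].
  apply: (@dominated_convergence _ _ _ leb setT measurableT (fun n x => (f0 \_ `]0, s n[ x)%:E)
    (fun x => (f0 \_ `]0, t[ x)%:E) (fun x => `|(f0 \_ `]0, T[ x)%:E|%E)) => //.
  - by move=> n; apply: (measurable_int leb); exact: (ip _ (sT n)).
  - by apply: (measurable_int leb); exact: (ip _ tT').
  - apply: filterS (ae_leb_neq t) => x xt _; apply: cvg_near_cst.
    have xt0 : 0 < `|x - t| by rewrite normr_gt0 subr_eq0.
    near=> n.
    have [_ st _] := sP n.
    have nx : n.+1%:R^-1 < `|x - t|.
      near: n; exists (Num.truncn `|x - t|^-1) => // n /= hn'.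
      rewrite -[ltRHS]invrK ltf_pV2 ?posrE ?invr_gt0 ?ltr0n//.
      by rewrite (lt_le_trans (truncnS_gt _))// ler_nat.
    have : (x < s n) = (x < t).
      have [h|h|h] := ltgtP x t; last by rewrite h eqxx in xt.
      - rewrite ltr0_norm in nx; last by lra.
        rewrite ltr_norml in st; case/andP: st => st1 st2.
        have -> : x < s n; last by [].
        by move: nx st1 st2; move: (n.+1%:R^-1) (s n) => q r; lra.
      - rewrite gtr0_norm in nx; last by lra.
        rewrite ltr_norml in st; case/andP: st => st1 st2.
        apply/negbTE; rewrite -leNgt.
        by move: nx st1 st2; move: (n.+1%:R^-1) (s n) => q r; lra.
    by rewrite /patch !mem_setE !in_itv /= => ->.
  - by have /integrable_abse := ip _ (lexx T).
  - apply: aeW => x n _ /=; rewrite lee_fin /patch !mem_setE !in_itv /=.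
    case: ifPn => [/andP[x0 xs]|_]; last by rewrite normr0.
    by rewrite x0 (lt_le_trans xs).
have fin r : r <= T -> (\int[leb]_x (f0 \_ `]0, r[ x)%:E)%E = (TI 0 r f)%:E.
  by move=> rT; rewrite TIf// /rI fineK//; apply: integrable_fin_num => //; exact: ip.
have : TI 0 (s n) f @[n --> \oo] --> TI 0 t f.
  rewrite (fin t tT') in cv; have /fine_cvgP[_] := cv.
  by apply: cvg_trans; apply: near_eq_cvg; near=> n; rewrite /= fin.
move=> /cvgrPdist_lt /(_ _ e0)[n _ /(_ n (leqnn _)) /=].
by rewrite distrC ltNge; have [_ _ ->] := sP n.
Unshelve. all: by end_near. Qed.

End IntegralContinuity.

(** * Control systems *)

Section Transport.
Variables (R : realType) (Y : ispace R) (hY : prehilbert Y).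
Local Notation H := (elt_of_prehilbert hY).
Local Notation d := (@hd _ _ hY).
Local Notation SY := (hd_sip hY).
Implicit Types (x y z w : H).

Definition on_elt (f : Y -> Y) (x : H) : H := lift hY (f (elt_val x)).

Lemma on_eltK f x : imem Y (f (elt_val x)) -> elt_val (on_elt f x) = f (elt_val x).
Proof. exact: liftK. Qed.

Lemma bounded_linear_blin f : bounded_linear f -> blin d (on_elt f).
Proof.
move=> [fm fl [c fc]].
have fl' (a : R[i]) x y : eqv d (on_elt f (a *: x + y)) (a *: on_elt f x + on_elt f y).
  have mx := elt_mem x; have my := elt_mem y.
  rewrite -ieqE elt_valD elt_valZ !on_eltK; [|exact: fm|exact: fm|].
    by rewrite elt_valD elt_valZ; exact: fl.
  by apply: fm; exact: elt_mem.
have fD x y : eqv d (on_elt f (x + y)) (on_elt f x + on_elt f y).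
  by have := fl' 1 x y; rewrite !scale1r.
have f0 : eqv d (on_elt f 0) 0.
  apply: (eqvP SY) => z; have := eqv_d SY z (fD 0 0).
  by rewrite addr0 (dDl SY) (d0l SY); lra.
split => // [a x|].
  have := fl' a x 0; rewrite !addr0 => h; apply: (eqv_trans SY h).
  by have := eqvD SY (eqv_refl SY (a *: on_elt f x)) f0; rewrite addr0.
exists c => x; rewrite -!inormE on_eltK; first exact/fc/elt_mem.
exact/fm/elt_mem.
Qed.

Lemma blin_bounded_linear (f : H -> H) : blin d f ->
  bounded_linear (fun x : Y => elt_val (f (lift hY x))).
Proof.
move=> bf; split.
- by move=> x _; exact: elt_mem.
- move=> a x y mx my; rewrite -elt_valZ -elt_valD ieqE.
  have -> : lift hY (a *: x + y) = a *: lift hY x + lift hY y.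
    by apply: val_inj; rewrite /= liftK ?elt_valD ?elt_valZ ?liftK//; exact: phL.
  apply: (eqv_trans SY (blD bf _ _)); apply: (eqvD SY); [exact: blZ|exact: eqv_refl SY _].
- have [c c0 hc] := blB0 bf; exists c => x mx; rewrite inormE.
  by rewrite -{2}(liftK hY mx) inormE.
Qed.

Lemma C0_semigroup_elt F : C0_semigroup F -> semigroup d (fun t => on_elt (F t)).
Proof.
move=> [Fb F0 FD Fc].
have Fm t (x : H) : 0 <= t -> imem Y (F t (elt_val x)).
  by move=> t0; case: (Fb _ t0) => + _ _; apply; exact: elt_mem.
split.
- by move=> t t0; apply: bounded_linear_blin; exact: Fb.
- by move=> x; rewrite -ieqE on_eltK; [apply: F0; exact: elt_mem|exact: Fm].
- move=> s t x s0 t0; rewrite -ieqE (on_eltK (Fm _ _ (addr_ge0 s0 t0))).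
  rewrite (on_eltK (Fm _ _ s0)) (on_eltK (Fm _ _ t0)).
  by apply: FD => //; exact: elt_mem.
- move=> x e e0; have /cvg_at_right0P/(_ _ e0)[h h0 hh] := Fc _ (elt_mem x).
  exists h => // t /andP[t0 th]; rewrite -inormE elt_valB on_eltK; last exact: Fm.
  move: t0; rewrite le_eqVlt => /predU1P[<-|t0].
    by rewrite (_ : inorm _ = 0)//; apply: F0; exact: elt_mem.
  by have := hh t; rewrite t0 th => /(_ isT); rewrite ger0_norm// sqrtr_ge0.
Qed.

Lemma generates_elt (A : Y -> Y -> Prop) F : C0_semigroup F -> generates A F ->
  forall x w, A (elt_val x) (elt_val w) <-> gen d (fun t => on_elt (F t)) x w.
Proof.
move=> cF gF x w.
have Fm t : 0 <= t -> imem Y (F t (elt_val x)).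
  by case: cF => Fb _ _ _ t0; case: (Fb _ t0) => + _ _; apply; exact: elt_mem.
have E t : 0 < t -> t * inorm ((t^-1)%:C *: (F t (elt_val x) - elt_val x) - elt_val w) =
    nm d (on_elt (F t) x - x - t%:C *: w).
  move=> t0; have m1 := Fm _ (ltW t0).
  rewrite -(liftK hY m1) -elt_valB -elt_valZ -elt_valB inormE.
  rewrite -{1}(gtr0_norm t0) -(nmR SY) scalerBr scalerA -rmorphM divff ?gt_eqF//.
  by rewrite scale1r.
rewrite gF; split => [[_ _ /cvg_at_right0P h]|h].
  move=> e e0; have [k k0 hk] := h _ e0; exists k => // t tk.
  have t0 : 0 < t by case/andP: tk.
  rewrite -E// mulrC ler_pM2r//; have := hk t tk.
  by rewrite ger0_norm ?sqrtr_ge0//; exact: ltW.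
split; [exact: elt_mem|exact: elt_mem|].
apply/cvg_at_right0P => e e0; have e2 : 0 < e / 2 by lra.
have [k k0 hk] := h _ e2; exists k => // t tk.
have t0 : 0 < t by case/andP: tk.
rewrite ger0_norm ?sqrtr_ge0//; have := hk t tk.
rewrite -E// mulrC ler_pM2r//; lra.
Qed.

Lemma generates_mem (A : Y -> Y -> Prop) F (x w : Y) : generates A F -> A x w ->
  imem Y x /\ imem Y w.
Proof. by move=> gF /gF[]. Qed.

End Transport.

Lemma rdotZ_idot (R : realType) (X : ispace R) (hX : prehilbert X) (a : R[i]) (x y : X) :
  imem X x -> imem X y -> rdot (a *: x) y = complex.Re (a * idot X x y).
Proof.
move=> mx my; rewrite -(liftK hX mx) -(liftK hX my) -elt_valZ idotE.
move: (lift hX x) (lift hX y) => {mx my x y} x y.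
rewrite -[LHS]/(hd (a *: x) y) (sipZ (hd_sip hX)).
have -> : conjc a *: y = (complex.Re a)%:C *: y - (complex.Im a)%:C *: ('i *: y).
  rewrite scalerA -scalerBl; congr (_ *: _); case: a => p q; apply/eqP.
  by rewrite eq_complex /= !(mul0r, mulr0, mulr1, subr0, addr0, add0r, oppr0) !eqxx.
by rewrite (dBr (hd_sip hX)) !(dRr (hd_sip hX)); case: a.
Qed.

Section PullBack.
Variables (R : realType) (V W : lmodType R[i]).

(** Meant for maps such as [K] and [gain], which are linear only up to norm zero. *)
Lemma pull_sip (d : W -> W -> R) (f : V -> W) : sip d ->
  (forall (a : R[i]) x y, eqv d (f (a *: x + y)) (a *: f x + f y)) ->
  sip (fun x y => d (f x) (f y)).
Proof.
move=> S fl.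
have fD x y : eqv d (f (x + y)) (f x + f y) by have := fl 1 x y; rewrite !scale1r.
have f0 : eqv d (f 0) 0.
  apply: (eqvP S) => z; have := eqv_d S z (fD 0 0).
  by rewrite addr0 (dDl S) (d0l S); lra.
have fZ a x : eqv d (f (a *: x)) (a *: f x).
  have := fl a x 0; rewrite !addr0 => h; apply: (eqv_trans S h).
  by have := eqvD S (eqv_refl S (a *: f x)) f0; rewrite addr0.
split => [x y z|a x y|r x y|x y|x].
- by rewrite (eqv_d S _ (fD _ _)) (dDl S).
- by rewrite (eqv_d S _ (fZ _ _)) (eqv_dr S _ (fZ _ _)) (sipZ S).
- by rewrite (eqv_d S _ (fZ _ _)) (dRl S).
- exact: sipC.
- exact: sip_ge0.
Qed.

End PullBack.

Section ControlSystem.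
Variables (R : realType) (Y U : ispace R) (hY : prehilbert Y) (hU : prehilbert U).
Variables (A : Y -> Y -> Prop) (E Es : R -> Y -> Y) (G : U -> Y) (T : R).
Variables (Bs : Y -> U) (K : Y -> R -> U).
Local Notation As := (adjoint A).
Local Notation H := (elt_of_prehilbert hY).
Local Notation d := (@hd _ _ hY).
Local Notation SY := (hd_sip hY).
Local Notation SU := (hd_sip hU).
Implicit Types (x y z w : H).

Record control_system : Prop := ControlSystem {
  cs_T : 0 < T;
  cs_complete : complete_sip d;
  cs_E : C0_semigroup E; cs_gE : generates A E;
  cs_Es : C0_semigroup Es; cs_gEs : generates As Es;
  cs_G : forall g, imem U g -> imem Y (G g);
  cs_Bs : control_adjoint As G Bs;
  cs_L : input_map_bounded As E Es G T;
  cs_K : adjoint_observation As Es T Bs K }.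

Hypothesis cS : control_system.
Local Notation cpl := (cs_complete cS).

Definition Ee t := on_elt (hY := hY) (E t).
Definition Ees t := on_elt (hY := hY) (Es t).

Lemma sgE : semigroup d Ee. Proof. exact: C0_semigroup_elt (cs_E cS). Qed.
Lemma sgEs : semigroup d Ees. Proof. exact: C0_semigroup_elt (cs_Es cS). Qed.
Lemma genE x w : A (elt_val x) (elt_val w) <-> gen d Ee x w.
Proof. exact: generates_elt (cs_E cS) (cs_gE cS) x w. Qed.
Lemma genEs x w : As (elt_val x) (elt_val w) <-> gen d Ees x w.
Proof. exact: generates_elt (cs_Es cS) (cs_gEs cS) x w. Qed.

Lemma EK t (x : H) : 0 <= t -> elt_val (Ee t x) = E t (elt_val x).
Proof.
move=> t0; apply: on_eltK; case: (cs_E cS) => Eb _ _ _.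
by case: (Eb _ t0) => + _ _; apply; exact: elt_mem.
Qed.

Lemma EsK t (x : H) : 0 <= t -> elt_val (Ees t x) = Es t (elt_val x).
Proof.
move=> t0; apply: on_eltK; case: (cs_Es cS) => Eb _ _ _.
by case: (Eb _ t0) => + _ _; apply; exact: elt_mem.
Qed.

Lemma gen_adj x v z w : gen d Ee x v -> gen d Ees z w -> d v z = d x w.
Proof. by move=> /genE gx /genEs[_ _ h]; rewrite /hd /rdot (h _ _ gx). Qed.

Lemma dualE t x y : 0 <= t -> d (Ee t x) y = d x (Ees t y).
Proof. by apply: (semigroup_dual SY cpl sgE sgEs) => *; exact: gen_adj. Qed.

Lemma Bs_mem z w : gen d Ees z w -> imem U (Bs (elt_val z)).
Proof. by move=> /genEs /(cs_Bs cS)[]. Qed.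

Lemma Bs_dot z w g : gen d Ees z w -> imem U g ->
  rdot (Bs (elt_val z)) g = d (z - w) (lift hY (G g)).
Proof.
move=> /genEs /(cs_Bs cS)[_ h] mg; rewrite /rdot h// /hd elt_valB liftK//.
exact: (cs_G cS).
Qed.

Lemma rdot_eqP (u v : U) : imem U u -> imem U v ->
  (forall g, imem U g -> rdot u g = rdot v g) -> ieq u v.
Proof.
move=> mu mv h; rewrite -(liftK hU mu) -(liftK hU mv) ieqE; apply: (eqvP SU) => z.
by rewrite /hd !liftK//; apply: h; exact: elt_mem.
Qed.

Lemma ieq_rdot (u v g : U) : imem U u -> imem U v -> imem U g -> ieq u v ->
  rdot u g = rdot v g.
Proof.
move=> mu mv mg h; rewrite !(hdE hU)//; apply: (eqv_d SU).
by rewrite -ieqE !liftK.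
Qed.

(** [Bs] is known through its pairings with controls, which depend on the class of [z - w]. The
    third element is an arbitrary representative [u] of the combination, because [Bs] takes
    representatives and need not respect [eqv] literally. *)
Lemma Bs_lin (a : R[i]) z w z' w' u : gen d Ees z w -> gen d Ees z' w' ->
  gen d Ees u (a *: w + w') -> eqv d u (a *: z + z') ->
  ieq (Bs (elt_val u)) (a *: Bs (elt_val z) + Bs (elt_val z')).
Proof.
move=> gz gz' gu uz; have m1 := Bs_mem gz; have m2 := Bs_mem gz'; have m3 := Bs_mem gu.
apply: rdot_eqP => //; first exact: phL.
move=> g mg; rewrite (phD hU)//; last exact: imemZ.
rewrite (Bs_dot gu mg) (Bs_dot gz')//.
rewrite (eqv_d SY _ (eqvB SY uz (eqv_refl SY _))).
have -> : a *: z + z' - (a *: w + w') = a *: (z - w) + (z' - w').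
  by rewrite opprD addrACA scalerBr.
rewrite (dDl SY); congr (_ + _).
have [_ hz] := cs_Bs cS (proj2 (genEs _ _) gz).
rewrite (rdotZ_idot hU)// hz// -elt_valB -(rdotZ_idot hY); [|exact: elt_mem|exact: (cs_G cS)].
by rewrite -elt_valZ /hd liftK//; exact: (cs_G cS).
Qed.

End ControlSystem.

Section ControlForms.
Variables (R : realType) (Y U : ispace R) (hY : prehilbert Y) (hU : prehilbert U).
Variables (A : Y -> Y -> Prop) (E Es : R -> Y -> Y) (G : U -> Y) (T : R).
Variables (Bs : Y -> U) (K : Y -> R -> U).
Hypothesis cS : control_system hY A E Es G T Bs K.
Local Notation As := (adjoint A).
Local Notation H := (elt_of_prehilbert hY).
Local Notation d := (@hd _ _ hY).
Local Notation SY := (hd_sip hY).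
Local Notation leb := (@time_measure R).
Local Notation Ee := (@Ee R Y hY E).
Local Notation Ees := (@Ees R Y hY Es).
Implicit Types (x y z w : H) (s t r : R).

Lemma T0 : 0 < T. Proof. exact: cs_T cS. Qed.

Lemma K_L2 x : L2_in_time 0 T (K (elt_val x)).
Proof. by case: (cs_K cS) => _ + _ _ _; apply; exact: elt_mem. Qed.

Lemma K_L2_sub x t : t <= T -> L2_in_time 0 t (K (elt_val x)).
Proof. by move=> tT; apply: (L2_sub hU _ tT (K_L2 x)). Qed.

Lemma K_mem x r : 0 < r < T -> imem U (K (elt_val x) r).
Proof. exact: L2_mem (K_L2 x). Qed.

Lemma K_lin (a : R[i]) x y : {ae leb, forall r, 0 < r < T ->
  ieq (K (elt_val (a *: x + y)) r) (a *: K (elt_val x) r + K (elt_val y) r)}.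
Proof.
case: (cs_K cS) => _ _ _ h _; rewrite elt_valD elt_valZ.
by apply: h; exact: elt_mem.
Qed.

Lemma K_lin_TI (a : R[i]) x y g t : t <= T -> L2_in_time 0 t g ->
  TI 0 t (fun r => rdot (K (elt_val (a *: x + y)) r) (g r)) =
  TI 0 t (fun r => rdot ((a *: K (elt_val x) + K (elt_val y)) r) (g r)).
Proof.
move=> tT lg; apply: TI_ae; apply: filterS (K_lin a x y) => r h rt.
have rT : 0 < r < T by case/andP: rt => -> /= rt; exact: lt_le_trans tT.
apply: (ieq_rdot hU); [exact: K_mem| |exact: L2_mem rt|exact: h].
by apply: (phL hU); exact: K_mem.
Qed.

Definition kappa t x y : R :=
  TI 0 t (fun r => rdot (K (elt_val x) r) (K (elt_val y) r)).

Lemma kappa_taint s t x y : 0 <= s -> t <= T ->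
  taint s t (fun r => rdot (K (elt_val x) r) (K (elt_val y) r)).
Proof.
by move=> s0 tT; apply: (taint_sub s0 tT); apply: (L2_taint hU); exact: K_L2.
Qed.

Lemma kappa_sip t : t <= T -> sip (kappa t).
Proof.
move=> tT; have hL := L2_prehilbert hU 0 t.
pose f x : elt_of_prehilbert hL := lift hL (K (elt_val x) : L2space U 0 t).
have fK x : elt_val (f x) = K (elt_val x) by rewrite liftK//; exact: K_L2_sub.
have := @pull_sip R H _ _ f (hd_sip hL).
have -> : (fun x y => hd (f x) (f y)) = kappa t.
  by apply/funext => x; apply/funext => y; rewrite /hd !fK.
apply=> a x y; apply: (eqvP (hd_sip hL)) => z.
have lz : L2_in_time 0 t (elt_val z) by exact: elt_mem z.
rewrite -[LHS]/(rdot (elt_val (f (a *: x + y))) (elt_val z)).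
rewrite -[RHS]/(rdot (a *: elt_val (f x) + elt_val (f y)) (elt_val z)) !fK.
exact: K_lin_TI.
Qed.

Lemma kappa_le s t x : 0 <= s -> s <= t -> t <= T -> kappa s x x <= kappa t x x.
Proof.
move=> s0 st tT; rewrite /kappa (@TI_cat _ s 0 t)//; last exact: kappa_taint.
rewrite lerDl; apply: rI_ge0; apply: aeW => r /=; rewrite in_itv /= => /andP[sr rt].
apply: (ph_ge0 hU); apply: K_mem.
by rewrite (le_lt_trans s0 sr) (lt_le_trans rt).
Qed.

Lemma kappa_ff : form_family d T kappa.
Proof.
split.
- by move=> s /andP[_ sT]; exact: kappa_sip.
- exact: kappa_le.
- case: (cs_K cS) => _ _ [c hc] _ _; exists `|c| => // s x /andP[s0 sT].
  apply: (le_trans (kappa_le x s0 sT (lexx _))).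
  have := hc _ (elt_mem x); rewrite (fine_sq_integral hU (K_L2 x)) inormE => h.
  by apply: (le_trans h); rewrite ler_wpM2r ?sqr_ge0 ?ler_norm.
- move=> x t tT e e0.
  by apply: (TI_cont _ tT e0); exact: kappa_taint.
Qed.

Lemma K_Bs z w : gen d Ees z w -> {ae leb, forall r, 0 < r < T ->
  ieq (K (elt_val z) r) (Bs (Es r (elt_val z)))}.
Proof.
move=> /(genEs cS) gz; case: (cs_K cS) => _ _ _ _ h.
by apply: h; exists (elt_val w).
Qed.

Lemma Bs_Es_L2 z w : gen d Ees z w -> L2_in_time 0 T (fun r => Bs (Es r (elt_val z))).
Proof.
move=> /(genEs cS) gz; case: (cs_K cS) => -[c h] _ _ _ _.
by have [] := h (elt_val z) (ex_intro _ _ gz).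
Qed.

Lemma TI_K_Bs g z w t : t <= T -> L2_in_time 0 t g -> gen d Ees z w ->
  TI 0 t (fun r => rdot (g r) (Bs (Es r (elt_val z)))) =
  TI 0 t (fun r => rdot (g r) (K (elt_val z) r)).
Proof.
move=> tT lg gz; apply: TI_ae; apply: filterS (K_Bs gz) => r h rt.
have rT : 0 < r < T by case/andP: rt => -> /= rt; exact: lt_le_trans tT.
have m1 := L2_mem lg rt; have m2 := K_mem z rT; have m3 := L2_mem (Bs_Es_L2 gz) rT.
rewrite (phC hU)// (phC hU m1)//; apply/esym; exact: (ieq_rdot hU m2 m3 m1 (h rT)).
Qed.

(** [opval] picks one of the values of [As], so it is known only as some [w'] in the graph of the
    generator. *)
Lemma opval_Es z w r : gen d Ees z w -> 0 <= r ->
  exists w', gen d Ees (Ees r z) w' /\ opval As (Es r (elt_val z)) = elt_val w'.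
Proof.
move=> gz r0; have gr := gen_E SY (sgEs cS) r0 gz.
have h : As (Es r (elt_val z)) (opval As (Es r (elt_val z))).
  rewrite /opval; apply: (@xgetPex _ _ [set w | As (Es r (elt_val z)) w]).
  exists (elt_val (Ees r w)); rewrite /= -(EsK cS _ r0); exact/(genEs cS).
have [_ mo] := generates_mem (cs_gEs cS) h.
exists (lift hY (opval As (Es r (elt_val z)))); split; last by rewrite liftK.
by apply/(genEs cS); rewrite liftK// (EsK cS _ r0).
Qed.

Lemma control_op_dot z w r (g : U) : gen d Ees z w -> 0 <= r -> imem U g ->
  complex.Re (ext_semigroup Es r (control_op As G g) (elt_val z)) =
  rdot g (Bs (Es r (elt_val z))).
Proof.
move=> gz r0 mg; rewrite /ext_semigroup /control_op.
have [w' [gw ->]] := opval_Es gz r0.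
have mr := Bs_mem cS gw; rewrite (EsK cS _ r0) in mr.
rewrite (phC hU)// -(EsK cS _ r0) (Bs_dot cS gw mg) (sipC SY).
by rewrite /hd elt_valB (liftK _ (cs_G cS mg)).
Qed.

Lemma mild_real s y0 (g : R -> U) (y : R -> Y) t z w : 0 <= s ->
  L2_in_time s T g -> mild_solution As E Es G T s (elt_val y0) g y ->
  s <= t <= T -> imem Y (y t) -> gen d Ees z w ->
  d (lift hY (y t)) z = d (Ee (t - s) y0) z +
    TI s t (fun r => rdot (g r) (Bs (Es (t - r) (elt_val z)))).
Proof.
move=> s0 lg my stT mt gz.
have ts : 0 <= t - s by rewrite subr_ge0; case/andP: stT.
have dz : dom As (elt_val z) by exists (elt_val w); exact/(genEs cS).
have := congr1 (@complex.Re R) (my t stT _ dz).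
rewrite -(EK cS _ ts) -{1}(liftK hY mt) /= => e.
have {e} : d (lift hY (y t)) z = d (Ee (t - s) y0) z + complex.Re (cintegral leb `[s, t]
    (fun r => ext_semigroup Es (t - r) (control_op As G (g r)) (elt_val z))).
  by rewrite /hd {1}/rdot e raddfD.
move=> ->; congr (_ + _); rewrite -[LHS]/(rI leb _ _) TI_cc; apply: TI_eq => r /andP[sr rt].
apply: control_op_dot gz _ _; first by rewrite subr_ge0 ltW.
apply: (L2_mem lg); rewrite sr /=; case/andP: stT => _; exact: lt_le_trans.
Qed.

End ControlForms.

(** * Final states and the completion of the square *)

Section OptimalControl.
Variables (R : realType) (Y U : ispace R) (hY : prehilbert Y) (hU : prehilbert U).
Variables (A : Y -> Y -> Prop) (E Es : R -> Y -> Y) (G : U -> Y) (T : R).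
Variables (Bs : Y -> U) (K : Y -> R -> U).
Hypothesis cS : control_system hY A E Es G T Bs K.
Variables (alpha : R) (alpha0 : 0 < alpha).
Local Notation As := (adjoint A).
Local Notation H := (elt_of_prehilbert hY).
Local Notation d := (@hd _ _ hY).
Local Notation SY := (hd_sip hY).
Local Notation SU := (hd_sip hU).
Local Notation leb := (@time_measure R).
Local Notation cpl := (cs_complete cS).
Local Notation Ee := (@Ee R Y hY E).
Local Notation Ees := (@Ees R Y hY Es).
Local Notation kappa := (@kappa R Y U hY K).
Local Notation kF := (kappa_ff hU cS).
Local Notation sEs := (sgEs cS).
Implicit Types (x y z w v : H) (s t r : R) (g : R -> U).

(** The two arguments of [f] are the time and the time to go, which the reversal exchanges. *)
Lemma TI_reverse s t (f : R -> R -> R) : taint s t (fun r => f r (T - r)) ->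
  TI s t (fun r => f r (T - r)) = TI (T - t) (T - s) (fun r => f (T - r) r) /\
  taint (T - t) (T - s) (fun r => f (T - r) r).
Proof.
move=> h; have h' : taint (T - (T - s)) (T - (T - t)) (fun r => f r (T - r)) by rewrite !subKr.
have [h1 e1] := TI_refl h'; rewrite !subKr in e1; rewrite -e1; split.
  by apply: TI_eq => r _; rewrite subKr.
by apply: taint_ae h1; apply: aeW => r _; rewrite subKr.
Qed.

Lemma L2_rev s g : 0 <= s -> L2_in_time s T g -> L2_in_time 0 (T - s) (fun r => g (T - r)).
Proof. by move=> s0 lg; apply: (L2_refl hU); rewrite subKr subr0. Qed.

(** The energy [kappa T] of [x - x'] is zero, so its non-negative integrand vanishes almost
    everywhere. *)
Lemma K_eqv_ae x x' : eqv d x x' -> {ae leb, forall r, 0 < r < T ->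
  ieq (K (elt_val x) r) (K (elt_val x') r)}.
Proof.
move=> xx; have [c c0 hc] := ff_bd kF.
have TT : 0 <= T <= T by rewrite lexx ltW// (T0 cS).
have Tle : T <= T by [].
have k0 : kappa T (x - x') (x - x') = 0.
  apply/eqP; rewrite eq_le (sip_ge0 (kappa_sip hU cS Tle)) andbT.
  by apply: (le_trans (hc _ _ TT)); rewrite (_ : nm d _ = 0) ?expr0n ?mulr0.
have mitv : measurable (`]0, T[%classic : set R) by [].
have pos : {ae leb, forall r, `]0, T[%classic r ->
    0 <= rdot (K (elt_val (x - x')) r) (K (elt_val (x - x')) r)}.
  apply: aeW => r /=; rewrite in_itv /= => rT; apply: (ph_ge0 hU); exact: (K_mem cS (x - x') rT).
have ae0 := rI_eq0 mitv (kappa_taint hU cS (x - x') (x - x') (lexx 0) Tle) pos k0.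
have kl := K_lin cS (-1) x' x.
apply: filterS2 ae0 kl => r h1 h2 rT.
have {}h1 : rdot (K (elt_val (x - x')) r) (K (elt_val (x - x')) r) = 0.
  by apply: h1; rewrite /= in_itv.
have {}h2 := h2 rT; rewrite !scaleN1r addrC in h2.
have mx := K_mem cS x rT; have mx' := K_mem cS x' rT; have md := K_mem cS (x - x') rT.
have n0 : inorm (K (elt_val (x - x')) r) = 0 by rewrite /inorm -/(rdot _ _) h1 sqrtr0.
have md' : imem U (- K (elt_val x') r + K (elt_val x) r).
  by rewrite addrC; exact: phB.
have h3 : eqv (@hd _ _ hU) (lift hU (K (elt_val (x - x')) r)) (lift hU (- K (elt_val x') r + K (elt_val x) r)).
  by rewrite -ieqE !liftK.
have := eqv_nm SU h3; rewrite -!inormE !liftK// n0 => h4.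
by rewrite /ieq addrC -h4.
Qed.

(** Turns the contribution of the control to the final state into an element of Y, so that
    identities known on the domain of [As] extend to all test elements. *)
Lemma rep_K s g : 0 <= s -> s <= T -> L2_in_time 0 (T - s) g ->
  exists u, forall z, d u z = TI 0 (T - s) (fun r => rdot (g r) (K (elt_val z) r)).
Proof.
move=> s0 sT lg; have Ts : T - s <= T by lra.
have [c c0 hc] := ff_bd kF.
have KL z := K_L2_sub hU cS z Ts.
pose q := Num.sqrt (TI 0 (T - s) (fun r => rdot (g r) (g r))).
have sw z : TI 0 (T - s) (fun r => rdot (g r) (K (elt_val z) r)) =
    TI 0 (T - s) (fun r => rdot (K (elt_val z) r) (g r)).
  by apply: TI_eq => r rs; rewrite (phC hU)//; [exact: L2_mem rs|exact: L2_mem (KL z) rs].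
have lin (a : R[i]) x y : TI 0 (T - s) (fun r => rdot (g r) (K (elt_val (a *: x + y)) r)) =
    TI 0 (T - s) (fun r => rdot ((a *: K (elt_val x) + K (elt_val y)) r) (g r)).
  by rewrite sw (K_lin_TI hU cS).
apply: (riesz (c := q * Num.sqrt c) SY cpl).
- move=> x y; have := lin 1 x y; rewrite !scale1r => ->.
  rewrite (sw x) (sw y) -rID//; try exact: (L2_taint hU).
  by apply: TI_eq => r rs; rewrite (phD hU)//; [exact: L2_mem (KL x) rs|exact: L2_mem (KL y) rs|exact: L2_mem rs].
- move=> r x; have := lin r%:C x 0; rewrite addr0 => ->.
  have k0 : TI 0 (T - s) (fun t => rdot ((r%:C *: K (elt_val x) + K (elt_val (0 : H))) t) (g t)) =
      r * TI 0 (T - s) (fun t => rdot (K (elt_val x) t) (g t)) + TI 0 (T - s) (fun t => rdot (K (elt_val (0 : H)) t) (g t)).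
    rewrite -rIZ//; last exact: (L2_taint hU).
    rewrite -rID//; [|apply: aintZ => //; exact: (L2_taint hU)|exact: (L2_taint hU)].
    apply: TI_eq => t ts; rewrite (phD hU); [|apply: imemZ => //; exact: L2_mem (KL x) ts|exact: L2_mem (KL 0) ts|exact: L2_mem ts].
    by rewrite (phR hU)//; [exact: L2_mem (KL x) ts|exact: L2_mem ts].
  (* [K] at 0 need not be the zero path; additivity up to null sets forces its pairing with [g] to
     vanish. *)
  have z0 : TI 0 (T - s) (fun t => rdot (K (elt_val (0 : H)) t) (g t)) = 0.
    have := lin 1 0 0; rewrite scale1r addr0 scale1r (sw 0).
    have -> : TI 0 (T - s) (fun t => rdot ((K (elt_val (0 : H)) + K (elt_val (0 : H))) t) (g t)) =
       TI 0 (T - s) (fun t => rdot (K (elt_val (0 : H)) t) (g t)) + TI 0 (T - s) (fun t => rdot (K (elt_val (0 : H)) t) (g t)).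
      rewrite -rID//; try exact: (L2_taint hU).
      by apply: TI_eq => t ts; rewrite (phD hU)//; [exact: L2_mem (KL 0) ts|exact: L2_mem (KL 0) ts|exact: L2_mem ts].
    lra.
  by rewrite k0 z0 addr0 (sw x).
- move=> x; apply: (le_trans (ler_norm _)).
  apply: (le_trans (L2_cs hU lg (KL x))).
  rewrite -mulrA ler_wpM2l ?sqrtr_ge0//.
  rewrite -[leRHS]ger0_norm ?mulr_ge0 ?sqrtr_ge0 ?nm_ge0// -[leRHS]sqrtr_sqr ler_wsqrtr//.
  by rewrite exprMn sqr_sqrtr//; apply: hc; apply/andP; split; lra.
Qed.

Lemma rev_taint s g z w : 0 <= s -> L2_in_time s T g -> gen d Ees z w ->
  taint s T (fun r => rdot (g r) (Bs (Es (T - r) (elt_val z)))).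
Proof.
move=> s0 lg gz; apply: (L2_taint hU) => //.
apply: (L2_refl hU (g := fun r => Bs (Es r (elt_val z)))).
by apply: (L2_sub hU _ _ (Bs_Es_L2 cS gz)); lra.
Qed.

(** On the domain of [As] this is the mild formulation read backwards in time. The right side is the
    pairing of [z] with a fixed element, by [rep_K], so density extends the identity to every
    [z]. *)
Lemma final_state s y0 g (y : R -> Y) z : 0 <= s < T ->
  L2_in_time s T g -> mild_solution As E Es G T s (elt_val y0) g y -> imem Y (y T) ->
  d (lift hY (y T)) z = d (Ee (T - s) y0) z +
    TI 0 (T - s) (fun r => rdot (g (T - r)) (K (elt_val z) r)).
Proof.
move=> /andP[s0 sT] lg my mT.
have lr := L2_rev s0 lg.
have [u hu] := rep_K s0 (ltW sT) lr.
rewrite -hu -(dDl SY); apply: (eqv_d SY); apply: (eqv_gen SY cpl sEs) => z' w gz.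
rewrite (dDl SY) hu (mild_real hU cS s0 lg my _ mT gz); last by rewrite lexx ltW.
congr (_ + _).
have := TI_reverse (f := fun r r' => rdot (g r) (Bs (Es r' (elt_val z')))) (rev_taint s0 lg gz).
move=> [-> _]; rewrite subrr; apply: (TI_K_Bs hU cS _ lr gz); lra.
Qed.

Definition feedback v t : U := - (alpha^-1)%:C *: K (elt_val v) (T - t).

Lemma feedback_L2 v s : 0 <= s -> L2_in_time s T (feedback v).
Proof.
move=> s0; have l1 : L2_in_time s T (fun t => K (elt_val v) (T - t)).
  by apply: (L2_refl hU); apply: (L2_sub hU _ _ (K_L2 cS v)); lra.
have := L2_lin hU (- (alpha^-1)%:C) l1 (L2_0 hU s T); rewrite addr0.
by [].
Qed.

(** [gam] is the reversed control and [del] its deviation from the feedback. The problem solved by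
    [v] identifies the cross term [(y T - v, v)] with [(del, kv)], so the cross terms of the two
    expanded squares cancel. It holds for every mild pair, whence optimality and uniqueness can be
    read off. *)
Lemma cost_identity s y0 v g (y : R -> Y) : 0 <= s < T ->
  L2_in_time s T g -> mild_solution As E Es G T s (elt_val y0) g y -> imem Y (y T) ->
  solves d alpha kappa id (T - s) (Ee (T - s) y0) v ->
  cost T alpha s g y =
  alpha * TI 0 (T - s) (fun r => rdot (g (T - r) - feedback v (T - r)) (g (T - r) - feedback v (T - r))) +
  d (lift hY (y T) - v) (lift hY (y T) - v) +
  (d v v + alpha^-1 * kappa (T - s) v v).
Proof.
move=> sT lg my mT hv; have /andP[s0 /ltW sT'] := sT.
have lr := L2_rev s0 lg; have Ts : T - s <= T by lra.
have lf := L2_rev s0 (feedback_L2 v s0).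
have lK := K_L2_sub hU cS v Ts.
have ld := L2_lin hU (-1) lf lr.
rewrite /cost (fine_sq_integral hU lg).
have -> : TI s T (fun r => rdot (g r) (g r)) =
    TI 0 (T - s) (fun r => rdot (g (T - r)) (g (T - r))).
  have := TI_reverse (s := s) (t := T) (f := fun r r' => rdot (g r) (g r)) (L2_taint hU lg lg).
  by rewrite subrr => -[].
have hL := L2_prehilbert hU 0 (T - s); have SL := hd_sip hL.
pose gam : elt_of_prehilbert hL := lift hL ((fun r => g (T - r)) : L2space U 0 (T - s)).
pose kv : elt_of_prehilbert hL := lift hL (K (elt_val v) : L2space U 0 (T - s)).
pose del := gam + (alpha^-1)%:C *: kv.
have gamK : elt_val gam = (fun r => g (T - r)) by rewrite liftK.
have kvK : elt_val kv = K (elt_val v) by rewrite liftK.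
have e1 : TI 0 (T - s) (fun r => rdot (g (T - r)) (g (T - r))) = hd gam gam.
  by rewrite -[RHS]/(rdot (elt_val gam) (elt_val gam)) gamK.
have e2 : TI 0 (T - s) (fun r => rdot (g (T - r) - feedback v (T - r)) (g (T - r) - feedback v (T - r))) =
    hd del del.
  rewrite -[RHS]/(rdot (elt_val del) (elt_val del)).
  rewrite /del elt_valD elt_valZ gamK kvK; apply: TI_eq => r _.
  by rewrite /feedback scaleNr opprK subKr.
have e3 : kappa (T - s) v v = hd kv kv.
  by rewrite -[RHS]/(rdot (elt_val kv) (elt_val kv)) kvK.
have e4 z : d (lift hY (y T)) z - d v z = TI 0 (T - s) (fun r => rdot (g (T - r)) (K (elt_val z) r)) +
    alpha^-1 * kappa (T - s) v z.
  have hz : d (Ee (T - s) y0) z = d v z + alpha^-1 * kappa (T - s) v z by rewrite -(hv z).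
  rewrite (final_state z sT lg my mT) hz addrAC [d v z + _]addrC addrK addrC.
  by [].
have e5 : d (lift hY (y T)) v - d v v = hd del kv.
  rewrite e4 e3 /del (dDl SL) (dRl SL); congr (_ + _).
  by rewrite -[RHS]/(rdot (elt_val gam) (elt_val kv)) gamK kvK.
have e6 : inorm (y T) ^+ 2 = d (lift hY (y T)) (lift hY (y T)).
  by rewrite (inorm2 hY mT) /hd liftK.
rewrite e1 e2 e3 e6; set D := lift hY (y T) in e5 *.
have e7 : hd gam gam = hd del del - 2 * alpha^-1 * hd del kv + alpha^-1 * alpha^-1 * hd kv kv.
  have -> : gam = del - (alpha^-1)%:C *: kv by rewrite /del addrK.
  rewrite !(dBl SL) !(dBr SL) !(dRl SL) !(dRr SL) (sipC SL kv del); ring.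
have e8 : d D D = d (D - v) (D - v) + 2 * hd del kv + d v v.
  rewrite -e5 !(dBl SY) !(dBr SY) (sipC SY v D); ring.
rewrite e7 e8; field; exact: lt0r_neq0.
Qed.

End OptimalControl.

(** * The optimal pair *)

Section OptimalEvolution.
Variables (R : realType) (Y U : ispace R) (hY : prehilbert Y) (hU : prehilbert U).
Variables (A : Y -> Y -> Prop) (E Es : R -> Y -> Y) (G : U -> Y) (T : R).
Variables (Bs : Y -> U) (K : Y -> R -> U).
Hypothesis cS : control_system hY A E Es G T Bs K.
Variables (alpha : R) (alpha0 : 0 < alpha).
Local Notation As := (adjoint A).
Local Notation H := (elt_of_prehilbert hY).
Local Notation d := (@hd _ _ hY).
Local Notation SY := (hd_sip hY).
Local Notation cpl := (cs_complete cS).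
Local Notation Ee := (@Ee R Y hY E).
Local Notation Ees := (@Ees R Y hY Es).
Local Notation kappa := (@kappa R Y U hY K).
Local Notation kF := (kappa_ff hU cS).
Local Notation sE := (sgE cS).
Local Notation sEs := (sgEs cS).
Local Notation lft := (lift hY).
Local Notation feedback := (@feedback R Y U hY T K alpha).
Implicit Types (x y z w v : H) (s t r : R) (g : R -> U).

Variable vv : R -> H -> H.
Hypothesis hvv : forall s z, 0 <= s <= T -> solves d alpha kappa id s (Ee s z) (vv s z).
Variables (cst : R -> R) (ysol : R -> (R -> U) -> R -> Y).
Hypothesis hys : forall s g, 0 <= s < T -> L2_in_time s T g ->
  [/\ continuous_in_time s T (ysol s g), mild_solution As E Es G T s 0 g (ysol s g) &
    forall t, s <= t <= T -> inorm (ysol s g t) ^+ 2 <= cst s * fine (sq_integral s T g)].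

Definition optimal_control t s (y0 : Y) : U := feedback (vv (T - s) (lft y0)) t.
(** [ysol] is the trajectory with datum 0 supplied by the input map, which exists for [s < T]. At
    [s = T] no time is left to act and the state is the datum. *)
Definition optimal_state t s (y0 : Y) : Y :=
  if s < T then E (t - s) y0 + ysol s (feedback (vv (T - s) (lft y0))) t else y0.

Local Notation fb s y0 := (feedback (vv (T - s) y0)).

Lemma fb_L2 s y0 : 0 <= s -> L2_in_time s T (fb s y0).
Proof. exact: (feedback_L2 hU cS). Qed.

Lemma E_mem t (y0 : Y) : 0 <= t -> imem Y y0 -> imem Y (E t y0).
Proof. by move=> t0 m; rewrite -(liftK hY m) -(EK cS _ t0); exact: elt_mem. Qed.

Lemma ysol_mem s g t : 0 <= s < T -> L2_in_time s T g -> s <= t <= T -> imem Y (ysol s g t).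
Proof. by move=> sT lg stT; have [h _ _] := hys sT lg; case: (h t stT). Qed.

Lemma opt_state_mem s t (y0 : Y) : 0 <= s -> s <= t <= T -> imem Y y0 ->
  imem Y (optimal_state t s y0).
Proof.
move=> s0 /andP[st tT] m; rewrite /optimal_state; case: ifPn => // sT.
apply: (imemD hY); first by apply: E_mem => //; rewrite subr_ge0.
by apply: ysol_mem; rewrite ?s0 ?st//; exact: fb_L2.
Qed.

Lemma cintegral_mild_shift s (x0 y0 : Y) g (y : R -> Y) : 0 <= s -> imem Y x0 -> 
  (forall t, s <= t <= T -> imem Y (y t)) ->
  mild_solution As E Es G T s 0 g y -> mild_solution As E Es G T s x0 g (fun t => E (t - s) x0 + y t).
Proof.
move=> s0 mx my h t stT z dz; have := h t stT z dz.
have ts : 0 <= t - s by rewrite subr_ge0; case/andP: stT.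
have mz : imem Y z by case: dz => w /(generates_mem (cs_gEs cS))[].
have mE := E_mem ts mx; have mt := my t stT.
(* [E (t - s) 0] need not be the zero function; it only has norm zero. *)
have z0 : idot Y (E (t - s) 0) z = 0.
  have -> : E (t - s) 0 = elt_val (Ee (t - s) 0) by rewrite (EK cS _ ts).
  rewrite -(liftK hY mz) idotE.
  have e0 : eqv d (Ee (t - s) 0) 0.
    by have := blZ (sgb sE ts) 0 0; rewrite !scale0r.
  by rewrite !(eqv_d SY _ e0) !(d0l SY).
rewrite z0 add0r => <-; rewrite -(liftK hY mE) -(liftK hY mt) -(liftK hY mz) -elt_valD !idotE.
apply/eqP; rewrite eq_complex /=; apply/andP; split; apply/eqP; exact: (dDl SY).
Qed.

Lemma opt_state_mild s (y0 : Y) : 0 <= s < T -> imem Y y0 ->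
  mild_solution As E Es G T s y0 (fb s (lft y0)) (fun t => optimal_state t s y0).
Proof.
move=> sT m; have /andP[s0 sT'] := sT; rewrite /optimal_state sT'.
have lf := fb_L2 (lft y0) s0.
have [_ hm _] := hys sT lf.
by apply: (cintegral_mild_shift y0 s0 m _ hm) => t stT; exact: ysol_mem.
Qed.

Lemma opt_state_cont s (y0 : Y) : 0 <= s < T -> imem Y y0 ->
  continuous_in_time s T (fun t => optimal_state t s y0).
Proof.
move=> sT m t stT; have /andP[s0 sT'] := sT; split; first exact: opt_state_mem.
have lf := fb_L2 (lft y0) s0.
have [hc _ _] := hys sT lf.
apply/cvg_within_itvP => e e0; have e2 : 0 < e / 2 by rewrite divr_gt0.
have [_ /cvg_within_itvP/(_ _ e2)[h h0 hh]] := hc t stT.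
have tsT : 0 <= t - s <= T by case/andP: stT => st tT; rewrite subr_ge0 st /= lerBlDr (le_trans tT)// lerDl.
have [h' h0' hh'] := sg_pcont SY cpl sE (lft y0) tsT e2.
exists (Num.min h h'); first by rewrite lt_min h0.
move=> r rsT; rewrite lt_min => /andP[rh rh'].
have rsT' : 0 <= r - s <= T by case/andP: rsT => st tT; rewrite subr_ge0 st /= lerBlDr (le_trans tT)// lerDl.
have {hh}k1 := hh r rsT rh.
have rr : r - s - (t - s) = r - t by rewrite opprB addrA subrK.
have := hh' (r - s) rsT'; rewrite rr => /(_ rh') k2.
have r0 : 0 <= r - s by case/andP: rsT'.
have t0 : 0 <= t - s by case/andP: tsT.
have mr := ysol_mem sT lf rsT; have mt := ysol_mem sT lf stT.
rewrite /optimal_state sT' ger0_norm ?sqrtr_ge0//.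
rewrite ger0_norm ?sqrtr_ge0// in k1.
move: k1; rewrite -{1}(liftK hY mr) -{1}(liftK hY mt) -elt_valB inormE => k1.
have E1 : E (r - s) y0 = elt_val (Ee (r - s) (lft y0)) by rewrite (EK cS _ r0) liftK.
have E2 : E (t - s) y0 = elt_val (Ee (t - s) (lft y0)) by rewrite (EK cS _ t0) liftK.
rewrite E1 E2 -{1}(liftK hY mr) -{1}(liftK hY mt) -!elt_valD -elt_valB inormE opprD addrACA.
apply: (le_lt_trans (nmD SY _ _)); rewrite [ltRHS](splitr e).
by apply: ltrD.
Qed.

Lemma optimal_admissible s (y0 : Y) : 0 <= s < T -> imem Y y0 ->
  admissible_pair As E Es G T s y0 (fun t => optimal_control t s y0) (fun t => optimal_state t s y0).
Proof.
move=> sT m; split; [by case/andP: sT => s0 _; exact: fb_L2|exact: opt_state_cont|].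
exact: opt_state_mild.
Qed.

Lemma opt_state_weak s t y0 z w : 0 <= s < T -> s <= t <= T -> gen d Ees z w ->
  d (lft (optimal_state t s (elt_val y0))) z = d (Ee (t - s) y0) z +
    TI s t (fun r => rdot (fb s y0 r) (Bs (Es (t - r) (elt_val z)))).
Proof.
move=> sT stT gz; have /andP[s0 _] := sT.
have hm := opt_state_mild sT (elt_mem y0); rewrite lift_val in hm.
apply: (mild_real hU cS s0 (fb_L2 _ s0) hm stT _ gz).
by apply: opt_state_mem => //; exact: elt_mem.
Qed.

Lemma subTs s : 0 <= s -> s <= T -> 0 <= T - s <= T.
Proof. by move=> s0 sT; rewrite subr_ge0 sT /= lerBlDr lerDl. Qed.

Lemma fb_TI s y0 x : 0 <= s -> s <= T ->
  TI 0 (T - s) (fun r => rdot (fb s y0 (T - r)) (K (elt_val x) r)) =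
  - (alpha^-1 * kappa (T - s) (vv (T - s) y0) x).
Proof.
move=> s0 sT; have /andP[_ Ts] := subTs s0 sT.
have tk := kappa_taint hU cS (vv (T - s) y0) x (lexx 0) Ts.
rewrite -rIZ// -rIN//; last by apply: aintZ.
apply: TI_eq => r /andP[r0 rs]; rewrite /feedback subKr.
have rT : 0 < r < T by rewrite r0 (lt_le_trans rs).
have -> : - (alpha^-1)%:C = (- alpha^-1)%:C :> R[i] by rewrite rmorphN.
by rewrite (phR hU) ?mulNr//; exact: (K_mem cS _ rT).
Qed.

(** The feedback built from [vv] subtracts [alpha^-1 * kappa] from the free evolution, and what is
    left is [vv] by the variational equation: the loop closes. *)
Lemma opt_state_final s y0 : 0 <= s -> s <= T ->
  eqv d (lft (optimal_state T s (elt_val y0))) (vv (T - s) y0).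
Proof.
move=> s0; rewrite le_eqVlt => /predU1P[->|sT].
  rewrite /optimal_state ltxx lift_val; apply: (eqvP SY) => z.
  have TT : 0 <= T - T <= T by apply: subTs => //; exact: ltW (T0 cS).
  have := hvv y0 TT z; rewrite /kappa subrr TI_void// mulr0 addr0 => ->.
  by rewrite (eqv_d SY _ (sg0 sE y0)).
have sT' : 0 <= s < T by rewrite s0.
apply: (eqvP SY) => z.
have hm := opt_state_mild sT' (elt_mem y0); rewrite lift_val in hm.
have mT : imem Y (optimal_state T s (elt_val y0)).
  by apply: opt_state_mem => //; [rewrite lexx ltW|exact: elt_mem].
rewrite (final_state hU cS z sT' (fb_L2 _ s0) hm mT) (fb_TI _ _ s0 (ltW sT)).
by rewrite -(hvv y0 (subTs s0 (ltW sT)) z) addrK.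
Qed.

Lemma Bs_Es_eqv z w z' w' : gen d Ees z w -> gen d Ees z' w' -> eqv d z z' ->
  ieq (Bs (elt_val z)) (Bs (elt_val z')).
Proof.
move=> gz gz' zz; apply: (rdot_eqP hU); [exact: (Bs_mem cS gz)|exact: (Bs_mem cS gz')|].
move=> g mg; rewrite (Bs_dot cS gz mg) (Bs_dot cS gz' mg); apply: (eqv_d SY).
apply: (eqvB SY) => //; apply: (gen_uniq SY gz).
by apply: (gen_eqv SY sEs (eqv_sym SY zz) (eqv_refl SY _)).
Qed.

Lemma Bs_Es_comp a b z w (u : U) : gen d Ees z w -> 0 <= a -> 0 <= b -> imem U u ->
  rdot u (Bs (Es a (elt_val (Ees b z)))) = rdot u (Bs (Es (a + b) (elt_val z))).
Proof.
move=> gz a0 b0 mu; have ab : 0 <= a + b by rewrite addr_ge0.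
have g1 := gen_E SY sEs a0 (gen_E SY sEs b0 gz); have g2 := gen_E SY sEs ab gz.
have := Bs_Es_eqv g1 g2 (eqv_sym SY (sgD sEs z a0 b0)).
have m1 := Bs_mem cS g1; have m2 := Bs_mem cS g2.
move=> h; rewrite -(EsK cS _ a0) -(EsK cS _ ab) (phC hU)// (phC hU mu)//.
exact: (ieq_rdot hU).
Qed.

(** Evolving the state at [t0] freely up to [t] keeps only the controls exerted before [t0]. *)
Lemma opt_state_push s t0 t y0 z w : 0 <= s < T -> s <= t0 -> t0 <= t -> t <= T ->
  gen d Ees z w ->
  d (Ee (t - t0) (lft (optimal_state t0 s (elt_val y0)))) z = d (Ee (t - s) y0) z +
    TI s t0 (fun r => rdot (fb s y0 r) (Bs (Es (t - r) (elt_val z)))).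
Proof.
move=> sT st0 t0t tT gz; have /andP[s0 _] := sT.
have tt0 : 0 <= t - t0 by rewrite subr_ge0.
have gz' := gen_E SY sEs tt0 gz.
have st0T : s <= t0 <= T by rewrite st0 (le_trans t0t).
rewrite (dualE cS _ _ tt0) (opt_state_weak _ sT st0T gz'); congr (_ + _).
  have t0s : 0 <= t0 - s by rewrite subr_ge0.
  rewrite -(dualE cS _ _ tt0); apply: (eqv_d SY).
  have -> : t - s = t - t0 + (t0 - s) by rewrite addrA subrK.
  by apply: (eqv_sym SY); exact: (sgD sE y0 tt0 t0s).
apply: TI_eq => r /andP[sr rt0].
have rT : s < r < T by rewrite sr (lt_le_trans rt0)// (le_trans t0t).
rewrite (Bs_Es_comp gz)//; first by rewrite [_ + (t - t0)]addrC addrA subrK.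
  by rewrite subr_ge0 ltW.
exact: L2_mem (fb_L2 y0 s0) rT.
Qed.

(** Pushed freely to T, the state at [t0] equals the final state plus the effect of the control
    withheld on [[t0, T]]. In reversed time that interval is [[0, T - t0]], so the final state
    solves the variational problem started at [t0]; uniqueness identifies the two solutions. *)
Lemma opt_costate s t0 y0 : 0 <= s < T -> s <= t0 -> t0 < T ->
  eqv d (vv (T - t0) (lft (optimal_state t0 s (elt_val y0)))) (vv (T - s) y0).
Proof.
move=> sT st0 t0T; have /andP[s0 sT'] := sT.
have t00 : 0 <= t0 by exact: le_trans st0.
have i1 := subTs t00 (ltW t0T); have i2 := subTs s0 (ltW sT').
have /andP[j0 j1] := i1; have /andP[j2 j3] := i2.
set v := vv (T - s) y0; set et := lft _.
have lK := K_L2_sub hU cS v j1.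
have [u hu] := rep_K hU cS t00 (ltW t0T) lK.
suff h : eqv d (Ee (T - t0) et) (v + (alpha^-1)%:C *: u).
  have hs : solves d alpha kappa id (T - t0) (Ee (T - t0) et) v.
    move=> z; rewrite (eqv_d SY _ h) (dDl SY) (dRl SY) hu.
    by [].
  exact: (solves_eqv SY alpha0 kF (blin_id SY) i1 (eqv_refl SY _) (hvv et i1) hs).
apply: (eqv_gen SY cpl sEs) => z w gz.
rewrite /et (opt_state_push y0 sT st0 (ltW t0T) (lexx T) gz) (dDl SY) (dRl SY) hu.
have tb : taint s t0 (fun r => rdot (fb s y0 r) (Bs (Es (T - r) (elt_val z)))).
  by apply: taint_sub (rev_taint hU cS s0 (fb_L2 y0 s0) gz) => //; exact: ltW.
have -> := (TI_reverse (T := T) (f := fun r r' => rdot (fb s y0 r) (Bs (Es r' (elt_val z)))) tb).1.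
have tz : taint 0 (T - s) (fun r => rdot (fb s y0 (T - r)) (Bs (Es r (elt_val z)))).
  apply: (L2_taint hU); first exact: (L2_rev hU s0 (fb_L2 y0 s0)).
  by apply: (L2_sub hU (lexx 0) j3); exact: (Bs_Es_L2 cS gz).
have lrev := L2_rev hU s0 (fb_L2 y0 s0).
have Tst : T - t0 <= T - s by rewrite lerD2l lerN2.
have c1 := TI_cat j0 Tst tz.
have c2 := TI_K_Bs hU cS j3 lrev gz.
have c3 := TI_K_Bs hU cS j1 (L2_sub hU (lexx 0) Tst lrev) gz.
have c4 := fb_TI y0 z s0 (ltW sT').
have c5 : TI 0 (T - t0) (fun r => rdot (fb s y0 (T - r)) (K (elt_val z) r)) =
    - (alpha^-1 * kappa (T - t0) v z).
  have tk := kappa_taint hU cS v z (lexx 0) j1.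
  rewrite -rIZ// -rIN//; last by apply: aintZ.
  apply: TI_eq => r /andP[r0 rs]; rewrite /feedback subKr.
  have rT : 0 < r < T by rewrite r0 (lt_le_trans rs).
  have -> : - (alpha^-1)%:C = (- alpha^-1)%:C :> R[i] by rewrite rmorphN.
  by rewrite (phR hU) ?mulNr//; exact: (K_mem cS _ rT).
have c6 := hvv y0 i2 z.
rewrite -c6 -/v /=; rewrite c2 c3 c4 c5 in c1.
move: c1; rewrite -/v -/(kappa (T - t0) v z).
move: (TI (T - t0) _ _) (alpha^-1 * kappa (T - s) v z) (alpha^-1 * kappa (T - t0) v z) (d v z).
move=> a b c e' h.
have -> : a = c - b by rewrite -[a](addKr (- c)) -h opprK.
ring.
Qed.

(** By [opt_costate] and [K_eqv_ae] the restarted control is the old one almost everywhere, so the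
    mild formulas agree once the integral is split at [t0]. For [t0 = T] the restarted state is the
    datum by definition. *)
Lemma opt_transition s t0 t (y0 : Y) : 0 <= s -> s <= t0 -> t0 <= t -> t <= T -> imem Y y0 ->
  ieq (optimal_state t s y0) (optimal_state t t0 (optimal_state t0 s y0)).
Proof.
move=> s0 st0 t0t tT my0.
have [x ->] : exists x : H, y0 = elt_val x by exists (lft y0); rewrite liftK.
have m := elt_mem x => {my0 y0}.
have t00 : 0 <= t0 by exact: le_trans st0.
have m0 : imem Y (optimal_state t0 s (elt_val x)).
  by apply: opt_state_mem => //; rewrite st0 (le_trans t0t).
have m1 : imem Y (optimal_state t s (elt_val x)).
  by apply: opt_state_mem => //; rewrite tT (le_trans st0).
have m2 : imem Y (optimal_state t t0 (optimal_state t0 s (elt_val x))).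
  by apply: opt_state_mem => //; rewrite tT t0t.
rewrite -(liftK hY m1) -(liftK hY m2) ieqE.
have [t0T|Tt0] := ltP t0 T; last first.
  have t0E : t0 = T by apply/eqP; rewrite eq_le Tt0 (le_trans t0t).
  have tE : t = T by apply/eqP; rewrite eq_le tT -{1}t0E.
  rewrite {2}/optimal_state t0E ltxx tE; exact: eqv_refl SY _.
have sT : 0 <= s < T by rewrite s0 (le_lt_trans st0).
have t0T' : 0 <= t0 < T by rewrite t00.
apply: (eqv_gen SY cpl sEs) => z w gz.
have i1 : s <= t <= T by rewrite tT (le_trans st0).
have i2 : t0 <= t <= T by rewrite tT t0t.
rewrite (opt_state_weak x sT i1 gz).
pose et := lft (optimal_state t0 s (elt_val x)).
have etE : optimal_state t0 s (elt_val x) = elt_val et by rewrite liftK.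
rewrite etE (opt_state_weak et t0T' i2 gz) /et (opt_state_push x sT st0 t0t tT gz).
have tb : taint s t (fun r => rdot (fb s x r) (Bs (Es (t - r) (elt_val z)))).
  apply: (L2_taint hU); first by apply: (L2_sub hU (lexx s) tT); exact: fb_L2.
  apply: (L2_refl hU (g := fun r => Bs (Es r (elt_val z)))).
  rewrite subrr; apply: (L2_sub hU (lexx 0) _ (Bs_Es_L2 cS gz)).
  by rewrite lerBlDr (le_trans tT)// lerDl.
rewrite (TI_cat st0 t0t tb) addrA; congr (_ + _).
have cE := opt_costate x sT st0 t0T.
apply: TI_ae; apply: filterS (ae_refl T (K_eqv_ae hU cS cE)) => r h /andP[r1 r2].
have rT : 0 < refl T r < T.
  rewrite /refl; apply/andP; split; first by rewrite subr_gt0 (lt_le_trans r2).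
  by rewrite ltrBlDr ltrDl (le_lt_trans t00).
have tr : 0 <= t - r by rewrite subr_ge0 ltW.
have mB : imem U (Bs (Es (t - r) (elt_val z))).
  by rewrite -(EsK cS _ tr); apply: (Bs_mem cS (gen_E SY sEs tr gz)).
have h1 := K_mem cS (vv (T - s) x) rT.
have h2 := K_mem cS (vv (T - t0) (lft (optimal_state t0 s (elt_val x)))) rT.
rewrite /feedback -/(refl T r) (phZ hU _ h1 mB) (phZ hU _ h2 mB); apply/esym.
by apply: (ieq_rdot hU) => //; [exact: imemZ|exact: h].
Qed.

End OptimalEvolution.

(** * Optimality, uniqueness and linear dependence on the datum *)

Section Optimality.
Variables (R : realType) (Y U : ispace R) (hY : prehilbert Y) (hU : prehilbert U).
Variables (A : Y -> Y -> Prop) (E Es : R -> Y -> Y) (G : U -> Y) (T : R).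
Variables (Bs : Y -> U) (K : Y -> R -> U).
Hypothesis cS : control_system hY A E Es G T Bs K.
Variables (alpha : R) (alpha0 : 0 < alpha).
Local Notation As := (adjoint A).
Local Notation H := (elt_of_prehilbert hY).
Local Notation d := (@hd _ _ hY).
Local Notation SY := (hd_sip hY).
Local Notation SU := (hd_sip hU).
Local Notation leb := (@time_measure R).
Local Notation cpl := (cs_complete cS).
Local Notation Ee := (@Ee R Y hY E).
Local Notation Ees := (@Ees R Y hY Es).
Local Notation kappa := (@kappa R Y U hY K).
Local Notation kF := (kappa_ff hU cS).
Local Notation sE := (sgE cS).
Local Notation sEs := (sgEs cS).
Local Notation lft := (lift hY).
Local Notation feedback := (@feedback R Y U hY T K alpha).
Implicit Types (x y z w v : H) (s t r : R) (g : R -> U).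

Variable vv : R -> H -> H.
Hypothesis hvv : forall s z, 0 <= s <= T -> solves d alpha kappa id s (Ee s z) (vv s z).
Variables (cst : R -> R) (ysol : R -> (R -> U) -> R -> Y).
Hypothesis hys : forall s g, 0 <= s < T -> L2_in_time s T g ->
  [/\ continuous_in_time s T (ysol s g), mild_solution As E Es G T s 0 g (ysol s g) &
    forall t, s <= t <= T -> inorm (ysol s g t) ^+ 2 <= cst s * fine (sq_integral s T g)].

Local Notation opt_control := (@optimal_control R Y U hY T K alpha vv).
Local Notation opt_state := (@optimal_state R Y U hY E T K alpha vv ysol).
Local Notation fb s y0 := (feedback (vv (T - s) y0)).

Lemma sub_rdot0 (u : U) : rdot (u - u) (u - u) = 0.
Proof. by rewrite subrr -(elt_val0 hU) -[LHS]/(hd _ _) (d0l SU). Qed.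

Lemma opt_cost s y0 : 0 <= s < T ->
  cost T alpha s (fun t => opt_control t s (elt_val y0)) (fun t => opt_state t s (elt_val y0)) =
  d (vv (T - s) y0) (vv (T - s) y0) +
  alpha^-1 * kappa (T - s) (vv (T - s) y0) (vv (T - s) y0).
Proof.
move=> sT; have /andP[s0 /ltW sT'] := sT.
have hm := opt_state_mild hU cS alpha vv hys sT (elt_mem y0); rewrite lift_val in hm.
have mT : imem Y (opt_state T s (elt_val y0)).
  by apply: (opt_state_mem hU cS alpha vv hys s0 _ (elt_mem y0)); rewrite sT' lexx.
have hv := hvv y0 (subTs s0 sT').
have -> : (fun t => opt_control t s (elt_val y0)) = fb s y0.
  by apply/funext => t; rewrite /optimal_control lift_val.
rewrite (cost_identity hU cS alpha0 sT (fb_L2 hU cS alpha vv y0 s0) hm mT hv).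
rewrite -[d (_ - _) _](nm2 SY) (opt_state_final hU cS hvv hys y0 s0 sT').
rewrite (@TI_eq _ 0 (T - s) _ (fun=> 0)); last by move=> r _; exact: sub_rdot0.
by rewrite /TI rI0 mulr0 expr0n /= !add0r.
Qed.

Lemma cost_excess s y0 g (y : R -> Y) : 0 <= s < T ->
  admissible_pair As E Es G T s (elt_val y0) g y ->
  cost T alpha s g y =
  alpha * TI 0 (T - s) (fun r => rdot (g (T - r) - fb s y0 (T - r)) (g (T - r) - fb s y0 (T - r))) +
  d (lft (y T) - vv (T - s) y0) (lft (y T) - vv (T - s) y0) +
  cost T alpha s (fun t => opt_control t s (elt_val y0)) (fun t => opt_state t s (elt_val y0)).
Proof.
move=> sT [lg cy my]; have /andP[s0 /ltW sT'] := sT.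
have mT : imem Y (y T) by have [] := cy T; rewrite ?sT' ?lexx.
by rewrite (cost_identity hU cS alpha0 sT lg my mT (hvv y0 (subTs s0 sT'))) (opt_cost _ sT).
Qed.

Lemma diff_L2 s g y0 : 0 <= s -> L2_in_time s T g ->
  L2_in_time 0 (T - s) (fun r => g (T - r) - fb s y0 (T - r)).
Proof.
move=> s0 lg; have := L2_lin hU (-1) (L2_rev hU s0 (fb_L2 hU cS alpha vv y0 s0)) (L2_rev hU s0 lg).
congr (L2_in_time _ _ _); apply/funext => r.
by rewrite -[LHS]/(-1 *: fb s y0 (T - r) + g (T - r)) scaleN1r addrC.
Qed.

Lemma optimal_exists s (y0 : Y) : 0 <= s < T -> imem Y y0 ->
  optimal_pair As E Es G T alpha s y0 (fun t => opt_control t s y0) (fun t => opt_state t s y0).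
Proof.
move=> sT my; split; first exact: (optimal_admissible hU cS alpha vv hys).
have [x xE] : exists x : H, y0 = elt_val x by exists (lft y0); rewrite liftK.
move=> g y; rewrite xE => ad; rewrite (cost_excess sT ad) lerDr addr_ge0 ?(sip_ge0 SY)//.
rewrite mulr_ge0 ?(ltW alpha0)//; apply: rI_ge0; apply: aeW => r /=; rewrite in_itv /= => rs.
have /andP[s0 _] := sT; case: ad => lg _ _.
by apply: (ph_ge0 hU); exact: L2_mem (diff_L2 x s0 lg) rs.
Qed.

(** By [cost_excess] the squared deviation from the feedback integrates to 0, so the controls agree
    almost everywhere; the mild formula then determines the states. *)
Lemma optimal_unique s (y0 : Y) g (y : R -> Y) : 0 <= s < T -> imem Y y0 ->
  optimal_pair As E Es G T alpha s y0 g y ->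
  {ae leb, forall t, s < t < T -> ieq (g t) (opt_control t s y0)} /\
  forall t, s <= t <= T -> ieq (y t) (opt_state t s y0).
Proof.
move=> sT my; have [x ->] : exists x : H, y0 = elt_val x by exists (lft y0); rewrite liftK.
move=> [ad op]; have /andP[s0 sT'] := sT; case: (ad) => lg cy hy.
have ld := diff_L2 x s0 lg; have lf := fb_L2 hU cS alpha vv x s0.
have := op _ _ (optimal_admissible hU cS alpha vv hys sT (elt_mem x)).
rewrite (cost_excess sT ad) -lerBrDr subrr => le0.
have D0 := sip_ge0 SY (lft (y T) - vv (T - s) x).
have mitv : measurable (`]0, T - s[%classic : set R) by [].
have pos : {ae leb, forall r, `]0, T - s[%classic r ->
    0 <= rdot (g (T - r) - fb s x (T - r)) (g (T - r) - fb s x (T - r))}.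
  by apply: aeW => r /=; rewrite in_itv /= => rs; apply: (ph_ge0 hU); exact: L2_mem ld rs.
have I0 : TI 0 (T - s) (fun r => rdot (g (T - r) - fb s x (T - r)) (g (T - r) - fb s x (T - r))) = 0.
  apply/eqP; rewrite eq_le (rI_ge0 pos) andbT -(pmulr_rle0 _ alpha0).
  by apply: le_trans le0; rewrite lerDl.
have ae0 := rI_eq0 mitv (L2_taint hU ld ld) pos I0.
have aeg : {ae leb, forall t, s < t < T -> ieq (g t) (fb s x t)}.
  apply: filterS (ae_refl T ae0) => t h /andP[st tT].
  rewrite /refl subKr in h; rewrite /ieq /inorm -/(rdot _ _) h ?sqrtr0//=.
  by rewrite in_itv /= subr_gt0 tT /= ltrD2l ltrN2.
split.
  apply: filterS aeg => t h st; rewrite /optimal_control lift_val.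
  exact: h.
move=> t stT; have [mt _] := cy t stT.
have mt' := opt_state_mem hU cS alpha vv hys s0 stT (elt_mem x).
rewrite -(liftK hY mt) -(liftK hY mt') ieqE.
apply: (eqv_gen SY cpl sEs) => z w gz.
rewrite (mild_real hU cS s0 lg hy stT mt gz) (opt_state_weak hU cS alpha vv hys x sT stT gz).
congr (_ + _); apply: TI_ae; apply: filterS aeg => r h /andP[sr rt].
have tT : t <= T by case/andP: stT.
have rT : s < r < T by rewrite sr (lt_le_trans rt).
have tr : 0 <= t - r by rewrite subr_ge0 ltW.
have mB : imem U (Bs (Es (t - r) (elt_val z))).
  by rewrite -(EsK cS _ tr); apply: (Bs_mem cS (gen_E SY sEs tr gz)).
by apply: (ieq_rdot hU (L2_mem lg rT) (L2_mem lf rT) mB); exact: h.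
Qed.

(** The real form sees a complex factor only through the other argument, so [a] is carried over to
    the test element [conjc a *: z], which still lies in the domain of the generator. *)
Lemma opt_state_linear s t (a : R[i]) x y : 0 <= s < T -> s <= t <= T ->
  eqv d (lft (opt_state t s (elt_val (a *: x + y))))
    (a *: lft (opt_state t s (elt_val x)) + lft (opt_state t s (elt_val y))).
Proof.
move=> sT stT; have /andP[s0 sT'] := sT; have /andP[st tT] := stT.
apply: (eqv_gen SY cpl sEs) => z w gz.
have ts : 0 <= t - s by rewrite subr_ge0.
have g0 : gen d Ees 0 0.
  have := gen_lin SY sEs (-1) gz gz; rewrite !scaleN1r !addNr.
  by [].
have gaz : gen d Ees (conjc a *: z) (conjc a *: w).
  by have := gen_lin SY sEs (conjc a) gz g0; rewrite !addr0.
rewrite (dDl SY) (sipZ SY).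
rewrite !(opt_state_weak hU cS alpha vv hys _ sT stT gz) (opt_state_weak hU cS alpha vv hys _ sT stT gaz).
have bE := sgb sE ts.
rewrite (eqv_d SY _ (blD bE _ _)) (dDl SY) (eqv_d SY _ (blZ bE _ _)) (sipZ SY).
rewrite -!addrA; congr (_ + _); rewrite [RHS]addrCA; congr (_ + _).
have BL u u' : gen d Ees u u' -> L2_in_time s t (fun r => Bs (Es (t - r) (elt_val u))).
  move=> gu; apply: (L2_refl hU (g := fun r => Bs (Es r (elt_val u)))).
  rewrite subrr; apply: (L2_sub hU (lexx 0) _ (Bs_Es_L2 cS gu)).
  by rewrite lerBlDr (le_trans tT)// lerDl.
have fL u : L2_in_time s t (fb s u) by apply: (L2_sub hU (lexx s) tT); exact: (fb_L2 hU cS alpha vv _ s0).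
rewrite -rID//; [|exact: (L2_taint hU (fL x) (BL _ _ gaz))|exact: (L2_taint hU (fL y) (BL _ _ gz))].
have i1 := subTs s0 (ltW sT').
have vl := solution_lin SY alpha0 kF sE (blin_id SY) (blin_id SY) hvv a x y i1.
have k1 := ae_refl T (K_eqv_ae hU cS vl).
have k2 := ae_refl T (K_lin cS a (vv (T - s) x) (vv (T - s) y)).
apply: TI_ae; apply: filterS2 k1 k2 => r h1 h2 /andP[sr rt].
have rT : 0 < refl T r < T.
  rewrite /refl; apply/andP; split; first by rewrite subr_gt0 (lt_le_trans rt).
  by rewrite ltrBlDr ltrDl (le_lt_trans s0).
have rst : s < r < t by rewrite sr rt.
have mB := L2_mem (BL _ _ gz) rst; have mB' := L2_mem (BL _ _ gaz) rst.
have m1 := K_mem cS (vv (T - s) (a *: x + y)) rT.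
have m2 := K_mem cS (vv (T - s) x) rT; have m3 := K_mem cS (vv (T - s) y) rT.
have m4 := K_mem cS (a *: vv (T - s) x + vv (T - s) y) rT.
have tr : 0 <= t - r by rewrite subr_ge0 ltW.
have e0 : ieq (Bs (Es (t - r) (elt_val (conjc a *: z)))) (conjc a *: Bs (Es (t - r) (elt_val z))).
  have gr := gen_E SY sEs tr gz; have gar := gen_E SY sEs tr gaz.
  have sc X : conjc a *: X = (conjc a - 1) *: X + X :> H by rewrite scalerBl scale1r subrK.
  have scU X : conjc a *: X = (conjc a - 1) *: X + X :> U by rewrite scalerBl scale1r subrK.
  rewrite scU -!(EsK cS _ tr); apply: (Bs_lin hU cS gr gr); rewrite -sc.
    exact: (gen_eqv SY sEs (eqv_refl SY _) (blZ (sgb sEs tr) _ _) gar).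
  exact: blZ (sgb sEs tr) _ _.
rewrite /feedback -/(refl T r); set c := - _.
have mc := imemZ hU (conjc c) mB.
rewrite (phZ hU c m1 mB) (ieq_rdot hU m1 m4 mc (h1 rT)).
rewrite (ieq_rdot hU m4 (phL hU a m2 m3) mc (h2 rT)) -(phZ hU c (phL hU a m2 m3) mB).
have -> (X X' : U) : c *: (a *: X + X') = a *: (c *: X) + c *: X'.
  by rewrite scalerDr !scalerA (mulrC c).
have m5 := imemZ hU c m2; have m6 := imemZ hU c m3.
rewrite (phD hU (imemZ hU a m5) m6 mB); congr (_ + _).
have ma := imemZ hU (conjc a) mB.
rewrite (phZ hU a m5 mB) (phC hU m5 ma) (phC hU m5 mB'); apply/esym.
exact: (ieq_rdot hU mB' ma m5 e0).
Qed.

End Optimality.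

(** * The evolution operator and the Riccati operator *)

Section RiccatiOperator.
Variables (R : realType) (Y U : ispace R) (hY : prehilbert Y) (hU : prehilbert U).
Variables (A : Y -> Y -> Prop) (E Es : R -> Y -> Y) (G : U -> Y) (T : R).
Variables (Bs : Y -> U) (K : Y -> R -> U).
Hypothesis cS : control_system hY A E Es G T Bs K.
Variables (alpha : R) (alpha0 : 0 < alpha).
Local Notation As := (adjoint A).
Local Notation H := (elt_of_prehilbert hY).
Local Notation d := (@hd _ _ hY).
Local Notation SY := (hd_sip hY).
Local Notation cpl := (cs_complete cS).
Local Notation Ee := (@Ee R Y hY E).
Local Notation Ees := (@Ees R Y hY Es).
Local Notation kappa := (@kappa R Y U hY K).
Local Notation kF := (kappa_ff hU cS).
Local Notation sE := (sgE cS).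
Local Notation sEs := (sgEs cS).
Local Notation lft := (lift hY).
Local Notation feedback := (@feedback R Y U hY T K alpha).
Implicit Types (x y z w v : H) (s t r : R) (g : R -> U).

Variable vv : R -> H -> H.
Hypothesis hvv : forall s z, 0 <= s <= T -> solves d alpha kappa id s (Ee s z) (vv s z).
Variables (cst : R -> R) (ysol : R -> (R -> U) -> R -> Y).
Hypothesis hys : forall s g, 0 <= s < T -> L2_in_time s T g ->
  [/\ continuous_in_time s T (ysol s g), mild_solution As E Es G T s 0 g (ysol s g) &
    forall t, s <= t <= T -> inorm (ysol s g t) ^+ 2 <= cst s * fine (sq_integral s T g)].

Local Notation opt_state := (@optimal_state R Y U hY E T K alpha vv ysol).
Local Notation fb s y0 := (feedback (vv (T - s) y0)).

Local Notation Q := (riccati_op Ees id vv).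
Local Notation lftQ s x := (elt_val (Q s (lft x))).
Local Notation P s x := (Es (T - s) (opt_state T s x)).

Lemma feedback_sq s x : 0 <= s -> s <= T ->
  TI s T (fun r => rdot (fb s x r) (fb s x r)) =
  alpha^-1 ^+ 2 * kappa (T - s) (vv (T - s) x) (vv (T - s) x).
Proof.
move=> s0 sT; have lf := fb_L2 hU cS alpha vv x s0.
have /andP[_ Ts] := subTs s0 sT.
have := TI_reverse (s := s) (t := T) (T := T) (f := fun r r' => rdot (fb s x r) (fb s x r)) (L2_taint hU lf lf).
rewrite subrr => -[-> _]; rewrite -rIZ//; last exact: (kappa_taint hU cS _ _ (lexx 0)).
apply: TI_eq => r /andP[r0 rs]; rewrite /feedback subKr.
have rT : 0 < r < T by rewrite r0 (lt_le_trans rs).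
have m := K_mem cS (vv (T - s) x) rT.
have -> : - (alpha^-1)%:C = (- alpha^-1)%:C :> R[i] by rewrite rmorphN.
have mc := imemZ hU (- alpha^-1)%:C m.
by rewrite (phR hU _ m mc) (phC hU m mc) (phR hU _ m m) mulrA mulrNN expr2.
Qed.

Lemma id_bounded_linear (X : ispace R) (hX : prehilbert X) : bounded_linear (id : X -> X).
Proof.
split => // [a x y mx my|]; last by exists 1 => x _; rewrite mul1r.
by rewrite /ieq subrr -(elt_val0 hX) inormE (nm0 (hd_sip hX)).
Qed.

Lemma opt_state_bounded_linear s t : 0 <= s -> s <= t <= T ->
  bounded_linear (opt_state t s).
Proof.
move=> s0 stT; have /andP[st tT] := stT.
have := le_trans st tT; rewrite le_eqVlt => /predU1P[sE|sT'].
  rewrite (_ : opt_state t s = id); first exact: id_bounded_linear.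
  by apply/funext => x; rewrite /optimal_state sE ltxx.
have sT : 0 <= s < T by rewrite s0.
split.
- by move=> x mx; exact: (opt_state_mem hU cS alpha vv hys s0 stT mx).
- move=> a x y mx my.
  have mo u := opt_state_mem hU cS alpha vv hys s0 stT (elt_mem (u : H)).
  have [x' ->] : exists x' : H, x = elt_val x' by exists (lft x); rewrite liftK.
  have [y' ->] : exists x' : H, y = elt_val x' by exists (lft y); rewrite liftK.
  rewrite -elt_valZ -elt_valD.
  have e1 : elt_val (a *: lft (opt_state t s (elt_val x')) + lft (opt_state t s (elt_val y'))) =
      a *: opt_state t s (elt_val x') + opt_state t s (elt_val y').
    by rewrite elt_valD elt_valZ (liftK hY (mo x')) (liftK hY (mo y')).
  rewrite -e1 -(liftK hY (mo (a *: x' + y'))) ieqE.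
  exact: (opt_state_linear hU cS alpha0 hvv hys a x' y' sT stT).
have [M M1 hM] := sg_bounded SY cpl sE T.
have M0 : 0 <= M by rewrite (le_trans _ M1).
have [c c0 hc] := ff_bd kF.
have i1 := subTs s0 (ltW sT').
(* [cst s] bounds the response by the control energy, [alpha^-1 ^+ 2 * c] that energy by the final
   state, and [M] the final state by the datum. *)
pose q := `|cst s| * (alpha^-1 ^+ 2 * (c * M ^+ 2)).
have q0 : 0 <= q.
  by apply: mulr_ge0 => //; apply: mulr_ge0; [exact: sqr_ge0|apply: mulr_ge0 => //; exact: sqr_ge0].
exists (M + Num.sqrt q) => x0 mx.
have [x ->] : exists x' : H, x0 = elt_val x' by exists (lft x0); rewrite liftK.
have lf := fb_L2 hU cS alpha vv x s0.
have ts : 0 <= t - s by rewrite subr_ge0.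
have tsT : 0 <= t - s <= T by rewrite ts lerBlDr (le_trans tT)// lerDl.
have [_ _ hb] := hys sT lf.
have my := ysol_mem hys sT lf stT.
rewrite /optimal_state sT' lift_val -(EK cS _ ts) -{1}(liftK hY my) -elt_valD !inormE.
apply: (le_trans (nmD SY _ _)); rewrite mulrDl; apply: lerD; first exact: hM.
rewrite -inormE liftK//.
have := hb t stT; rewrite (fine_sq_integral hU lf) (feedback_sq x s0 (ltW sT')) => h.
have r0 : 0 <= Num.sqrt q * nm d x by rewrite mulr_ge0 ?sqrtr_ge0 ?nm_ge0.
rewrite -ler_sqr ?nnegrE ?sqrtr_ge0// exprMn (sqr_sqrtr q0).
apply: (le_trans h); apply: (@le_trans _ _ (`|cst s| * (alpha^-1 ^+ 2 * kappa (T - s) (vv (T - s) x) (vv (T - s) x)))).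
  rewrite ler_wpM2r ?ler_norm// mulr_ge0 ?sqr_ge0//.
  exact: (sip_ge0 (ff_sip kF i1)).
have -> : q * nm d x ^+ 2 = `|cst s| * (alpha^-1 ^+ 2 * (c * (M * nm d x) ^+ 2)) by rewrite /q exprMn; ring.
apply: ler_wpM2l => //; apply: ler_wpM2l; first exact: sqr_ge0.
apply: (le_trans (hc _ _ i1)); apply: ler_wpM2l => //.
rewrite ler_sqr ?nnegrE ?mulr_ge0 ?nm_ge0//.
apply: (le_trans (solves_bd SY alpha0 kF i1 (hvv x i1))).
by apply: hM.
Qed.

Lemma opt_state_id t (x : Y) : 0 <= t <= T -> imem Y x -> ieq (opt_state t t x) x.
Proof.
move=> /andP[t0 tT] mx; have [x' ->] : exists x' : H, x = elt_val x' by exists (lft x); rewrite liftK.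
rewrite /optimal_state; case: ifPn => tT'; last by rewrite ieqE; exact: eqv_refl SY _.
have sT : 0 <= t < T by rewrite t0.
have stT : t <= t <= T by rewrite lexx.
have mo := opt_state_mem hU cS alpha vv hys t0 stT (elt_mem x').
rewrite -[X in ieq X _](_ : opt_state t t (elt_val x') = _); last by rewrite /optimal_state tT'.
rewrite -(liftK hY mo) ieqE; apply: (eqv_gen SY cpl sEs) => z w gz.
rewrite (opt_state_weak hU cS alpha vv hys x' sT stT gz) TI_void// addr0 subrr.
by rewrite (eqv_d SY _ (sg0 sE x')).
Qed.

Lemma P_mem s (x : Y) : 0 <= s <= T -> imem Y x -> imem Y (P s x).
Proof.
move=> /andP[s0 sT] mx; have /andP[i1 _] := subTs s0 sT.
have sTT : s <= T <= T by rewrite sT lexx.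
have mo := opt_state_mem hU cS alpha vv hys s0 sTT mx.
by rewrite -(liftK hY mo) -(EsK cS _ i1); exact: elt_mem.
Qed.

Lemma P_riccati s (x : Y) : 0 <= s <= T -> imem Y x -> ieq (P s x) (lftQ (T - s) x).
Proof.
move=> sT' mx; have /andP[s0 sT] := sT'; have /andP[i1 _] := subTs s0 sT.
have sTT : s <= T <= T by rewrite sT lexx.
have [x' ->] : exists x' : H, x = elt_val x' by exists (lft x); rewrite liftK.
have mo := opt_state_mem hU cS alpha vv hys s0 sTT (elt_mem x').
rewrite lift_val -(liftK hY mo) -(EsK cS _ i1) ieqE /riccati_op.
apply: (blin_eqv SY (sgb sEs i1)); exact: (opt_state_final hU cS hvv hys x' s0 sT).
Qed.

Lemma P_lift s (x : Y) : 0 <= s <= T -> imem Y x ->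
  eqv d (lft (P s x)) (Q (T - s) (lft x)).
Proof.
by move=> sT mx; rewrite -ieqE liftK; [exact: P_riccati|exact: P_mem].
Qed.

Lemma revT s : 0 <= s <= T -> 0 <= T - s <= T.
Proof. by move=> /andP[s0 sT]; exact: subTs. Qed.

Lemma Q_blin s : 0 <= s <= T -> blin d (Q s).
Proof. exact: (riccati_op_blin SY alpha0 kF sE sEs (blin_id SY) (blin_id SY) hvv). Qed.

Lemma Q_sym s x y : 0 <= s <= T -> d (Q s x) y = d x (Q s y).
Proof. exact: (riccati_op_sym SY kF (dualE cS) (fun _ _ => erefl) hvv). Qed.

Lemma Q_mulI s x y : 0 <= s <= T -> d (Q s x) ('i *: y) = d x ('i *: Q s y).
Proof.
move=> sT; rewrite (Q_sym _ _ sT); apply: (eqv_dr SY).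
exact: (blZ (Q_blin sT)).
Qed.

Lemma Q_form s x : 0 <= s <= T ->
  d (Q s x) x = d (vv s x) (vv s x) + alpha^-1 * kappa s (vv s x) (vv s x).
Proof. exact: (riccati_op_form SY (dualE cS) (fun _ _ => erefl) hvv). Qed.

(** Symmetry makes this number equal to its own negative. *)
Lemma Q_quad_Im s x : 0 <= s <= T -> d (Q s x) ('i *: x) = 0.
Proof.
move=> sT; have := Q_mulI x x sT.
have -> : d x ('i *: Q s x) = - d (Q s x) ('i *: x).
  rewrite (sipC SY) (sipZ SY) (_ : conjc 'i = (-1)%:C * 'i); last first.
    by apply/eqP; rewrite eq_complex /= !(mul0r, mulr0, mulN1r, subr0, addr0, oppr0) !eqxx.
  by rewrite -scalerA (dRr SY) mulN1r.
by move: (d _ _) => u h; lra.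
Qed.

End RiccatiOperator.

Section OptimalCostAndFeedback.
Variables (R : realType) (Y U : ispace R) (hY : prehilbert Y) (hU : prehilbert U).
Variables (A : Y -> Y -> Prop) (E Es : R -> Y -> Y) (G : U -> Y) (T : R).
Variables (Bs : Y -> U) (K : Y -> R -> U).
Hypothesis cS : control_system hY A E Es G T Bs K.
Variables (alpha : R) (alpha0 : 0 < alpha).
Local Notation As := (adjoint A).
Local Notation H := (elt_of_prehilbert hY).
Local Notation d := (@hd _ _ hY).
Local Notation SY := (hd_sip hY).
Local Notation SU := (hd_sip hU).
Local Notation leb := (@time_measure R).
Local Notation cpl := (cs_complete cS).
Local Notation Ee := (@Ee R Y hY E).
Local Notation Ees := (@Ees R Y hY Es).
Local Notation kappa := (@kappa R Y U hY K).
Local Notation kF := (kappa_ff hU cS).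
Local Notation sE := (sgE cS).
Local Notation sEs := (sgEs cS).
Local Notation lft := (lift hY).
Local Notation feedback := (@feedback R Y U hY T K alpha).
Implicit Types (x y : Y) (s t r : R) (g : R -> U).

Variable vv : R -> H -> H.
Hypothesis hvv : forall s z, 0 <= s <= T -> solves d alpha kappa id s (Ee s z) (vv s z).
Variables (cst : R -> R) (ysol : R -> (R -> U) -> R -> Y).
Hypothesis hys : forall s g, 0 <= s < T -> L2_in_time s T g ->
  [/\ continuous_in_time s T (ysol s g), mild_solution As E Es G T s 0 g (ysol s g) &
    forall t, s <= t <= T -> inorm (ysol s g t) ^+ 2 <= cst s * fine (sq_integral s T g)].

Local Notation opt_control := (@optimal_control R Y U hY T K alpha vv).
Local Notation opt_state := (@optimal_state R Y U hY E T K alpha vv ysol).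

Local Notation Q := (riccati_op Ees id vv).
Local Notation P s x := (Es (T - s) (opt_state T s x)).

Lemma P_bounded_linear s : 0 <= s <= T -> bounded_linear (fun x : Y => P s x).
Proof.
move=> sT; have bQ := blin_bounded_linear (Q_blin hU cS alpha0 hvv (revT sT)).
case: bQ => _ Ql [c Qc]; have P_m x := P_mem hU cS alpha vv hys sT (x := x).
split.
- exact: P_m.
- move=> a x y mx my; have ml := phL hY a mx my.
  rewrite -(liftK hY (P_m _ ml)) -(liftK hY (P_m _ mx)) -(liftK hY (P_m _ my)).
  rewrite -elt_valZ -elt_valD ieqE.
  apply: (eqv_trans SY (P_lift hU cS hvv hys sT ml)).
  apply: (eqv_trans SY (y := a *: Q (T - s) (lft x) + Q (T - s) (lft y))).
    rewrite -ieqE elt_valD elt_valZ; exact: Ql.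
  apply: (eqvD SY); last by apply: (eqv_sym SY); exact: (P_lift hU cS hvv hys sT my).
  by apply: (eqvZ SY); apply: (eqv_sym SY); exact: (P_lift hU cS hvv hys sT mx).
- exists c => x mx; rewrite -(liftK hY (P_m _ mx)) inormE.
  rewrite (eqv_nm SY (P_lift hU cS hvv hys sT mx)) -inormE; exact: Qc.
Qed.

Lemma idot_P s (x y : Y) : 0 <= s <= T -> imem Y x -> imem Y y ->
  idot Y (P s x) y = d (Q (T - s) (lft x)) (lft y) +i* d (Q (T - s) (lft x)) ('i *: lft y).
Proof.
move=> sT mx my; have mP := P_mem hU cS alpha vv hys sT mx.
rewrite -{1}(liftK hY mP) -{1}(liftK hY my) idotE.
by rewrite !(eqv_d SY _ (P_lift hU cS hvv hys sT mx)).
Qed.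

Lemma P_symmetric s (x y : Y) : 0 <= s <= T -> imem Y x -> imem Y y ->
  idot Y (P s x) y = idot Y x (P s y).
Proof.
move=> sT mx my; have mP := P_mem hU cS alpha vv hys sT my.
rewrite (idot_P sT mx my).
have -> : idot Y x (P s y) = idot Y (elt_val (lft x)) (elt_val (lft (P s y))) by rewrite !liftK.
rewrite idotE.
rewrite (eqv_dr SY _ (P_lift hU cS hvv hys sT my)) (Q_sym hU cS hvv _ _ (revT sT)).
rewrite (Q_mulI hU cS alpha0 hvv _ _ (revT sT)).
by rewrite -(eqv_dr SY _ (eqvZ SY 'i (P_lift hU cS hvv hys sT my))).
Qed.

Lemma P_quadratic s (x : Y) : 0 <= s <= T -> imem Y x ->
  idot Y (P s x) x = (d (vv (T - s) (lft x)) (vv (T - s) (lft x)) +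
    alpha^-1 * kappa (T - s) (vv (T - s) (lft x)) (vv (T - s) (lft x)))%:C.
Proof.
move=> sT mx; rewrite (idot_P sT mx mx) (Q_quad_Im hU cS alpha0 hvv _ (revT sT)).
by rewrite (Q_form cS hvv _ (revT sT)).
Qed.

Lemma P_ge0 s (x : Y) : 0 <= s <= T -> imem Y x -> 0 <= idot Y (P s x) x.
Proof.
move=> sT mx; rewrite (P_quadratic sT mx) lecR addr_ge0 ?(sip_ge0 SY)//.
by rewrite mulr_ge0 ?invr_ge0 ?(ltW alpha0)// (sip_ge0 (ff_sip kF (revT sT))).
Qed.

Lemma optimal_cost_P s (x : Y) : 0 <= s < T -> imem Y x ->
  (cost T alpha s (fun t => opt_control t s x) (fun t => opt_state t s x))%:C =
  idot Y (P s x) x.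
Proof.
move=> /[dup] sT /andP[s0 /ltW sT'] mx.
rewrite P_quadratic ?s0//; have := opt_cost hU cS alpha0 hvv hys (lft x) sT.
by rewrite liftK// => ->.
Qed.

Lemma P_continuous (x : Y) : imem Y x -> continuous_in_time 0 T (fun t => P t x).
Proof.
move=> mx t tT; split; first exact: (P_mem hU cS alpha vv hys tT mx).
apply/cvg_within_itvP => e e0.
have [h h0 hh] := riccati_op_pcont SY cpl alpha0 kF sE sEs (blin_id SY) (blin_id SY) hvv
  (lft x) (revT tT) e0.
exists h => // r rT rt; rewrite ger0_norm ?sqrtr_ge0//.
have m1 := P_mem hU cS alpha vv hys rT mx; have m2 := P_mem hU cS alpha vv hys tT mx.
rewrite -(liftK hY m1) -(liftK hY m2) -elt_valB inormE.
rewrite (eqv_nm SY (eqvB SY (P_lift hU cS hvv hys rT mx) (P_lift hU cS hvv hys tT mx))).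
apply: hh; first exact: revT.
by rewrite (_ : T - r - (T - t) = t - r) 1?distrC//; ring.
Qed.

(** By the transition property, [opt_state T t] applied to the state at [t] is the final state. *)
Lemma P_opt_state s t (x : Y) : 0 <= s -> s <= t <= T -> imem Y x ->
  ieq (P t (opt_state t s x)) (Es (T - t) (opt_state T s x)).
Proof.
move=> s0 /andP[st tT] mx.
have t0 : 0 <= t by exact: le_trans st.
have mt : imem Y (opt_state t s x).
  by apply: (opt_state_mem hU cS alpha vv hys s0 _ mx); rewrite st.
have tr := opt_transition hU cS alpha0 hvv hys s0 st tT (lexx T) mx.
have m1 : imem Y (opt_state T s x).
  by apply: (opt_state_mem hU cS alpha vv hys s0 _ mx); rewrite lexx (le_trans st).
have m2 : imem Y (opt_state T t (opt_state t s x)).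
  by apply: (opt_state_mem hU cS alpha vv hys t0 _ mt); rewrite lexx tT.
have tT0 : 0 <= T - t by rewrite subr_ge0.
rewrite -(liftK hY m1) -(liftK hY m2) -!(EsK cS)// ieqE.
apply: (blin_eqv SY (sgb sEs tT0)); apply: (eqv_sym SY).
by rewrite -ieqE !liftK.
Qed.

Lemma feedback_representation s (x : Y) : 0 <= s < T -> imem Y x ->
  {ae leb, forall t, s < t < T ->
     ieq (opt_control t s x) (- (alpha^-1)%:C *: K (opt_state T s x) (T - t))}.
Proof.
move=> /andP[s0 /ltW sT] mx.
have mT : imem Y (opt_state T s x).
  by apply: (opt_state_mem hU cS alpha vv hys s0 _ mx); rewrite sT lexx.
have := opt_state_final hU cS hvv hys (lft x) s0 sT; rewrite liftK// => h.
have := ae_refl T (K_eqv_ae hU cS (eqv_sym SY h)).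
apply: filterS => t /= ht /andP[st tT].
have tT' : 0 < T - t < T by rewrite subr_gt0 tT /= ltrBlDr ltrDl (le_lt_trans s0).
move: (ht tT'); rewrite liftK// /optimal_control /feedback.
have m1 := K_mem cS (vv (T - s) (lft x)) tT'.
have m2 := K_mem cS (lft (opt_state T s x)) tT'; rewrite liftK// in m2.
rewrite -(liftK hU m1) -(liftK hU m2) -!elt_valZ !ieqE.
exact: (eqvZ SU).
Qed.

End OptimalCostAndFeedback.

(** * Regularisation by averages *)

Section AverageFamilies.
Variables (R : realType) (V : lmodType R[i]) (d : V -> V -> R) (H : sip d).
Hypothesis cpl : complete_sip d.
Variables (F : R -> V -> V) (sF : semigroup d F).
Local Notation N := (nm d).

Lemma is_avg_uniq ep x g g' : is_avg d F ep x g -> is_avg d F ep x g' -> eqv d g g'.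
Proof. by move=> h h'; apply: (eqvP H) => y; rewrite h h'. Qed.

Lemma eqv_zero z : eqv d z (z + z) -> eqv d z 0.
Proof.
move=> h; apply: (eqvP H) => y.
by have := eqv_d H y h; rewrite (dDl H) (d0l H); lra.
Qed.

Lemma lin_blin (g : V -> V) :
  (forall (a : R[i]) x y, eqv d (g (a *: x + y)) (a *: g x + g y)) ->
  (exists c, forall x, N (g x) <= c * N x) -> blin d g.
Proof.
move=> gl gb; have gD x y : eqv d (g (x + y)) (g x + g y) by have := gl 1 x y; rewrite !scale1r.
have g0 : eqv d (g 0) 0 by apply: eqv_zero; have := gD 0 0; rewrite addr0.
split => // a x; have := gl a x 0; rewrite !addr0 => h; apply: (eqv_trans H h).
by have := eqvD H (eqv_refl H (a *: g x)) g0; rewrite addr0.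
Qed.

Lemma averages_ex : exists g : nat -> V -> V, forall n x, is_avg d F n.+1%:R^-1 x (g n x).
Proof.
have h n x : exists y, is_avg d F n.+1%:R^-1 x y by apply: (avg_ex H cpl sF); rewrite invr_gt0.
by exists (fun n x => sval (cid (h n x))) => n x; case: cid.
Qed.

Variable g : nat -> V -> V.
Hypothesis hg : forall n x, is_avg d F n.+1%:R^-1 x (g n x).
Let ep0 n : 0 < n.+1%:R^-1 :> R. Proof. by rewrite invr_gt0. Qed.

Lemma averages_bounded : exists2 b, 0 <= b & forall n x, N (g n x) <= b * N x.
Proof.
have [M M1 hM] := sg_bounded H cpl sF 1; have M0 : 0 <= M by lra.
exists M => // n x; apply: (avg_bd H cpl sF (ep0 n) _ _ (hg n x)).
  by rewrite mulr_ge0 ?nm_ge0.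
move=> t /andP[t0 tn]; apply: hM; rewrite t0 (le_trans tn)// invf_le1 ?ltr0n//.
by rewrite ler1n.
Qed.

Lemma averages_blin n : blin d (g n).
Proof.
have [b b0 hb] := averages_bounded; apply: lin_blin; last by exists b.
move=> a x y; apply: (is_avg_uniq (hg n _)).
exact: (avg_lin H cpl sF a (ep0 n) (hg n x) (hg n y)).
Qed.

Lemma averages_cvg x (e : R) : 0 < e -> \forall n \near \oo, N (g n x - x) < e.
Proof.
move=> e0; have e2 : 0 < e / 2 by rewrite divr_gt0.
have [k k0 hk] := avg_cvg H cpl sF x e2.
near=> n; apply: (@le_lt_trans _ _ (e / 2)); last by rewrite ltr_pdivrMr// ltr_pMr// ltr1n.
apply: hk (hg n x); rewrite ep0 /=.
by near: n; exact: (near_infty_natSinv_lt (PosNum k0)).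
Unshelve. all: by end_near. Qed.

(** By [averages_gen] this bounded operator is the generator composed with the averages. *)
Definition avg_rate n x := (n.+1%:R)%:C *: (F n.+1%:R^-1 x - x).

Lemma averages_gen n x : gen d F (g n x) (avg_rate n x).
Proof. by have := avg_gen H cpl sF (ep0 n) (hg n x); rewrite invrK. Qed.

Lemma avg_rate_blin n : blin d (avg_rate n).
Proof.
have bF := sgb sF (ltW (ep0 n)); have [c c0 hc] := blB0 bF.
apply: lin_blin => [a x y|].
  rewrite /avg_rate; set r := _%:C; set S := F _ in bF hc *.
  have -> : a *: (r *: (S x - x)) + r *: (S y - y) = r *: (a *: S x + S y - (a *: x + y)).
    by rewrite scalerA mulrC -scalerA -scalerDr scalerBr opprD addrACA.
  apply: (eqvZ H); apply: (eqvB H) (eqv_refl H _).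
  apply: (eqv_trans H (blD bF _ _)); apply: (eqvD H) (eqv_refl H _); exact: blZ.
exists (n.+1%:R * (c + 1)) => x; rewrite (nmR H) ger0_norm// -mulrA ler_wpM2l//.
by apply: (le_trans (nmB H _ _)); rewrite mulrDl mul1r lerD2r.
Qed.

Lemma averages_commute n t x : 0 <= t -> eqv d (F t (g n x)) (g n (F t x)).
Proof. by move=> t0; apply: (is_avg_uniq _ (hg n _)); exact: (avg_E H cpl sF). Qed.

End AverageFamilies.

Lemma gen_scale (R : realType) (V : lmodType R[i]) (d : V -> V -> R) (H : sip d) F
  (sF : semigroup d F) (a : R[i]) x w : gen d F x w -> gen d F (a *: x) (a *: w).
Proof.
move=> gx; have := gen_lin H sF (-1) gx gx; rewrite !scaleN1r !addNr => g0.
by have := gen_lin H sF a gx g0; rewrite !addr0.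
Qed.

(** * Bounded gains and the regularised Riccati equation *)

Section RegularisedGain.
Variables (R : realType) (Y U : ispace R) (hY : prehilbert Y) (hU : prehilbert U).
Variables (A : Y -> Y -> Prop) (E Es : R -> Y -> Y) (G : U -> Y) (T : R).
Variables (Bs : Y -> U) (K : Y -> R -> U).
Hypothesis cS : control_system hY A E Es G T Bs K.
Variables (alpha : R) (alpha0 : 0 < alpha).
Local Notation As := (adjoint A).
Local Notation H := (elt_of_prehilbert hY).
Local Notation d := (@hd _ _ hY).
Local Notation du := (@hd _ _ hU).
Local Notation SY := (hd_sip hY).
Local Notation SU := (hd_sip hU).
Local Notation cpl := (cs_complete cS).
Local Notation Ee := (@Ee R Y hY E).
Local Notation Ees := (@Ees R Y hY Es).
Local Notation kappa := (@kappa R Y U hY K).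
Local Notation kF := (kappa_ff hU cS).
Local Notation sE := (sgE cS).
Local Notation sEs := (sgEs cS).
Local Notation lft := (lift hY).
Implicit Types (x y z w : H) (s t r : R).

Variables (Gr Gs W : H -> H) (bGr : blin d Gr) (bGs : blin d Gs) (bW : blin d W).
Hypothesis gGs : forall x, gen d Ees (Gs x) (W x).
Hypothesis Gs_comm : forall t x, 0 <= t -> eqv d (Ees t (Gs x)) (Gs (Ees t x)).
Hypothesis dualG : forall x y, d (Gr x) y = d x (Gs y).

Definition gain x : elt_of_prehilbert hU := lift hU (Bs (elt_val (Gs x))).

Lemma gainK x : elt_val (gain x) = Bs (elt_val (Gs x)).
Proof. by rewrite liftK//; exact: (Bs_mem cS (gGs x)). Qed.

Lemma gain_lin (a : R[i]) x y : eqv du (gain (a *: x + y)) (a *: gain x + gain y).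
Proof.
rewrite -ieqE elt_valD elt_valZ !gainK.
have lin f : blin d f -> eqv d (f (a *: x + y)) (a *: f x + f y).
  move=> bf; apply: (eqv_trans SY (blD bf _ _)).
  by apply: (eqvD SY) (eqv_refl SY _); exact: blZ.
apply: (Bs_lin hU cS (gGs x) (gGs y) _ (lin _ bGs)).
exact: (gen_eqv SY sEs (eqv_refl SY _) (lin _ bW) (gGs _)).
Qed.

(** For a fixed control [g] the pairing with [gain x] is [d (Gs x - W x) (G g)], bounded in [x] with
    a constant that depends on the norm of [G g]. For fixed [x] these pairings are bounded over the
    unit ball of U, so the uniform boundedness principle in Y provides a common constant. *)
Lemma gain_bounded : exists2 c, 0 <= c & forall x, nm du (gain x) <= c * nm d x.
Proof.
have gainE x (g : elt_of_prehilbert hU) :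
    du (gain x) g = d (Gs x - W x) (lft (G (elt_val g))).
  by rewrite -(Bs_dot cS (gGs x) (elt_mem g)) /du gainK.
have gD x y : eqv du (gain (x + y)) (gain x + gain y).
  by have := gain_lin 1 x y; rewrite !scale1r.
have g0 : eqv du (gain 0) 0 by apply: (eqv_zero SU); have := gD 0 0; rewrite addr0.
have gZ (a : R[i]) x : eqv du (gain (a *: x)) (a *: gain x).
  have := gain_lin a x 0; rewrite !addr0 => h; apply: (eqv_trans SU h).
  by have := eqvD SU (eqv_refl SU (a *: gain x)) g0; rewrite addr0.
pose I := {g : elt_of_prehilbert hU | nm du g <= 1}.
have [] := @uniform_boundedness R _ d SY I (fun g x => `|du (gain x) (sval g)|) cpl.
- by move=> g x y; rewrite (eqv_d SU _ (gD _ _)) (dDl SU) ler_normD.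
- by move=> g r x; rewrite (eqv_d SU _ (gZ _ _)) (dRl SU) normrM.
- move=> g; have [c c0 hc] := blB0 bGs; have [c' c0' hc'] := blB0 bW.
  exists ((c + c') * nm d (lft (G (elt_val (sval g))))) => x.
  rewrite gainE mulrAC; apply: (le_trans (cs_abs SY _ _)).
  rewrite ler_wpM2r ?nm_ge0//; apply: (le_trans (nmB SY _ _)).
  by rewrite mulrDl lerD.
- move=> x; exists (nm du (gain x)) => -[g /= g1].
  by apply: (le_trans (cs_abs SU _ _)); rewrite ler_piMr ?nm_ge0.
move=> c hc; exists `|c| => // x; set u := gain x.
have q0 : 0 <= `|c| * nm d x by rewrite mulr_ge0 ?nm_ge0.
have [u0|] := ltP 0 (nm du u); last by move=> h; exact: le_trans h q0.
have g1 : nm du ((nm du u)^-1%:C *: u) <= 1.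
  by rewrite (nmR SU) ger0_norm ?invr_ge0 ?nm_ge0// mulVf ?gt_eqF.
have := hc (exist (fun g => nm du g <= 1) _ g1) x; rewrite /= -/u (dRr SU) -(nm2 SU) expr2 mulrA.
rewrite mulVf ?gt_eqF// mul1r ger0_norm ?nm_ge0// => h; apply: (le_trans h).
by rewrite ler_wpM2r ?nm_ge0// ler_norm.
Qed.

Definition gain_form x y : R := du (gain x) (gain y).

Lemma gain_form_sip : sip gain_form.
Proof. exact: (pull_sip SU gain_lin). Qed.

Lemma gain_form_bounded : exists2 c, 0 <= c &
  forall x y, `|gain_form x y| <= c * nm d x * nm d y.
Proof.
have [c c0 hc] := gain_bounded; exists (c * c); first exact: mulr_ge0.
move=> x y; apply: (le_trans (cs_abs SU _ _)).
apply: (le_trans (ler_pM (nm_ge0 _ _) (nm_ge0 _ _) (hc x) (hc y))).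
by rewrite mulrACA [leLHS]mulrA.
Qed.

(** Commutation of averages and semigroup turns the observation of an averaged orbit into the
    bounded [gain] along the orbit. *)
Lemma Bs_Es_Gs t x : 0 <= t -> ieq (Bs (elt_val (Ees t (Gs x)))) (elt_val (gain (Ees t x))).
Proof.
move=> t0; rewrite gainK.
apply: (Bs_Es_eqv hU cS (gen_E SY sEs t0 (gGs x)) (gGs _)); exact: Gs_comm.
Qed.

(** The hypothesis [kC] of [riccati_derivative]: on averaged elements the observation may be
    replaced by [gain] along the orbit. *)
Lemma kappa_gain s t x y : 0 <= s -> s <= t -> t <= T ->
  kappa t (Gs x) (Gs y) - kappa s (Gs x) (Gs y) =
  TI s t (fun r => gain_form (Ees r x) (Ees r y)).
Proof.
move=> s0 st tT.
rewrite [X in X - _](TI_cat s0 st (kappa_taint hU cS _ _ (lexx 0) tT)) addrC addKr.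
apply: TI_ae; apply: filterS2 (K_Bs cS (gGs x)) (K_Bs cS (gGs y)) => r hx hy /andP[sr rt].
have r0 : 0 < r by exact: le_lt_trans sr.
have rT : 0 < r < T by rewrite r0 (lt_le_trans rt).
have mx := K_mem cS (Gs x) rT; have my := K_mem cS (Gs y) rT.
have Kg z : ieq (K (elt_val (Gs z)) r) (Bs (Es r (elt_val (Gs z)))) ->
   imem U (K (elt_val (Gs z)) r) -> ieq (K (elt_val (Gs z)) r) (elt_val (gain (Ees r z))).
  move=> h m; have mB : imem U (Bs (elt_val (Ees r (Gs z)))).
    exact: (Bs_mem cS (gen_E SY sEs (ltW r0) (gGs z))).
  have hB := Bs_Es_Gs z (ltW r0); rewrite -(EsK cS _ (ltW r0)) in h.
  rewrite -(liftK hU m) -(liftK hU mB) ieqE in h.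
  rewrite -(liftK hU mB) ieqE in hB.
  by rewrite -(liftK hU m) ieqE; exact: (eqv_trans SU h hB).
have kx := Kg x (hx rT) mx; have ky := Kg y (hy rT) my.
rewrite (ieq_rdot hU mx (elt_mem (gain (Ees r x))) my kx).
rewrite (phC hU (elt_mem _) my) (ieq_rdot hU my (elt_mem (gain (Ees r y))) (elt_mem _) ky).
by rewrite (phC hU (elt_mem _) (elt_mem _)).
Qed.

Variable vn : R -> H -> H.
Hypothesis hvn : forall s z, 0 <= s <= T -> solves d alpha kappa Gs s (Gr (Ee s z)) (vn s z).
Local Notation Q := (riccati_op Ees Gs vn).
Local Notation Pn t x := (elt_val (Q (T - t) (lft x))).

Let bQ s : 0 <= s <= T -> blin d (Q s).
Proof. exact: (riccati_op_blin SY alpha0 kF sE sEs bGr bGs hvn). Qed.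
Let bvn s : 0 <= s <= T -> blin d (vn s).
Proof. exact: (solution_blin SY alpha0 kF sE bGr bGs hvn). Qed.

Lemma Pn_bounded_linear t : 0 <= t <= T -> bounded_linear (fun x : Y => Pn t x).
Proof. by move=> tT; apply: blin_bounded_linear; apply: bQ; exact: revT. Qed.

Lemma Pn_continuous (x : Y) : continuous_in_time 0 T (fun t => Pn t x).
Proof.
move=> t tT; split; first exact: elt_mem.
apply/cvg_within_itvP => e e0.
have [h h0 hh] := riccati_op_pcont SY cpl alpha0 kF sE sEs bGr bGs hvn (lft x) (revT tT) e0.
exists h => // r rT rt; rewrite ger0_norm ?sqrtr_ge0// -elt_valB inormE.
by apply: hh; [exact: revT|rewrite (_ : T - r - (T - t) = t - r) 1?distrC//; ring].
Qed.

Lemma gen_Pn t x : 0 <= t <= T ->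
  gen d Ees (Q (T - t) x) (Ees (T - t) (W (vn (T - t) x))).
Proof. by move=> /revT/andP[t0 _]; exact: (gen_E SY sEs t0 (gGs _)). Qed.

(** [Pn t] ends with the semigroup applied to an averaged element. By [Bs_Es_Gs] its gain is, up to
    norm zero, [gain] composed with bounded operators. *)
Lemma Pn_bounded_gain : bounded_gain As T Bs (fun t (x : Y) => Pn t x).
Proof.
move=> t tT; have /andP[t0 _] := revT tT; split.
  by move=> x mx; exists (elt_val (Ees (T - t) (W (vn (T - t) (lft x))))); apply/(genEs cS); exact: gen_Pn.
have mB x := Bs_mem cS (gen_Pn x tT); split.
- by move=> x _; exact: mB.
- move=> a x y mx my; have lin f : blin d f -> eqv d (f (lft (a *: x + y))) (a *: f (lft x) + f (lft y)).
    move=> bf; have -> : lft (a *: x + y) = a *: lft x + lft y.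
      by apply: val_inj; rewrite /= liftK ?elt_valD ?elt_valZ ?liftK//; exact: phL.
    apply: (eqv_trans SY (blD bf _ _)).
    by apply: (eqvD SY) (eqv_refl SY _); exact: blZ.
  apply: (Bs_lin hU cS (gen_Pn _ tT) (gen_Pn _ tT) _ (lin _ (bQ (revT tT)))).
  apply: (gen_eqv SY sEs (eqv_refl SY _) _ (gen_Pn _ tT)).
  apply: (lin (fun x => Ees (T - t) (W (vn (T - t) x)))).
  apply: (blin_comp SY (f := Ees (T - t)) (g := W \o vn (T - t))); first exact: (sgb sEs t0).
  by apply: (blin_comp SY) => //; apply: bvn; exact: revT.
- have [c c0 hc] := gain_bounded; have [c1 c10 hc1] := blB0 (bvn (revT tT)).
  have [c2 c20 hc2] := blB0 (sgb sEs t0).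
  exists (c * (c2 * c1)) => x mx.
  have := Bs_Es_Gs (vn (T - t) (lft x)) t0; rewrite -{1}(liftK hU (mB (lft x))) ieqE => h.
  rewrite -{1}(liftK hU (mB (lft x))) inormE (eqv_nm SU h).
  apply: (le_trans (hc _)); rewrite -!mulrA ler_wpM2l//.
  apply: (le_trans (hc2 _)); rewrite ler_wpM2l//.
  by apply: (le_trans (hc1 _)); rewrite -inormE liftK.
Qed.

(** The derivative in the time to go, hence the opposite sign in [Pn_derivative]. *)
Let D s x w y w' : R := d (Q s x) w' + d w (Q s y) -
  alpha^-1 * gain_form (Ees s (vn s x)) (Ees s (vn s y)).

Lemma Pn_derivative x w y w' t : gen d Ee x w -> gen d Ee y w' -> 0 <= t < T ->
  has_derivative_within T (fun r => d (Q (T - r) x) y +i* d (Q (T - r) x) ('i *: y)) t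
    (- (D (T - t) x w y w' +i* D (T - t) x w ('i *: y) ('i *: w'))).
Proof.
move=> gx gy /andP[t0 tT]; have tTT : 0 <= t <= T by rewrite t0 ltW.
have der y1 w1 : gen d Ee y1 w1 -> forall e : R, 0 < e -> exists2 h, 0 < h & forall r, 0 <= r <= T ->
    r != t -> `|r - t| < h ->
    `|(r - t)^-1 * (d (Q (T - r) x) y1 - d (Q (T - t) x) y1) + D (T - t) x w y1 w1| <= e.
  move=> g1 e e0.
  have [h h0 hh] := riccati_derivative SY cpl alpha0 (cs_T cS) kF sE sEs (dualE cS) bGr bGs
    dualG hvn gain_form_sip gain_form_bounded kappa_gain gx g1 (revT tTT) e0.
  exists h => // r rT rt rth; have := hh (T - r) (revT rT).
  rewrite (_ : T - r - (T - t) = - (r - t)); last by ring.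
  rewrite normrN => /(_ rth) k.
  have n0 : 0 < `|r - t| by rewrite normr_gt0 subr_eq0.
  rewrite -(ler_pM2l n0) -normrM mulrDr mulVKf ?subr_eq0// [leRHS]mulrC.
  by move: k; rewrite mulNr opprK.
apply/cvg_within_itv_dnbhsP => e e0; have e4 : 0 < e / 4 by rewrite divr_gt0.
(* The pairings with [y] and with ['i *: y] yield the real and the imaginary part of the complex
   difference quotient. *)
have [h1 h10 hh1] := der _ _ gy _ e4.
have [h2 h20 hh2] := der _ _ (gen_scale SY sE 'i gy) _ e4.
exists (Num.min h1 h2); first by rewrite lt_min h10.
move=> r rT rt; rewrite lt_min => /andP[r1 r2].
have {hh1}k1 := hh1 r rT rt r1; have {hh2}k2 := hh2 r rT rt r2.
move: k1 k2; set a := (X in `|X| <= _ -> _); set b := (X in _ -> `|X| <= _ -> _) => k1 k2.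
rewrite (_ : _ * _ - - _ = a +i* b); last first.
  apply/eqP; rewrite eq_complex /= /a /b !opprK mul0r subr0 mul0r addr0.
  by rewrite !eqxx.
rewrite ger0_norm ?sqrtr_ge0//= /Normc.normc.
apply: (@le_lt_trans _ _ (`|a| + `|b|)); last by lra.
have na := normr_ge0 a; have nb := normr_ge0 b.
rewrite -ler_sqr ?nnegrE ?sqrtr_ge0 ?addr_ge0// sqr_sqrtr ?addr_ge0 ?sqr_ge0//.
rewrite -(real_normK (num_real a)) -(real_normK (num_real b)).
move: (`|a|) (`|b|) na nb => u v; nra.
Qed.

Lemma Pn_riccati : riccati_problem A T alpha Bs (fun x : Y => Pn T x) (fun t (x : Y) => Pn t x).
Proof.
split=> [x Ax y Ay|x mx]; last by rewrite ieqE; exact: (eqv_refl SY).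
move=> AxAx AyAy t tT; have tTT : 0 <= t <= T by case/andP: tT => -> /ltW.
have [mx mAx] := generates_mem (cs_gE cS) AxAx; have [my mAy] := generates_mem (cs_gE cS) AyAy.
rewrite -(liftK hY mx) -(liftK hY mAx) in AxAx *.
rewrite -(liftK hY my) -(liftK hY mAy) in AyAy *.
move: (lft x) (lft Ax) (lft y) (lft Ay) AxAx AyAy => x' w y' w' {mx mAx my mAy x Ax y Ay}.
move=> /(genE cS) gx /(genE cS) gy.
exists (- (D (T - t) x' w y' w' +i* D (T - t) x' w ('i *: y') ('i *: w'))).
  have := Pn_derivative gx gy tT; congr (has_derivative_within _ _ _ _).
  by apply/funext => r; rewrite idotE lift_val.
have /andP[s0 _] := revT tTT; rewrite !lift_val.
set s := T - t in s0 *.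
have mB z : imem U (Bs (elt_val (Q s z))) by exact: (Bs_mem cS (gen_Pn z tTT)).
have Bg z : eqv du (lift hU (Bs (elt_val (Q s z)))) (gain (Ees s (vn s z))).
  by rewrite -ieqE liftK//; exact: Bs_Es_Gs.
rewrite -{1}(liftK hU (mB x')) -(liftK hU (mB y')) !idotE.
rewrite !(eqv_d SU _ (Bg _)) !(eqv_dr SU _ (Bg _)) !(eqv_dr SU _ (eqvZ SU 'i (Bg _))).
have bs := revT tTT.
have e1 : d w ('i *: Q s y') = d w (Q s ('i *: y')).
  by apply: (eqv_dr SY); apply: (eqv_sym SY); exact: (blZ (bQ bs)).
have e2 : du (gain (Ees s (vn s x'))) ('i *: gain (Ees s (vn s y'))) =
    gain_form (Ees s (vn s x')) (Ees s (vn s ('i *: y'))).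
  rewrite /gain_form; apply: (eqv_dr SU).
  have b1 : blin d (Ees s \o vn s) by apply: (blin_comp SY); [exact: (sgb sEs s0)|exact: (bvn (revT tTT))].
  have [c c0 hc] := gain_bounded.
  have bg : eqv du (gain (Ees s (vn s ('i *: y')))) (gain ('i *: Ees s (vn s y'))).
    rewrite -[eqv _ _ _]/(_ = 0); apply/eqP; rewrite eq_le nm_ge0 andbT.
    have := gain_lin (-1) ('i *: Ees s (vn s y')) (Ees s (vn s ('i *: y'))).
    rewrite !scaleN1r ![- _ + _]addrC => /(eqv_nm SU) <-.
    by apply: (le_trans (hc _)); rewrite (blZ b1 'i y') mulr0.
  apply: (eqv_sym SU); apply: (eqv_trans SU bg).
  have := gain_lin 'i (Ees s (vn s y')) 0; rewrite !addr0 => h; apply: (eqv_trans SU h).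
  have g0 : eqv du (gain 0) 0.
    by apply: (eqv_zero SU); have := gain_lin 1 0 0; rewrite !scale1r addr0.
  by have := eqvD SU (eqv_refl SU ('i *: gain (Ees s (vn s y')))) g0; rewrite addr0.
rewrite e1 e2 /D /gain_form; apply/eqP; rewrite eq_complex /=; apply/andP; split; apply/eqP; ring.
Qed.

End RegularisedGain.

(** * Riccati synthesis for abstract control systems *)

Section AbstractTheorem.
Variables (R : realType) (Y U : ispace R) (hY : prehilbert Y) (hU : prehilbert U).
Variables (A : Y -> Y -> Prop) (E Es : R -> Y -> Y) (G : U -> Y) (T : R).
Variables (Bs : Y -> U) (K : Y -> R -> U).
Hypothesis cS : control_system hY A E Es G T Bs K.
Variables (alpha : R) (alpha0 : 0 < alpha).
Local Notation As := (adjoint A).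
Local Notation SY := (hd_sip hY).
Local Notation cpl := (cs_complete cS).

Theorem riccati_synthesis :
  exists (Phi : R -> R -> Y -> Y) (ghat : R -> R -> Y -> U),
  let P (s : R) (x : Y) : Y := Es (T - s) (Phi T s x) in
  (forall s y0, 0 <= s < T -> imem Y y0 ->
     optimal_pair As E Es G T alpha s y0
       (fun t => ghat t s y0) (fun t => Phi t s y0) /\
     forall g y, optimal_pair As E Es G T alpha s y0 g y ->
       {ae @time_measure R, forall t, s < t < T -> ieq (g t) (ghat t s y0)} /\
       forall t, s <= t <= T -> ieq (y t) (Phi t s y0)) /\
  [/\ forall s t, 0 <= s -> s <= t <= T -> bounded_linear (Phi t s),
      forall t x, 0 <= t <= T -> imem Y x -> ieq (Phi t t x) x
    & forall s tau t x, 0 <= s -> s <= tau -> tau <= t -> t <= T -> imem Y x ->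
        ieq (Phi t s x) (Phi t tau (Phi tau s x))] /\
  [/\ forall t, 0 <= t <= T -> bounded_linear (P t),
      forall s y0, 0 <= s < T -> imem Y y0 ->
        (cost T alpha s (fun t => ghat t s y0) (fun t => Phi t s y0))%:C =
        idot Y (P s y0) y0,
      forall t x y, 0 <= t <= T -> imem Y x -> imem Y y ->
        idot Y (P t x) y = idot Y x (P t y),
      forall t x, 0 <= t <= T -> imem Y x -> 0 <= idot Y (P t x) x
    & forall z, imem Y z -> continuous_in_time 0 T (fun t => P t z)] /\
  (forall s y0, 0 <= s < T -> imem Y y0 ->
     (forall t, s <= t <= T ->
        ieq (P t (Phi t s y0)) (Es (T - t) (Phi T s y0))) /\
     {ae @time_measure R, forall t, s < t < T ->
        ieq (ghat t s y0) (- (alpha^-1)%:C *: K (Phi T s y0) (T - t))}) /\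
  (forall x, imem Y x -> ieq (P T x) x) /\
  exists (Pn : nat -> R -> Y -> Y) (PTn : nat -> Y -> Y),
    [/\ forall n t, 0 <= t <= T -> bounded_linear (Pn n t),
        forall n, riccati_problem A T alpha Bs (PTn n) (Pn n) /\
                  bounded_gain As T Bs (Pn n),
        forall z, imem Y z -> inorm (PTn n z - z) @[n --> \oo] --> (0 : R)
      & forall z, imem Y z ->
          (forall n, continuous_in_time 0 T (fun t => Pn n t z)) /\
          forall e : R, 0 < e -> \forall n \near \oo,
            forall t, 0 <= t <= T -> inorm (Pn n t z - P t z) < e].
Proof.
have T0 := cs_T cS.
have sE := sgE cS; have sEs := sgEs cS; have kF := kappa_ff hU cS.
have bI := blin_id SY.
(* The choice requires a total function; outside [[0, T]] the value is an arbitrary 0. *)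
have /choice[vv hvv] (p : R * elt_of_prehilbert hY) : exists v, 0 <= p.1 <= T ->
    solves (@hd _ _ hY) alpha (@kappa R Y U hY K) id p.1 (Ee E p.1 p.2) v.
  case: (boolP (0 <= p.1 <= T)) => pT; last by exists 0.
  by have [v hv] := solves_ex SY cpl alpha0 kF bI (Ee E p.1 p.2) pT; exists v.
pose v s z := vv (s, z).
have hv s z : 0 <= s <= T -> solves (@hd _ _ hY) alpha (@kappa R Y U hY K) id s (Ee E s z) (v s z).
  exact: hvv (s, z).
have /choice[cst hcst] (s : R) : exists c : R, 0 <= s < T -> forall g : R -> U, L2_in_time s T g ->
      exists y, [/\ continuous_in_time s T y, mild_solution As E Es G T s 0 g y &
        forall t, s <= t <= T -> inorm (y t) ^+ 2 <= c * fine (sq_integral s T g)].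
  case: (boolP (0 <= s < T)) => sT; last by exists 0.
  by have [c hc] := cs_L cS sT; exists c.
have /choice[yy hyy] (p : R * (R -> U)) : exists y, 0 <= p.1 < T -> L2_in_time p.1 T p.2 ->
    [/\ continuous_in_time p.1 T y, mild_solution As E Es G T p.1 0 p.2 y &
        forall t, p.1 <= t <= T -> inorm (y t) ^+ 2 <= cst p.1 * fine (sq_integral p.1 T p.2)].
  case: (pselect (0 <= p.1 < T /\ L2_in_time p.1 T p.2)) => [[sT lg]|h].
    by have [y hy] := hcst p.1 sT p.2 lg; exists y.
  by exists (fun=> 0) => sT lg; case: h.
pose ysol s g := yy (s, g).
have hys s g : 0 <= s < T -> L2_in_time s T g ->
  [/\ continuous_in_time s T (ysol s g), mild_solution As E Es G T s 0 g (ysol s g) &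
    forall t, s <= t <= T -> inorm (ysol s g t) ^+ 2 <= cst s * fine (sq_integral s T g)].
  exact: hyy (s, g).
exists (fun t s => optimal_state E T K alpha v ysol t s), (fun t s => optimal_control T K alpha v t s).
move=> P.
split; first by move=> s y0 sT my; split;
  [exact: (optimal_exists hU cS alpha0 hv hys)|move=> g y; exact: (optimal_unique hU cS alpha0 hv hys sT my)].
split; first split.
- by move=> s t s0 stT; exact: (opt_state_bounded_linear hU cS alpha0 hv hys s0 stT).
- by move=> t x tT mx; exact: (opt_state_id hU cS alpha v hys tT mx).
- by move=> s t0 t x s0 st0 t0t tT mx; exact: (opt_transition hU cS alpha0 hv hys).
split; first split.
- by move=> t tT; exact: (P_bounded_linear hU cS alpha0 hv hys tT).
- by move=> s y0 sT my; exact: (optimal_cost_P hU cS alpha0 hv hys sT my).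
- by move=> t x y tT mx my; exact: (P_symmetric hU cS alpha0 hv hys tT mx my).
- by move=> t x tT mx; exact: (P_ge0 hU cS alpha0 hv hys tT mx).
- by move=> z mz; exact: (P_continuous hU cS alpha0 hv hys mz).
split.
  move=> s y0 sT my; split; last exact: (feedback_representation hU cS hv hys sT my).
  by move=> t stT; apply: (P_opt_state hU cS alpha0 hv hys) => //; case/andP: sT.
have TT : 0 <= T <= T by rewrite lexx ltW.
have PT x : imem Y x -> ieq (P T x) x.
  move=> mx; have h := opt_state_id hU cS alpha v hys TT mx.
  have mo : imem Y (optimal_state E T K alpha v ysol T T x).
    by apply: (opt_state_mem hU cS alpha v hys _ _ mx); rewrite ?lexx ?ltW.
  rewrite /P subrr -(liftK hY mo) -(EsK cS _ (lexx 0)) -{2}(liftK hY mx) ieqE.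
  apply: (eqv_trans SY (sg0 sEs _)).
  by rewrite -(liftK hY mo) -{2}(liftK hY mx) ieqE in h.
split=> //.
have [Gn hGn] := averages_ex SY cpl sE; have [Gsn hGsn] := averages_ex SY cpl sEs.
have bG := averages_blin SY cpl sE hGn; have bGs := averages_blin SY cpl sEs hGsn.
have [b1 b10 hb1] := averages_bounded SY cpl sE hGn.
have [b2 b20 hb2] := averages_bounded SY cpl sEs hGsn.
have dG n x y : hd (Gn n x) y = hd x (Gsn n y).
  by apply: (avg_dual SY cpl sE sEs (gen_adj cS) (hGn n x) (hGsn n y)); rewrite invr_gt0.
have gGs n := averages_gen SY cpl sEs hGsn n.
have bW n := avg_rate_blin SY sEs n.
have cm n := averages_commute SY cpl sEs hGsn n.
have /choice[vn' hvn'] (p : nat * R * elt_of_prehilbert hY) : exists w, 0 <= p.1.2 <= T ->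
    solves (@hd _ _ hY) alpha (@kappa R Y U hY K) (Gsn p.1.1) p.1.2 (Gn p.1.1 (Ee E p.1.2 p.2)) w.
  case: (boolP (0 <= p.1.2 <= T)) => pT; last by exists 0.
  have [w hw] := solves_ex SY cpl alpha0 kF (bGs p.1.1) (Gn p.1.1 (Ee E p.1.2 p.2)) pT.
  by exists w.
pose vn n s z := vn' (n, s, z).
have hvn n s z : 0 <= s <= T ->
    solves (@hd _ _ hY) alpha (@kappa R Y U hY K) (Gsn n) s (Gn n (Ee E s z)) (vn n s z).
  exact: hvn' (n, s, z).
pose Pn n t (x : Y) : Y := elt_val (riccati_op (Ees Es) (Gsn n) (vn n) (T - t) (lift hY x)).
have cvg z : imem Y z -> forall e : R, 0 < e -> \forall n \near \oo,
    forall t, 0 <= t <= T -> inorm (Pn n t z - P t z) < e.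
  move=> mz e e0; have b0 : 0 <= Num.max b1 b2 by rewrite le_max b10.
  have h1 n x : nm (@hd _ _ hY) (Gn n x) <= Num.max b1 b2 * nm (@hd _ _ hY) x.
    by apply: (le_trans (hb1 n x)); rewrite ler_wpM2r ?nm_ge0// le_max lexx.
  have h2 n x : nm (@hd _ _ hY) (Gsn n x) <= Num.max b1 b2 * nm (@hd _ _ hY) x.
    by apply: (le_trans (hb2 n x)); rewrite ler_wpM2r ?nm_ge0// le_max lexx orbT.
  have := riccati_op_cvg SY cpl alpha0 kF sE sEs bG bGs dG b0 h1 h2
    (averages_cvg SY cpl sE hGn) (averages_cvg SY cpl sEs hGsn) hv hvn (lift hY z) e0.
  apply: filterS => n hn t tT.
  have mP := P_mem hU cS alpha v hys tT mz; rewrite -/(P t z) in mP.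
  rewrite -(liftK hY mP) -elt_valB inormE.
  rewrite (eqv_nm SY (eqvB SY (eqv_refl SY _) (P_lift hU cS hv hys tT mz))).
  exact: (hn _ (revT tT)).
(* The terminal operators are read off from [Pn]; they tend to the identity because [Pn n T] tends
   to [P T]. *)
exists Pn, (fun n x => Pn n T x); split.
- by move=> n t tT; exact: (Pn_bounded_linear hU cS alpha0 (bG n) (bGs n) (hvn n) tT).
- move=> n; split.
    exact: (Pn_riccati hU cS alpha0 (bG n) (bGs n) (bW n) (gGs n) (cm n) (dG n) (hvn n)).
  exact: (Pn_bounded_gain hU cS alpha0 (bG n) (bGs n) (bW n) (gGs n) (cm n) (hvn n)).
- move=> z mz; apply/cvgrPdist_lt => e e0; have := cvg z mz e e0.
  apply: filterS => n /(_ T TT) hn; rewrite sub0r normrN ger0_norm ?sqrtr_ge0//.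
  have mP := P_mem hU cS alpha v hys TT mz; rewrite -/(P T z) in mP.
  have pz : eqv (@hd _ _ hY) (lift hY (P T z)) (lift hY z) by rewrite -ieqE !liftK//; exact: PT.
  rewrite -(liftK hY mP) -elt_valB inormE (eqv_nm SY (eqvB SY (eqv_refl SY _) pz)) in hn.
  by rewrite -(liftK hY mz) -elt_valB inormE {1}(liftK hY mz).
- move=> z mz; split; last exact: cvg.
  by move=> n; exact: (Pn_continuous hU cS alpha0 (bG n) (bGs n) (hvn n)).
Qed.

End AbstractTheorem.

(** * Weighted spaces of square integrable fields *)

Lemma fast_cauchy (R : realType) (u : nat -> R) (s : R) : 0 <= s ->
  (forall k, `|u k.+1 - u k| <= s * 2^-1 ^+ k) ->
  u n @[n --> \oo] --> lim (u n @[n --> \oo]) /\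
  forall n, `|u n - lim (u n @[n --> \oo])| <= 2 * s * 2^-1 ^+ n.
Proof.
move=> s0 hu.
have cv : cvgn u.
  have -> : u = (fun n => series (telescope u) n + u 0%N).
    by apply/funext => n; rewrite telescopeK /= subrK.
  apply: is_cvgD; last exact: is_cvg_cst.
  apply: normed_cvg; apply: (@series_le_cvg _ _ (geometric s 2^-1)) => //.
  - by move=> n; exact: normr_ge0.
  - by move=> n; rewrite /geometric /= mulr_ge0// exprn_ge0.
  - by apply: is_cvg_geometric_series; rewrite ger0_norm// invf_lt1// ltr1n.
split=> // n; set l := lim _.
have un k : `|u (n + k)%N - u n| <= 2 * s * (2^-1 ^+ n - 2^-1 ^+ (n + k)).
  elim: k => [|k IH]; first by rewrite addn0 !subrr normr0 mulr0.
  rewrite addnS (le_trans (ler_distD (u (n + k)%N) _ _))//.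
  have := hu (n + k)%N; rewrite exprS; move: (2^-1 ^+ (n + k)) (2^-1 ^+ n) IH => p q IH h.
  lra.
rewrite -subr_le0; apply/ler_addgt0Pr => e e0; rewrite add0r.
move/cvgrPdist_lt : cv => /(_ e e0) [m _ me].
have h := me (n + m)%N (leq_addl _ _).
have h2 := ler_distD (u (n + m)%N) l (u n); rewrite (distrC (u n) l).
have := un m; have : 0 <= 2 * s * 2^-1 ^+ (n + m) by rewrite !mulr_ge0// exprn_ge0.
move: h h2; rewrite -/l /= mulrBr; clear; lra.
Qed.

Section L2Complete.
Context d (T : measurableType d) (R : realType) (mu : {measure set T -> \bar R}).
Variables (D : set T) (mD : measurable D).
Local Notation aint := (aint mu D).
Local Notation rI := (rI mu D).

(** The completeness argument of Riesz and Fischer in quadratic form. The sum [S] of the squared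
    increments with weights [4 ^+ k] is integrable, since the increments decay like 16^-k, hence
    finite almost everywhere. There the increments are at most [Num.sqrt (s x) * 2^-1 ^+ k], which
    gives a pointwise limit and a dominating function. *)
Lemma L2_fast_cauchy (f : nat -> T -> R) (C : R) :
  (forall n, measurable_fun D (f n)) ->
  (forall n, aint (fun x => (f n.+1 x - f n x) ^+ 2)) ->
  (forall n, rI (fun x => (f n.+1 x - f n x) ^+ 2) <= C * (4^-1 ^+ n) ^+ 2) ->
  exists2 g : T -> R, measurable_fun D g & exists C', forall n,
    aint (fun x => (f n x - g x) ^+ 2) /\
    rI (fun x => (f n x - g x) ^+ 2) <= C' * 4^-1 ^+ n.
Proof.
move=> mf df hC.
pose h k x := ((4 ^+ k * (f k.+1 x - f k x) ^+ 2)%:E)%E.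
have mh k : measurable_fun D (h k).
  apply/measurable_EFinP; apply: measurable_funM => //.
  by apply: measurable_funX; exact: measurable_funB.
have h0 k x : (0 <= h k x)%E by rewrite lee_fin mulr_ge0 ?sqr_ge0// exprn_ge0.
pose S x := (\sum_(k <oo) h k x)%E.
have S0 x : (0 <= S x)%E by apply: nneseries_ge0.
have mS : measurable_fun D S.
  apply: ge0_emeasurable_sum => //.
have IS : (\int[mu]_(x in D) S x < +oo)%E.
  rewrite integral_nneseries//.
  apply: (@le_lt_trans _ _ (\sum_(k <oo) (geometric `|C| 4^-1 k)%:E)%E).
    apply: lee_nneseries => [k _ _|k _]; first exact: integral_ge0.
    have := aint_EFin mD (aintZ mD (4 ^+ k) (df k)); rewrite /h => ->.
    rewrite lee_fin rIZ//; apply: (le_trans (ler_wpM2l _ (hC k))); first exact: exprn_ge0.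
    rewrite /geometric /= (_ : 4 ^+ k * _ = C * 4^-1 ^+ k * (4 * 4^-1) ^+ k); last first.
      by rewrite exprMn expr2; ring.
    rewrite mulfV ?pnatr_eq0// expr1n mulr1; apply: ler_wpM2r; last exact: ler_norm.
    by apply: exprn_ge0; rewrite invr_ge0.
  have cg : series (geometric `|C| 4^-1) n @[n --> \oo] --> (`|C| * (1 - 4^-1)^-1).
    by apply: cvg_geometric_series; rewrite ger0_norm// invf_lt1// ltr1n.
  rewrite (_ : (\sum_(k <oo) _)%E = (`|C| * (1 - 4^-1)^-1)%:E) ?ltry//.
  apply/cvg_lim => //; under eq_fun do rewrite sumEFin.
  by apply/fine_cvgP; split; [exact: nearW|exact: cg].
have iS : mu.-integrable D S.
  apply/integrableP; split => //.
  by rewrite (eq_integral S)// => x _; rewrite gee0_abs.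
have fS := integrable_ae mD iS.
pose s x := fine (S x).
have s0 x : 0 <= s x by exact: fine_ge0.
have is_s : aint s.
  apply: aint_lty => //; last 1 first.
  - rewrite (@integral_ae _ _ _ _ _ _ S)//.
    by apply: filterS fS => x /= + Dx => /(_ Dx) /fineK.
  - by apply: measurable_aemf; exact: (measurableT_comp (fine_measurable _) mS).
  - exact: aeW.
have st k x : D x -> S x \is a fin_num ->
    `|f k.+1 x - f k x| <= Num.sqrt (s x) * 2^-1 ^+ k.
  move=> Dx fx; have : (h k x <= S x)%E.
    rewrite (@le_trans _ _ (\sum_(0 <= i < k.+1) h i x)%E)//.
      by rewrite big_nat_recr//= leeDr// sume_ge0.
    exact: nneseries_lim_ge.
  rewrite -(fineK fx) lee_fin -/(s x) => hk.
  rewrite exprVn ler_pdivlMr ?exprn_gt0//.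
  rewrite -ler_sqr ?nnegrE ?sqrtr_ge0 ?mulr_ge0 ?exprn_ge0// sqr_sqrtr//.
  by rewrite exprMn real_normK ?num_real// -exprM mulnC exprM -natrX mulrC.
pose l x := lim (f n x @[n --> \oo]).
have cvl x : D x -> S x \is a fin_num -> f n x @[n --> \oo] --> l x /\
    forall n, `|f n x - l x| <= 2 * Num.sqrt (s x) * 2^-1 ^+ n.
  by move=> Dx fx; apply: (@fast_cauchy _ (f ^~ x)); rewrite ?sqrtr_ge0// => k; exact: st.
have [g mg lg] : aemf mu D l.
  apply: (@aemf_cvg _ _ _ mu D f) => [n|]; first exact: measurable_aemf.
  by apply: filterS fS => x /= hx Dx; case: (cvl x Dx (hx Dx)).
exists g => //; exists (4 * rI s) => n.
have ib : aint (fun x => 4 * 4^-1 ^+ n * s x) by exact: aintZ.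
have le : {ae mu, forall x, D x -> (f n x - g x) ^+ 2 <= 4 * 4^-1 ^+ n * s x}.
  apply: filterS2 fS lg => x /= hx + Dx => <-//.
  have [_ /(_ n)] := cvl x Dx (hx Dx).
  rewrite -ler_sqr ?nnegrE ?mulr_ge0 ?sqrtr_ge0 ?exprn_ge0 ?invr_ge0//.
  rewrite real_normK ?num_real// !exprMn sqr_sqrtr// => /le_trans; apply.
  rewrite le_eqVlt; apply/orP; left; apply/eqP.
  rewrite -exprM mulnC exprM (_ : 2^-1 ^+ 2 = 4^-1 :> R); last by rewrite expr2; field.
  by ring.
have ifg : aint (fun x => (f n x - g x) ^+ 2).
  apply: (aint_dom mD _ ib).
    by apply: measurable_aemf; apply: measurable_funX; exact: measurable_funB.
  by apply: filterS le => x /= + Dx => /(_ Dx); rewrite ger0_norm ?sqr_ge0.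
split=> //; apply: (le_trans (le_rI mD ifg ib le)).
by rewrite rIZ// mulrAC.
Qed.

End L2Complete.

(** * Pointwise bounds for pairings with a real matrix weight *)

Section WeightedPairing.
Variable R : realType.
Implicit Types (M : 'M[R]_3) (u v w : 'rV[R[i]]_3) (a z : R[i]).

Definition wdot M u v : R[i] := \sum_i u 0 i * (mulv M v 0 i)^*.

Definition csum u : R := \sum_i csq (u 0 i).

Lemma csq_ge0 z : 0 <= csq z.
Proof. by rewrite addr_ge0 ?sqr_ge0. Qed.

Lemma csq_lin a z z' : csq (a * z + z') <= 2 * csq a * csq z + 2 * csq z'.
Proof.
case: a z z' => [p q] [r s] [t y]; rewrite /csq /=.
have := sqr_ge0 (p * r - q * s - t); have := sqr_ge0 (p * s + q * r - y).
nra.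
Qed.

Lemma csum_ge0 u : 0 <= csum u.
Proof. by apply: sumr_ge0 => i _; exact: csq_ge0. Qed.

Lemma mulvE M v i : mulv M v 0 i = \sum_j v 0 j * (M i j)%:C.
Proof. by rewrite /mulv mxE; apply: eq_bigr => j _; rewrite !mxE. Qed.

Lemma mulvD M a v w : mulv M (a *: v + w) = a *: mulv M v + mulv M w.
Proof. by rewrite /mulv mulmxDl scalemxAl. Qed.

Lemma wdotDl M u v w : wdot M (u + v) w = wdot M u w + wdot M v w.
Proof. by rewrite -big_split; apply: eq_bigr => i _; rewrite mxE mulrDl. Qed.

Lemma wdotZl M a u w : wdot M (a *: u) w = a * wdot M u w.
Proof. by rewrite mulr_sumr; apply: eq_bigr => i _; rewrite mxE mulrA. Qed.

Lemma wdotZr M a u w : wdot M u (a *: w) = a^* * wdot M u w.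
Proof.
rewrite mulr_sumr; apply: eq_bigr => i _.
by rewrite -[a *: w]addr0 mulvD /mulv mul0mx addr0 mxE rmorphM mulrCA.
Qed.

Lemma Re_sum (I : finType) (F : I -> R[i]) :
  complex.Re (\sum_i F i) = \sum_i complex.Re (F i).
Proof. exact: (@big_morph _ _ (@complex.Re R) 0 +%R 0 +%R (fun a b => ltac:(by case: a b => ? ? [])) erefl). Qed.

Lemma Re_wdot M u v : complex.Re (wdot M u v) = \sum_i \sum_j M i j *
  (complex.Re (u 0 i) * complex.Re (v 0 j) + complex.Im (u 0 i) * complex.Im (v 0 j)).
Proof.
rewrite Re_sum; apply: eq_bigr => i _.
rewrite mulvE rmorph_sum mulr_sumr Re_sum; apply: eq_bigr => j _.
by case: (u 0 i) (v 0 j) => [p q] [r s] /=; ring.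
Qed.

Lemma Re_wdotC M u v : M^T = M -> complex.Re (wdot M u v) = complex.Re (wdot M v u).
Proof.
move=> MT; rewrite !Re_wdot exchange_big; apply: eq_bigr => i _; apply: eq_bigr => j _.
by rewrite -{1}MT mxE; ring.
Qed.

(** For a real weight the real part splits into the quadratic forms of the real and of the imaginary
    part of [u]. *)
Lemma wdot_ge M u c : (forall xi : 'rV[R]_3, c * (xi *m xi^T) 0 0 <= (xi *m M *m xi^T) 0 0) ->
  c * csum u <= complex.Re (wdot M u u).
Proof.
move=> hM; have qE (xi : 'rV[R]_3) : (xi *m M *m xi^T) 0 0 =
    \sum_i \sum_j M i j * (xi 0 i * xi 0 j).
  rewrite mxE exchange_big; apply: eq_bigr => j _; rewrite !mxE mulr_suml.
  by apply: eq_bigr => i _; ring.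
have nE (xi : 'rV[R]_3) : (xi *m xi^T) 0 0 = \sum_i xi 0 i ^+ 2.
  by rewrite mxE; apply: eq_bigr => i _; rewrite mxE expr2.
have h1 := hM (\row_i complex.Re (u 0 i)); have h2 := hM (\row_i complex.Im (u 0 i)).
rewrite !nE !qE in h1 h2.
rewrite Re_wdot (_ : csum u = \sum_i (\row_i complex.Re (u 0 i)) 0 i ^+ 2 +
   \sum_i (\row_i complex.Im (u 0 i)) 0 i ^+ 2); last first.
  by rewrite -big_split; apply: eq_bigr => i _; rewrite !mxE.
rewrite mulrDr (le_trans (lerD h1 h2))// le_eqVlt; apply/orP; left; apply/eqP.
rewrite -big_split; apply: eq_bigr => i _; rewrite -big_split; apply: eq_bigr => j _.
by rewrite !mxE [RHS]mulrDr.
Qed.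

Lemma wdot_le M u K : 0 <= K -> (forall i j, `|M i j| <= K) ->
  complex.Re (wdot M u u) <= 3 * K * csum u.
Proof.
move=> K0 hM; rewrite Re_wdot.
apply: (@le_trans _ _ (\sum_i \sum_j K / 2 * (csq (u 0 i) + csq (u 0 j)))).
  apply: ler_sum => i _; apply: ler_sum => j _.
  apply: (le_trans (ler_norm _)); rewrite normrM -mulrA; apply: ler_pM => //.
  case: (u 0 i) (u 0 j) => [p q] [r s]; rewrite /csq /= ler_norml.
  have := sqr_ge0 (p - r); have := sqr_ge0 (p + r); have := sqr_ge0 (q - s); have := sqr_ge0 (q + s).
  by move=> h1 h2 h3 h4; apply/andP; split; nra.
rewrite le_eqVlt; apply/orP; left; apply/eqP.
by rewrite /csum !big_ord_recr !big_ord0 /=; field.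
Qed.

End WeightedPairing.

Section FieldSpaces.
Variables (R : realType) (mu : {measure set (E3 R) -> \bar R}) (D : set (E3 R)).
Hypothesis mD : measurable D.
Local Notation aint := (aint mu D).
Local Notation rI := (rI mu D).
Implicit Types (f g : E3 R -> R[i]) (u v w : E3 R -> 'rV[R[i]]_3) (M : E3 R -> 'M[R]_3).

Lemma L2_funP f : L2_fun mu D f <->
  [/\ measurable_fun D (fun x => complex.Re (f x)),
      measurable_fun D (fun x => complex.Im (f x)),
      aint (fun x => complex.Re (f x) ^+ 2) & aint (fun x => complex.Im (f x) ^+ 2)].
Proof.
split=> [[mr mi fi]|[mr mi ar ai]]; last first.
  by split => //; rewrite (aint_EFin mD (aintD mD ar ai)) ltry.
have mr2 := measurable_aemf mu (measurable_funX 2 mr).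
have mi2 := measurable_aemf mu (measurable_funX 2 mi).
have ac : aint (fun x => csq (f x)).
  apply: aint_lty => //; first exact: aemfD.
  by apply: aeW => x _; exact: csq_ge0.
split => //; apply: (aint_dom mD _ ac) => //; apply: aeW => x _;
  by rewrite ger0_norm ?sqr_ge0// /csq ?lerDl ?lerDr sqr_ge0.
Qed.

Lemma L2_fun_csq f : L2_fun mu D f -> aint (fun x => csq (f x)).
Proof. by move=> /L2_funP[_ _ ar ai]; exact: aintD. Qed.

Lemma L2_fun0 : L2_fun mu D (fun=> 0).
Proof. by apply/L2_funP; split => //=; rewrite expr0n; exact: aint0. Qed.

Lemma L2_fun_lin (a : R[i]) f g : L2_fun mu D f -> L2_fun mu D g ->
  L2_fun mu D (fun x => a * f x + g x).
Proof.
move=> /[dup] /L2_fun_csq cf /L2_funP[mrf mif _ _] /[dup] /L2_fun_csq cg /L2_funP[mrg mig _ _].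
have [mr mi] : measurable_fun D (fun x => complex.Re (a * f x + g x)) /\
    measurable_fun D (fun x => complex.Im (a * f x + g x)).
  have -> : (fun x => complex.Re (a * f x + g x)) = fun x =>
      complex.Re a * complex.Re (f x) - complex.Im a * complex.Im (f x) + complex.Re (g x).
    by apply/funext => x; case: a (f x) (g x) => [p q] [r s] [t y].
  have -> : (fun x => complex.Im (a * f x + g x)) = fun x =>
      complex.Re a * complex.Im (f x) + complex.Im a * complex.Re (f x) + complex.Im (g x).
    by apply/funext => x; case: a (f x) (g x) => [p q] [r s] [t y] /=; ring.
  by split; apply: measurable_funD => //; [apply: measurable_funB|apply: measurable_funD];
    apply: measurable_funM.
have ac : aint (fun x => 2 * csq a * csq (f x) + 2 * csq (g x)).
  by apply: aintD => //; apply: aintZ.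
have [mr2 mi2] := (measurable_funX 2 mr, measurable_funX 2 mi).
apply/L2_funP; split => //; apply: (aint_dom mD _ ac); try exact: measurable_aemf;
  apply: aeW => x Dx; apply: le_trans (csq_lin _ _ _);
  by rewrite ger0_norm ?sqr_ge0// /csq ?lerDl ?lerDr sqr_ge0.
Qed.

Lemma L2_field0 : L2_field mu D 0.
Proof.
move=> i; have := L2_fun0; congr (L2_fun _ _ _).
by apply/funext => x; rewrite mxE.
Qed.

Lemma L2_field_lin (a : R[i]) u v : L2_field mu D u -> L2_field mu D v ->
  L2_field mu D (a *: u + v).
Proof.
move=> hu hv i; have := L2_fun_lin a (hu i) (hv i); congr (L2_fun _ _ _).
by apply/funext => x; rewrite !mxE.
Qed.

Lemma aint_sum n (F : 'I_n -> E3 R -> R) : (forall i, aint (F i)) ->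
  aint (fun x => \sum_(i < n) F i x).
Proof.
elim: n F => [|n IH] F mF.
  by under [X in aint X]eq_fun do rewrite big_ord0; exact: aint0.
under [X in aint X]eq_fun do rewrite big_ord_recr.
by apply: aintD => //; exact: IH.
Qed.

Variable M : E3 R -> 'M[R]_3.
Hypothesis mM : forall i j, measurable_fun D (fun x => M x i j).
Variables (c K : R) (c0 : 0 < c) (K0 : 0 <= K).
Hypothesis hK : {ae mu, forall x, D x -> forall i j, `|M x i j| <= K}.
Hypothesis hsym : {ae mu, forall x, D x -> (M x)^T = M x}.
Hypothesis hpos : {ae mu, forall x, D x ->
  forall xi : 'rV[R]_3, c * (xi *m xi^T) 0 0 <= (xi *m M x *m xi^T) 0 0}.

Definition wform u v : R := rI (fun x => complex.Re (wdot (M x) (u x) (v x))).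

Lemma aint_wdot u v : L2_field mu D u -> L2_field mu D v ->
  aint (fun x => complex.Re (wdot (M x) (u x) (v x))).
Proof.
move=> hu hv; under [X in aint X]eq_fun do rewrite Re_wdot.
apply: aint_sum => i; apply: aint_sum => j.
have /L2_funP[ur ui ur2 ui2] := hu i; have /L2_funP[vr vi vr2 vi2] := hv j.
have ai : aint (fun x => complex.Re (u x 0 i) * complex.Re (v x 0 j) +
    complex.Im (u x 0 i) * complex.Im (v x 0 j)).
  by apply: aintD => //; apply: aintM2 => //; exact: measurable_aemf.
have [an _] := rI_norm mD ai.
apply: (aint_dom mD _ (aintZ mD K an)).
  by apply: aemfM; [exact: measurable_aemf|exact: aint_aemf ai].
by apply: filterS hK => x /= h Dx; rewrite normrM ler_wpM2r// h.
Qed.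

Lemma wformDl u v w : L2_field mu D u -> L2_field mu D v -> L2_field mu D w ->
  wform (u + v) w = wform u w + wform v w.
Proof.
move=> hu hv hw; rewrite -(rID mD (aint_wdot hu hw) (aint_wdot hv hw)).
by apply: rI_eq => x _; rewrite wdotDl raddfD.
Qed.

Lemma wformZ (a : R[i]) u v : wform (a *: u) v = wform u (conjc a *: v).
Proof.
apply: rI_eq => x _; rewrite wdotZl wdotZr; congr (complex.Re (_ * _)).
by symmetry; exact: conjcK.
Qed.

Lemma wformR (r : R) u v : L2_field mu D u -> L2_field mu D v ->
  wform (r%:C *: u) v = r * wform u v.
Proof.
move=> hu hv; rewrite -(rIZ mD r (aint_wdot hu hv)); apply: rI_eq => x _.
by rewrite wdotZl; case: (wdot _ _ _) => p q /=; rewrite mul0r subr0.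
Qed.

Lemma wformC u v : wform u v = wform v u.
Proof. by apply: rI_ae; apply: filterS hsym => x + Dx => /(_ Dx); exact: Re_wdotC. Qed.

Lemma wform_ge0 u : 0 <= wform u u.
Proof.
apply: rI_ge0; apply: filterS hpos => x /= + Dx => /(_ Dx) h.
by apply: le_trans (wdot_ge (u x) h); rewrite mulr_ge0 ?csum_ge0// ltW.
Qed.

Lemma wform_Im u v : rI (fun x => complex.Im (wdot (M x) (u x) (v x))) = wform u ('i *: v).
Proof.
apply: rI_eq => x _; rewrite wdotZr; case: (wdot _ _ _) => p q /=.
by rewrite mul0r sub0r mulN1r opprK.
Qed.

Lemma wform_comp u i : L2_field mu D u ->
  rI (fun x => complex.Re (u x 0 i) ^+ 2) <= c^-1 * wform u u /\
  rI (fun x => complex.Im (u x 0 i) ^+ 2) <= c^-1 * wform u u.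
Proof.
move=> hu; have /L2_funP[_ _ ar ai] := hu i.
have aw := aintZ mD c^-1 (aint_wdot hu hu); have aw' := aint_wdot hu hu.
have le x : D x -> (forall xi : 'rV[R]_3, c * (xi *m xi^T) 0 0 <= (xi *m M x *m xi^T) 0 0) ->
    csq (u x 0 i) <= c^-1 * complex.Re (wdot (M x) (u x) (u x)).
  move=> Dx /(wdot_ge (u x)) h; rewrite mulrC ler_pdivlMr// mulrC.
  apply: le_trans h; rewrite ler_wpM2l ?(ltW c0)// /csum (bigD1 i)//= lerDl.
  by apply: sumr_ge0 => j _; exact: csq_ge0.
rewrite -!(rIZ mD c^-1 aw'); split; apply: (le_rI mD) => //;
  apply: filterS hpos => x /= + Dx => /(_ Dx)/(le x Dx); apply: le_trans;
  by rewrite /csq ?lerDl ?lerDr sqr_ge0.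
Qed.

Lemma wform_le u : L2_field mu D u -> wform u u <= 3 * K *
  (\sum_i rI (fun x => complex.Re (u x 0 i) ^+ 2) + \sum_i rI (fun x => complex.Im (u x 0 i) ^+ 2)).
Proof.
move=> hu; have ac : aint (fun x => csum (u x)).
  by apply: aint_sum => i; apply: L2_fun_csq.
have -> : \sum_i rI (fun x => complex.Re (u x 0 i) ^+ 2) +
    \sum_i rI (fun x => complex.Im (u x 0 i) ^+ 2) = rI (fun x => csum (u x)).
  have cE i : rI (fun x => complex.Re (u x 0 i) ^+ 2) + rI (fun x => complex.Im (u x 0 i) ^+ 2) =
      rI (fun x => csq (u x 0 i)).
    by have /L2_funP[_ _ ar ai] := hu i; rewrite -rID.
  rewrite -big_split !big_ord_recr big_ord0 /= !cE add0r.
  rewrite -rID//; [|exact: L2_fun_csq..]; rewrite -rID//; last exact: L2_fun_csq.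
    by apply: rI_eq => x _; rewrite /csum !big_ord_recr big_ord0 /= add0r.
  by apply: aintD => //; exact: L2_fun_csq.
rewrite -(rIZ mD _ ac); apply: (le_rI mD (aint_wdot hu hu)); first exact: aintZ.
by apply: filterS hK => x /= + Dx => /(_ Dx); exact: wdot_le.
Qed.

Lemma field_complete (u : nat -> E3 R -> 'rV[R[i]]_3) : (forall n, L2_field mu D (u n)) ->
  (forall n, wform (u n.+1 - u n) (u n.+1 - u n) <= (4^-1 ^+ n) ^+ 2) ->
  exists2 g, L2_field mu D g & exists C, forall n, wform (u n - g) (u n - g) <= C * 4^-1 ^+ n.
Proof.
move=> hu hd.
have hB v w : L2_field mu D v -> L2_field mu D w -> L2_field mu D (v - w).
  by move=> hv hw; have := L2_field_lin (-1) hw hv; rewrite scaleN1r addrC.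
have hdn n := hB _ _ (hu n.+1) (hu n).
(* A common statement for [p] the real or the imaginary part: coercivity turns the rate in the
   weighted norm into an L^2 rate for each scalar component. *)
have cp (p : R[i] -> R) i : (forall a b, p (a - b) = p a - p b) ->
    (forall v, L2_field mu D v -> measurable_fun D (fun x => p (v x 0 i)) /\ aint (fun x => p (v x 0 i) ^+ 2)) ->
    (forall v, L2_field mu D v -> rI (fun x => p (v x 0 i) ^+ 2) <= c^-1 * wform v v) ->
    exists g : E3 R -> R, measurable_fun D g /\ exists C', forall n,
    aint (fun x => (p (u n x 0 i) - g x) ^+ 2) /\
    rI (fun x => (p (u n x 0 i) - g x) ^+ 2) <= C' * 4^-1 ^+ n.
  move=> pB pm pw.
  have e n : (fun x => (p (u n.+1 x 0 i) - p (u n x 0 i)) ^+ 2) =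
      (fun x => p ((u n.+1 - u n) x 0 i) ^+ 2).
    by apply/funext => x; rewrite -pB !mxE.
  have [|n|n|g mg gP] := @L2_fast_cauchy _ _ _ mu D mD (fun n x => p (u n x 0 i)) c^-1.
  - by move=> n; case: (pm _ (hu n)).
  - by rewrite e; case: (pm _ (hdn n)).
  - by rewrite e (le_trans (pw _ (hdn n)))// ler_wpM2l// invr_ge0 ltW.
  - by exists g.
have cR i : exists g : E3 R -> R, measurable_fun D g /\ exists C', forall n,
    aint (fun x => (complex.Re (u n x 0 i) - g x) ^+ 2) /\
    rI (fun x => (complex.Re (u n x 0 i) - g x) ^+ 2) <= C' * 4^-1 ^+ n.
  apply: (cp (@complex.Re R)) => [[? ?] [? ?]//|v /(_ i)/L2_funP[]//|v hv].
  by case: (wform_comp i hv).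
have cI i : exists g : E3 R -> R, measurable_fun D g /\ exists C', forall n,
    aint (fun x => (complex.Im (u n x 0 i) - g x) ^+ 2) /\
    rI (fun x => (complex.Im (u n x 0 i) - g x) ^+ 2) <= C' * 4^-1 ^+ n.
  apply: (cp (@complex.Im R)) => [[? ?] [? ?]//|v /(_ i)/L2_funP[]//|v hv].
  by case: (wform_comp i hv).
have /choice[gR hR] := cR; have /choice[gI hI] := cI.
pose g x : 'rV[R[i]]_3 := \row_i (gR i x +i* gI i x).
have ReB n i x : complex.Re ((u n - g) x 0 i) = complex.Re (u n x 0 i) - gR i x.
  by rewrite !mxE; case: (u n x 0 i).
have ImB n i x : complex.Im ((u n - g) x 0 i) = complex.Im (u n x 0 i) - gI i x.
  by rewrite !mxE; case: (u n x 0 i).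
have hug n : L2_field mu D (u n - g).
  move=> i; have [mR [C1 /(_ n)[a1 _]]] := hR i; have [mI [C2 /(_ n)[a2 _]]] := hI i.
  have /L2_funP[m1 m2 _ _] := hu n i.
  apply/L2_funP; split; [under eq_fun do rewrite ReB|under eq_fun do rewrite ImB|
    under eq_fun do rewrite ReB|under eq_fun do rewrite ImB] => //; exact: measurable_funB.
exists g; first by have := hB _ _ (hu 0%N) (hug 0%N); rewrite opprB addrC subrK.
have /choice[C1 hC1] i : exists C, forall n, rI (fun x => (complex.Re (u n x 0 i) - gR i x) ^+ 2) <= C * 4^-1 ^+ n.
  by have [_ [C h]] := hR i; exists C => n; case: (h n).
have /choice[C2 hC2] i : exists C, forall n, rI (fun x => (complex.Im (u n x 0 i) - gI i x) ^+ 2) <= C * 4^-1 ^+ n.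
  by have [_ [C h]] := hI i; exists C => n; case: (h n).
exists (3 * K * (\sum_i C1 i + \sum_i C2 i)) => n.
apply: (le_trans (wform_le (hug n))); rewrite -[leRHS]mulrA ler_wpM2l ?mulr_ge0//.
rewrite mulrDl !mulr_suml; apply: lerD; apply: ler_sum => i _.
- by rewrite (_ : (fun x => _) = fun x => (complex.Re (u n x 0 i) - gR i x) ^+ 2)//; apply/funext => x; rewrite ReB.
- by rewrite (_ : (fun x => _) = fun x => (complex.Im (u n x 0 i) - gI i x) ^+ 2)//; apply/funext => x; rewrite ImB.
Qed.

End FieldSpaces.

(** * The boundary and its surface measure *)

Section RationalBoxes.
Variable R : realType.
Implicit Types (p : E3 R) (q : rat * rat * rat * rat) (V : set (E3 R)).

(** Countably many measurable boxes that form a base of the topology: they make open sets measurable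
    for the product sigma-algebra and supply the countable cover in [surface_sigma_finite]. *)
Definition rbox q : set (E3 R) :=
  [set p | [/\ `|ratr q.1.1.1 - p.1.1| < ratr q.2, `|ratr q.1.1.2 - p.1.2| < ratr q.2 &
    `|ratr q.1.2 - p.2| < ratr q.2]].

Lemma measurable_rbox q : measurable (rbox q).
Proof.
have -> : rbox q = (ball (ratr q.1.1.1 : R) (ratr q.2) `*` ball (ratr q.1.1.2 : R) (ratr q.2)) `*`
    ball (ratr q.1.2 : R) (ratr q.2).
  by apply/seteqP; split => [p []|p [[]]].
by do 2?apply: measurableX; exact: (measurable_ball (R := R)).
Qed.

Lemma nbhs_rbox p V : nbhs p V -> exists2 q, rbox q p & rbox q `<=` V.
Proof.
move=> /nbhs_ballP[e /= e0 eV].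
have [f /itvP fe] : exists f : rat, ratr f \in `]0, e / 2[%R by apply: rat_in_itvoo; rewrite divr_gt0.
have f0 : 0 < ratr f :> R by rewrite fe.
have near (x : R) : exists q : rat, `|ratr q - x| < ratr f.
  have /rat_in_itvoo[q /itvP qx] : x - ratr f < x + ratr f by lra.
  by exists q; rewrite ltr_distl !qx.
have [q1 h1] := near p.1.1; have [q2 h2] := near p.1.2; have [q3 h3] := near p.2.
have f2 : ratr f < e / 2 :> R by rewrite fe.
exists (q1, q2, q3, f) => // z [/= z1 z2 z3]; apply: eV.
have tri (a b c : R) : `|a - b| < ratr f -> `|a - c| < ratr f -> `|b - c| < e.
  move=> ab ac; apply: le_lt_trans (ler_distD a _ _) _; rewrite distrC; lra.
by split; [split|]; apply: tri; eassumption.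
Qed.

Lemma open_measurable3 V : open V -> measurable V.
Proof.
move=> oV; have -> : V = \bigcup_(q in [set: rat * rat * rat * rat])
    (if `[< rbox q `<=` V >] then rbox q else set0).
  apply/seteqP; split => [p Vp|p [q _]]; last by case: asboolP => // qV /qV.
  have [|q qp qV] := @nbhs_rbox p V; first exact: open_nbhs_nbhs.
  by exists q => //; case: asboolP.
apply: countable_bigcupT_measurable => // q; case: ifP => _ //; exact: measurable_rbox.
Qed.

Lemma measurable_boundary (O : set (E3 R)) : measurable (boundary O).
Proof.
apply: measurableD; last by apply: open_measurable3; exact: open_interior.
rewrite -[closure O]setCK; apply: measurableC; apply: open_measurable3.
by apply: closed_openC; exact: closed_closure.
Qed.

End RationalBoxes.

(** * Graph charts and local Hausdorff measure *)

Section LipschitzChart.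
Variables (R : realType) (phi : R * R -> R) (dphi : R * R -> R * R) (L : R).
Hypothesis dP : forall p : R * R, @is_derive R (R * R)%type R p (1, 0) phi (dphi p).1 /\
  @is_derive R (R * R)%type R p (0, 1) phi (dphi p).2.
Hypothesis dL : forall p q, `|dphi p - dphi q| <= L * `|p - q|.

Let slice1 (b a : R) : is_derive a (1 : R) (fun s => phi (s, b)) (dphi (a, b)).1.
Proof.
have [[h1 h2] _] := dP (a, b).
have e : (fun h : R => h^-1 *: (phi (h *: (1, 0) + (a, b)) - phi (a, b))) =
  (fun h : R => h^-1 *: (phi (h *: 1 + a, b) - phi (a, b))).
  apply/funext => h; do 2?congr (_ *: _); congr (phi _ - _).
  by congr pair; rewrite /= ?scaler0 ?add0r.
apply: DeriveDef; first by move: h1; rewrite /derivable e.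
by rewrite -h2 /derive /= /derive e.
Qed.

Let slice2 (a b : R) : is_derive b (1 : R) (fun s => phi (a, s)) (dphi (a, b)).2.
Proof.
have [_ [h1 h2]] := dP (a, b).
have e : (fun h : R => h^-1 *: (phi (h *: (0, 1) + (a, b)) - phi (a, b))) =
  (fun h : R => h^-1 *: (phi (a, h *: 1 + b) - phi (a, b))).
  apply/funext => h; do 2?congr (_ *: _); congr (phi _ - _).
  by congr pair; rewrite /= ?scaler0 ?add0r.
apply: DeriveDef; first by move: h1; rewrite /derivable e.
by rewrite -h2 /derive /= /derive e.
Qed.

Lemma mean_value_bound (f df : R -> R) (M a b : R) : (forall x : R, is_derive x (1 : R) f (df x)) ->
  (forall x, Num.min a b <= x <= Num.max a b -> `|df x| <= M) -> `|f a - f b| <= M * `|a - b|.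
Proof.
move=> fd hM.
have cf : continuous f.
  move=> x; apply: differentiable_continuous; apply/derivable1_diffP.
  by case: (fd x).
have cw x y : {within `[x, y], continuous f} by apply: continuous_subspaceT.
have [ab|/ltW ba] := leP a b.
  have [c /itvP cab h] := MVT_segment ab (fun x _ => fd x) (cw a b).
  rewrite distrC h normrM (distrC a) ler_wpM2r// hM//.
  by rewrite (min_idPl ab) (max_idPr ab) !cab.
have [c /itvP cab h] := MVT_segment ba (fun x _ => fd x) (cw b a).
rewrite h normrM ler_wpM2r// hM//.
by rewrite (min_idPr ba) (max_idPl ba) !cab.
Qed.

(** A Lipschitz gradient is bounded on a square. Since only the two partial derivatives are given,
    the mean value theorem is applied along the two sides of the corner at [(a', b)]. *)
Lemma chart_lipschitz (r : R) : exists2 M, 0 <= M & forall a b a' b',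
  `|a| <= r -> `|b| <= r -> `|a'| <= r -> `|b'| <= r ->
  `|phi (a, b) - phi (a', b')| <= M * (`|a - a'| + `|b - b'|).
Proof.
pose M := `|dphi 0| + `|L| * `|r|; have M0 : 0 <= M by rewrite addr_ge0// mulr_ge0.
have bd a b : `|a| <= r -> `|b| <= r -> `|dphi (a, b)| <= M.
  move=> ar br; rewrite -[dphi (a, b)](subrK (dphi 0)) (le_trans (ler_normD _ _))//.
  rewrite addrC lerD2l (le_trans (dL _ _))// subr0.
  apply: (@le_trans _ _ (`|L| * `|(a, b)|)); first by rewrite ler_wpM2r// ler_norm.
  rewrite ler_wpM2l// (_ : `|(a, b)| = Num.max `|a| `|b|)// ge_max.
  by rewrite !(le_trans _ (ler_norm r)).
have n1 (p : R * R) : `|p.1| <= `|p| by rewrite (_ : `|p| = Num.max `|p.1| `|p.2|)// le_max lexx.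
have n2 (p : R * R) : `|p.2| <= `|p| by rewrite (_ : `|p| = Num.max `|p.1| `|p.2|)// le_max lexx orbT.
have btw a a' x : `|a| <= r -> `|a'| <= r -> Num.min a a' <= x <= Num.max a a' -> `|x| <= r.
  rewrite !ler_norml => /andP[h1 h2] /andP[h3 h4] /andP[].
  rewrite ge_min le_max => k1 k2; apply/andP; split.
    by case/orP: k1 => k; [exact: le_trans h1 k|exact: le_trans h3 k].
  by case/orP: k2 => k; [exact: le_trans k h2|exact: le_trans k h4].
exists M => // a b a' b' ar br ar' br'.
rewrite -(subrK (phi (a', b)) (phi (a, b))) -addrA mulrDr.
apply: (le_trans (ler_normD _ _)); apply: lerD.
  apply: (mean_value_bound (slice1 b)) => x /(btw _ _ _ ar ar') xr.
  exact: le_trans (n1 _) (bd _ _ xr br).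
apply: (mean_value_bound (slice2 a')) => x /(btw _ _ _ br br') xr.
exact: le_trans (n2 _) (bd _ _ ar' xr).
Qed.

Lemma chart_continuous : continuous phi.
Proof.
move=> p; have [M M0 hM] := chart_lipschitz (`|p.1| + `|p.2| + 1).
apply/cvgrPdist_lt => e e0.
have M1 : 0 < 2 * M + 1 by lra.
have d0 : 0 < Num.min 1 (e / (2 * M + 1)) by rewrite lt_min ltr01 divr_gt0.
have nb : nbhs p (ball p (Num.min 1 (e / (2 * M + 1)))) by exact: nbhsx_ballx.
apply: filterS nb => -[a' b'].
case: p hM => a b /= hM [/= h1 h2].
rewrite /ball /= !lt_min in h1 h2; case/andP: h1 => h1 h1'; case/andP: h2 => h2 h2'.
have na := normr_ge0 a; have nb := normr_ge0 b.
have ka : `|a'| <= `|a| + 1.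
  by have := ler_distD a 0 a'; rewrite !sub0r !normrN => /le_trans; apply; rewrite lerD2l ltW.
have kb : `|b'| <= `|b| + 1.
  by have := ler_distD b 0 b'; rewrite !sub0r !normrN => /le_trans; apply; rewrite lerD2l ltW.
have := hM a b a' b'; move=> /(_ ltac:(lra) ltac:(lra) ltac:(lra) ltac:(lra)) h.
apply: (le_lt_trans h).
apply: (@le_lt_trans _ _ (2 * M * (e / (2 * M + 1)))).
  by rewrite -mulrA mulrCA ler_wpM2l//; lra.
by rewrite mulrCA gtr_pMr// ltr_pdivrMr//; lra.
Qed.

End LipschitzChart.

Section HausdorffLocal.
Variables (R : realType).

Lemma hausdorff2_0 (A : set (E3 R)) : A = set0 -> hausdorff2 A = 0%E.
Proof.
move=> ->; apply/eqP; rewrite eq_le; apply/andP; split.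
  apply: ge_ereal_sup => _ [delta d0 ->]; apply: ereal_inf_lbound.
  exists (fun=> set0), (fun=> 0); split => //; first by move=> _; rewrite lexx ltW.
  by rewrite eseries0// => k _ _; rewrite expr0n mulr0.
apply: ereal_sup_ubound; exists 1 => //; apply/eqP; rewrite eq_le; apply/andP; split.
  apply: le_ereal_inf_tmp => _ [C [d [_ _ _ ->]]]; apply: nneseries_ge0 => k _ _.
  by rewrite lee_fin mulr_ge0 ?sqr_ge0// divr_ge0// pi_ge0.
apply: ereal_inf_lbound.
exists (fun=> set0), (fun=> 0); split => //; first by move=> _; rewrite lexx ler01.
by rewrite eseries0// => k _ _; rewrite expr0n mulr0.
Qed.

(* A set that is parametrised by a square of side [2 r], with distances at most
   [K] times the sup distance of the parameters, is cut into [n ^ 2] cells. *)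
Lemma hausdorff2_param (A : set (E3 R)) (r K : R) (x y : E3 R -> R) : 0 < r -> 0 < K ->
  (forall p, A p -> `|x p| < r /\ `|y p| < r) ->
  (forall p p', A p -> A p' -> Defs.edist p p' <= K * Num.max `|x p - x p'| `|y p - y p'|) ->
  (hausdorff2 A <= (pi / 4 * (2 * r * K) ^+ 2)%:E)%E.
Proof.
move=> r0 K0 hr hK; apply: ge_ereal_sup => _ [delta d0 ->].
(* Large enough for cells of side [2 * r / n] to have diameter at most [delta]. The total
   [n * n * (K * m) ^+ 2] does not depend on n. *)
pose n := (Num.truncn (2 * r * K / delta)).+1.
have n0 : 0 < n%:R :> R by rewrite ltr0n.
pose m := 2 * r / n%:R; have m0 : 0 < m by rewrite divr_gt0// mulr_gt0.
have Km : K * m <= delta.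
  rewrite /m mulrA ler_pdivrMr// (mulrC K) [delta * _]mulrC -ler_pdivrMr//.
  by rewrite ltW// truncnS_gt.
have mn : n%:R * m = 2 * r by rewrite /m mulrCA divff ?mulr1 ?gt_eqF.
move: m m0 Km mn => m m0 Km mn.
(* The quotient and the remainder of k by n are the row and the column of the cell; indices from
   [n * n] on carry the empty set with diameter bound 0. *)
pose cell k := [set p | A p /\ (Num.truncn ((x p + r) / m) = k %/ n)%N /\
   (Num.truncn ((y p + r) / m) = k %% n)%N].
pose C k := if (k < n * n)%N then cell k else set0.
pose dd k : R := if (k < n * n)%N then K * m else 0.
have idx z : `|z| < r -> (Num.truncn ((z + r) / m) < n)%N.
  rewrite ltr_norml => /andP[z1 z2].
  have z0 : 0 <= (z + r) / m by rewrite divr_ge0 ?ltW//; lra.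
  by rewrite truncn_lt_nat// ltr_pdivrMr// mn; lra.
have close z z' : `|z| < r -> `|z'| < r ->
    Num.truncn ((z + r) / m) = Num.truncn ((z' + r) / m) -> `|z - z'| <= m.
  rewrite !ltr_norml => /andP[z1 z2] /andP[z3 z4] e.
  have /truncn_itv/andP[a1 a2] : 0 <= (z + r) / m by rewrite divr_ge0 ?ltW//; lra.
  have /truncn_itv/andP[a3 a4] : 0 <= (z' + r) / m by rewrite divr_ge0 ?ltW//; lra.
  rewrite e in a1 a2; move: a1 a2 a3 a4.
  rewrite !ler_pdivlMr// !ltr_pdivrMr// -!natr1 => a1 a2 a3 a4.
  rewrite ler_norml; apply/andP; split; lra.
apply: (@le_trans _ _ (\sum_(0 <= k <oo) (pi / 4 * dd k ^+ 2)%:E)%E).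
  apply: ereal_inf_lbound; exists C, dd; split => //.
  - move=> p Ap; have [/idx i1 /idx i2] := hr p Ap.
    exists (Num.truncn ((x p + r) / m) * n + Num.truncn ((y p + r) / m))%N => //.
    rewrite /C ifT; last first.
      by rewrite (@leq_trans (Num.truncn ((x p + r) / m) * n + n))%N ?ltn_add2l// -mulSnr leq_mul2r i1 orbT.
    by split => //; rewrite divnMDl// divn_small// addn0 modnMDl modn_small.
  - by move=> k; rewrite /dd; case: ifP; rewrite ?lexx ?(ltW d0)// mulr_ge0// ltW.
  - move=> k p p'; rewrite /C /dd; case: ifP => // _ [Ap [e1 e2]] [Ap' [e3 e4]].
    apply: (le_trans (hK p p' Ap Ap')); rewrite ler_wpM2l ?(ltW K0)// ge_max.
    have [a1 a2] := hr p Ap; have [a3 a4] := hr p' Ap'.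
    by rewrite !close// ?e1 ?e2 ?e3 ?e4.
have dd0 k : (0 <= (pi / 4 * dd k ^+ 2)%:E)%E.
  by rewrite lee_fin mulr_ge0 ?sqr_ge0// divr_ge0// pi_ge0.
rewrite (nneseries_split 0 (n * n)) => [|k _]; last exact: dd0.
rewrite add0n eseries0 ?adde0; last first.
  by move=> k kn _; rewrite /dd ltnNge kn /= expr0n mulr0.
rewrite (eq_big_nat _ _ (F2 := fun=> (pi / 4 * (K * m) ^+ 2)%:E)); last first.
  by move=> k /andP[_ kn]; rewrite /dd kn.
rewrite sumEFin lee_fin sumr_const_nat subn0 -(mulr_natr _ (n * n)) natrM.
rewrite le_eqVlt; apply/orP; left; apply/eqP; rewrite -mn; ring.
Qed.

End HausdorffLocal.

Lemma near_lt (R : realType) (T : topologicalType) (f : T -> R) (p : T) (e : R) :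
  {for p, continuous f} -> f p < e -> nbhs p [set q | f q < e].
Proof. by move=> cf fe; apply: (cf [set x | x < e]); have := @cvgr_lt R R (nbhs (f p)) _ id (f p) cvg_id e fe; apply. Qed.

Lemma near_gt (R : realType) (T : topologicalType) (f : T -> R) (p : T) (e : R) :
  {for p, continuous f} -> e < f p -> nbhs p [set q | e < f q].
Proof. by move=> cf fe; apply: (cf [set x | e < x]); have := @cvgr_gt R R (nbhs (f p)) _ id (f p) cvg_id e fe; apply. Qed.

Section BoundaryPatch.
Variable R : realType.
Implicit Types (p q : E3 R) (v : 'rV[R]_3).

Lemma ord3_ind (P : 'I_3 -> Prop) : P 0 -> P 1 -> P (1 + 1) -> forall i, P i.
Proof.
move=> P0 P1 P2 [[|[|[|//]]] i3].
- by rewrite (_ : Ordinal i3 = 0)//; exact: val_inj.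
- by rewrite (_ : Ordinal i3 = 1)//; exact: val_inj.
- by rewrite (_ : Ordinal i3 = 1 + 1)//; exact: val_inj.
Qed.

Lemma row3E (v : 'rV[R]_3) : row3 (v 0 0) (v 0 1) (v 0 (1 + 1)) = v.
Proof. by apply/rowP; apply: ord3_ind; rewrite mxE. Qed.

Lemma vecE p : (vec p 0 0 = p.1.1) * (vec p 0 1 = p.1.2) * (vec p 0 (1 + 1) = p.2).
Proof. by rewrite !mxE. Qed.

Lemma vecK p : unvec (vec p) = p.
Proof. by rewrite /unvec !vecE; case: p => [[]]. Qed.

Lemma vecB p q : vec (p - q) = vec p - vec q.
Proof. by apply/rowP; apply: ord3_ind; rewrite !mxE. Qed.

Lemma sum3E (F : 'I_3 -> R) : \sum_i F i = F 0 + F 1 + F (1 + 1).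
Proof.
rewrite !big_ord_recl big_ord0 addr0 addrA; congr (F _ + F _ + F _); exact: val_inj.
Qed.

Variables (O : set (E3 R)) (x0 : E3 R) (Q : 'M[R]_3).
Variables (phi : R * R -> R) (dphi : R * R -> R * R).
Hypothesis gc : graph_chart O x0 Q phi dphi.

Definition crd p : 'rV[R]_3 := vec (p - x0) *m Q^T.
Local Notation crd0 p := (crd p 0 0).
Local Notation crd1 p := (crd p 0 1).
Local Notation crd2 p := (crd p 0 (1 + 1)).

Lemma crdK p : x0 + unvec (row3 (crd0 p) (crd1 p) (crd2 p) *m Q) = p.
Proof.
have [/mulmx1C QT _ _ _ _] := gc.
by rewrite row3E /crd -mulmxA QT mulmx1 vecK addrC subrK.
Qed.

Lemma edist_crd p q : Defs.edist p q ^+ 2 =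
  (crd0 p - crd0 q) ^+ 2 + (crd1 p - crd1 q) ^+ 2 + (crd2 p - crd2 q) ^+ 2.
Proof.
have [/mulmx1C QT _ _ _ _] := gc.
rewrite sqr_sqrtr; last by apply: sumr_ge0 => i _; exact: sqr_ge0.
have nE v : \sum_i v 0 i ^+ 2 = (v *m v^T) 0 0.
  by rewrite mxE; apply: eq_bigr => i _; rewrite mxE expr2.
transitivity (\sum_i (vec p - vec q) 0 i ^+ 2); first by apply: eq_bigr => i _; rewrite !mxE.
transitivity (\sum_i (crd p - crd q) 0 i ^+ 2); last by rewrite sum3E !mxE.
have -> : crd p - crd q = (vec p - vec q) *m Q^T.
  by rewrite /crd -mulmxBl !vecB opprB addrA subrK.
by rewrite !nE trmx_mul trmxK mulmxA -(mulmxA _ Q^T) QT mulmx1.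
Qed.

Lemma crd_continuous i : continuous (fun p => crd p 0 i).
Proof.
have -> : (fun p => crd p 0 i) = fun p : E3 R => (p.1.1 - x0.1.1) * Q i 0 +
    (p.1.2 - x0.1.2) * Q i 1 + (p.2 - x0.2) * Q i (1 + 1).
  by apply/funext => p; rewrite /crd mxE sum3E vecB !mxE.
have c1 : continuous (fun p : E3 R => p.1.1).
  by move=> p; apply: (@continuous_comp _ _ _ fst fst); exact: cvg_fst.
have c2 : continuous (fun p : E3 R => p.1.2).
  by move=> p; apply: (@continuous_comp _ _ _ fst snd); [exact: cvg_fst|exact: cvg_snd].
have c3 : continuous (fun p : E3 R => p.2) by move=> p; exact: cvg_snd.
move=> p.
have cm (f : E3 R -> R) (a b : R) : {for p, continuous f} -> {for p, continuous (fun q => (f q - a) * b)}.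
  by move=> cf; apply: cvgM; [apply: cvgB; [exact: cf|exact: cvg_cst]|exact: cvg_cst].
apply: (cvgD (cvgD (cm _ _ _ (c1 p)) (cm _ _ _ (c2 p))) (cm _ _ _ (c3 p))).
Qed.

Lemma crd_norm_continuous i : continuous (fun p => `|crd p 0 i|).
Proof.
move=> p; apply: (continuous_comp (@crd_continuous i p)).
by apply: (@norm_continuous _ R).
Qed.

(** A point of the box strictly above the graph has a neighbourhood disjoint from [O], so it is not
    in the closure; one strictly below has a neighbourhood inside [O], so it is interior. *)
Lemma boundary_graph : exists r h, [/\ 0 < r, 0 < h & forall p, boundary O p ->
  `|crd0 p| < r -> `|crd1 p| < r -> `|crd2 p| < h -> crd2 p = phi (crd0 p, crd1 p)].
Proof.
have [_ _ dP [L dL] [r [h [r0 h0 hO]]]] := gc.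
exists r, h; split => // p [clO niO] pr0 pr1 ph.
have cphi := chart_continuous dP dL.
have cF : {for p, continuous (fun q => phi (crd0 q, crd1 q) - crd2 q)}.
  have cp : (crd0 q, crd1 q) @[q --> p] --> (crd0 p, crd1 p).
    exact: (cvg_pair (@crd_continuous 0 p) (@crd_continuous 1 p)).
  have cc : phi (crd0 q, crd1 q) @[q --> p] --> phi (crd0 p, crd1 p).
    exact: (cvg_comp (fun q => (crd0 q, crd1 q)) phi cp (cphi _)).
  exact: (cvgB cc (@crd_continuous (1 + 1) p)).
have Fp : Filter (nbhs p) by exact: nbhs_filter.
have near_box : \forall q \near p, [/\ `|crd0 q| < r, `|crd1 q| < r & `|crd2 q| < h].
  have nb i (e : R) : `|crd p 0 i| < e -> \forall q \near p, `|crd q 0 i| < e.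
    by move=> pe; exact: (near_lt (@crd_norm_continuous i p) pe).
  by apply: filterS3 (nb 0 r pr0) (nb 1 r pr1) (nb (1 + 1) h ph) => q.
apply/eqP; rewrite eq_le; apply/andP; split; rewrite leNgt; apply/negP => lt.
- have n1 : \forall q \near p, phi (crd0 q, crd1 q) - crd2 q < 0.
    by apply: (near_lt cF); rewrite subr_lt0.
  have [q [Oq [[q0 q1 q2] q3]]] := clO _ (filterI near_box n1).
  by move: Oq; rewrite -(crdK q) hO// => qq; move: q3; rewrite subr_lt0 => /(lt_trans qq); rewrite ltxx.
- apply: niO; have n1 : \forall q \near p, 0 < phi (crd0 q, crd1 q) - crd2 q.
    by apply: (near_gt cF); rewrite subr_gt0.
  apply: filterS2 near_box n1 => q [q0 q1 q2]; rewrite subr_gt0 => q3.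
  by rewrite -(crdK q) hO.
Qed.

Lemma hausdorff2_patch : exists V (C : R), nbhs x0 V /\
  forall B, B `<=` V -> (hausdorff2 (B `&` boundary O) <= C%:E)%E.
Proof.
have [_ _ dP [L dL] _] := gc.
have [r [h [r0 h0 bg]]] := boundary_graph.
have [M M0 hM] := chart_lipschitz dP dL r.
pose V := [set p | [/\ `|crd0 p| < r, `|crd1 p| < r & `|crd2 p| < h]].
(* [m] bounds the first two coordinate differences and [2 * M * m] the third, so that
   [2 + 4 * M ^+ 2 <= K ^+ 2] is what is needed. *)
pose K := 2 + 2 * M; have K0 : 0 < K by rewrite /K; lra.
have Fx : Filter (nbhs x0) by exact: nbhs_filter.
exists V, (pi / 4 * (2 * r * K) ^+ 2); split.
  have c0 i : crd x0 0 i = 0 by rewrite /crd subrr (_ : vec 0 = 0) ?mul0mx ?mxE//; apply/rowP; apply: ord3_ind; rewrite !mxE.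
  have nb i (e : R) : 0 < e -> \forall q \near x0, `|crd q 0 i| < e.
    by move=> e0; apply: (near_lt (@crd_norm_continuous i x0)); rewrite c0 normr0.
  by apply: filterS3 (nb 0 r r0) (nb 1 r r0) (nb (1 + 1) h h0) => q.
move=> B BV; apply: (@hausdorff2_param _ _ _ _ (fun p => crd0 p) (fun p => crd1 p)) => //.
  by move=> p [/BV[]].
move=> p q [/BV[p1 p2 p3] bp] [/BV[q1 q2 q3] bq].
have e1 := bg p bp p1 p2 p3; have e2 := bg q bq q1 q2 q3.
have := hM (crd0 p) (crd1 p) (crd0 q) (crd1 q) (ltW p1) (ltW p2) (ltW q1) (ltW q2).
rewrite -e1 -e2 => h3.
set m := Num.max _ _.
have m1 : `|crd0 p - crd0 q| <= m by rewrite /m le_max lexx.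
have m2 : `|crd1 p - crd1 q| <= m by rewrite /m le_max lexx orbT.
have m0 : 0 <= m by exact: le_trans m1.
have m3 : `|crd2 p - crd2 q| <= M * (2 * m).
  by apply: (le_trans h3); rewrite ler_wpM2l//; lra.
rewrite -ler_sqr ?nnegrE ?sqrtr_ge0 ?mulr_ge0 ?(ltW K0)// edist_crd.
have sq (a b : R) : `|a| <= b -> a ^+ 2 <= b ^+ 2.
  by move=> ab; rewrite -(real_normK (num_real a)) ler_sqr ?nnegrE// (le_trans _ ab).
have := sq _ _ m1; have := sq _ _ m2; have := sq _ _ m3.
have : 0 <= M * m ^+ 2 by rewrite mulr_ge0 ?sqr_ge0.
have : 0 <= m ^+ 2 by rewrite sqr_ge0.
rewrite (_ : (K * m) ^+ 2 = 4 * m ^+ 2 + 8 * (M * m ^+ 2) + (M * (2 * m)) ^+ 2); last by rewrite /K; ring.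
move: ((crd0 p - _) ^+ 2) ((crd1 p - _) ^+ 2) ((crd2 p - _) ^+ 2) (m ^+ 2) (M * m ^+ 2) ((M * _) ^+ 2).
clear; move=> *; lra.
Qed.

End BoundaryPatch.

(** Every boundary point lies in a rational box inside a patch of finite measure, so the boxes of
    finite measure cover the boundary; its complement is a null set for the surface measure. *)
Lemma surface_sigma_finite (R : realType) (O : set (E3 R)) (sg : {measure set (E3 R) -> \bar R}) :
  C11_boundary O -> surface_measure O sg -> sigma_finite setT sg.
Proof.
move=> hC hsg.
pose F n : set (E3 R) := if n is m.+1 then
  if unpickle m is Some q then
    if (sg (rbox q) < +oo)%E then rbox q else set0 else set0
  else ~` boundary O.
exists F.
  apply/seteqP; split => // p _.
  have [bp|] := pselect (boundary O p); last by exists 0%N.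
  have [Q [phi [dphi gc]]] := hC p bp.
  have [V [C [nV hV]]] := hausdorff2_patch gc.
  have [q qp qV] := nbhs_rbox nV.
  exists (pickle q).+1; first by [].
  rewrite /F pickleK ifT; first exact: qp.
  by rewrite hsg; [exact: le_lt_trans (hV _ qV) (ltry _)|exact: measurable_rbox].
case=> [|m]; rewrite /F.
  split; first by apply: measurableC; exact: measurable_boundary.
  rewrite hsg; last by apply: measurableC; exact: measurable_boundary.
  by rewrite hausdorff2_0 ?ltry// setICl.
case: (unpickle m) => [q|]; last by rewrite measure0; split; [exact: measurable0|exact: ltry].
case: ifPn => h; last by rewrite measure0; split; [exact: measurable0|exact: ltry].
by split; [exact: measurable_rbox|exact: h].
Qed.

(** * The space of boundary controls *)

Section SigmaFiniteCopy.
Context d (T : measurableType d) (R : realType) (mu : {measure set T -> \bar R}).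
Hypothesis h : sigma_finite setT mu.

(** An alias that carries [h], so that the structure required by Tonelli's theorem can be attached
    to it. *)
Definition sigma_finite_copy : set T -> \bar R := let _ := h in mu.

HB.instance Definition _ := Measure.copy sigma_finite_copy mu.
HB.instance Definition _ := Measure_isSigmaFinite.Build _ _ _ sigma_finite_copy h.

End SigmaFiniteCopy.

Section TraceSpace.
Variables (R : realType) (O : set (E3 R)) (sg : {measure set (E3 R) -> \bar R}).
Hypothesis fsg : sigma_finite setT sg.
Local Notation Gam := (boundary O).
Local Notation mGam := (measurable_boundary O).
Implicit Types (f g : E3 R -> R[i]^o).

(** The kernel of the Slobodeckij seminorm: the exponent 3 is the dimension 2 of the surface plus
    twice the order 1/2. The inverse of 0 being 0, the kernel vanishes on the diagonal. *)
Definition rieszker (p q : E3 R) : R := (Defs.edist p q ^+ 3)^-1.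

Lemma measurable_rieszker d (T : measurableType d) (D : set T) (a b : T -> E3 R) :
  (forall i, measurable_fun D (fun t => vec (a t) 0 i)) ->
  (forall i, measurable_fun D (fun t => vec (b t) 0 i)) ->
  measurable_fun D (fun t => rieszker (a t) (b t)).
Proof.
move=> ma mb.
pose s t := \sum_i (vec (a t) 0 i - vec (b t) 0 i) ^+ 2.
have ms : measurable_fun D s.
  have -> : s = fun t => (vec (a t) 0 0 - vec (b t) 0 0) ^+ 2 + (vec (a t) 0 1 - vec (b t) 0 1) ^+ 2 +
     (vec (a t) 0 (1 + 1) - vec (b t) 0 (1 + 1)) ^+ 2.
    by apply/funext => t; rewrite /s sum3E.
  by apply: measurable_funD; first apply: measurable_funD;
    apply: measurable_funX; apply: measurable_funB.
(* The inverse of the distance as a real power of its square, which is measurable without excluding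
   the zeros. *)
have -> : (fun t => rieszker (a t) (b t)) = (fun t => (s t `^ (- 2^-1)) ^+ 3).
  apply/funext => t; rewrite powRN powR12_sqrt ?exprVn//.
  by apply: sumr_ge0 => i _; exact: sqr_ge0.
apply: measurable_funX; exact: (measurableT_comp (measurable_powR _) ms).
Qed.

Lemma measurable_vec (D : set (E3 R)) i : measurable_fun D (fun p : E3 R => vec p 0 i).
Proof.
apply: (measurable_funS measurableT) => //; move: i; apply: ord3_ind.
- have -> : (fun p : E3 R => vec p 0 0) = fst \o fst by apply/funext => p; rewrite vecE.
  by apply: measurableT_comp; exact: measurable_fst.
- have -> : (fun p : E3 R => vec p 0 1) = snd \o fst by apply/funext => p; rewrite vecE.
  by apply: measurableT_comp; [exact: measurable_snd|exact: measurable_fst].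
- have -> : (fun p : E3 R => vec p 0 (1 + 1)) = snd by apply/funext => p; rewrite vecE.
  exact: measurable_snd.
Qed.

Definition gag f (x : E3 R) : \bar R :=
  (\int[sg]_(y in Gam) (csq (f x - f y) * rieszker x y)%:E)%E.

Definition cmeasurable f := measurable_fun Gam (fun x => complex.Re (f x)) /\
  measurable_fun Gam (fun x => complex.Im (f x)).

Lemma csqB (z w : R[i]) :
  csq (z - w) = (complex.Re z - complex.Re w) ^+ 2 + (complex.Im z - complex.Im w) ^+ 2.
Proof. by case: z w => [p q] [r s]. Qed.

Lemma rieszker_ge0 x y : 0 <= rieszker x y.
Proof. by rewrite invr_ge0 exprn_ge0// sqrtr_ge0. Qed.

Lemma gag_inner f x : cmeasurable f ->
  measurable_fun Gam (fun y => (csq (f x - f y) * rieszker x y)%:E).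
Proof.
move=> [mr mi]; apply/measurable_EFinP; apply: measurable_funM.
  under eq_fun do rewrite csqB.
  by apply: measurable_funD; apply: measurable_funX; apply: measurable_funB.
by apply: measurable_rieszker => i; [exact: measurable_cst|exact: measurable_vec].
Qed.

(** Tonelli's theorem for the sigma-finite copy, after [f] has been extended by 0 and the
    restriction to the boundary has been moved into the integrand as an indicator. *)
Lemma measurable_gag f : cmeasurable f -> measurable_fun Gam (gag f).
Proof.
move=> [mr mi].
pose fr := (fun x => complex.Re (f x)) \_ Gam.
pose fi := (fun x => complex.Im (f x)) \_ Gam.
have mfr : measurable_fun setT fr.
  by apply/(measurable_restrict _ mGam measurableT); rewrite setTI.
have mfi : measurable_fun setT fi.
  by apply/(measurable_restrict _ mGam measurableT); rewrite setTI.
pose F (z : E3 R * E3 R) : \bar R := (((fr z.1 - fr z.2) ^+ 2 + (fi z.1 - fi z.2) ^+ 2) *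
  rieszker z.1 z.2 * \1_Gam z.2)%:E.
have mF : measurable_fun setT F.
  apply/measurable_EFinP; apply: measurable_funM; first apply: measurable_funM.
  - by apply: measurable_funD; apply: measurable_funX; apply: measurable_funB;
      apply: measurableT_comp => //; by [exact: measurable_fst|exact: measurable_snd].
  - apply: measurable_rieszker => i; first exact: (measurableT_comp (measurable_vec (D := setT) i) measurable_fst).
    exact: (measurableT_comp (measurable_vec (D := setT) i) measurable_snd).
  - by apply: measurableT_comp; [exact: measurable_indic mGam|exact: measurable_snd].
have F0 z : (0 <= F z)%E.
  by rewrite lee_fin !mulr_ge0 ?addr_ge0 ?sqr_ge0 ?rieszker_ge0.
have := measurable_fun_fubini_tonelli_F (m2 := sigma_finite_copy fsg) F mF F0.
move=> /(measurable_funS measurableT (@subsetT _ Gam)).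
apply: eq_measurable_fun => x; rewrite inE => Gx.
rewrite /fubini_F /gag [RHS]integral_mkcond; apply: eq_integral => y _.
rewrite /F /= patchE indicE /fr /fi !patchE (mem_set Gx).
by case: ifPn => yG; rewrite ?mulr0 ?mulr1 ?csqB.
Qed.

Lemma Hhalf_parts f : Hhalf O sg f <-> L2_fun sg Gam f /\
  (\int[sg]_(x in Gam) gag f x < +oo)%E.
Proof.
have gag0 : (0 <= \int[sg]_(x in Gam) gag f x)%E.
  apply: integral_ge0 => x _; apply: integral_ge0 => y _.
  by rewrite lee_fin mulr_ge0 ?csq_ge0 ?rieszker_ge0.
have int0 : (0 <= \int[sg]_(x in Gam) (csq (f x))%:E)%E.
  by apply: integral_ge0 => x _; rewrite lee_fin csq_ge0.
split=> [[lf h]|[lf h]]; split => //.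
  by apply: le_lt_trans h; rewrite /Hhalf_sqnorm leeDr.
by apply: lte_add_pinfty => //; case: lf.
Qed.

Lemma L2_cmeasurable f : L2_fun sg Gam f -> cmeasurable f.
Proof. by case. Qed.

(** The pointwise bound [csq_lin] is integrated twice; comparing and adding the outer integrals
    rests on [measurable_gag]. *)
Lemma Hhalf_lin (a : R[i]) f g : Hhalf O sg f -> Hhalf O sg g -> Hhalf O sg (a *: f + g).
Proof.
move=> /Hhalf_parts[lf hf] /Hhalf_parts[lg hg].
have lh : L2_fun sg Gam (a *: f + g) by exact: (L2_fun_lin mGam a lf lg).
apply/Hhalf_parts; split; first exact: lh.
have mf := L2_cmeasurable lf; have mg := L2_cmeasurable lg; have mh := L2_cmeasurable lh.
have gag0 k x : (0 <= gag k x)%E.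
  by apply: integral_ge0 => y _; rewrite lee_fin mulr_ge0 ?csq_ge0 ?rieszker_ge0.
have ka : 0 <= 2 * csq a by rewrite mulr_ge0 ?csq_ge0.
have m1 : measurable_fun Gam (fun x => ((2 * csq a)%:E * gag f x)%E).
  by apply: measurable_funeM; exact: measurable_gag.
have m2 : measurable_fun Gam (fun x => (2%:E * gag g x)%E).
  by apply: measurable_funeM; exact: measurable_gag.
apply: (@le_lt_trans _ _ (\int[sg]_(x in Gam) ((2 * csq a)%:E * gag f x + 2%:E * gag g x)%E)%E).
  apply: (ge0_le_integral sg mGam _ (measurable_gag mh) (emeasurable_funD m1 m2)).
    by move=> x _; exact: gag0.
  move=> x Gx; rewrite /gag.
  have n1 y : (0 <= (csq (f x - f y) * rieszker x y)%:E)%E by rewrite lee_fin mulr_ge0 ?csq_ge0 ?rieszker_ge0.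
  have n2 y : (0 <= (csq (g x - g y) * rieszker x y)%:E)%E by rewrite lee_fin mulr_ge0 ?csq_ge0 ?rieszker_ge0.
  have if1 := gag_inner x mf; have ig1 := gag_inner x mg.
  have z1 := measurable_funeM (2 * csq a)%:E if1; have z2 := measurable_funeM 2%:E ig1.
  rewrite -(ge0_integralZl_EFin sg mGam (fun y _ => n1 y) if1 ka).
  rewrite -(ge0_integralZl_EFin sg mGam (fun y _ => n2 y) ig1 (ltW (ltr0Sn R 1))).
  rewrite -(ge0_integralD sg mGam _ z1 _ z2); first last.
  - by move=> y _; apply: mule_ge0; [rewrite lee_fin|exact: n2].
  - by move=> y _; apply: mule_ge0; [rewrite lee_fin|exact: n1].
  apply: (ge0_le_integral sg mGam _ (gag_inner x mh) (emeasurable_funD z1 z2)).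
    by move=> y _; rewrite lee_fin mulr_ge0 ?csq_ge0 ?rieszker_ge0.
  move=> y _; rewrite -!EFinM -EFinD lee_fin !mulrA -mulrDl ler_wpM2r ?rieszker_ge0//.
  have -> : (a *: f + g) x - (a *: f + g) y = a * (f x - f y) + (g x - g y).
    by rewrite mulrBr opprD addrACA.
  exact: csq_lin.
rewrite (ge0_integralD sg mGam _ m1 _ m2); first last.
- by move=> x _; apply: mule_ge0; [rewrite lee_fin|exact: gag0].
- by move=> x _; apply: mule_ge0; [rewrite lee_fin|exact: gag0].
rewrite (ge0_integralZl_EFin sg mGam (fun x _ => gag0 f x) (measurable_gag mf) ka).
rewrite (ge0_integralZl_EFin sg mGam (fun x _ => gag0 g x) (measurable_gag mg) (ltW (ltr0Sn R 1))).
by apply: lte_add_pinfty; apply: lte_mul_pinfty; [rewrite lee_fin|by []|exact: hf|rewrite lee_fin|by []|exact: hg].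
Qed.

Lemma Hhalf0 : Hhalf O sg 0.
Proof.
apply/Hhalf_parts; split; first exact: (L2_fun0 sg mGam).
rewrite (_ : gag 0 = fun=> 0%E) ?integral0 ?ltry//.
apply/funext => x; apply: integral0_eq => y _.
by rewrite subrr /csq /= expr0n addr0 mul0r.
Qed.

Variables (nu : E3 R -> 'rV[R]_3) (S : L2_boundary O sg -> L2_boundary O sg -> Prop).
Variable q : (E3 R -> R[i]^o) -> (E3 R -> R[i]^o) -> R[i].
Hypothesis hq : sqrt_form S q.
Local Notation U := (Htan O nu sg q).
Local Notation cmp x i := (fun p : E3 R => (x : E3 R -> 'rV[R[i]]_3) p 0 i).

Lemma cmp_lin (a : R[i]) (x y : U) i : cmp (a *: x + y) i = a *: (cmp x i : E3 R -> R[i]^o) + cmp y i.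
Proof. by apply/funext => p; rewrite !mxE. Qed.

Lemma Htan_idot_lin (a : R[i]) (x y z : U) : imem U x -> imem U y -> imem U z ->
  idot U (a *: x + y) z = a * idot U x z + idot U y z.
Proof.
move=> [mx _] [my _] [mz _]; have [ql _ _ _ _] := hq.
rewrite mulr_sumr -big_split; apply: eq_bigr => i _.
by rewrite cmp_lin ql.
Qed.

Lemma Htan_idotC (x y : U) : imem U x -> imem U y -> idot U y x = conjc (idot U x y).
Proof.
move=> [mx _] [my _]; have [_ qC _ _ _] := hq.
by rewrite [RHS]rmorph_sum; apply: eq_bigr => i _; rewrite qC.
Qed.

Lemma Htan_prehilbert : prehilbert U.
Proof.
have m0 : imem U 0.
  split=> [i|]; last by apply: aeW => x _; apply: big1 => i _; rewrite mxE mul0r.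
  rewrite (_ : cmp 0 i = 0); first exact: Hhalf0.
  by apply/funext => p; rewrite mxE.
have mL (a : R[i]) (x y : U) : imem U x -> imem U y -> imem U (a *: x + y).
  move=> [mx tx] [my ty]; split=> [i|]; first by rewrite cmp_lin; exact: Hhalf_lin.
  apply: filterS2 tx ty => p hx hy Gp.
  rewrite -[RHS](mulr0 a) -{2}(hx Gp) -[RHS]addr0 -{3}(hy Gp) mulr_sumr -big_split.
  by apply: eq_bigr => i _; rewrite !mxE mulrDl mulrA.
have l0 (z : U) : imem U z -> idot U 0 z = 0.
  move=> mz; have := Htan_idot_lin (-1) m0 m0 mz.
  by rewrite scaleN1r mulN1r !addNr.
have lZ (a : R[i]) (x z : U) : imem U x -> imem U z -> idot U (a *: x) z = a * idot U x z.
  by move=> mx mz; rewrite -[a *: x]addr0 (Htan_idot_lin a mx m0 mz) l0// addr0.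
have mZ (a : R[i]) (x : U) : imem U x -> imem U (a *: x).
  by move=> mx; rewrite -[a *: x]addr0; exact: mL.
have rZ (a : R[i]) (x z : U) : imem U x -> imem U z -> idot U z (a *: x) = conjc a * idot U z x.
  by move=> mx mz; rewrite (Htan_idotC (mZ a _ mx) mz) lZ// (Htan_idotC mx mz); exact: rmorphM.
split => //.
- move=> x y z mx my mz; rewrite /rdot -[x]scale1r (Htan_idot_lin 1 mx my mz) scale1r mul1r.
  by case: (idot U x z) (idot U y z) => [? ?] [].
- move=> a x y mx my; rewrite /rdot lZ// rZ//; congr (complex.Re (_ * _)).
  by symmetry; exact: conjcK.
- move=> r x y mx my; rewrite /rdot lZ//; case: (idot U x y) => s t /=.
  by rewrite mul0r subr0.
- by move=> x y mx my; rewrite /rdot (Htan_idotC my mx); case: (idot U y x).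
- move=> x [mx _]; have [_ _ q0 _ _] := hq.
  have : 0 <= idot U x x by apply: sumr_ge0 => i _; exact: q0.
  by rewrite lecE => /andP[].
- move=> x y mx my; rewrite /rdot rZ//; case: (idot U x y) => s t /=.
  by rewrite mul0r sub0r mulN1r opprK.
Qed.

End TraceSpace.

(** * The state space *)

Section StateSpace.
Variables (R : realType) (O : set (E3 R)) (eps mu : E3 R -> 'M[R]_3).
Hypothesis oO : open O.

Definition good_coef (M : E3 R -> 'M[R]_3) :=
  (forall i j, W1infty O (fun x => M x i j)) /\ coef_symmetric O M /\ coef_posdef O M.

Hypotheses (heps : good_coef eps) (hmu : good_coef mu).
Local Notation l3 := (@leb3 R).
Local Notation mO := (open_measurable3 oO).

Lemma good_coef_bounds M : good_coef M -> exists c K : R, [/\ 0 < c, 0 <= K,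
  {ae l3, forall x, O x -> forall i j, `|M x i j| <= K} &
  {ae l3, forall x, O x ->
    forall xi : 'rV[R]_3, c * (xi *m xi^T) 0 0 <= (xi *m M x *m xi^T) 0 0}].
Proof.
move=> [hM [_ [c c0 hc]]].
have /choice[K hK] (p : 'I_3 * 'I_3) : exists K, {ae l3, forall x, O x -> `|M x p.1 p.2| <= K}.
  by have [[_ h] _] := hM p.1 p.2.
(* The sum of the nine essential bounds serves all entries at once, off a finite union of null
   sets. *)
exists c, (\sum_p `|K p|); split => //; first exact: sumr_ge0.
have : {ae l3, forall x, forall p, O x -> `|M x p.1 p.2| <= K p}.
  exact: (@filter_forall _ ('I_3 * 'I_3)%type (fun p x => O x -> `|M x p.1 p.2| <= K p) (almost_everywhere l3) _ hK).
apply: filterS => x h Ox i j; apply: (le_trans (h (i, j) Ox)).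
apply: (le_trans (ler_norm _)); rewrite (bigD1 (i, j))//= lerDl.
by apply: sumr_ge0.
Qed.

Lemma good_coef_measurable M : good_coef M -> forall i j, measurable_fun O (fun x => M x i j).
Proof. by move=> [hM _] i j; have [[]] := hM i j. Qed.

Local Notation Y := (stateY O eps mu).
Local Notation wf M := (wform l3 O M).

Lemma stateY_rdot (y z : Y) : rdot y z = wf eps y.1 z.1 + wf mu y.2 z.2.
Proof. by []. Qed.

Lemma stateY_Im (y z : Y) : complex.Im (idot Y y z) =
  wf eps y.1 ('i *: z.1) + wf mu y.2 ('i *: z.2).
Proof. by rewrite -!wform_Im. Qed.

Lemma stateY_prehilbert : prehilbert Y.
Proof.
have [c [K [c0 K0 hK hc]]] := good_coef_bounds heps.
have [c' [K' [c0' K0' hK' hc']]] := good_coef_bounds hmu.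
have mm := good_coef_measurable heps; have mm' := good_coef_measurable hmu.
have [_ [se _]] := heps; have [_ [sm _]] := hmu.
split.
- by split; exact: (L2_field0 _ mO).
- by move=> a x y [x1 x2] [y1 y2]; split; exact: (L2_field_lin mO).
- move=> x y z [x1 x2] [y1 y2] [z1 z2]; rewrite !stateY_rdot.
  rewrite (wformDl mO mm hK x1 y1 z1) (wformDl mO mm' hK' x2 y2 z2); exact: addrACA.
- by move=> a x y _ _; rewrite !stateY_rdot !wformZ.
- move=> r x y [x1 x2] [y1 y2]; rewrite !stateY_rdot.
  by rewrite (wformR mO mm hK r x1 y1) (wformR mO mm' hK' r x2 y2) mulrDr.
- by move=> x y _ _; rewrite !stateY_rdot (wformC se) (wformC sm).
- move=> x _; rewrite stateY_rdot.
  apply: addr_ge0; [exact: (wform_ge0 c0 hc)|exact: (wform_ge0 c0' hc')].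
- by move=> x y _ _; rewrite stateY_Im stateY_rdot.
Qed.

(** Both weighted forms are non-negative, so each is at most the squared norm of Y, and the electric
    and magnetic fields converge separately. *)
Lemma stateY_complete : complete_sip (@hd R Y stateY_prehilbert).
Proof.
have [c [K [c0 K0 hK hc]]] := good_coef_bounds heps.
have [c' [K' [c0' K0' hK' hc']]] := good_coef_bounds hmu.
have mm := good_coef_measurable heps; have mm' := good_coef_measurable hmu.
pose hY := stateY_prehilbert; move=> u hu.
have um n : L2_field l3 O (elt_val (u n)).1 /\ L2_field l3 O (elt_val (u n)).2 by exact: (elt_mem (u n)).
have dE (a : Y) : inorm a ^+ 2 = wf eps a.1 a.1 + wf mu a.2 a.2.
  rewrite /inorm -[complex.Re _]/(rdot a a) stateY_rdot sqr_sqrtr; first by [].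
  apply: addr_ge0; [exact: (wform_ge0 c0 hc)|exact: (wform_ge0 c0' hc')].
have d2 n : wf eps ((elt_val (u n.+1)).1 - (elt_val (u n)).1) ((elt_val (u n.+1)).1 - (elt_val (u n)).1) +
    wf mu ((elt_val (u n.+1)).2 - (elt_val (u n)).2) ((elt_val (u n.+1)).2 - (elt_val (u n)).2) <= (4^-1 ^+ n) ^+ 2.
  have := hu n; rewrite -inormE elt_valB -ler_sqr ?nnegrE ?sqrtr_ge0 ?exprn_ge0 ?invr_ge0//.
  by rewrite dE.
have d21 n : wf eps ((elt_val (u n.+1)).1 - (elt_val (u n)).1)
    ((elt_val (u n.+1)).1 - (elt_val (u n)).1) <= (4^-1 ^+ n) ^+ 2.
  by apply: le_trans (d2 n); rewrite lerDl; exact: (wform_ge0 c0' hc').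
have d22 n : wf mu ((elt_val (u n.+1)).2 - (elt_val (u n)).2)
    ((elt_val (u n.+1)).2 - (elt_val (u n)).2) <= (4^-1 ^+ n) ^+ 2.
  by apply: le_trans (d2 n); rewrite lerDr; exact: (wform_ge0 c0 hc).
have [g1 hg1 [C1 hC1]] := field_complete mO mm c0 K0 hK hc (fun n => (um n).1) d21.
have [g2 hg2 [C2 hC2]] := field_complete mO mm' c0' K0' hK' hc' (fun n => (um n).2) d22.
have mg : imem Y ((g1, g2) : Y) by split.
exists (lift hY ((g1, g2) : Y)).
apply/cvgrPdist_lt => e e1.
have cg : (C1 + C2) * 4^-1 ^+ n @[n --> \oo] --> (C1 + C2) * (0 : R).
  by apply: cvgM; [exact: cvg_cst|apply: cvg_expr; rewrite ger0_norm// invf_lt1// ltr1n].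
rewrite mulr0 in cg; have e2 : 0 < e ^+ 2 by rewrite exprn_gt0.
move/cvgrPdist_lt : cg => /(_ _ e2); apply: filterS => n h.
rewrite sub0r normrN ger0_norm ?nm_ge0// -inormE elt_valB liftK//.
rewrite -ltr_sqr ?nnegrE ?sqrtr_ge0 ?(ltW e1)// dE.
apply: le_lt_trans (lerD (hC1 n) (hC2 n)) _; rewrite -mulrDl.
by move: h; rewrite sub0r normrN => /(le_lt_trans (ler_norm _)).
Qed.

End StateSpace.

(** * The boundary control problem for Maxwell's equations *)

Theorem theorem1p2 (R : realType) (T : R) (hT : 0 < T)
  (* the domain, its exterior unit normal and its surface measure *)
  (O : set (E3 R)) (nu : E3 R -> 'rV[R]_3)
  (sg : {measure set (E3 R) -> \bar R})
  (hO_bounded : bounded_set O) (hO_open : open O) (hO_connected : connected O)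
  (hO_C11 : C11_boundary O) (hnu : exterior_unit_normal O nu)
  (hsg : surface_measure O sg)
  (* the coefficients *)
  (eps mu sigma : E3 R -> 'M[R]_3)
  (heps : (forall i j, W1infty O (fun x => eps x i j)) /\
          coef_symmetric O eps /\ coef_posdef O eps)
  (hmu : (forall i j, W1infty O (fun x => mu x i j)) /\
         coef_symmetric O mu /\ coef_posdef O mu)
  (hsigma : (forall i j, Linfty O (fun x => sigma x i j)) /\
            coef_symmetric O sigma /\ coef_nonneg O sigma)
  (* S = sqrt(- Delta_Gamma), and the inner product (S f, g) on H^{1/2} *)
  (S : L2_boundary O sg -> L2_boundary O sg -> Prop)
  (hS : is_sqrt_of S (@laplace_beltrami R O nu sg))
  (q : (E3 R -> R[i]^o) -> (E3 R -> R[i]^o) -> R[i])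
  (hq : sqrt_form S q) :
  let Y := stateY O eps mu in
  let U := Htan O nu sg q in
  let A : Y -> Y -> Prop := @maxwell_op R O sg eps mu sigma in
  let As : Y -> Y -> Prop := adjoint A in
  forall
  (* the semigroups generated by A and by its adjoint *)
  (E Es : R -> Y -> Y)
  (hE : C0_semigroup E /\ contractive E /\ generates A E)
  (hEs : C0_semigroup Es /\ generates As Es)
  (* the Green map, the adjoint of B and the known well-posedness facts *)
  (G : U -> Y) (hG : @green_map R O sg eps mu sigma (imem U) G)
  (Bs : Y -> U) (hBs : control_adjoint As G Bs)
  (hL : input_map_bounded As E Es G T)
  (K : Y -> R -> U) (hK : adjoint_observation As Es T Bs K)
  (alpha : R) (halpha : 0 < alpha),
  exists (Phi : R -> R -> Y -> Y) (ghat : R -> R -> Y -> U),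
  let P (s : R) (x : Y) : Y := Es (T - s) (Phi T s x) in
  (* S1 *)
  (forall s y0, 0 <= s < T -> imem Y y0 ->
     optimal_pair As E Es G T alpha s y0
       (fun t => ghat t s y0) (fun t => Phi t s y0) /\
     forall g y, optimal_pair As E Es G T alpha s y0 g y ->
       {ae @time_measure R, forall t, s < t < T -> ieq (g t) (ghat t s y0)} /\
       forall t, s <= t <= T -> ieq (y t) (Phi t s y0)) /\
  (* S2 *)
  [/\ forall s t, 0 <= s -> s <= t <= T -> bounded_linear (Phi t s),
      forall t x, 0 <= t <= T -> imem Y x -> ieq (Phi t t x) x
    & forall s tau t x, 0 <= s -> s <= tau -> tau <= t -> t <= T -> imem Y x ->
        ieq (Phi t s x) (Phi t tau (Phi tau s x))] /\
  (* S3 *)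
  [/\ forall t, 0 <= t <= T -> bounded_linear (P t),
      forall s y0, 0 <= s < T -> imem Y y0 ->
        (cost T alpha s (fun t => ghat t s y0) (fun t => Phi t s y0))%:C =
        idot Y (P s y0) y0,
      forall t x y, 0 <= t <= T -> imem Y x -> imem Y y ->
        idot Y (P t x) y = idot Y x (P t y),
      forall t x, 0 <= t <= T -> imem Y x -> 0 <= idot Y (P t x) x
    & forall z, imem Y z -> continuous_in_time 0 T (fun t => P t z)] /\
  (* S4 *)
  (forall s y0, 0 <= s < T -> imem Y y0 ->
     (forall t, s <= t <= T ->
        ieq (P t (Phi t s y0)) (Es (T - t) (Phi T s y0))) /\
     {ae @time_measure R, forall t, s < t < T ->
        ieq (ghat t s y0) (- (alpha^-1)%:C *: K (Phi T s y0) (T - t))}) /\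
  (* S5 *)
  (forall x, imem Y x -> ieq (P T x) x) /\
  exists (Pn : nat -> R -> Y -> Y) (PTn : nat -> Y -> Y),
    [/\ forall n t, 0 <= t <= T -> bounded_linear (Pn n t),
        forall n, riccati_problem A T alpha Bs (PTn n) (Pn n) /\
                  bounded_gain As T Bs (Pn n),
        forall z, imem Y z -> inorm (PTn n z - z) @[n --> \oo] --> (0 : R)
      & forall z, imem Y z ->
          (forall n, continuous_in_time 0 T (fun t => Pn n t z)) /\
          forall e : R, 0 < e -> \forall n \near \oo,
            forall t, 0 <= t <= T -> inorm (Pn n t z - P t z) < e].
Proof.
move=> Y U A As E Es [cE [_ gE]] [cEs gEs] G hG Bs hBs hL K hK alpha halpha.
have hU : prehilbert U := Htan_prehilbert (surface_sigma_finite hO_C11 hsg) nu hq.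
pose hY := stateY_prehilbert hO_open heps hmu.
have cG g : imem U g -> imem Y (G g).
  by move=> /hG[c1 [c2 [[l1 _ _] [l2 _ _] _ _]]]; split.
have cY : complete_sip (@hd R Y hY) by exact: stateY_complete.
have cS : control_system hY A E Es G T Bs K.
  exact: (ControlSystem hT cY cE gE cEs gEs cG hBs hL hK).
exact: (riccati_synthesis hU cS halpha).
Qed.
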